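(* Let $p>2$ be a prime, $\mathbb K$ an algebraically closed field of characteristic $p$, and $q\in\mathbb K$ a primitive $r$-th root of unity with $r$ divisible by $8$ and coprime to $p$. Then there is a choice of the parameters $\boldsymbol\alpha=(\alpha_1,\dots,\alpha_p)\in\mathbb K^p$ such that the semidirect biproduct Hopf algebra $A=u_q\mathfrak{sl}_2\ltimes \mathrm{SF}_{2p}\rtimes\mathbb K[S_p]$ is simultaneously: (1) unimodular; (2) quasitriangular, with R-matrix $R=R_{\mathsf z}D\Theta\bar R_{\boldsymbol\alpha}$; (3) ribbon, i.e. $(A,R)$ admits a ribbon element $v$; (4) twist degenerate, i.e. $\lambda(v)=0$ for $\lambda$ a nonzero left integral of $A$; (5) chromatic non-degenerate but not chromatic compact.
   Context: Write $r'=r/2$, $r''=r/4$, $\{k\}=q^k-q^{-k}$, $[k]=\{k\}/\{1\}$, $[k]!=[k]\cdots[1]$. The algebra $A$: generated over $\mathbb K$ by $K,E,F$, $L$, $Z_l^{\pm}$ ($1\le l\le p$) and the elements $\sigma\in S_p$, with relations: $K^{r'}=1$, $E^{r'}=F^{r'}=0$, $KEK^{-1}=q^2E$, $KFK^{-1}=q^{-2}F$, $[E,F]=\frac{K-K^{-1}}{q-q^{-1}}$; $L^2=1$, $LZ_l^\pm=-Z_l^\pm L$, all $Z_l^{\pm}$ square to zero and pairwise anticommute; $L$ commutes with $K,E,F$; $KZ_l^\pm=-Z_l^\pm K$, $EZ_l^\pm=-Z_l^\pm E$, $FZ_l^\pm=Z_l^\pm F$; the elements of $S_p$ multiply as in $S_p$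 (the identity permutation being $1$), commute with $E,F,K,L$, and $\sigma Z_l^\pm=Z^\pm_{\sigma(l)}\sigma$. Put $\bar L=K^{r''}L$. Hopf structure: $K,L,\sigma$ grouplike; $\Delta(E)=1\otimes E+E\otimes K$, $\Delta(F)=F\otimes1+K^{-1}\otimes F$, $\Delta(Z_l^\pm)=1\otimes Z_l^\pm+Z_l^\pm\otimes\bar L$; $\epsilon(E)=\epsilon(F)=\epsilon(Z_l^\pm)=0$; $S(E)=-EK^{-1}$, $S(F)=-KF$, $S(Z_l^\pm)=-Z_l^\pm\bar L$, and $S(g)=g^{-1}$ for grouplike generators $g$. R-matrix: $R_{\mathsf z}=\frac12\sum_{v,w\in\{0,1\}}(-1)^{vw}L^w\otimes L^v$, $D=\frac1{r'}\sum_{b,c=0}^{r'-1}q^{-2bc}K^b\otimes K^c$, $\Theta=\sum_{a=0}^{r'-1}\frac{\{1\}^a}{[a]!}q^{a(a-1)/2}E^a\otimes F^a$, $\bar R_{\boldsymbol\alpha}=\exp\big(\sum_{l=1}^p\alpha_l(Z_l^+\otimes\bar LZ_l^--Z_l^-\otimes\bar LZ_l^+)\big)$, where the exponential of a sum of commuting square-zero terms $x_l$ is understood as $\prod_l(1+x_l)$. Definitions. For a finite-dimensional Hopf algebra $A$: a left integral is $\lambda\in A^*$ with $\lambda(h_{(2)})h_{(1)}=\lambda(h)1$ for all $h$; a two-sided cointegral is $\Lambda\in A$ with $h\Lambda=\epsilon(h)\Lambda=\Lambda h$ for all $h$; $A$ is unimodular if it has a nonzero two-sided cointegral. Quasitriangular: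 $R=R'\otimes R''\in A\otimes A$ satisfies $\Delta(R')\otimes R''=R_1'\otimes R_2'\otimes R_1''R_2''$, $R'\otimes\Delta^{cop}(R'')=R_1'R_2'\otimes R_1''\otimes R_2''$, $\epsilon(R')R''=1=\epsilon(R'')R'$, and $\Delta^{cop}(h)R=R\Delta(h)$. Monodromy: $M=R_{21}R=M'\otimes M''$. A ribbon element is a central $v\in A$ with $S(v)=v$, $\epsilon(v)=1$, $M\Delta(v)=v\otimes v$. Let $P_{\mathbb 1}$ be the projective cover of the trivial $A$-module. Let $\Lambda_{P_{\mathbb 1}},\Delta_0^{P_{\mathbb 1}}:P_{\mathbb 1}\to P_{\mathbb 1}$ be the maps given by the action of $\Lambda$ (a nonzero two-sided cointegral) and of $\lambda(S(M'))M''$ ($\lambda$ a nonzero left integral), respectively. $A$ is chromatic non-degenerate if $\Delta_0^{P_{\mathbb 1}}\ne0$, and chromatic compact if $\Delta_0^{P_{\mathbb 1}}=\zeta\Lambda_{P_{\mathbb 1}}$ for some $\zeta\in\mathbb K^\times$. *)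

(* Defs.v *)
(* MathComp, with finitely supported functions from multinomials' monalg and
   boolp for the classical reflection of propositions into bool. *)
From HB Require Import structures.
From mathcomp Require Import all_boot all_order all_fingroup all_algebra.
(* Re-imported so that [repr] is the quotient one, not the finite-group one. *)
From mathcomp Require Import generic_quotient.
From mathcomp Require Import finmap.
From mathcomp Require Import boolp.
From mathcomp.multinomials Require Import monalg.

Set Implicit Arguments.
Unset Strict Implicit.
Unset Printing Implicit Defensive.

Import GRing.Theory.
Local Open Scope ring_scope.
Local Open Scope quotient_scope.

(* MathComp's algType requires 1 != 0, which is not known a priori for an
   algebra given by generators and relations; a pzAlgType is a unital
   associative K-algebra without that requirement. *)
HB.mixin Record Lmodule_isPzAlgebra (K : fieldType) A of GRing.Lmodule K A := {
  pz_one : A;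
  pz_mul : A -> A -> A;
  pz_mulA : associative pz_mul;
  pz_mul1 : left_id pz_one pz_mul;
  pz_mulr1 : right_id pz_one pz_mul;
  pz_mulDl : left_distributive pz_mul +%R;
  pz_mulDr : right_distributive pz_mul +%R;
  pz_scaleAl : forall (c : K) (x y : A), c *: pz_mul x y = pz_mul (c *: x) y;
  pz_scaleAr : forall (c : K) (x y : A), c *: pz_mul x y = pz_mul x (c *: y)
}.

#[short(type="pzAlgType")]
HB.structure Definition PzAlgebra (K : fieldType) :=
  {A of GRing.Lmodule K A & Lmodule_isPzAlgebra K A}.

HB.instance Definition _ (K : fieldType) (A : pzAlgType K) :=
  GRing.Zmodule_isPzRing.Build (PzAlgebra.sort A)
    pz_mulA pz_mul1 pz_mulr1 pz_mulDl pz_mulDr.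

Section PzAlgebraTheory.
Variables (K : fieldType) (A : pzAlgType K).
Lemma pzscaleAl (c : K) (x y : A) : c *: (x * y) = (c *: x) * y.
Proof. exact: pz_scaleAl. Qed.
Lemma pzscaleAr (c : K) (x y : A) : c *: (x * y) = x * (c *: y).
Proof. exact: pz_scaleAr. Qed.
End PzAlgebraTheory.

Section Span.
Variables (K : fieldType) (V : lmodType K) (X : V -> Prop).

Definition span : {pred V} := fun v =>
  `[< forall S : {pred V}, submod_closed S ->
        (forall x, X x -> x \in S) -> v \in S >].

Lemma span_gen x : X x -> x \in span.
Proof. by move=> Xx; apply/asboolP => S _; apply. Qed.

Lemma span_submod_closed : submod_closed span.
Proof.
split=> [|c u v /asboolP su /asboolP sv]; apply/asboolP => S Ssub XS.
  by case: Ssub.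
by case: (Ssub) => _ SD; apply: SD; [apply: su | apply: sv].
Qed.

HB.instance Definition _ :=
  GRing.isSubmodClosed.Build K V span span_submod_closed.

Lemma span_ind (S : {pred V}) : submod_closed S ->
  (forall x, X x -> x \in S) -> {subset span <= S}.
Proof. by move=> Ssub XS v /asboolP; apply. Qed.

End Span.

Section FreeLift.
Variables (K : fieldType) (X : choiceType) (U : lmodType K) (f : X -> U).

Definition flift (g : {malg K[X]}) : U := \sum_(k <- msupp g) g@_k *: f k.

Lemma fliftEw (d : {fset X}) g : (msupp g `<=` d)%fset ->
  flift g = \sum_(k <- d) g@_k *: f k.
Proof.
move=> le; rewrite [LHS](big_fset_incl _ le) => //= x xd /mcoeff_outdom ->.
by rewrite scale0r.
Qed.

Lemma flift_is_linear : linear flift.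
Proof.
move=> c g h; pose d := (msupp g `|` msupp h)%fset.
have sub : (msupp (c *: g + h) `<=` d)%fset.
  apply: (fsubset_trans (msuppD_le _ _)).
  by apply: fsetSU; apply: msuppZ_le.
rewrite (fliftEw sub) (fliftEw (fsubsetUl (msupp g) (msupp h))).
rewrite (fliftEw (fsubsetUr (msupp g) (msupp h))) scaler_sumr -big_split /=.
by apply: eq_bigr => k _; rewrite mcoeffD mcoeffZ scalerDl scalerA.
Qed.

HB.instance Definition _ :=
  GRing.isLinear.Build K {malg K[X]} U *:%R flift flift_is_linear.

Lemma fliftU x : flift << x >> = f x.
Proof. by rewrite (fliftEw msuppU_le) big_seq_fset1 mcoeffUU scale1r. Qed.

End FreeLift.

Section Tensor.
Variables (K : fieldType) (V W : lmodType K).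
Local Notation free := {malg K[(V * W)%type]}.

Inductive tensor_rel : free -> Prop :=
| tensor_rel_l c v v' w : tensor_rel
    (<< (c *: v + v', w) >> - (c *: << (v, w) >> + << (v', w) >>))
| tensor_rel_r c v w w' : tensor_rel
    (<< (v, c *: w + w') >> - (c *: << (v, w) >> + << (v, w') >>)).

Definition tensor := Quotient.quot (span tensor_rel).
HB.instance Definition _ := Choice.on tensor.
HB.instance Definition _ := GRing.Zmodule.on tensor.
HB.instance Definition _ : EqQuotient _ _ tensor := EqQuotient.on tensor.

Definition tpi (g : free) : tensor := \pi_tensor g.

Lemma tpiD : {morph tpi : g h / g + h}.
Proof. by move=> g h; rewrite /tpi [LHS]Quotient.pi_add. Qed.

Lemma tpi_eq g h : tpi g = tpi h <-> g - h \in span tensor_rel.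
Proof.
by rewrite Quotient.idealrBE; split=> [/eqP|/eqP].
Qed.

Lemma reprtK t : tpi (repr t) = t. Proof. exact: reprK. Qed.

Definition tscale := locked (fun c (t : tensor) => tpi (c *: repr t)).

Lemma tpiZ c g : tpi (c *: g) = tscale c (tpi g).
Proof.
rewrite /tscale -lock; apply/tpi_eq; rewrite -scalerBr; apply: rpredZ.
by apply/tpi_eq; rewrite reprtK.
Qed.

Fact tscaleA a b t : tscale a (tscale b t) = tscale (a * b) t.
Proof. by rewrite -[t]reprtK -!tpiZ scalerA. Qed.
Fact tscale1 : left_id 1 tscale.
Proof. by move=> t; rewrite -[t]reprtK -!tpiZ scale1r. Qed.
Fact tscaleDr : right_distributive tscale +%R.
Proof.
by move=> c t u; rewrite -[t]reprtK -[u]reprtK -tpiD -!tpiZ -tpiD scalerDr.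
Qed.
Fact tscaleDl t : {morph tscale^~ t : a b / a + b}.
Proof. by move=> a b; rewrite -[t]reprtK -!tpiZ -tpiD scalerDl. Qed.

HB.instance Definition _ := GRing.Zmodule_isLmodule.Build K tensor
  tscaleA tscale1 tscaleDr tscaleDl.

Lemma tpi_is_linear : linear tpi.
Proof. by move=> c g h; rewrite tpiD tpiZ. Qed.
HB.instance Definition _ :=
  GRing.isLinear.Build K free tensor *:%R tpi tpi_is_linear.

End Tensor.

HB.lock Definition tens (K : fieldType) (V W : lmodType K) (v : V) (w : W) :
  tensor V W := tpi << (v, w) >>.
Arguments tens {K V W} v w.

Section TensorTheory.
Variables (K : fieldType) (V W : lmodType K).
Local Notation free := {malg K[(V * W)%type]}.
Local Notation tensor := (tensor V W).
Local Notation tens := (@tens K V W).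

Lemma tens_linear_l w : linear (tens^~ w).
Proof. by move=> c v v'; rewrite !unlock -linearP; apply/tpi_eq/span_gen; left. Qed.
Lemma tens_linear_r v : linear (tens v).
Proof. by move=> c w w'; rewrite !unlock -linearP; apply/tpi_eq/span_gen; right. Qed.

Lemma tens_ind (P : tensor -> Prop) :
  (forall c v w t, P t -> P (c *: tens v w + t)) -> P 0 -> forall t, P t.
Proof.
move=> PD P0 t; rewrite -[t]reprtK; move: (repr t) => g.
rewrite [g]monalgE raddf_sum; elim: (X in \sum_(i <- X) _) => [|k s IH].
  by rewrite big_nil.
rewrite big_cons; have -> : << g@_k *g k >> = g@_k *: << k >> :> free.
  by apply/malgP => x; rewrite mcoeffZ !mcoeffU mulr_natr.
by rewrite /= tpiZ; case: k => v w; move: (PD g@_(v, w) v w); rewrite tens.unlock; apply.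
Qed.

End TensorTheory.

(* Sweedler sums: for f bilinear, [tlift f t] is the value at t of the linear
   map sending [tens v w] to [f v w] (see [tliftE] and [tlift_is_linear]). *)
HB.lock Definition tlift (K : fieldType) (V W U : lmodType K)
    (f : V -> W -> U) (t : tensor V W) : U :=
  flift (fun vw => f vw.1 vw.2) (repr t).
Arguments tlift {K V W U} f t.

Section Lift.
Variables (K : fieldType) (V W U : lmodType K) (f : V -> W -> U).
Local Notation tensor_rel := (@tensor_rel K V W).
Hypotheses (f_l : forall w, linear (f^~ w)) (f_r : forall v, linear (f v)).
Let ff := (fun vw : V * W => f vw.1 vw.2).

Lemma flift_tensor_rel g : g \in span tensor_rel -> flift ff g = 0.
Proof.
move=> gs; apply/eqP; move: g gs.
apply: (@span_ind _ _ _ [pred g | flift ff g == 0]).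
  split=> [|c u v]; rewrite !inE ?linear0 // => /eqP u0 /eqP v0.
  by rewrite linearP /= u0 v0 scaler0 addr0.
move=> _ [c v v' w|c v w w']; rewrite inE linearB linearP /= !fliftU /ff /=.
  by rewrite f_l subrr.
by rewrite f_r subrr.
Qed.

Lemma tlift_pi g : tlift f (tpi g) = flift ff g.
Proof.
apply/eqP; rewrite -subr_eq0 unlock -/ff -linearB /= flift_tensor_rel //.
by apply/tpi_eq; rewrite reprtK.
Qed.

Lemma tliftE v w : tlift f (tens v w) = f v w.
Proof. by rewrite tens.unlock tlift_pi fliftU. Qed.

Lemma tlift_is_linear : linear (tlift f).
Proof.
move=> c t u; rewrite -[t]reprtK -[u]reprtK -linearP !tlift_pi.
by rewrite linearP.
Qed.

End Lift.

Definition tmull (K : fieldType) (A B : pzAlgType K) (a : A) (b : B) :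
    tensor A B -> tensor A B :=
  tlift (fun c d => tens (a * c) (b * d)).
HB.lock Definition tmul (K : fieldType) (A B : pzAlgType K)
    (t u : tensor A B) : tensor A B :=
  tlift (fun a b => tmull a b u) t.
Arguments tmul {K A B} t u.

Section TensorAlgebra.
Variables (K : fieldType) (A B : pzAlgType K).
Local Notation T := (tensor A B).
Implicit Types (a c : A) (b d : B) (t u : T).


Local Lemma lin_comp (U V W : lmodType K) (g : V -> W) (f : U -> V) :
  linear f -> linear g -> linear (fun x => g (f x)).
Proof. by move=> lf lg c x y; rewrite lf lg. Qed.

Local Lemma lin_aux (U : lmodType K) (c k : K) (x y u v : U) :
  k *: (c *: x + y) + (c *: u + v) = c *: (k *: x + u) + (k *: y + v).
Proof. by rewrite !scalerDr !scalerA (mulrC k) addrACA. Qed.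

Local Lemma mulr_lin (X : pzAlgType K) (x : X) : linear (fun y : X => x * y).
Proof. by move=> c y z; rewrite mulrDr pzscaleAr. Qed.
Local Lemma mull_lin (X : pzAlgType K) (x : X) : linear (fun y : X => y * x).
Proof. by move=> c y z; rewrite mulrDl pzscaleAl. Qed.

Local Lemma mull_l a b d : linear (fun c => tens (a * c) (b * d)).
Proof. exact: lin_comp (mulr_lin a) (tens_linear_l _). Qed.
Local Lemma mull_r a b c : linear (fun d => tens (a * c) (b * d)).
Proof. exact: lin_comp (mulr_lin b) (tens_linear_r _). Qed.

Lemma tmullE a b c d : tmull a b (tens c d) = tens (a * c) (b * d).
Proof. by rewrite /tmull tliftE // => *; [exact: mull_l | exact: mull_r]. Qed.
Lemma tmull_linear a b : linear (tmull a b).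
Proof. by apply: tlift_is_linear => *; [exact: mull_l | exact: mull_r]. Qed.

Local Lemma lin0 (U V : lmodType K) (f : U -> V) : linear f -> f 0 = 0.
Proof. by move=> lf; rewrite -[0 in LHS](subrr 0) -scaleN1r addrC lf scaleN1r addNr. Qed.

Lemma tmull_linear_l b u : linear (fun a => tmull a b u).
Proof.
move=> c a a'; elim/tens_ind: u => [k x y u IH|]; last first.
  by rewrite !(lin0 (tmull_linear _ _)) scaler0 addr0.
rewrite !tmull_linear IH !tmullE mulrDl -pzscaleAl tens_linear_l.
exact: lin_aux.
Qed.
Lemma tmull_linear_r a u : linear (fun b => tmull a b u).
Proof.
move=> c b b'; elim/tens_ind: u => [k x y u IH|]; last first.
  by rewrite !(lin0 (tmull_linear _ _)) scaler0 addr0.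
rewrite !tmull_linear IH !tmullE mulrDl -pzscaleAl tens_linear_r.
exact: lin_aux.
Qed.

Lemma tmul_linear_l u : linear (tmul^~ u).
Proof.
by rewrite unlock; apply: tlift_is_linear => [b|a]; [exact: tmull_linear_l | exact: tmull_linear_r].
Qed.
Lemma tmul_tens a b u : tmul (tens a b) u = tmull a b u.
Proof.
by rewrite unlock tliftE // => [b'|a']; [exact: tmull_linear_l | exact: tmull_linear_r].
Qed.
Lemma tmul_linear_r t : linear (tmul t).
Proof.
move=> c u u'; elim/tens_ind: t => [k x y t IH|]; last first.
  by rewrite !(lin0 (tmul_linear_l _)) scaler0 addr0.
rewrite !tmul_linear_l IH !tmul_tens tmull_linear.
exact: lin_aux.
Qed.
Lemma tmulE a b c d : tmul (tens a b) (tens c d) = tens (a * c) (b * d).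
Proof. by rewrite tmul_tens tmullE. Qed.

Fact tmul0t u : tmul 0 u = 0. Proof. exact: (lin0 (tmul_linear_l u)). Qed.
Fact tmult0 t : tmul t 0 = 0. Proof. exact: (lin0 (tmul_linear_r t)). Qed.

Local Notation tmul := (@tmul K A B).

Fact tmulA : associative tmul.
Proof.
move=> t u w; elim/tens_ind: t => [k a b t IH|]; last by rewrite !tmul0t.
suff E : tmul (tens a b) (tmul u w) = tmul (tmul (tens a b) u) w.
  by rewrite [LHS]tmul_linear_l IH E [in RHS]tmul_linear_l [RHS]tmul_linear_l.
move=> {t IH}.
elim/tens_ind: u => [{}k c d u IH|]; last by rewrite tmul0t tmult0 tmul0t.
suff E : tmul (tens a b) (tmul (tens c d) w) =
         tmul (tmul (tens a b) (tens c d)) w.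
  by rewrite [in LHS]tmul_linear_l [LHS]tmul_linear_r IH E tmul_linear_r tmul_linear_l.
move=> {u IH}.
elim/tens_ind: w => [{}k e f w IH|]; last by rewrite !tmult0.
by rewrite !tmul_linear_r IH !tmulE !mulrA.
Qed.
Fact tmul1t : left_id (@tens K A B 1 1) tmul.
Proof.
elim/tens_ind => [k a b t IH|]; last by rewrite tmult0.
by rewrite tmul_linear_r IH tmulE !mul1r.
Qed.
Fact tmult1 : right_id (@tens K A B 1 1) tmul.
Proof.
elim/tens_ind => [k a b t IH|]; last by rewrite tmul0t.
by rewrite tmul_linear_l IH tmulE !mulr1.
Qed.
Fact tmulDl : left_distributive tmul +%R.
Proof. by move=> t u w; rewrite -[t]scale1r tmul_linear_l !scale1r. Qed.
Fact tmulDr : right_distributive tmul +%R.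
Proof. by move=> t u w; rewrite -[u]scale1r tmul_linear_r !scale1r. Qed.

Fact tscaleAl (k : K) t u : k *: tmul t u = tmul (k *: t) u.
Proof. by rewrite -[k *: t]addr0 tmul_linear_l tmul0t addr0. Qed.
Fact tscaleAr (k : K) t u : k *: tmul t u = tmul t (k *: u).
Proof. by rewrite -[k *: u]addr0 tmul_linear_r tmult0 addr0. Qed.

HB.instance Definition _ := Lmodule_isPzAlgebra.Build K T
  tmulA tmul1t tmult1 tmulDl tmulDr tscaleAl tscaleAr.
HB.instance Definition _ := GRing.PzRing.copy T (PzAlgebra.sort T).

Lemma tens1 : (1 : T) = tens (1 : A) (1 : B). Proof. exact: erefl. Qed.
Lemma tensM a b c d : tens a b * tens c d = tens (a * c) (b * d).
Proof. exact: tmulE. Qed.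

End TensorAlgebra.

Lemma malg_scaleAr (K : fieldType) (M : monomType) (c : K)
    (x y : {malg K[M]}) : c *: (x * y) = x * (c *: y).
Proof.
rewrite malgME (malgMEw (fsubset_refl (msupp x)) (msuppZ_le c y)).
rewrite scaler_sumr; apply: eq_bigr => k _; rewrite scaler_sumr.
apply: eq_bigr => l _; apply/malgP => m.
by rewrite !mcoeffZ !mcoeffU mulrnAr mulrCA.
Qed.

Section FreeAlgebra.
Variables (K : fieldType) (X : choiceType).

Definition free_alg := {malg K[{fmonom X}]}.
HB.instance Definition _ := GRing.Lalgebra.on free_alg.
HB.instance Definition _ := GRing.Lalgebra_isAlgebra.Build K free_alg
  (@malg_scaleAr K {fmonom X}).

End FreeAlgebra.

HB.lock Definition fgen (K : fieldType) (X : choiceType) (x : X) :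
  free_alg K X := << fmu x >>.

Section QuotientAlgebra.
Variables (K : fieldType) (F : algType K) (rel : F -> F -> Prop).

Definition two_sided_ideal (I : {pred F}) :=
  submod_closed I /\
  forall x y, x \in I -> y * x \in I /\ x * y \in I.

Definition rel_ideal : {pred F} := fun z =>
  `[< forall I : {pred F}, two_sided_ideal I ->
        (forall x y, rel x y -> x - y \in I) -> z \in I >].

Lemma rel_ideal_gen x y : rel x y -> x - y \in rel_ideal.
Proof. by move=> xy; apply/asboolP => I _; apply. Qed.

Lemma rel_ideal_two_sided : two_sided_ideal rel_ideal.
Proof.
split; [split=> [|c u v /asboolP su /asboolP sv] | move=> x y /asboolP sx].
- by apply/asboolP => I [[]].
- apply/asboolP => I II rI; case: (II) => -[_ ID] _.
  by apply: ID; [apply: su | apply: sv].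
- split; apply/asboolP => I II rI.
    exact: (II.2 x y (sx I II rI)).1.
  exact: (II.2 x y (sx I II rI)).2.
Qed.

Lemma rel_ideal_ind (I : {pred F}) : two_sided_ideal I ->
  (forall x y, rel x y -> x - y \in I) -> {subset rel_ideal <= I}.
Proof. by move=> II rI v /asboolP; apply. Qed.

HB.instance Definition _ := GRing.isSubmodClosed.Build K F rel_ideal
  (proj1 rel_ideal_two_sided).

(* The quotient of F by the two-sided ideal generated by the differences
   x - y for [rel x y]; for F = free_alg K X this is the unital associative
   algebra presented by the generators X and the relations x = y. *)
Definition presented := Quotient.quot rel_ideal.
HB.instance Definition _ := Choice.on presented.
HB.instance Definition _ := GRing.Zmodule.on presented.
HB.instance Definition _ : EqQuotient _ _ presented := EqQuotient.on presented.

Definition ppi (x : F) : presented := \pi_presented x.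

Lemma ppi_eq x y : ppi x = ppi y <-> x - y \in rel_ideal.
Proof. by rewrite Quotient.idealrBE; split=> [/eqP|/eqP]. Qed.

Lemma ppi_rel x y : rel x y -> ppi x = ppi y.
Proof. by move=> /rel_ideal_gen /ppi_eq. Qed.

Lemma reprpK t : ppi (repr t) = t. Proof. exact: reprK. Qed.

Lemma ppiD : {morph ppi : x y / x + y}.
Proof. by move=> x y; rewrite /ppi [LHS]Quotient.pi_add. Qed.

Definition pscale := locked (fun c (t : presented) => ppi (c *: repr t)).
Definition pmul := locked (fun t u : presented => ppi (repr t * repr u)).

Lemma ppiZ_def c x : ppi (c *: x) = pscale c (ppi x).
Proof.
rewrite /pscale -lock; apply/ppi_eq; rewrite -scalerBr; apply: rpredZ.
by apply/ppi_eq; rewrite reprpK.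
Qed.

Lemma ppiM_def x y : ppi (x * y) = pmul (ppi x) (ppi y).
Proof.
have idealM := proj2 rel_ideal_two_sided.
rewrite /pmul -lock; apply/ppi_eq; set x' := repr _; set y' := repr _.
rewrite -[X in X - _](addrNK (x * y')) -mulrBr -addrA -mulrBl.
apply: rpredD; [apply: (idealM _ x _).1 | apply: (idealM _ y' _).2].
  by apply/ppi_eq; rewrite reprpK.
by apply/ppi_eq; rewrite reprpK.
Qed.

Fact pscaleA a b t : pscale a (pscale b t) = pscale (a * b) t.
Proof. by rewrite -[t]reprpK -!ppiZ_def scalerA. Qed.
Fact pscale1 : left_id 1 pscale.
Proof. by move=> t; rewrite -[t]reprpK -!ppiZ_def scale1r. Qed.
Fact pscaleDr : right_distributive pscale +%R.
Proof.
by move=> c t u; rewrite -[t]reprpK -[u]reprpK -ppiD -!ppiZ_def -ppiD scalerDr.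
Qed.
Fact pscaleDl t : {morph pscale^~ t : a b / a + b}.
Proof. by move=> a b; rewrite -[t]reprpK -!ppiZ_def -ppiD scalerDl. Qed.
HB.instance Definition _ := GRing.Zmodule_isLmodule.Build K presented
  pscaleA pscale1 pscaleDr pscaleDl.

Fact pmulA : associative pmul.
Proof.
by move=> t u w; rewrite -[t]reprpK -[u]reprpK -[w]reprpK -!ppiM_def mulrA.
Qed.
Fact pmul1t : left_id (ppi 1) pmul.
Proof. by move=> t; rewrite -[t]reprpK -ppiM_def mul1r. Qed.
Fact pmult1 : right_id (ppi 1) pmul.
Proof. by move=> t; rewrite -[t]reprpK -ppiM_def mulr1. Qed.
Fact pmulDl : left_distributive pmul +%R.
Proof.
move=> t u w; rewrite -[t]reprpK -[u]reprpK -[w]reprpK.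
by rewrite -ppiD -!ppiM_def -ppiD mulrDl.
Qed.
Fact pmulDr : right_distributive pmul +%R.
Proof.
move=> t u w; rewrite -[t]reprpK -[u]reprpK -[w]reprpK.
by rewrite -ppiD -!ppiM_def -ppiD mulrDr.
Qed.
Fact ppscaleAl c t u : c *: pmul t u = pmul (c *: t) u.
Proof.
by rewrite -[t]reprpK -[u]reprpK -ppiM_def /GRing.scale /= -!ppiZ_def -ppiM_def
  scalerAl.
Qed.
Fact ppscaleAr c t u : c *: pmul t u = pmul t (c *: u).
Proof.
by rewrite -[t]reprpK -[u]reprpK -ppiM_def /GRing.scale /= -!ppiZ_def -ppiM_def
  scalerAr.
Qed.
HB.instance Definition _ := Lmodule_isPzAlgebra.Build K presented
  pmulA pmul1t pmult1 pmulDl pmulDr ppscaleAl ppscaleAr.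
HB.instance Definition _ := GRing.PzRing.copy presented (PzAlgebra.sort presented).

Lemma ppi_is_linear : linear ppi.
Proof. by move=> c x y; rewrite ppiD ppiZ_def. Qed.
HB.instance Definition _ :=
  GRing.isLinear.Build K F presented *:%R ppi ppi_is_linear.
Lemma ppi_is_monoid_morphism : monoid_morphism ppi.
Proof. by split; [| exact: ppiM_def]. Qed.
HB.instance Definition _ :=
  GRing.isMonoidMorphism.Build F presented ppi ppi_is_monoid_morphism.

End QuotientAlgebra.

Section HopfAlgebra.
Variables (K : fieldType) (A : pzAlgType K).

Record hopf_struct := HopfStruct {
  comul : {linear A -> tensor A A};
  counit : {scalar A};
  antipode : {linear A -> A};
  comul_morph : monoid_morphism (fun h : A => comul h : tensor A A);
  counit_morph : monoid_morphism (fun h : A => counit h : K);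
  comulA : forall h : A,
    tlift (fun a b : A => tlift (fun c d : A => tens (tens a c) d) (comul b)) (comul h) =
    tlift (fun a b : A => tens (comul a) b) (comul h);
  counitl : forall h : A, tlift (fun a b : A => counit a *: b) (comul h) = h;
  counitr : forall h : A, tlift (fun a b : A => counit b *: a) (comul h) = h;
  antipodel : forall h : A,
    tlift (fun a b : A => antipode a * b) (comul h) = counit h *: (1 : A);
  antipoder : forall h : A,
    tlift (fun a b : A => a * antipode b) (comul h) = counit h *: (1 : A)
}.

Definition tswap : tensor A A -> tensor A A := tlift (fun a b : A => tens b a).

Variable H : hopf_struct.
Implicit Types (h Lam v : A) (lam : {scalar A}) (R : tensor A A).

Definition comul_op h := tswap (comul H h).

Definition grouplike h := comul H h = tens h h /\ counit H h = 1.

Definition left_integral lam := forall h,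
  tlift (fun h1 h2 : A => lam h2 *: h1) (comul H h) = lam h *: (1 : A).

Definition nonzero_left_integral lam :=
  left_integral lam /\ exists h, lam h != 0.

Definition nonzero_cointegral Lam :=
  (forall h, h * Lam = counit H h *: Lam /\ Lam * h = counit H h *: Lam) /\
  Lam <> 0.

Definition unimodular := exists Lam, nonzero_cointegral Lam.

Definition quasitriangular R :=
  [/\ tlift (fun a b : A => tens (comul H a) b) R =
        tlift (fun a1 b1 : A =>
          tlift (fun a2 b2 : A => tens (tens a1 a2) (b1 * b2)) R) R,
      tlift (fun a b : A => tens a (comul_op b)) R =
        tlift (fun a1 b1 : A =>
          tlift (fun a2 b2 : A => tens (a1 * a2) (tens b1 b2)) R) R,
      tlift (fun a b : A => counit H a *: b) R = 1,
      tlift (fun a b : A => counit H b *: a) R = 1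
    & forall h, comul_op h * R = R * comul H h].

Definition monodromy R := tswap R * R.

Definition ribbon_element R v :=
  [/\ forall h, v * h = h * v, antipode H v = v, counit H v = 1
    & monodromy R * comul H v = tens v v].

(* The space of left integrals is one-dimensional, so any nonzero one will do. *)
Definition twist_degenerate v :=
  exists2 lam, nonzero_left_integral lam & lam v = 0.

Definition projective (P : lmodType A) :=
  forall (M N : lmodType A) (g : {linear M -> N}) (f : {linear P -> N}),
    (forall y, exists x, g x = y) ->
    exists e : {linear P -> M}, forall x, g (e x) = f x.

(* P is projective and maps onto the trivial module (K with A acting through
   the counit) with superfluous kernel. *)
Definition projective_cover_of_trivial (P : lmodType A) :=
  projective P /\
  exists pr : {linear P -> K | fun a c => counit H a * c},
    (forall c, exists x, pr x = c) /\
    forall N : {pred P}, submod_closed N ->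
      (forall x, exists2 y, y \in N & pr (x - y) = 0) -> forall x, x \in N.

(* The element whose action on the projective cover is the map
   Delta_0^{P_1}. *)
Definition chromatic_elt R lam : A :=
  tlift (fun a b : A => lam (antipode H a) *: b) (monodromy R).

Definition chromatic_nondegenerate R :=
  exists (P : lmodType A) lam,
    [/\ projective_cover_of_trivial P, nonzero_left_integral lam
      & exists x : P, chromatic_elt R lam *: x <> 0].

Definition chromatic_compact R :=
  exists (P : lmodType A) lam Lam,
    [/\ projective_cover_of_trivial P, nonzero_left_integral lam,
        nonzero_cointegral Lam
      & exists2 zeta : K, zeta != 0 &
          forall x : P, chromatic_elt R lam *: x = (zeta *: Lam) *: x].

End HopfAlgebra.

Section TheAlgebra.
Variable p : nat.

Inductive gen :=
| genK | genE | genF | genL | genZ of bool & 'I_p | genS of 'S_p.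

Definition gen_code (g : gen) : 'I_4 + (bool * 'I_p) + 'S_p :=
  match g with
  | genK => inl (inl (inord 0))
  | genE => inl (inl (inord 1))
  | genF => inl (inl (inord 2))
  | genL => inl (inl (inord 3))
  | genZ b l => inl (inr (b, l))
  | genS s => inr s
  end.
Definition gen_decode (c : 'I_4 + (bool * 'I_p) + 'S_p) : gen :=
  match c with
  | inl (inl i) => nth genL [:: genK; genE; genF] i
  | inl (inr (b, l)) => genZ b l
  | inr s => genS s
  end.
Fact gen_codeK : cancel gen_code gen_decode.
Proof. by case=> //=; rewrite inordK. Qed.
HB.instance Definition _ := Choice.copy gen (can_type gen_codeK).

Variables (K : fieldType) (r : nat) (q : K).
Local Notation r' := (r %/ 2)%N.
Local Notation r'' := (r %/ 4)%N.
Local Notation free := (free_alg K gen).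

Local Notation fK := (@fgen K gen genK : free).
Local Notation fE := (@fgen K gen genE : free).
Local Notation fF := (@fgen K gen genF : free).
Local Notation fL := (@fgen K gen genL : free).
Local Notation fZ e l := (@fgen K gen (genZ e l) : free).
Local Notation fS s := (@fgen K gen (genS s) : free).
(* K is invertible because K^r' = 1 *)
Local Notation fKinv := (fK ^+ r'.-1).

(* [fZ true l] is Z_l^+ and [fZ false l] is Z_l^-.  Permutations act on the
   left of {1, ..., p}: their product is composition, sigma tau = sigma o tau,
   whereas MathComp's [(s * t)%g] is "s, then t". *)
Inductive A_rel : free -> free -> Prop :=
| A_rel_Kr : A_rel (fK ^+ r') 1
| A_rel_Er : A_rel (fE ^+ r') 0
| A_rel_Fr : A_rel (fF ^+ r') 0
| A_rel_KE : A_rel (fK * fE * fKinv) (q ^+ 2 *: fE)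
| A_rel_KF : A_rel (fK * fF * fKinv) (q ^- 2 *: fF)
| A_rel_EF : A_rel (fE * fF - fF * fE) ((q - q^-1)^-1 *: (fK - fKinv))
| A_rel_L2 : A_rel (fL ^+ 2) 1
| A_rel_LZ e l : A_rel (fL * fZ e l) (- (fZ e l * fL))
| A_rel_Z2 e l : A_rel (fZ e l ^+ 2) 0
| A_rel_ZZ e l e' l' : A_rel (fZ e l * fZ e' l') (- (fZ e' l' * fZ e l))
| A_rel_LK : A_rel (fL * fK) (fK * fL)
| A_rel_LE : A_rel (fL * fE) (fE * fL)
| A_rel_LF : A_rel (fL * fF) (fF * fL)
| A_rel_KZ e l : A_rel (fK * fZ e l) (- (fZ e l * fK))
| A_rel_EZ e l : A_rel (fE * fZ e l) (- (fZ e l * fE))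
| A_rel_FZ e l : A_rel (fF * fZ e l) (fZ e l * fF)
| A_rel_S1 : A_rel (fS 1%g) 1
| A_rel_SS s t : A_rel (fS s * fS t) (fS (t * s)%g)
| A_rel_SE s : A_rel (fS s * fE) (fE * fS s)
| A_rel_SF s : A_rel (fS s * fF) (fF * fS s)
| A_rel_SK s : A_rel (fS s * fK) (fK * fS s)
| A_rel_SL s : A_rel (fS s * fL) (fL * fS s)
| A_rel_SZ s e l : A_rel (fS s * fZ e l) (fZ e (s l) * fS s).

(* u_q sl_2 |x SF_{2p} x| K[S_p] *)
Definition biproduct : Type := presented A_rel.
HB.instance Definition _ := PzAlgebra.on biproduct.
HB.instance Definition _ := GRing.PzRing.on biproduct.
Local Notation A := biproduct.

Definition aK : A := ppi A_rel fK.
Definition aE : A := ppi A_rel fE.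
Definition aF : A := ppi A_rel fF.
Definition aL : A := ppi A_rel fL.
Definition aZp l : A := ppi A_rel (fZ true l).
Definition aZm l : A := ppi A_rel (fZ false l).
Definition aS s : A := ppi A_rel (fS s).
Definition aKinv : A := aK ^+ r'.-1.
Definition aLbar : A := aK ^+ r'' * aL.

Definition Zcoprod (H : hopf_struct A) (z : A) :=
  [/\ comul H z = tens (1 : A) z + tens z aLbar, counit H z = 0
    & antipode H z = - (z * aLbar)].

(* L is its own inverse because L^2 = 1. *)
Definition biproduct_hopf (H : hopf_struct A) :=
  [/\ [/\ grouplike H aK, grouplike H aL & forall s, grouplike H (aS s)],
      [/\ antipode H aK = aKinv, antipode H aL = aL
        & forall s, antipode H (aS s) = aS s^-1%g],
      [/\ comul H aE = tens (1 : A) aE + tens aE aK, counit H aE = 0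
        & antipode H aE = - (aE * aKinv)],
      [/\ comul H aF = tens aF (1 : A) + tens aKinv aF, counit H aF = 0
        & antipode H aF = - (aK * aF)]
    & forall l, Zcoprod H (aZp l) /\ Zcoprod H (aZm l)].

Definition qbrace (k : nat) : K := q ^+ k - q ^- k.
Definition qint (k : nat) : K := qbrace k / qbrace 1.
Definition qfact (k : nat) : K := \prod_(1 <= i < k.+1) qint i.

Local Notation T := (tensor A A).

Definition Rz : T :=
  2^-1 *: \sum_(v < 2) \sum_(w < 2) (-1) ^+ (v * w)%N *: tens (aL ^+ w) (aL ^+ v).

Definition Dmx : T :=
  r'%:R^-1 *: \sum_(b < r') \sum_(c < r')
    q ^- (2 * b * c)%N *: tens (aK ^+ b) (aK ^+ c).

Definition Theta : T :=
  \sum_(a < r') (qbrace 1 ^+ a / qfact a * q ^+ ((a * a.-1) %/ 2)%N) *: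
    tens (aE ^+ a) (aF ^+ a).

(* The commuting square-zero terms of the exponent are the 2p elements
   alpha_l Z_l^+ (x) Lbar Z_l^- and - alpha_l Z_l^- (x) Lbar Z_l^+ (the sum of
   the two for a given l does not square to zero). *)
Definition Rbar (alpha : 'I_p -> K) : T :=
  \prod_(l < p) ((1 + alpha l *: tens (aZp l) (aLbar * aZm l)) *
                 (1 - alpha l *: tens (aZm l) (aLbar * aZp l))).

Definition Rmatrix (alpha : 'I_p -> K) : T := Rz * Dmx * Theta * Rbar alpha.

End TheAlgebra.

(* Main.v *)
Require Import Defs.
From HB Require Import structures.
From mathcomp Require Import all_boot all_order all_fingroup all_algebra.
From mathcomp Require Import generic_quotient finmap boolp ring zify.
From mathcomp.multinomials Require Import monalg.

(* The algebra A has the PBW-type top element Z = prod_l Z_l^+ Z_l^-, and with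
   n = r' - 1 the element Lambda = (sum_s s)(1 + L)(sum_c K^c) F^n E^n Z is a
   two-sided cointegral.  A functional rho picking the coefficient of
   K F^n E^n Z is built as an average of matrix coefficients of explicit
   representations; rho(Lambda_1) Lambda_2 = 1, so rho o S is the left integral,
   and no basis of A is ever needed.
   All alpha_l are taken equal to 1, which makes R invariant under S_p.
   - Ribbon: v = K^{-1} u with u the Drinfeld element.  Then S(v) v^{-1} is a
     central grouplike element; the filtration by the number of letters E, F, Z
     puts it in the group generated by K, L and S_p, and centrality forces 1.
   - Twist: the automorphism L |-> -L fixes rho and sends v to -v, because
     S(R_z'') R_z' = L for the factor R_z of R.
   - Chromatic: with s = (sum_s s)(1 + L)(sum_c K^c), the factors R_z and D are
     absorbed by s, and top-degree considerations give
     s lambda(S(M')) M'' = k Lambda with k <> 0.  Hence Delta_0 is nonzero on the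
     projective cover; as eps(s) = p! 2 r' = 0 in characteristic p while
     s Lambda = eps(s) Lambda, it is not a multiple of Lambda. *)

Set Implicit Arguments.
Unset Strict Implicit.
Unset Printing Implicit Defensive.

Import GRing.Theory.
Local Open Scope ring_scope.

(** * Linear calculus on tensor products *)

(** A is given only by generators and relations, so spanning sets are cheap and every nonvanishing
    must come from a module. The modules used here have a vacuum on which K and L act by scalars
    [kap] and [ell]; E, F and the Z raise the degree by at most one, and the top vector has degree n
    + n + 2p. Hence a matrix coefficient from the vacuum to the top vanishes on shorter words, and
    Fourier inversion over [kap] and [ell] separates the powers of K and L. The power K^1 is singled
    out because Δ(E^n) has leading term E^n ⊗ K^n and K K^n = 1; this makes rho(Λ_1) Λ_2 equal to 1.
    That identity replaces a basis: a = rho(S(a) Λ_1) Λ_2 exhibits finitely many elements with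
    linear coordinates, enough linear algebra for minimal idempotents and separating functionals.
    Both hexagon identities for R are instances of one computation with truncated q-exponentials,
    whose terms of too high degree vanish because E^N = F^N = 0. *)

Section LinearCalculus.
Variable K : fieldType.
Implicit Types U V W : lmodType K.

Lemma linD U V (f : U -> V) : linear f -> {morph f : x y / x + y}.
Proof. by move=> lf x y; rewrite -[x]scale1r lf !scale1r. Qed.
Lemma lin0 U V (f : U -> V) : linear f -> f 0 = 0.
Proof. by move=> lf; apply: (addrI (f 0)); rewrite -(linD lf) !addr0. Qed.
Lemma linZ U V (f : U -> V) : linear f -> forall c, {morph f : x / c *: x}.
Proof. by move=> lf c x; rewrite -[c *: x]addr0 lf (lin0 lf) addr0. Qed.
Lemma linN U V (f : U -> V) : linear f -> {morph f : x / - x}.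
Proof. by move=> lf x; rewrite -!scaleN1r (linZ lf). Qed.
Lemma linB U V (f : U -> V) : linear f -> {morph f : x y / x - y}.
Proof. by move=> lf x y; rewrite (linD lf) (linN lf). Qed.
Lemma lin_sum U V (f : U -> V) (lf : linear f) I (r : seq I) (P : pred I) F :
  f (\sum_(i <- r | P i) F i) = \sum_(i <- r | P i) f (F i).
Proof. exact: (big_morph f (linD lf) (lin0 lf)). Qed.

Lemma linear_app U V W (g : {linear V -> W}) (f : U -> V) :
  linear f -> linear (fun x => g (f x)).
Proof. by move=> lf c x y; rewrite lf linearP. Qed.
Lemma linear_compose U V W (g : V -> W) (f : U -> V) :
  linear g -> linear f -> linear (fun x => g (f x)).
Proof. by move=> lg lf c x y; rewrite lf lg. Qed.
Lemma linear_id U : linear (fun x : U => x). Proof. by []. Qed.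
Lemma linear_zero U V : linear (fun _ : U => 0 : V).
Proof. by move=> c x y; rewrite scaler0 addr0. Qed.
Lemma linear_add U V (f g : U -> V) :
  linear f -> linear g -> linear (fun x => f x + g x).
Proof. by move=> lf lg c x y; rewrite lf lg scalerDr addrACA. Qed.
Lemma linear_opp U V (f : U -> V) : linear f -> linear (fun x => - f x).
Proof. by move=> lf c x y; rewrite lf opprD scalerN. Qed.
Lemma linear_scaler U V (f : U -> V) k : linear f -> linear (fun x => k *: f x).
Proof. by move=> lf c x y; rewrite lf scalerDr !scalerA mulrC. Qed.
Lemma linear_scalel U V (f : U -> K^o) (v : V) :
  linear f -> linear (fun x => (f x : K) *: v).
Proof. by move=> lf c x y; rewrite lf scalerDl scalerA. Qed.
Lemma linear_scalarl U V (f : {scalar V}) (g : U -> V) :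
  linear g -> linear (fun x => f (g x) : K^o).
Proof. by move=> lg c x y; rewrite lg linearP. Qed.
Lemma linear_scalarM U (f : U -> K^o) k :
  linear f -> linear (fun x => (k * (f x : K)) : K^o).
Proof. by move=> lg c x y; rewrite lg mulrDr /GRing.scale /= mulrCA. Qed.
Lemma linear_scalarMl U (f : U -> K^o) k :
  linear f -> linear (fun x => ((f x : K) * k) : K^o).
Proof. by move=> lg c x y; rewrite lg mulrDl /GRing.scale /= mulrA. Qed.
Lemma linear_sumf U V I (r : seq I) (P : pred I) (F : I -> U -> V) :
  (forall i, linear (F i)) -> linear (fun x => \sum_(i <- r | P i) F i x).
Proof.
move=> lF c x y; rewrite scaler_sumr -big_split /=.
by apply: eq_bigr => i _; apply: lF.
Qed.

Lemma linear_mull (A : pzAlgType K) U (f : U -> A) a :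
  linear f -> linear (fun x => a * f x).
Proof. by move=> lf c x y; rewrite lf mulrDr pzscaleAr. Qed.
Lemma linear_mulr (A : pzAlgType K) U (f : U -> A) a :
  linear f -> linear (fun x => f x * a).
Proof. by move=> lf c x y; rewrite lf mulrDl pzscaleAl. Qed.

Lemma linear_tensl U V W (f : U -> V) (w : W) :
  linear f -> linear (fun x => tens (f x) w).
Proof. by move=> lf c x y; rewrite lf; apply: tens_linear_l. Qed.
Lemma linear_tensr U V W (f : U -> W) (v : V) :
  linear f -> linear (fun x => tens v (f x)).
Proof. by move=> lf c x y; rewrite lf; apply: tens_linear_r. Qed.
Lemma linear_tlift U V W (X : lmodType K) (h : V -> W -> X) (f : U -> tensor V W) :
  (forall w, linear (h^~ w)) -> (forall v, linear (h v)) ->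
  linear f -> linear (fun x => tlift h (f x)).
Proof. by move=> h1 h2 lf c x y; rewrite lf; apply: tlift_is_linear. Qed.
(** [tlift] is a finite sum over one chosen representative of [t], so linearity in a parameter holds
    term by term. *)
Lemma linear_tliftf U V W (X : lmodType K) (h : U -> V -> W -> X) t :
  (forall v w, linear (fun u => h u v w)) -> linear (fun u => tlift (h u) t).
Proof.
move=> lh c x y; rewrite !tlift.unlock /flift scaler_sumr -big_split /=.
apply: eq_bigr => -[v w] _ /=.
by rewrite lh scalerDr !scalerA mulrC.
Qed.
End LinearCalculus.

(** Linearity is decided by the shape of the body. The last alternative takes a linearity hypothesis
    of the context, possibly applied to parameters, as the outer map; this is why proofs put facts
    such as [lp] or [lm] into the context before calling [lin]. *)
Ltac lin1 := first
  [ exact: linear_id | exact: linear_zero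
  | apply: linear_add | apply: linear_opp | apply: linear_mull
  | apply: linear_mulr | apply: linear_tensl | apply: linear_tensr
  | apply: linear_scaler | apply: linear_app | apply: linear_scalel
  | apply: linear_scalarl | apply: linear_scalarM | apply: linear_scalarMl
  | apply: linear_sumf => ?
  | apply: linear_tlift => [?|?|] | apply: linear_tliftf => ? ?
  | match goal with h : _ |- _ => first
      [ apply: (linear_compose h) | apply: (linear_compose (h _))
      | apply: (linear_compose (h _ _)) | apply: (linear_compose (h _ _ _))] end ].
Ltac lin := intros; repeat (assumption || lin1); try done.

(** Coefficients are absorbed in the left leg. Such lists of pairs later play the role of the
    summation R' ⊗ R''. *)
Lemma tens_sum (K : fieldType) (V W : lmodType K) (t : tensor V W) :
  exists s : seq (V * W), t = \sum_(i <- s) tens i.1 i.2.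
Proof.
elim/tens_ind: t => [c v w t [s ->]|]; last by exists [::]; rewrite big_nil.
exists ((c *: v, w) :: s); rewrite big_cons /=.
by rewrite (linZ (@tens_linear_l _ _ _ w)).
Qed.

Lemma tens_ext (K : fieldType) (V W U : lmodType K) (f g : tensor V W -> U) :
  linear f -> linear g -> (forall v w, f (tens v w) = g (tens v w)) -> f =1 g.
Proof.
move=> lf lg fg t; elim/tens_ind: t => [c v w t IH|]; last by rewrite !lin0.
by rewrite lf lg fg IH.
Qed.

Section TensorRules.
Variables (K : fieldType) (V W : lmodType K).
Implicit Types (v : V) (w : W).
Lemma tensDl v v' w : tens (v + v') w = tens v w + tens v' w.
Proof. exact: (linD (@tens_linear_l _ _ _ w)). Qed.
Lemma tensDr v w w' : tens v (w + w') = tens v w + tens v w'.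
Proof. exact: (linD (@tens_linear_r _ _ _ v)). Qed.
Lemma tensNl v w : tens (- v) w = - tens v w.
Proof. exact: (linN (@tens_linear_l _ _ _ w)). Qed.
Lemma tensNr v w : tens v (- w) = - tens v w.
Proof. exact: (linN (@tens_linear_r _ _ _ v)). Qed.
Lemma tensZl c v w : tens (c *: v) w = c *: tens v w.
Proof. exact: (linZ (@tens_linear_l _ _ _ w)). Qed.
Lemma tensZr c v w : tens v (c *: w) = c *: tens v w.
Proof. exact: (linZ (@tens_linear_r _ _ _ v)). Qed.
Lemma tens0l w : tens (0 : V) w = 0.
Proof. exact: (lin0 (@tens_linear_l _ _ _ w)). Qed.
Lemma tens0r v : tens v (0 : W) = 0.
Proof. exact: (lin0 (@tens_linear_r _ _ _ v)). Qed.
Lemma tens_suml I (r : seq I) (P : pred I) F w :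
  tens (\sum_(i <- r | P i) F i) w = \sum_(i <- r | P i) tens (F i : V) w.
Proof. exact: (lin_sum (@tens_linear_l _ _ _ w)). Qed.
Lemma tens_sumr I (r : seq I) (P : pred I) F v :
  tens v (\sum_(i <- r | P i) F i) = \sum_(i <- r | P i) tens v (F i : W).
Proof. exact: (lin_sum (@tens_linear_r _ _ _ v)). Qed.
End TensorRules.

Lemma tlift_sum (K : fieldType) (V W U : lmodType K) (f : V -> W -> U) :
  (forall w, linear (f^~ w)) -> (forall v, linear (f v)) ->
  forall (s : seq (V * W)),
  tlift f (\sum_(i <- s) tens i.1 i.2) = \sum_(i <- s) f i.1 i.2.
Proof.
move=> f1 f2 s; rewrite (lin_sum (tlift_is_linear f1 f2)).
by apply: eq_bigr => i _; rewrite tliftE.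
Qed.

(** * Algebra maps and their tensor products *)

Section AlgHom.
Variable K : fieldType.
Implicit Types A B C : pzAlgType K.

Definition alghom A B (f : A -> B) : Prop :=
  [/\ linear f, f 1 = 1 & {morph f : x y / x * y}].

Lemma alghom_lin A B (f : A -> B) : alghom f -> linear f. Proof. by case. Qed.
Lemma alghom1 A B (f : A -> B) : alghom f -> f 1 = 1. Proof. by case. Qed.
Lemma alghomM A B (f : A -> B) : alghom f -> {morph f : x y / x * y}.
Proof. by case. Qed.
Lemma alghomX A B (f : A -> B) (hf : alghom f) n : {morph f : x / x ^+ n}.
Proof.
by move=> x; elim: n => [|n IH]; rewrite ?expr0 ?alghom1 // !exprS alghomM ?IH.
Qed.
Lemma alghom_prod A B (f : A -> B) (hf : alghom f) I (r : seq I) (P : pred I) F :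
  f (\prod_(i <- r | P i) F i) = \prod_(i <- r | P i) f (F i).
Proof. exact: (big_morph f (alghomM hf) (alghom1 hf)). Qed.

Lemma alghom_id A : alghom (fun x : A => x). Proof. by []. Qed.
Lemma alghom_comp A B C (g : B -> C) (f : A -> B) :
  alghom g -> alghom f -> alghom (fun x => g (f x)).
Proof.
move=> [lg g1 gM] [lf f1 fM]; split=> [c x y||x y]; first by rewrite lf lg.
  by rewrite f1.
by rewrite fM gM.
Qed.

Lemma alghom_tensl A B : alghom (fun x : A => tens x (1 : B)).
Proof. by split=> [||x y]; [lin | rewrite tens1 | rewrite tensM mulr1]. Qed.
Lemma alghom_tensr A B : alghom (fun x : B => tens (1 : A) x).
Proof. by split=> [||x y]; [lin | rewrite tens1 | rewrite tensM mulr1]. Qed.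

Section Copair.
Variables (A B C : pzAlgType K) (f : A -> C) (g : B -> C).
Hypotheses (hf : alghom f) (hg : alghom g)
  (fg : forall a b, f a * g b = g b * f a).

(** The universal property of the tensor product of algebras, for two algebra maps with commuting
    images. *)
Definition tcopair (t : tensor A B) : C := tlift (fun a b => f a * g b) t.

Lemma tcopair_bil1 b : linear (fun a => f a * g b).
Proof. by have := alghom_lin hf; lin. Qed.
Lemma tcopair_bil2 a : linear (fun b => f a * g b).
Proof. by have := alghom_lin hg; lin. Qed.
Lemma tcopairE a b : tcopair (tens a b) = f a * g b.
Proof. by rewrite /tcopair tliftE //; [exact: tcopair_bil1 | exact: tcopair_bil2]. Qed.
Lemma tcopair_lin : linear tcopair.
Proof. by apply: tlift_is_linear; [exact: tcopair_bil1 | exact: tcopair_bil2]. Qed.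

Lemma alghom_copair : alghom tcopair.
Proof.
split; first exact: tcopair_lin.
  by rewrite tens1 tcopairE (alghom1 hf) (alghom1 hg) mulr1.
have lc := tcopair_lin.
move=> x y; apply: (tens_ext (f := fun x => tcopair (x * y))
   (g := fun x => tcopair x * tcopair y)) x => [||a b].
- by move=> c u v; rewrite mulrDl -pzscaleAl lc.
- by lin.
apply: (tens_ext (f := fun y => tcopair (tens a b * y))
   (g := fun y => tcopair (tens a b) * tcopair y)) y => [||a' b'].
- by move=> c u v; rewrite mulrDr -pzscaleAr lc.
- by lin.
rewrite tensM !tcopairE (alghomM hf) (alghomM hg) -!mulrA; congr (_ * _).
by rewrite !mulrA fg.
Qed.
End Copair.

Definition tmap A B A' B' (f : A -> A') (g : B -> B') : tensor A B -> tensor A' B' :=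
  tcopair (fun a => tens (f a) (1 : B')) (fun b => tens (1 : A') (g b)).

Lemma alghom_tmap A B A' B' (f : A -> A') (g : B -> B') :
  alghom f -> alghom g -> alghom (tmap f g).
Proof.
move=> hf hg; apply: alghom_copair.
- exact: (alghom_comp (alghom_tensl _ _)).
- exact: (alghom_comp (alghom_tensr _ _)).
- by move=> a b; rewrite !tensM !mulr1 !mul1r.
Qed.
Lemma tmapE A B A' B' (f : A -> A') (g : B -> B') :
  alghom f -> alghom g -> forall a b, tmap f g (tens a b) = tens (f a) (g b).
Proof.
move=> hf hg a b; rewrite /tmap tcopairE; first by rewrite tensM mulr1 mul1r.
- exact: (alghom_comp (alghom_tensl _ _)).
- exact: (alghom_comp (alghom_tensr _ _)).
Qed.

Lemma tswapE A (a b : A) : tswap (tens a b) = tens b a.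
Proof. by rewrite /tswap tliftE //; lin. Qed.
Lemma tswap_lin A : linear (@tswap K A).
Proof. by rewrite /tswap; apply: tlift_is_linear; lin. Qed.
Lemma alghom_tswap A : alghom (@tswap K A).
Proof.
split; first exact: tswap_lin.
  by rewrite tens1 tswapE.
have lc := @tswap_lin A.
move=> x y; apply: (tens_ext (f := fun x => tswap (x * y))
   (g := fun x => tswap x * tswap y)) x => [||a b].
- by move=> c u v; rewrite mulrDl -pzscaleAl lc.
- by lin.
apply: (tens_ext (f := fun y => tswap (tens a b * y))
   (g := fun y => tswap (tens a b) * tswap y)) y => [||a' b'].
- by move=> c u v; rewrite mulrDr -pzscaleAr lc.
- by lin.
by rewrite tensM !tswapE tensM.
Qed.
Lemma tswapK A : involutive (@tswap K A).
Proof.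
apply: tens_ext; [by have := @tswap_lin A; lin|by lin|].
by move=> a b; rewrite !tswapE.
Qed.

End AlgHom.

(** * Integrals and cointegrals *)

Section TliftRules.
Variable K : fieldType.
Implicit Types V W U : lmodType K.

(** Again a matter of one fixed representative of [t]; this is how a linear map is moved into and
    out of a Sweedler sum. *)
Lemma tlift_comp V W U U' (g : U -> U') (f : V -> W -> U) t :
  linear g -> g (tlift f t) = tlift (fun a b => g (f a b)) t.
Proof.
move=> lg; rewrite !tlift.unlock /flift (lin_sum lg).
by apply: eq_bigr => i _; rewrite (linZ lg).
Qed.
Lemma eq_tlift V W U (f g : V -> W -> U) t : f =2 g -> tlift f t = tlift g t.
Proof.
by move=> fg; rewrite !tlift.unlock /flift; apply: eq_bigr => i _; rewrite fg.
Qed.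
Lemma tlift_id V W (t : tensor V W) : tlift (fun a b => tens a b) t = t.
Proof.
apply: tens_ext t; [by apply: tlift_is_linear; lin | by [] |].
by move=> v w; rewrite tliftE //; lin.
Qed.
End TliftRules.

Section Integrals.
Variables (K : fieldType) (A : pzAlgType K) (H : hopf_struct A).
Local Notation D := (comul H).
Local Notation eps := (counit H).
Local Notation S := (antipode H).
Local Notation T := (tensor A A).

Lemma alghom_comul : alghom (fun x => D x : T).
Proof. by case: (comul_morph H) => D1 DM; split=> //; lin. Qed.
Lemma comulM : {morph D : x y / x * y}. Proof. exact: (alghomM alghom_comul). Qed.
Lemma comul1 : D 1 = 1 :> T. Proof. exact: (alghom1 alghom_comul). Qed.
Lemma counitM : {morph eps : x y / x * y}. Proof. by case: (counit_morph H). Qed.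
Lemma counit1 : eps 1 = 1. Proof. by case: (counit_morph H). Qed.

(** [papl f] is f ⊗ id and [papr f] is id ⊗ f, with K ⊗ A and A ⊗ K identified with A. *)
Definition papl (f : A -> K) (t : T) : A := tlift (fun x y => f x *: y) t.
Definition papr (f : A -> K) (t : T) : A := tlift (fun x y => f y *: x) t.

Section Functional.
Variables (f : A -> K).
Hypothesis lf : linear (f : A -> K^o).
Lemma paplE x y : papl f (tens x y) = f x *: y.
Proof. by rewrite /papl tliftE //; lin. Qed.
Lemma paprE x y : papr f (tens x y) = f y *: x.
Proof. by rewrite /papr tliftE //; lin. Qed.
Lemma papl_lin : linear (papl f). Proof. by apply: tlift_is_linear; lin. Qed.
Lemma papr_lin : linear (papr f). Proof. by apply: tlift_is_linear; lin. Qed.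

Lemma papl_mul a t : papl f (tens (1 : A) a * t) = a * papl f t.
Proof.
have lp := papl_lin; move: t; apply: tens_ext; [lin|lin|] => x y.
by rewrite tensM !paplE mul1r pzscaleAr.
Qed.
Lemma papr_mul a t : papr f (tens a (1 : A) * t) = a * papr f t.
Proof.
have lp := papr_lin; move: t; apply: tens_ext; [lin|lin|] => x y.
by rewrite tensM !paprE mul1r pzscaleAr.
Qed.

Lemma papr_coassoc h :
  tlift (fun x y => tens x (papr f (D y))) (D h) = D (papr f (D h)).
Proof.
have := comulA H h; pose G := tlift (fun (xy : T) (z : A) => f z *: xy).
have lG : linear G by apply: tlift_is_linear; lin.
move/(congr1 G); rewrite !(tlift_comp _ _ lG).
move=> E; transitivity (tlift (fun a b => G (tens (D a) b)) (D h)); last first.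
  rewrite /papr (tlift_comp (g := D)); last by lin.
  by apply: eq_tlift => a b; rewrite linearZ /G tliftE //; lin.
rewrite -E; apply: eq_tlift => a b; rewrite (tlift_comp _ _ lG).
rewrite /papr (tlift_comp (g := fun x => tens a x)); last by lin.
apply: eq_tlift => c d; rewrite /G tliftE; [|lin..].
by rewrite tensZr.
Qed.
End Functional.

(** Coassociativity turns S(a_1) a_2 ⊗ a_3 into ε(a_1) 1 ⊗ a_2. *)
Lemma antipode_slide a :
  tens (1 : A) a = tlift (fun b c => tens (S b) (1 : A) * D c) (D a) :> T.
Proof.
have := comulA H a.
pose m := tlift (fun x y : A => S x * y).
have lm : linear m by apply: tlift_is_linear; lin.
pose G := tlift (fun (xy : T) (z : A) => tens (m xy) z).
have lG : linear G by apply: tlift_is_linear; lin.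
have GE x z : G (tens x z) = tens (m x) z by rewrite /G tliftE //; lin.
move/(congr1 G); rewrite !(tlift_comp _ _ lG) => E.
transitivity (tlift (fun x y => G (tens (D x) y)) (D a)).
  rewrite -[in LHS](counitl H a) (tlift_comp (g := fun x => tens (1 : A) x)); last by lin.
  apply: eq_tlift => x y; rewrite GE /m antipodel.
  by rewrite tensZl tensZr.
rewrite -E; apply: eq_tlift => b c; rewrite (tlift_comp _ _ lG).
rewrite -[D c in RHS]tlift_id (tlift_comp (g := fun t => tens (S b) (1 : A) * t)); last by lin.
apply: eq_tlift => x y; rewrite GE /m tliftE; [|lin..].
by rewrite tensM mul1r.
Qed.

(** After [antipode_slide], the factor Δ(a_2) Δ(Λ) = Δ(a_2 Λ) is ε(a_2) Δ(Λ), and the counit leaves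
    S(a) in the left leg. *)
Lemma slide_cointegral Lam a : (forall h, h * Lam = eps h *: Lam) ->
  tens (1 : A) a * D Lam = tens (S a) (1 : A) * D Lam :> T.
Proof.
move=> hL; rewrite antipode_slide.
have -> : S a = tlift (fun b c => eps c *: S b) (D a).
  rewrite -[in LHS](counitr H a) (tlift_comp (g := S)); last by lin.
  by apply: eq_tlift => b c; rewrite linearZ.
rewrite (tlift_comp (g := fun t : T => t * D Lam)); last by lin.
rewrite (tlift_comp (g := fun x : A => tens x (1 : A) * D Lam)); last by lin.
apply: eq_tlift => b c.
by rewrite -mulrA -comulM hL linearZ /= tensZl -pzscaleAl -pzscaleAr.
Qed.

(** * The Frobenius system given by a cointegral *)

Section Frobenius.
Variables (Lam : A) (rho : {scalar A}).
Hypotheses (LamP : forall h, h * Lam = eps h *: Lam /\ Lam * h = eps h *: Lam)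
  (rhoLam : papl rho (D Lam) = 1).
Let lrho : linear (rho : A -> K^o). Proof. exact: linearP. Qed.
Let LamPl h : h * Lam = eps h *: Lam. Proof. by case: (LamP h). Qed.

(** Apply rho ⊗ id to [slide_cointegral]. This is the dual basis formula a = rho(S(a) Λ_1) Λ_2. *)
Lemma frob_expand a : a = papl rho (tens (S a) (1 : A) * D Lam).
Proof. by rewrite -slide_cointegral // papl_mul // rhoLam mulr1. Qed.

Lemma rho_Lam : rho Lam = 1.
Proof.
have := congr1 eps rhoLam; rewrite /papl counit1 (tlift_comp (g := fun x : A => eps x : K^o)); last by lin.
move=> <-; rewrite -[in LHS](counitr H Lam).
have lr : linear (fun x : A => rho x : K^o) by lin.
rewrite (tlift_comp (g := fun x : A => rho x : K^o)) //.
by apply: (@eq_tlift _ _ _ K^o) => b c; rewrite !linearZ /= mulrC.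
Qed.

Variables (g g' : A).
Hypotheses (gg' : g * g' = 1) (g'g : g' * g = 1)
  (S2 : forall x, S (S x) = g * x * g')
  (SM : forall x y, S (x * y) = S y * S x)
  (SD : forall x, D (S x) = tswap (tlift (fun a b => tens (S a) (S b)) (D x)))
  (epsS : forall x, eps (S x) = eps x).

Lemma antipode_inj : injective S.
Proof.
move=> x y /(congr1 S); rewrite !S2 => /(congr1 (fun z => g' * z * g)).
by rewrite !mulrA g'g !mul1r -!mulrA g'g !mulr1.
Qed.
Lemma antipode_surj y : exists x, S x = y.
Proof.
exists (S (g' * y * g)); rewrite S2 !mulrA gg' mul1r -mulrA gg' mulr1 //.
Qed.
Lemma antipode1 : S 1 = 1.
Proof.
have [x Sx] := antipode_surj 1.
by rewrite -[LHS]mul1r -{1}Sx -SM mul1r.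
Qed.

Lemma counit_g : eps g * eps g' = 1. Proof. by rewrite -counitM gg' counit1. Qed.

(** In the Frobenius expansion of S(Λ) the coefficient S^2(Λ) = g Λ g' equals Λ, and Λ Λ_1 ⊗ Λ_2 = Λ
    ⊗ Λ. *)
Lemma antipode_Lam : S Lam = Lam.
Proof.
have SL h : h * S Lam = eps h *: S Lam.
  by have [x <-] := antipode_surj h; rewrite -SM (LamP x).2 linearZ /= epsS.
rewrite [LHS]frob_expand S2 LamPl -pzscaleAl (LamP g').2.
rewrite scalerA counit_g scale1r.
have -> : tens Lam (1 : A) * D Lam = tens Lam Lam :> T.
  rewrite -[in LHS](tlift_id (D Lam)) (tlift_comp (g := fun t : T => tens Lam (1 : A) * t));
    last by lin.
  transitivity (tens Lam (tlift (fun a b : A => eps a *: b) (D Lam)) : T);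
    last by rewrite counitl.
  rewrite (tlift_comp (g := fun x : A => tens Lam x)); last by lin.
  apply: eq_tlift => x y; rewrite tensM mul1r.
  by rewrite (LamP x).2 tensZl tensZr.
by rewrite paplE // rho_Lam scale1r.
Qed.

Definition lambda_of_rho (x : A) : K^o := rho (S x).
Lemma lambda_lin : linear lambda_of_rho.
Proof. by rewrite /lambda_of_rho; lin. Qed.
HB.instance Definition _ :=
  GRing.isLinear.Build K A K^o *%R lambda_of_rho lambda_lin.
Definition lambda : {scalar A} := lambda_of_rho.

(** By injectivity of S it suffices to apply S: since S(Λ) = Λ and S reverses coproducts, Λ_1 λ(Λ_2)
    goes to rho(Λ_1) Λ_2 = 1. *)
Lemma lambda_Lam : papr lambda (D Lam) = 1.
Proof.
apply: antipode_inj; rewrite antipode1 -rhoLam -[in RHS]antipode_Lam SD.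
have lp := papl_lin lrho; have lsw := @tswap_lin K A.
rewrite /papr (tlift_comp (g := S)); last by lin.
rewrite (tlift_comp (g := @tswap K A)) // (tlift_comp _ _ lp).
by apply: eq_tlift => x y; rewrite linearZ /= tswapE paplE.
Qed.

(** Expand a = rho(S(a) Λ_1) Λ_2. Then a_1 λ(a_2) = rho(S(a) Λ_1) Λ_2 λ(Λ_3), and coassociativity
    with [lambda_Lam] reduces this to rho(S(a)) 1. *)
Lemma lambdaP : nonzero_left_integral H lambda.
Proof.
have ll : linear (lambda : A -> K^o) by exact: linearP.
have lpr := papr_lin ll.
split; last first.
  exists Lam; have := congr1 eps lambda_Lam; rewrite counit1 => E.
  suff -> : lambda Lam = 1 by rewrite oner_eq0.
  rewrite -E -[in LHS](counitl H Lam) /papr.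
  rewrite (tlift_comp (g := fun x : A => lambda x : K^o)); last by lin.
  rewrite (tlift_comp (g := fun x : A => eps x : K^o)); last by lin.
  by apply: (@eq_tlift _ _ _ K^o) => x y; rewrite !linearZ /= mulrC.
move=> a; change (papr lambda (D a) = lambda a *: (1 : A)).
rewrite [in LHS](frob_expand a).
pose f x := rho (S a * x); have lf : linear (f : A -> K^o) by rewrite /f; lin.
have fE t : papl rho (tens (S a) (1 : A) * t) = papl f t.
  have l1 := papl_lin lrho; have l2 := papl_lin lf.
  by move: t; apply: tens_ext; [lin|lin|] => x y; rewrite tensM !paplE // mul1r.
rewrite fE /papl (tlift_comp (g := D)); last by lin.
rewrite (tlift_comp _ _ lpr).
have := papr_coassoc ll Lam; rewrite lambda_Lam comul1.
have l2 := papl_lin lf; move/(congr1 (papl f)); rewrite (tlift_comp _ _ l2) => E.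
transitivity (papl f (1 : T)); last by rewrite tens1 paplE // /f mulr1.
rewrite -E; apply: eq_tlift => x y.
by rewrite paplE // linearZ /= (linZ lpr).
Qed.

(** Both functionals, rho on the left leg and [lam] on the right leg, are applied to (1 ⊗ a) Δ(Λ).
    Starting with rho gives [lam a]; starting with [lam], after sliding a to the left leg, gives
    lam(Λ) rho(S(a)). *)
Lemma left_integral_unique lam : left_integral H lam ->
  forall a, lam a = lam Lam * lambda a.
Proof.
move=> lamP a; have ll : linear (lam : A -> K^o) by exact: linearP.
have lpr := papr_lin ll.
have E : papr lam (tens (1 : A) a * D Lam) = lam Lam *: S a.
  rewrite slide_cointegral // papr_mul //.
  have -> : papr lam (D Lam) = lam Lam *: (1 : A) by exact: lamP.
  by rewrite -pzscaleAr mulr1.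
have := congr1 rho E; rewrite linearZ /= => <-.
have lr : linear (fun x : A => rho x : K^o) by lin.
have -> : lam a = lam (papl rho (tens (1 : A) a * D Lam)).
  by rewrite papl_mul // rhoLam mulr1.
move: (tens (1 : A) a * D Lam); have l3 := papl_lin lrho.
apply: (@tens_ext _ _ _ K^o); [lin|lin|] => x y.
by rewrite paplE // paprE // !linearZ /= mulrC.
Qed.

End Frobenius.
End Integrals.

(** * Drinfeld elements and ribbon elements *)

Section Drinfeld.
Variables (K : fieldType) (A : pzAlgType K) (H : hopf_struct A).
Local Notation D := (comul H).
Local Notation eps := (counit H).
Local Notation S := (antipode H).
Local Notation T := (tensor A A).
Local Notation "x \ox y" := (tens (x : A) (y : A) : T) (at level 38).

Section Coassoc.
Variables (U : lmodType K) (Phi : A -> A -> A -> U).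
Hypotheses (Phi1 : forall y z, linear (fun x => Phi x y z))
  (Phi2 : forall x z, linear (fun y => Phi x y z))
  (Phi3 : forall x y, linear (fun z => Phi x y z)).

Definition tri1 : tensor T A -> U :=
  tlift (fun xy z => tlift (fun x y => Phi x y z) xy).
Lemma tri1_lin : linear tri1. Proof. by apply: tlift_is_linear; lin. Qed.
Lemma tri1E (t : T) z : tri1 (tens t z) = tlift (fun x y => Phi x y z) t.
Proof. by rewrite /tri1 tliftE //; lin. Qed.
Definition tri2 : tensor A T -> U :=
  tlift (fun x yz => tlift (fun y z => Phi x y z) yz).
Lemma tri2_lin : linear tri2. Proof. by apply: tlift_is_linear; lin. Qed.
Lemma tri2E x (t : T) : tri2 (tens x t) = tlift (fun y z => Phi x y z) t.
Proof. by rewrite /tri2 tliftE //; lin. Qed.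

Lemma coassoc3 h :
  tlift (fun a b => tlift (fun y z => Phi y z b) (D a)) (D h) =
  tlift (fun a b => tlift (fun y z => Phi a y z) (D b)) (D h).
Proof.
have := congr1 tri1 (comulA H h); rewrite !(tlift_comp _ _ tri1_lin) => E.
transitivity (tlift (fun a b => tri1 (tens (D a) b)) (D h)).
  by apply: eq_tlift => a b; rewrite tri1E.
rewrite -E; apply: eq_tlift => a b; rewrite (tlift_comp _ _ tri1_lin).
by apply: eq_tlift => c d; rewrite tri1E tliftE //; lin.
Qed.

Variables (R : T) (rs : seq (A * A)).
Hypotheses (RE : R = \sum_(i <- rs) tens i.1 i.2) (qtR : quasitriangular H R).

Lemma hexagonl :
  tlift (fun a b => tlift (fun x y => Phi x y b) (D a)) R =
  \sum_(i <- rs) \sum_(j <- rs) Phi i.1 j.1 (i.2 * j.2).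
Proof.
case: qtR => /(congr1 tri1) + _ _ _ _; rewrite !(tlift_comp _ _ tri1_lin) => E.
transitivity (tlift (fun a b => tri1 (tens (D a) b)) R).
  by apply: eq_tlift => a b; rewrite tri1E.
have lt := tri1_lin; rewrite E [in X in tlift _ X = _]RE tlift_sum; [|lin..].
apply: eq_bigr => i _; rewrite (tlift_comp _ _ tri1_lin) RE tlift_sum; [|lin..].
by apply: eq_bigr => j _; rewrite tri1E tliftE.
Qed.

(** The second axiom is about the opposite coproduct, hence the exchanged arguments [y] and [x] of
    [Phi]. *)
Lemma hexagonr :
  tlift (fun a b => tlift (fun x y => Phi a y x) (D b)) R =
  \sum_(i <- rs) \sum_(j <- rs) Phi (i.1 * j.1) i.2 j.2.
Proof.
have lt := tri2_lin; have lsw := @tswap_lin K A.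
case: qtR => _ /(congr1 tri2) + _ _ _; rewrite !(tlift_comp _ _ lt) => E.
transitivity (tlift (fun a b => tri2 (tens a (comul_op H b))) R).
  apply: eq_tlift => a b; rewrite tri2E /comul_op -[in RHS](tlift_id (D b)).
  rewrite (tlift_comp _ _ lsw) (tlift_comp (g := tlift (fun y z => Phi a y z))); last by lin.
  by apply: eq_tlift => x y; rewrite tswapE tliftE //; lin.
rewrite E [in X in tlift _ X = _]RE tlift_sum; [|lin..].
apply: eq_bigr => i _; rewrite (tlift_comp _ _ lt) RE tlift_sum; [|lin..].
by apply: eq_bigr => j _; rewrite tri2E tliftE.
Qed.
End Coassoc.

Variables (R : T) (rs : seq (A * A)).
Hypotheses (RE : R = \sum_(i <- rs) tens i.1 i.2) (qtR : quasitriangular H R).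

Lemma braid h : comul_op H h * R = R * D h. Proof. by case: qtR. Qed.

Lemma counit_R1 : \sum_(i <- rs) eps i.1 *: i.2 = 1.
Proof. by case: qtR => _ _ + _ _; rewrite RE tlift_sum //; lin. Qed.
Lemma counit_R2 : \sum_(i <- rs) eps i.2 *: i.1 = 1.
Proof. by case: qtR => _ _ _ + _; rewrite RE tlift_sum //; lin. Qed.

(** (S ⊗ id)(R) is a left inverse of R: the first hexagon collects the product into S(a_1) a_2 ⊗
    b. *)
Lemma skewR_mulR :
  \sum_(i <- rs) \sum_(j <- rs) (S i.1 * j.1) \ox (i.2 * j.2) = 1.
Proof.
rewrite -(@hexagonl _ (fun x y z => (S x * y) \ox z) _ _ _ R) //; [|lin..].
transitivity (tlift (fun a b => (1 : A) \ox (eps a *: b)) R).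
  apply: eq_tlift => a b.
  rewrite -(tlift_comp (g := fun x => x \ox b)); last by lin.
  by rewrite antipodel tensZl tensZr.
rewrite RE tlift_sum; [|lin..].
by rewrite -tens_sumr counit_R1.
Qed.

(** The second hexagon produces a ⊗ S(b_1) b_2. Together with the next lemma it says that (id ⊗
    S)(R) is the inverse of R in A ⊗ A^op. *)
Lemma R_mul_skew12 :
  \sum_(i <- rs) \sum_(j <- rs) (i.1 * j.1) \ox (S j.2 * i.2) = 1.
Proof.
rewrite -(@hexagonr _ (fun x y z => x \ox (S z * y)) _ _ _ R) //; [|lin..].
transitivity (tlift (fun a b => (eps b *: a) \ox (1 : A)) R).
  apply: eq_tlift => a b.
  rewrite -(tlift_comp (g := fun y => a \ox y)); last by lin.
  by rewrite antipodel tensZl tensZr.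
rewrite RE tlift_sum; [|lin..].
by rewrite -tens_suml counit_R2.
Qed.

Lemma R_mul_skew21 :
  \sum_(i <- rs) \sum_(j <- rs) (i.1 * j.1) \ox (j.2 * S i.2) = 1.
Proof.
rewrite -(@hexagonr _ (fun x y z => x \ox (z * S y)) _ _ _ R) //; [|lin..].
transitivity (tlift (fun a b => (eps b *: a) \ox (1 : A)) R).
  apply: eq_tlift => a b.
  rewrite -(tlift_comp (g := fun y => a \ox y)); last by lin.
  by rewrite antipoder tensZl tensZr.
rewrite RE tlift_sum; [|lin..].
by rewrite -tens_suml counit_R2.
Qed.

(** The first hexagon identifies both sides with Δ of the left leg of R, multiplied by R on one side
    or by its opposite on the other; [braid] exchanges the two. *)
Lemma yang_baxter (U : lmodType K) (Psi : T -> A -> U) :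
  (forall b, linear (Psi^~ b)) -> (forall t, linear (Psi t)) ->
  \sum_(i <- rs) \sum_(j <- rs) Psi (R * i.1 \ox j.1) (i.2 * j.2) =
  \sum_(i <- rs) \sum_(j <- rs) Psi (j.1 \ox i.1 * R) (i.2 * j.2).
Proof.
move=> P1 P2.
rewrite -(@hexagonl _ (fun x y z => Psi (R * x \ox y) z) _ _ _ R) //; [|lin..].
rewrite -(@hexagonl _ (fun x y z => Psi (y \ox x * R) z) _ _ _ R) //; [|lin..].
apply: eq_tlift => a b.
rewrite -(tlift_comp (g := fun t : T => Psi (R * t) b)); last by lin.
rewrite tlift_id -braid /comul_op -[in LHS](tlift_id (D a)).
rewrite (tlift_comp _ _ (@tswap_lin K A)).
rewrite (tlift_comp (g := fun t : T => Psi (t * R) b)); last by lin.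
by apply: eq_tlift => x y; rewrite tswapE.
Qed.

Variables (g g' : A).
Hypotheses (gg' : g * g' = 1) (g'g : g' * g = 1)
  (S2 : forall x, S (S x) = g * x * g')
  (SM : forall x y, S (x * y) = S y * S x) (S1 : S 1 = 1)
  (SD : forall x, D (S x) = tswap (tlift (fun a b => tens (S a) (S b)) (D x)))
  (epsS : forall x, eps (S x) = eps x)
  (Dg' : D g' = g' \ox g') (epsg' : eps g' = 1).

(** (S ⊗ id)(R) has R as right inverse and (S ⊗ S)(R) as left inverse, the latter by applying S ⊗ id
    to [R_mul_skew12]. *)
Lemma antipode_R : \sum_(i <- rs) S i.1 \ox S i.2 = R.
Proof.
set SSR := LHS; pose SR := \sum_(i <- rs) S i.1 \ox i.2.
have SRR : SR * R = 1.
  rewrite -skewR_mulR /SR mulr_suml; apply: eq_bigr => i _.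
  by rewrite [in LHS]RE mulr_sumr; apply: eq_bigr => j _; rewrite tensM.
suff SSRSR : SSR * SR = 1 by rewrite -[LHS]mulr1 -SRR mulrA SSRSR mul1r.
pose f := tlift (fun x y => S x \ox y); have lf : linear f by apply: tlift_is_linear; lin.
have fE x y : f (x \ox y) = S x \ox y by rewrite /f tliftE //; lin.
transitivity (f 1); last by rewrite tens1 fE S1.
rewrite -R_mul_skew12 (lin_sum lf) mulr_sumr; apply: eq_bigr => i _.
rewrite (lin_sum lf) mulr_suml; apply: eq_bigr => j _.
by rewrite fE tensM SM.
Qed.

Definition drinfeld : A := \sum_(i <- rs) S i.2 * i.1.
Local Notation u := drinfeld.

(** With m(p ⊗ q) = S(q) p, the sum S^2(x_2) m(Δ^cop(x_1) R) = S^2(x_2) m(R Δ(x_1)) is evaluated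
    twice: the left form collapses to S^2(x) u by S(y_1) y_2 = ε(y), the right form to u x by y_1
    S(y_2) = ε(y). *)
Lemma drinfeld_S2 x : S (S x) * u = u * x.
Proof.
pose m (t : T) : A := tlift (fun p q => S q * p) t.
have lm : linear m by apply: tlift_is_linear; lin.
have mE p q : m (p \ox q) = S q * p by rewrite /m tliftE //; lin.
pose Psi t b := S (S b) * m t.
have E : tlift (fun a b => Psi (comul_op H a * R) b) (D x) =
         tlift (fun a b => Psi (R * D a) b) (D x).
  by apply: eq_tlift => a b; rewrite braid.
have El a : m (comul_op H a * R) = eps a *: u.
  have ls := @tswap_lin K A.
  rewrite /comul_op -[D a]tlift_id (tlift_comp _ _ ls).
  rewrite (tlift_comp (g := fun t : T => m (t * R))); last by lin.
  transitivity (tlift (fun y z => \sum_(i <- rs) S i.2 * (S y * z) * i.1) (D a)).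
    apply: eq_tlift => y z; rewrite tswapE RE mulr_sumr (lin_sum lm).
    by apply: eq_bigr => i _; rewrite tensM mE SM !mulrA.
  rewrite -(tlift_comp (g := fun w : A => \sum_(i <- rs) S i.2 * w * i.1)); last by lin.
  rewrite antipodel /u scaler_sumr; apply: eq_bigr => i _.
  by rewrite -pzscaleAr mulr1 -pzscaleAl.
have Er a : m (R * D a) = tlift (fun y z => S z * u * y) (D a).
  rewrite -[in LHS](tlift_id (D a)) (tlift_comp (g := fun t : T => m (R * t))); last by lin.
  apply: eq_tlift => y z; rewrite RE mulr_suml (lin_sum lm) mulr_sumr mulr_suml.
  by apply: eq_bigr => i _; rewrite tensM mE SM !mulrA.
transitivity (tlift (fun a b => Psi (comul_op H a * R) b) (D x)).
  rewrite -[in LHS](counitl H x).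
  rewrite (tlift_comp (g := fun x : A => S (S x) * u)); last by lin.
  by apply: eq_tlift => a b; rewrite /Psi El !linearZ /= -pzscaleAl -pzscaleAr.
rewrite E.
transitivity (tlift (fun a b => tlift (fun y z => S (S b) * (S z * u * y)) (D a)) (D x)).
  apply: eq_tlift => a b; rewrite /Psi Er (tlift_comp (g := fun t : A => S (S b) * t)) //.
  by lin.
rewrite (@coassoc3 _ (fun y z b => S (S b) * (S z * u * y))); [|lin..].
rewrite -[in RHS](counitr H x) (tlift_comp (g := fun x : A => u * x)); last by lin.
apply: eq_tlift => a b.
transitivity (S (tlift (fun y z : A => y * S z) (D b)) * u * a).
  rewrite (tlift_comp (g := fun t : A => S t * u * a)); last by lin.
  by apply: eq_tlift => y z; rewrite SM !mulrA.
by rewrite antipoder linearZ /= S1 -!pzscaleAl mul1r pzscaleAr.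
Qed.

Definition ribbon_candidate := locked (g' * u).
Local Notation v := ribbon_candidate.
Lemma ribbon_candidateE : v = g' * u.
Proof. by rewrite /ribbon_candidate -lock. Qed.

(** Conjugation by g and conjugation by u both give S^2. *)
Lemma ribbon_central x : v * x = x * v.
Proof. by rewrite ribbon_candidateE -mulrA -drinfeld_S2 S2 !mulrA g'g mul1r. Qed.

Lemma antipode_surj' y : exists x, S x = y.
Proof. by apply: (@antipode_surj _ _ H g g' gg'). Qed.

(** R'' S^2(R') is a left inverse of u: moving u through S^2 and multiplying the legs of
    [R_mul_skew21] gives 1. Centrality of v makes the inverse two-sided. *)
Lemma ribbon_inv : exists2 vi, v * vi = 1 & vi * v = 1.
Proof.
pose z := \sum_(i <- rs) i.2 * S (S i.1).
suff zu : z * u = 1.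
  have E : z * g * v = 1 by rewrite ribbon_candidateE mulrA -(mulrA z) gg' mulr1.
  by exists (z * g); rewrite // ribbon_central.
pose f := tlift (fun p q : A => q * p); have lf : linear f by apply: tlift_is_linear; lin.
have fE p q : f (p \ox q) = q * p by rewrite /f tliftE //; lin.
transitivity (f 1); last by rewrite tens1 fE mulr1.
rewrite -R_mul_skew21 exchange_big (lin_sum lf) /z mulr_suml /=; apply: eq_bigr => j _.
rewrite -mulrA drinfeld_S2 /u mulr_suml mulr_sumr (lin_sum lf); apply: eq_bigr => i _.
by rewrite fE !mulrA.
Qed.

Lemma counit_ribbon : eps v = 1.
Proof.
rewrite ribbon_candidateE counitM epsg' mul1r linear_sum -(counit1 H) -counit_R1 linear_sum.
by apply: eq_bigr => i _; rewrite counitM epsS linearZ /= mulrC.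
Qed.

Local Notation M := (monodromy R).
(** R carries Δ to Δ^cop and R_21 carries it back. *)
Lemma monodromy_comul h : M * D h = D h * M.
Proof.
rewrite /monodromy -mulrA -braid !mulrA; congr (_ * _).
have := congr1 (@tswap K A) (braid h).
by rewrite !(alghomM (@alghom_tswap K A)) /comul_op tswapK => ->.
Qed.

(* The comultiplication of both legs of R, in the leg order R14 R13 R24 R23. *)
Lemma comul_both_legs (U : lmodType K) (Phi : A -> A -> A -> A -> U) :
  (forall y z w, linear (fun x => Phi x y z w)) ->
  (forall x z w, linear (fun y => Phi x y z w)) ->
  (forall x y w, linear (fun z => Phi x y z w)) ->
  (forall x y z, linear (fun w => Phi x y z w)) ->
  tlift (fun a b : A => tlift (fun x y : A => tlift (fun z w : A => Phi x y z w) (D b)) (D a)) R =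
  \sum_(i <- rs) \sum_(k <- rs) \sum_(j <- rs) \sum_(l <- rs)
    Phi (i.1 * k.1) (j.1 * l.1) (k.2 * l.2) (i.2 * j.2).
Proof.
move=> P1 P2 P3 P4.
rewrite (@hexagonl _ (fun x y b : A => tlift (fun z w : A => Phi x y z w) (D b)) _ _ _ R rs) //; [|lin..].
transitivity (\sum_(i <- rs) \sum_(j <- rs) tlift (fun z w : A =>
    tlift (fun z' w' : A => Phi i.1 j.1 (z * z') (w * w')) (D j.2)) (D i.2)).
  apply: eq_bigr => i _; apply: eq_bigr => j _; rewrite comulM.
  have E (t t' : T) : tlift (fun z w : A => Phi i.1 j.1 z w) (t * t') =
    tlift (fun z w : A => tlift (fun z' w' : A => Phi i.1 j.1 (z * z') (w * w')) t') t.
    move: t; apply: tens_ext; [lin|lin|] => x y; rewrite tliftE; [|lin..].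
    move: t'; apply: tens_ext; [lin|lin|] => x' y'.
    by rewrite tensM !tliftE //; lin.
  exact: E.
rewrite exchange_big /=.
transitivity (\sum_(j <- rs) \sum_(i <- rs) \sum_(k <- rs)
   tlift (fun z' w' : A => Phi (i.1 * k.1) j.1 (k.2 * z') (i.2 * w')) (D j.2)).
  apply: eq_bigr => j _.
  rewrite -(@hexagonr _ (fun x y z : A => tlift (fun z' w' : A => Phi x j.1 (z * z') (y * w')) (D j.2))
    _ _ _ R rs) //; [|lin..].
  rewrite [in RHS]RE tlift_sum //; lin.
rewrite exchange_big; apply: eq_bigr => i _ /=.
rewrite exchange_big; apply: eq_bigr => k _ /=.
rewrite -(@hexagonr _ (fun x y z : A => Phi (i.1 * k.1) x (k.2 * z) (i.2 * y))
    _ _ _ R rs) //; [|lin..].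
by rewrite [in RHS]RE tlift_sum //; lin.
Qed.

(** The inverse relation [R_mul_skew12] with its legs exchanged, placed between given outer
    factors. *)
Lemma cancel_skew (x y z w : A) :
  \sum_(i <- rs) \sum_(j <- rs) (x * S j.2 * i.2 * z) \ox (y * i.1 * j.1 * w) =
  (x * z) \ox (y * w).
Proof.
pose f (t : T) := x \ox y * tswap t * z \ox w.
have lf : linear f by have ls := @tswap_lin K A; rewrite /f; lin.
transitivity (f 1); last by rewrite /f tens1 tswapE !tensM !mulr1.
rewrite -R_mul_skew12 (lin_sum lf); apply: eq_bigr => i _.
rewrite (lin_sum lf); apply: eq_bigr => j _.
by rewrite /f tswapE !tensM !mulrA.
Qed.
Lemma cancel_skew' (x y z w : A) :
  \sum_(i <- rs) \sum_(j <- rs) (y * i.1 * j.1 * w) \ox (x * S j.2 * i.2 * z) =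
  (y * w) \ox (x * z).
Proof.
have := congr1 (@tswap K A) (cancel_skew x y z w).
rewrite tswapE (lin_sum (@tswap_lin K A)) => <-; apply: eq_bigr => i _.
by rewrite (lin_sum (@tswap_lin K A)); apply: eq_bigr => j _; rewrite tswapE.
Qed.

(** Since M commutes with Δ(S(R'')), it can be placed between the two factors of Δ(u) = Δ(S(R''))
    Δ(R'). Expanding both coproducts gives four copies of R around R_21 R, which then cancel in two
    rounds. *)
Lemma monodromy_drinfeld : M * D u = u \ox u.
Proof.
pose Phi (x y z w : A) : T := S w \ox S z * M * x \ox y.
have E : M * D u = tlift (fun a b : A => tlift (fun x y : A =>
    tlift (fun z w : A => Phi x y z w) (D b)) (D a)) R.
  rewrite [in X in _ = tlift _ X]RE tlift_sum; [|rewrite /Phi; lin..].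
  rewrite /u linear_sum mulr_sumr; apply: eq_bigr => i _ /=.
  rewrite comulM mulrA monodromy_comul SD -[D i.1 in LHS]tlift_id.
  rewrite (tlift_comp (g := fun t : T => _ * t)); last by lin.
  apply: eq_tlift => x y; rewrite (tlift_comp _ _ (@tswap_lin K A)).
  rewrite (tlift_comp (g := fun t : T => t * M * x \ox y)); last by lin.
  by apply: eq_tlift => z w; rewrite tswapE.
rewrite {}E comul_both_legs; [|rewrite /Phi; lin..].
have RE21 : tswap R = \sum_(i <- rs) i.2 \ox i.1.
  rewrite RE (lin_sum (@tswap_lin K A)).
  by apply: eq_bigr => i _; rewrite tswapE.
pose Psi k l (t : T) (b : A) := S b \ox S (k.2 * l.2) * tswap R * t * k.1 \ox l.1.
transitivity (\sum_(k <- rs) \sum_(l <- rs) \sum_(i <- rs) \sum_(j <- rs)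
    Psi k l (R * i.1 \ox j.1) (i.2 * j.2)).
  rewrite exchange_big; apply: eq_bigr => k _ /=.
  rewrite [RHS]exchange_big; apply: eq_bigr => i _ /=.
  rewrite [RHS]exchange_big; apply: eq_bigr => j _ /=.
  by apply: eq_bigr => l _; rewrite /Phi /Psi /monodromy -!mulrA !tensM.
(* Yang-Baxter moves R behind the legs indexed by i and j. This brings R_21 next to the legs indexed
   by i, with which it cancels. *)
transitivity (\sum_(k <- rs) \sum_(l <- rs) \sum_(j <- rs)
    (S j.2 * j.1) \ox S (k.2 * l.2) * R * k.1 \ox l.1).
  apply: eq_bigr => k _; apply: eq_bigr => l _.
  rewrite yang_baxter; [|rewrite /Psi; lin..].
  rewrite exchange_big; apply: eq_bigr => j _ /=.
  have := cancel_skew (S j.2) (S (k.2 * l.2)) j.1 1.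
  rewrite [in RHS]mulr1 => <-; rewrite exchange_big /= !mulr_suml.
  apply: eq_bigr => i _ /=.
  rewrite /Psi RE21 !(mulr_sumr, mulr_suml); apply: eq_bigr => e _.
  by rewrite !mulrA !tensM SM mulr1.
rewrite exchange_big /=.
(* The remaining factor R cancels against the legs indexed by k in the same way. *)
transitivity (\sum_(l <- rs) \sum_(j <- rs) (S j.2 * j.1) \ox (S l.2 * l.1)).
  apply: eq_bigr => l _; rewrite exchange_big; apply: eq_bigr => j _ /=.
  have := cancel_skew' (S l.2) (S j.2 * j.1) l.1 1.
  rewrite [in RHS]mulr1 => <-; rewrite exchange_big /=.
  apply: eq_bigr => k _ /=.
  rewrite [in LHS]RE !(mulr_sumr, mulr_suml); apply: eq_bigr => f _.
  by rewrite !tensM SM mulr1.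
rewrite /u tens_sumr; apply: eq_bigr => l _.
by rewrite tens_suml.
Qed.

Lemma monodromy_ribbon : M * D v = v \ox v.
Proof.
rewrite ribbon_candidateE comulM mulrA monodromy_comul -mulrA monodromy_drinfeld Dg'.
by rewrite tensM.
Qed.

(** The flip of S ⊗ S is an antihomomorphism that fixes M and sends Δ(x) to Δ(S(x)). Applied to M
    Δ(v) = v ⊗ v it gives the same equation for S(v), and dividing one by the other shows that S(v)
    v^-1 is grouplike. *)
Lemma ribbon_of_grouplikes :
  (forall w, D w = w \ox w -> eps w = 1 -> (forall x, w * x = x * w) -> w = 1) ->
  ribbon_element H R v.
Proof.
move=> triv; split; [exact: ribbon_central| |exact: counit_ribbon|exact: monodromy_ribbon].
have [vi vvi viv] := ribbon_inv.
pose at_ := tlift (fun x y : A => S y \ox S x).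
have lat : linear at_ by apply: tlift_is_linear; lin.
have atE x y : at_ (x \ox y) = S y \ox S x by rewrite /at_ tliftE //; lin.
have atM t t' : at_ (t * t') = at_ t' * at_ t.
  move: t; apply: tens_ext; [lin|lin|] => x y.
  move: t'; apply: tens_ext; [lin|lin|] => x' y'.
  by rewrite tensM !atE tensM !SM.
have atD x : at_ (D x) = D (S x).
  rewrite SD (tlift_comp _ _ (@tswap_lin K A)).
  by apply: eq_tlift => a b; rewrite tswapE.
have atR : at_ R = tswap R.
  rewrite -[in RHS]antipode_R [in LHS]RE (lin_sum lat) (lin_sum (@tswap_lin K A)).
  by apply: eq_bigr => i _; rewrite atE tswapE.
have atR21 : at_ (tswap R) = R.
  rewrite -[in RHS]antipode_R [in LHS]RE (lin_sum (@tswap_lin K A)) (lin_sum lat).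
  by apply: eq_bigr => i _; rewrite tswapE atE.
have MSv : M * D (S v) = S v \ox S v.
  have atMon : at_ M = M by rewrite /M atM atR atR21.
  rewrite monodromy_comul -atD -[X in _ * X]atMon -atM monodromy_ribbon.
  by rewrite atE.
have w1 : S v * vi = 1.
  apply: triv.
  - have E : D (S v * vi) * v \ox v = (S v * vi) \ox (S v * vi) * v \ox v.
      rewrite -[in LHS]monodromy_ribbon mulrA -monodromy_comul -mulrA -comulM.
      have E1 : S v * vi * v = S v by rewrite -mulrA viv mulr1.
      by rewrite tensM E1.
    have := congr1 (fun t : T => t * vi \ox vi) E.
    by rewrite /= -!mulrA tensM vvi -tens1 !mulr1.
  - rewrite counitM epsS counit_ribbon mul1r.
    by have := counit1 H; rewrite -vvi counitM counit_ribbon mul1r => ->.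
  - move=> x; have [y <-] := antipode_surj' x.
    have viC z : vi * z = z * vi.
      transitivity (vi * (z * v) * vi); first by rewrite -!mulrA vvi mulr1.
      by rewrite -ribbon_central !mulrA viv mul1r.
    by rewrite -mulrA viC !mulrA -SM -SM ribbon_central.
by rewrite -[LHS]mulr1 -viv mulrA w1 mul1r.
Qed.
End Drinfeld.

(** * The projective cover of the trivial module *)

Section RightIdeal.
Variables (K : fieldType) (A : pzAlgType K) (e : A).
(** For an idempotent e this is the left ideal A e, described by an equation so that membership is a
    boolean. *)
Definition fixed_right : {pred A^o} := fun x : A => x * e == x.
Lemma fixed_right_submod : submod_closed fixed_right.
Proof.
split=> [|c u v]; rewrite ?unfold_in /fixed_right ?mul0r // => /eqP ue /eqP ve.
by rewrite mulrDl /GRing.scale /= -mulrA ue ve.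
Qed.
HB.instance Definition _ :=
  GRing.isSubmodClosed.Build A A^o fixed_right fixed_right_submod.
Definition Pmod := {x : A^o | x \in fixed_right}.
HB.instance Definition _ := SubChoice.on Pmod.
HB.instance Definition _ := [SubChoice_isSubLmodule of Pmod by <:].
End RightIdeal.

Section TrivialModule.
Variables (K : fieldType) (A : pzAlgType K) (H : hopf_struct A).
Local Notation eps := (counit H).
(** The field again, with A acting through the counit; the argument records which Hopf structure
    supplies it. *)
Definition trivmod (_ : hopf_struct A) : Type := K.
HB.instance Definition _ := GRing.Zmodule.on (trivmod H).
Definition triv_scale (a : A) (x : trivmod H) : trivmod H := eps a * x.
Fact triv_scaleA a b x : triv_scale a (triv_scale b x) = triv_scale (a * b) x.
Proof. by rewrite /triv_scale counitM mulrA. Qed.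
Fact triv_scale1 : left_id 1 triv_scale.
Proof. by move=> x; rewrite /triv_scale counit1 mul1r. Qed.
Fact triv_scaleDr : right_distributive triv_scale +%R.
Proof. by move=> a x y; rewrite /triv_scale mulrDr. Qed.
Fact triv_scaleDl x : {morph triv_scale^~ x : a b / a + b}.
Proof. by move=> a b; rewrite /triv_scale linearD mulrDl. Qed.
HB.instance Definition _ := GRing.Zmodule_isLmodule.Build A (trivmod H)
  triv_scaleA triv_scale1 triv_scaleDr triv_scaleDl.
End TrivialModule.

Section ProjectiveCover.
Variables (K : fieldType) (A : pzAlgType K) (H : hopf_struct A).
Local Notation eps := (counit H).

Section Idempotent.
Variables (e : A).
Hypotheses (ee : e * e = e) (epse : eps e = 1)
  (e_min : forall y, y * e = y -> eps y = 1 -> exists x, e = x * y).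
Let P := Pmod e.

Fact e_fixed : (e : A^o) \in fixed_right e. Proof. by rewrite unfold_in /fixed_right ee. Qed.
Definition idem_elt : P := exist _ (e : A^o) e_fixed.
Lemma Pmod_val (x : P) : (val x : A) * e = val x.
Proof. by apply/eqP; case: x. Qed.
Lemma Pmod_scale (x : P) : x = (val x : A) *: idem_elt.
Proof. by apply: val_inj; change ((val x : A) = (val x : A) * e); rewrite Pmod_val. Qed.

Definition Pmod_counit (x : P) : K := eps (val x : A).
Lemma Pmod_counitB : {morph Pmod_counit : x y / x - y}.
Proof. move=> x y; exact: (raddfB eps (val x : A) (val y)). Qed.
Lemma Pmod_counitZ (a : A) (x : P) : Pmod_counit (a *: x) = eps a * Pmod_counit x.
Proof. exact: (counitM H a (val x)). Qed.
HB.instance Definition _ := GRing.isZmodMorphism.Build P K Pmod_counit Pmod_counitB.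
HB.instance Definition _ := GRing.isScalable.Build A P K
  (fun (a : A) (c : K) => eps a * c) Pmod_counit Pmod_counitZ.

(** A map out of A e is determined by the image of e, so a lift of that image defines the lifted
    map. *)
Lemma Pmod_projective : projective P.
Proof.
move=> M N g f gsurj; have [m gm] := gsurj (f idem_elt).
pose h (x : P) : M := (val x : A) *: m.
have lh : linear h by move=> a x y; rewrite /h linearP /= scalerDl scalerA.
pose hM := GRing.isLinear.Build A P M *:%R h lh.
pose hL : {linear P -> M} := HB.pack h hM.
by exists hL => x; rewrite /= /h linearZ /= gm -linearZ -Pmod_scale.
Qed.

(** A submodule that surjects onto the trivial module contains some y in A e with ε(y) = 1. By
    [e_min], e lies in A y, so the submodule is everything. *)
Lemma Pmod_cover : projective_cover_of_trivial H P.
Proof.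
split; first exact: Pmod_projective.
exists (Pmod_counit : {linear P -> K | fun a c => eps a * c}); split.
  move=> c; exists ((c *: (1 : A)) *: idem_elt).
  rewrite /= Pmod_counitZ (_ : Pmod_counit _ = 1) //.
  by rewrite linearZ /= counit1 !mulr1.
move=> N Nsub Nsurj x; have [y Ny] := Nsurj idem_elt.
rewrite /= Pmod_counitB (_ : Pmod_counit idem_elt = 1) // => /eqP.
rewrite subr_eq0 => /eqP epsy.
have [z ez] := e_min (Pmod_val y) (esym epsy).
have -> : x = ((val x : A) * z) *: y.
  apply: val_inj; change ((val x : A) = (val x : A) * z * (val y : A)).
  by rewrite -mulrA -ez Pmod_val.
have [N0 ND] := Nsub.
by have := ND ((val x : A) * z) y 0 Ny N0; rewrite addr0.
Qed.
End Idempotent.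

(** * Linear algebra over a finite spanning family with linear coordinates *)

Section Frame.
Variables (n : nat) (b : 'I_n -> A) (c : A -> 'rV[K]_n).
Hypotheses (c_lin : linear c) (cE : forall a, a = \sum_i c a 0 i *: b i).

Lemma coord_inj : injective c.
Proof. by move=> x y cxy; rewrite (cE x) cxy -cE. Qed.
(** Right multiplication by y seen through the coordinates. Its row space is the set of coordinates
    of A y, so its rank is the dimension of that left ideal. *)
Definition rmulmx y : 'M[K]_n := \matrix_(i, j) c (b i * y) 0 j.
Lemma comb_rmulmx (d : 'rV[K]_n) y :
  d *m rmulmx y = c ((\sum_i d 0 i *: b i) * y).
Proof.
apply/rowP => j; rewrite mxE mulr_suml (lin_sum c_lin) summxE.
by apply: eq_bigr => i _; rewrite -pzscaleAl (linZ c_lin) !mxE.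
Qed.
Lemma coord_mul a y : c (a * y) = c a *m rmulmx y.
Proof. by rewrite comb_rmulmx -cE. Qed.
Lemma rmulmxM x y : rmulmx (x * y) = rmulmx x *m rmulmx y.
Proof.
apply/row_matrixP => i; rewrite row_mul.
have E z : row i (rmulmx z) = c (b i * z) by apply/rowP => j; rewrite !mxE.
by rewrite !E -coord_mul mulrA.
Qed.

(** Among the y with ε(y) = 1 choose y0 with dim A y0 minimal. Then A y0 y0 = A y0, and any x with
    y0 = x y0 y0 yields the idempotent x y0. *)
Lemma minimal_idempotent : exists e, [/\ e * e = e, eps e = 1 &
  forall y, y * e = y -> eps y = 1 -> exists x, e = x * y].
Proof.
pose Pk k := `[< exists2 y, eps y = 1 & \rank (rmulmx y) = k >].
have exP : exists k, Pk k.
  by exists (\rank (rmulmx 1)); apply/asboolP; exists 1; rewrite ?counit1.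
case: (ex_minnP exP) => m /asboolP [y0 epsy0 <-{m}] min_y0 {exP}.
have {}min_y0 y : eps y = 1 -> (\rank (rmulmx y0) <= \rank (rmulmx y))%N.
  by move=> ey; apply: min_y0; apply/asboolP; exists y.
(* A y is contained in A y0 and has no smaller dimension, so the two left ideals coincide. *)
have back x y : y = x * y0 -> eps y = 1 -> exists x', y0 = x' * y.
  move=> yx epsy; have sub : (rmulmx y <= rmulmx y0)%MS.
    by rewrite yx rmulmxM submxMl.
  have : (rmulmx y0 <= rmulmx y)%MS.
    by have := mxrank_leqif_sup sub; case=> _ <-; rewrite eqn_leq mxrankS // min_y0.
  move=> le; have /submxP[d cd] : (c y0 <= rmulmx y)%MS.
    by apply: submx_trans le; have := coord_mul 1 y0; rewrite mul1r => ->; exact: submxMl.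
  by exists (\sum_i d 0 i *: b i); apply: coord_inj; rewrite -comb_rmulmx -cd.
have epsyy : eps (y0 * y0) = 1 by rewrite counitM epsy0 mulr1.
have [x yx] := back y0 (y0 * y0) erefl epsyy.
(* Right multiplication by y0 maps A y0 onto the equally large A y0 y0, so it is injective there; in
   matrices, the kernel and the row space meet in 0. *)
have inj w : w * y0 * y0 = 0 -> w * y0 = 0.
  move=> w0; apply: coord_inj; rewrite (lin0 c_lin).
  have rk : \rank (rmulmx y0 *m rmulmx y0) = \rank (rmulmx y0).
    by apply/eqP; rewrite eqn_leq mxrankM_maxl -rmulmxM min_y0.
  have /eqP := mxrank_mul_ker (rmulmx y0) (rmulmx y0).
  rewrite rk -{2}[\rank _]addn0 eqn_add2l mxrank_eq0 => /eqP cap0.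
  apply/eqP; rewrite -submx0 -cap0 sub_capmx coord_mul submxMl /=.
  by apply/sub_kermxP; rewrite -!coord_mul w0 (lin0 c_lin).
pose e := x * y0; have ey : e * y0 = y0 by rewrite /e -mulrA -yx.
have epse : eps e = 1.
  by have := congr1 eps ey; rewrite counitM epsy0 mulr1.
exists e; split=> //.
  have : (e * x - x) * y0 = 0.
    apply: inj; rewrite !mulrBl -(mulrA e) -/e -(mulrA e) ey ey.
    by rewrite subrr.
  by rewrite mulrBl -mulrA -/e => /eqP; rewrite subr_eq0 => /eqP.
move=> y ye epsy; have [|x' y0x] := back (y * x) y _ epsy.
  by rewrite -mulrA.
by exists (x * x'); rewrite -mulrA -y0x.
Qed.

(** A matrix of largest rank among those whose rows are coordinates of elements of W has all
    coordinates of W in its row space; its cokernel separates w from W. *)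
Lemma separating_functional (W : {pred A}) w : submod_closed W -> w \notin W ->
  exists f : A -> K^o, [/\ linear f, forall x, x \in W -> f x = 0 & f w = 1].
Proof.
move=> [W0 WD] Ww.
have WZ k x : x \in W -> k *: x \in W.
  by move=> Wx; have := WD k x 0 Wx W0; rewrite addr0.
have WA x y : x \in W -> y \in W -> x + y \in W.
  by move=> Wx Wy; have := WD 1 x y Wx Wy; rewrite scale1r.
pose Pk k := `[< exists2 B : 'M[K]_n, \rank B = k &
   forall i, exists2 x, x \in W & row i B = c x >].
have exP : exists k, Pk k.
  exists 0%N; apply/asboolP; exists 0; first by rewrite mxrank0.
  by move=> i; exists 0; rewrite // (lin0 c_lin); apply/rowP => j; rewrite !mxE.
have ubP k : Pk k -> (k <= n)%N by move=> /asboolP[B <- _]; apply: rank_leq_row.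
case: (ex_maxnP exP ubP) => m /asboolP[B rkB BW] maxB.
have rowW (d : 'rV[K]_n) : exists2 x, x \in W & d *m B = c x.
  rewrite mulmx_sum_row; elim/big_rec: _ => [|i t _ [x Wx ->]].
    by exists 0; rewrite // (lin0 c_lin).
  have [y Wy ->] := BW i; exists (d 0 i *: y + x); last by rewrite c_lin.
  by apply: WA => //; apply: WZ.
have sub x : x \in W -> (c x <= B)%MS.
  move=> Wx; have sB : (B <= B + c x)%MS by apply: addsmxSl.
  have : (\rank (B + c x)%MS <= \rank B)%N.
    rewrite rkB; apply: maxB; apply/asboolP.
    exists (B + c x)%MS => // i.
    have /sub_addsmxP[[d1 d2] /= ->] : (row i (B + c x)%MS <= B + c x)%MS by apply: row_sub.
    have [y Wy ->] := rowW d1.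
    exists (y + d2 0 0 *: x); first by apply: WA => //; apply: WZ.
    by rewrite (linD c_lin) (linZ c_lin) {1}[d2]mx11_scalar mul_scalar_mx.
  move=> ge; apply: submx_trans (addsmxSr B (c x)) _.
  by rewrite -(mxrank_leqif_sup sB).2 eqn_leq ge mxrankS.
have : ~~ (c w <= B)%MS.
  apply: contra Ww => /submxP[d cd]; have [x Wx dx] := rowW d.
  by rewrite (coord_inj (etrans cd dx)).
rewrite submxE => /matrix0Pn[i [j]]; rewrite ord1 {i} => nz.
(* An entry of the cokernel matrix that is nonzero at w, normalised there. *)
pose f x : K^o := (c x *m cokermx B) 0 j / (c w *m cokermx B) 0 j.
exists f; split=> [k x y|x /sub|]; last by rewrite /f divff.
  by rewrite /f c_lin mulmxDl -scalemxAl mxE mulrDl mxE -mulrA.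
by rewrite submxE /f => /eqP ->; rewrite mxE mul0r.
Qed.
End Frame.

(** The spanning family consists of the right legs of Δ(Λ), with coordinates rho(S(a) Λ_1) as in
    [frob_expand]. *)
Lemma frobenius_frame (Lam : A) (rho : {scalar A}) :
  (forall h, h * Lam = eps h *: Lam /\ Lam * h = eps h *: Lam) ->
  papl rho (comul H Lam) = 1 ->
  exists n (b : 'I_n -> A) (c : A -> 'rV[K]_n),
    linear c /\ forall a, a = \sum_i c a 0 i *: b i.
Proof.
move=> LamP rhoLam; have [s sE] := tens_sum (comul H Lam).
pose x (i : 'I_(size s)) := nth (0, 0) s i.
exists (size s), (fun i => (x i).2), (fun a => \row_i rho (antipode H a * (x i).1)).
split=> [k a a'|a].
  by apply/rowP => i; rewrite !mxE linearP mulrDl -pzscaleAl linearP.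
have lr : linear (rho : A -> K^o) by exact: linearP.
rewrite {1}(frob_expand LamP rhoLam a) sE mulr_sumr (lin_sum (papl_lin lr)).
rewrite (big_nth (0, 0)) big_mkord; apply: eq_bigr => i _.
by rewrite tensM paplE // mul1r mxE.
Qed.

Section Coradical.
Variables (n : nat) (b : 'I_n -> A) (c : A -> 'rV[K]_n).
Hypotheses (c_lin : linear c) (cE : forall a, a = \sum_i c a 0 i *: b i).
Variable F : nat -> {pred A}.
Hypotheses (F_sub : forall k, submod_closed (F k))
  (F_mono : forall j k, (j <= k)%N -> {subset F j <= F k})
  (F_ex : forall x, exists k, x \in F k)
  (F_comul : forall k x, x \in F k -> comul H x \in
     Defs.span (fun t : tensor A A => exists i (y z : A),
        [/\ (i <= k)%N, y \in F i, z \in F (k - i)%N & t = tens y z])).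

(* The coradical lies in the bottom of any coalgebra filtration: a functional
   vanishing on F_k but not on w recovers w from its own coproduct. *)
Lemma grouplike_in_bottom w : comul H w = tens w w -> w \in F 0%N.
Proof.
move=> Dw; case: (ex_minnP (F_ex w)) => -[//|m] wm min_w.
have /(separating_functional c_lin cE (F_sub m)) : w \notin F m.
  by apply/negP => /min_w; rewrite ltnn.
move=> [f [lf f0 fw]]; have lp := papl_lin lf.
have [F00 F0D] := F_sub 0%N.
suff : papl f (comul H w) \in F 0%N by rewrite Dw paplE // fw scale1r.
have := F_comul wm.
pose G : {pred tensor A A} := [pred t | papl f t \in F 0%N].
apply: (@Defs.span_ind _ _ _ G).
  by split=> [|k t t']; rewrite !inE ?(lin0 lp) // lp; apply: F0D.
move=> _ [i [y [z [ile yi zi ->]]]]; rewrite inE paplE //.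
move: ile; rewrite leq_eqVlt => /orP[/eqP im|].
  by have := F0D (f y) z 0; rewrite addr0; apply; rewrite // im subnn in zi.
rewrite ltnS => ile; rewrite f0 ?scale0r //; apply: F_mono ile _ _; exact: yi.
Qed.
End Coradical.

(** * From the identity s C = k Λ to the chromatic properties *)

Section Chromatic.
Variables (Lam : A) (rho : {scalar A}) (lam0 : {scalar A}).
Hypotheses (LamP : nonzero_cointegral H Lam) (rhoLam : papl rho (comul H Lam) = 1)
  (lam0P : nonzero_left_integral H lam0)
  (lam0_unique : forall lam : {scalar A}, left_integral H lam ->
     forall a, lam a = lam Lam * lam0 a).
Variables (R : tensor A A) (s : A) (k : K).
Hypotheses (k0 : k != 0) (epss : eps s = 0)
  (sC : s * chromatic_elt H R lam0 = k *: Lam).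
Local Notation C := (chromatic_elt H R lam0).

(** Were C e = 0 for the generator e of the cover, then 0 = s C e = k Λ e = k ε(e) Λ, although ε(e)
    = 1. *)
Lemma chromatic_nondegenerateP : chromatic_nondegenerate H R.
Proof.
have [LamP' Lam0] := LamP.
have [n [b [c [c_lin cE]]]] := frobenius_frame LamP' rhoLam.
have [e [ee epse e_min]] := minimal_idempotent c_lin cE.
exists (Pmod e), lam0; split=> //; first exact: Pmod_cover.
exists (idem_elt ee) => /(congr1 val) Ce.
have {}Ce : C * e = 0 by [].
have := congr1 (fun x => s * x) Ce; rewrite /= mulr0 mulrA sC -pzscaleAl.
rewrite (LamP' e).2 epse scale1r => /eqP.
have -> : (k *: Lam == 0) = (Lam == 0).
  apply/eqP/eqP => [E|->]; last by rewrite scaler0.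
  by rewrite -[Lam]scale1r -(mulVf k0) -scalerA E scaler0.
by move/eqP.
Qed.

(** The cover P is arbitrary here and is reached through projectivity: lifting its projection along
    ε : A → K gives a map P → A hitting some a with ε(a) = 1. The compactness equation becomes
    lam(Λ) C a = ζ Λ' a in A. Multiplying by s kills the right side, so lam(Λ) = 0; the equation
    itself then gives Λ' = 0. *)
Lemma chromatic_not_compact : ~ chromatic_compact H R.
Proof.
move=> [P [lam [Lam' [[Pproj [pr [prsurj _]]] [lamP _] [Lam'P Lam'0] [z z0 act]]]]].
have [LamP' Lam0] := LamP.
pose epsT (x : A^o) : trivmod H := eps (x : A).
have epsTZ : linear epsT by move=> a x y; rewrite /epsT linearD /= counitM.
pose epsL : {linear A^o -> trivmod H} :=
  HB.pack epsT (GRing.isLinear.Build A A^o (trivmod H) *:%R epsT epsTZ).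
pose prT (x : P) : trivmod H := pr x.
have prZ a x : pr (a *: x) = eps a * pr x by exact: (linearZ_LR pr).
have prD x y : pr (x + y) = pr x + pr y by exact: (raddfD pr).
have prTZ : linear prT.
  move=> a x y; change (pr (a *: x + y) = eps a * pr x + pr y).
  by rewrite prD; congr (_ + _); apply: prZ.
pose prL : {linear P -> trivmod H} :=
  HB.pack prT (GRing.isLinear.Build A P (trivmod H) *:%R prT prTZ).
have epsurj y : exists x, epsL x = y.
  exists ((y : K) *: (1 : A)); rewrite /= /epsT linearZ /= counit1; exact: mulr1.
have [phi phiE] := Pproj _ _ epsL prL epsurj.
have [x0 prx0] := prsurj 1.
pose a : A := phi x0.
have epsa : eps a = 1 by have := phiE x0; rewrite /= /prT prx0.
have CE : chromatic_elt H R lam = lam Lam *: C.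
  rewrite /chromatic_elt !tlift.unlock /flift scaler_sumr.
  apply: eq_bigr => i _; rewrite (lam0_unique lamP) -scalerA.
  by rewrite !scalerA; congr (_ *: _); rewrite -!mulrA mulrCA.
have := congr1 phi (act x0); rewrite !linearZ CE => E.
have {}E : (lam Lam *: C) * a = (z *: Lam') * a by exact: E.
have := congr1 (fun x => s * x) E.
rewrite /= !mulrA -!pzscaleAr sC -!pzscaleAl (LamP' a).2 epsa scale1r.
rewrite (Lam'P s).1 epss scale0r mul0r scaler0 scalerA => E0.
have lLam0 : lam Lam = 0.
  apply: contra_notP Lam0 => /eqP l0; have lk : lam Lam * k != 0 by rewrite mulf_neq0.
  by rewrite -[Lam]scale1r -(mulVf lk) -scalerA E0 scaler0.
move: E; rewrite lLam0 scale0r mul0r -pzscaleAl (Lam'P a).2 epsa scale1r => E.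
by apply: Lam'0; rewrite -[Lam']scale1r -(mulVf z0) -scalerA -E scaler0.
Qed.
End Chromatic.
End ProjectiveCover.

(** * Presented algebras and their representations *)

Local Open Scope quotient_scope.

Section FreeAlgebraLift.
Variables (K : fieldType) (X : choiceType) (B : pzAlgType K) (g : X -> B).
Local Notation F := (free_alg K X).

Lemma malg_ext (Y : choiceType) (U : lmodType K) (f h : {malg K[Y]} -> U) :
  linear f -> linear h -> (forall k, f << k >> = h << k >>) -> f =1 h.
Proof.
move=> lf lh fh x; rewrite [x]monalgE (lin_sum lf) (lin_sum lh).
apply: eq_bigr => k _; have -> : << x@_k *g k >> = x@_k *: << k >>.
  by apply/malgP => y; rewrite mcoeffZ !mcoeffU mulr_natr.
by rewrite (linZ lf) (linZ lh) fh.
Qed.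

Definition free_lift : F -> B :=
  flift (fun m : {fmonom X} => \prod_(x <- (m : seq X)) g x).

Lemma free_lift_lin : linear free_lift. Proof. exact: flift_is_linear. Qed.
Lemma free_liftU m : free_lift << m >> = \prod_(x <- (m : seq X)) g x.
Proof. exact: fliftU. Qed.

Lemma alghom_free_lift : [/\ free_lift 1 = 1 & {morph free_lift : x y / x * y}].
Proof.
have ll := free_lift_lin; split; first by rewrite free_liftU fm1 big_nil.
move=> x y.
have mulrl (z : F) : linear (fun t : F => t * z).
  by move=> k u v; rewrite mulrDl scalerAl.
have mulll (z : F) : linear (fun t : F => z * t).
  by move=> k u v; rewrite mulrDr scalerAr.
apply: (malg_ext (f := fun x : F => free_lift (x * y))
  (h := fun x : F => free_lift x * free_lift y)) x => [||m].
- exact: linear_compose ll (mulrl y).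
- exact: linear_mulr ll.
apply: (malg_ext (f := fun y : F => free_lift (<< m >> * y))
  (h := fun y : F => free_lift << m >> * free_lift y)) y => [||m'].
- exact: linear_compose ll (mulll _).
- exact: linear_mull ll.
have -> : (<< m >> : F) * << m' >> = << mmul m m' >>.
  by rewrite malgM_def fgmulUU mulr1.
by rewrite !free_liftU fmM big_cat.
Qed.
Lemma free_lift1 : free_lift 1 = 1. Proof. by case: alghom_free_lift. Qed.
Lemma free_liftM : {morph free_lift : x y / x * y}.
Proof. by case: alghom_free_lift. Qed.
Lemma free_lift_gen x : free_lift (@fgen K X x) = g x.
Proof. by rewrite fgen.unlock free_liftU fmU big_seq1. Qed.
Lemma free_liftX n : {morph free_lift : x / x ^+ n}.
Proof.
by move=> x; elim: n => [|n IH]; rewrite ?expr0 ?free_lift1 // !exprS free_liftM IH.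
Qed.
Lemma free_liftB : {morph free_lift : x y / x - y}.
Proof. exact: linB free_lift_lin. Qed.
Lemma free_liftN : {morph free_lift : x / - x}.
Proof. exact: linN free_lift_lin. Qed.
Lemma free_liftZ k : {morph free_lift : x / k *: x}.
Proof. exact: linZ free_lift_lin k. Qed.
Lemma free_lift0 : free_lift 0 = 0.
Proof. exact: lin0 free_lift_lin. Qed.
End FreeAlgebraLift.

Section PresentedLift.
Variables (K : fieldType) (X : choiceType).
Local Notation F := (free_alg K X).
Variable (rel : F -> F -> Prop).
Local Notation Q := (presented rel).

Definition respects (B : pzAlgType K) (g : X -> B) :=
  forall x y, rel x y -> free_lift g x = free_lift g y.

Section Lift.
Variables (B : pzAlgType K) (g : X -> B).
Hypothesis rg : respects g.

Definition plift (t : Q) : B := free_lift g (repr t).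

Lemma plift_ppi x : plift (ppi rel x) = free_lift g x.
Proof.
suff I0 z : z \in rel_ideal rel -> free_lift g z = 0.
  apply/eqP; rewrite -subr_eq0 -(linB (free_lift_lin g)) I0 //.
  by apply/ppi_eq; rewrite reprpK.
move=> zI; apply/eqP; move: z zI.
apply: (@rel_ideal_ind K F rel [pred z | free_lift g z == 0]).
  split; first split=> [|k u v]; rewrite ?inE ?free_lift0 //.
    move=> /eqP u0 /eqP v0; by rewrite free_lift_lin u0 v0 scaler0 addr0.
  move=> x' y; rewrite !inE => /eqP x0.
  by rewrite !free_liftM x0 mul0r mulr0 eqxx.
by move=> x' y xy; rewrite inE free_liftB (rg xy) subrr.
Qed.

Lemma alghom_plift : alghom plift.
Proof.
split=> [k x y||x y].
- rewrite -[x]reprpK -[y]reprpK -linearP !plift_ppi; exact: free_lift_lin.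
- by rewrite (plift_ppi 1) free_lift1.
by rewrite -[x]reprpK -[y]reprpK -rmorphM !plift_ppi free_liftM.
Qed.
Lemma plift_gen x : plift (ppi rel (@fgen K X x)) = g x.
Proof. by rewrite plift_ppi free_lift_gen. Qed.
End Lift.

Lemma word_prod (k : {fmonom X}) :
  << k >> = \prod_(x <- (k : seq X)) @fgen K X x :> F.
Proof.
case: k => s; elim: s => [|x s IH]; first by rewrite big_nil -fmoneE.
rewrite big_cons -IH fgen.unlock malgM_def fgmulUU mulr1; congr << _ >>.
by apply/eqP; rewrite fmP fmM fmU.
Qed.

Lemma free_lift_ppi x : free_lift (fun g => ppi rel (@fgen K X g)) x = ppi rel x.
Proof.
move: x; apply: malg_ext; [exact: free_lift_lin|by move=> c y z; rewrite linearP|] => k.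
by rewrite free_liftU word_prod rmorph_prod.
Qed.

Lemma presented_ind (P : {pred Q}) : submod_closed P -> 1 \in P ->
  (forall x a, a \in P -> ppi rel (@fgen K X x) * a \in P) -> forall a, a \in P.
Proof.
move=> [P0 PD] P1 PM a.
have PA x y : x \in P -> y \in P -> x + y \in P.
  by move=> Px Py; have := PD 1 x y Px Py; rewrite scale1r.
have PZ k x : x \in P -> k *: x \in P.
  by move=> Px; have := PD k x 0 Px P0; rewrite addr0.
rewrite -[a]reprpK; move: (repr a) => f; rewrite [f]monalgE raddf_sum /=.
elim/big_ind: _ => // k _.
have -> : (<< f@_k *g k >> : F) = f@_k *: (<< k >> : F).
  by apply/malgP => y; rewrite mcoeffZ !mcoeffU mulr_natr.
rewrite linearZ /=; apply: PZ.
rewrite word_prod.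
elim: (k : seq X) => [|x s IH]; first by rewrite big_nil rmorph1.
by rewrite big_cons rmorphM; apply: PM.
Qed.

End PresentedLift.

Section OppositeAlgebra.
Variables (K : fieldType) (A : pzAlgType K).
(** The antipode is an algebra map into this algebra, so the universal property of the presentation
    produces it. *)
Definition opp_alg : Type := A.
HB.instance Definition _ := GRing.Lmodule.on opp_alg.
Definition opp_mul (x y : opp_alg) : opp_alg := (y : A) * (x : A).
Fact opp_mulA : associative opp_mul.
Proof. by move=> x y z; rewrite /opp_mul mulrA. Qed.
Fact opp_mul1 : left_id (1 : A) opp_mul.
Proof. by move=> x; rewrite /opp_mul mulr1. Qed.
Fact opp_mulr1 : right_id (1 : A) opp_mul.
Proof. by move=> x; rewrite /opp_mul mul1r. Qed.
Fact opp_mulDl : left_distributive opp_mul +%R.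
Proof. by move=> x y z; apply: (mulrDr (z : A)). Qed.
Fact opp_mulDr : right_distributive opp_mul +%R.
Proof. by move=> x y z; apply: (mulrDl (y : A) z x). Qed.
Fact opp_scaleAl (c : K) (x y : opp_alg) : c *: opp_mul x y = opp_mul (c *: x) y.
Proof. by apply: (pzscaleAr c (y : A)). Qed.
Fact opp_scaleAr (c : K) (x y : opp_alg) : c *: opp_mul x y = opp_mul x (c *: y).
Proof. by apply: (pzscaleAl c (y : A)). Qed.
HB.instance Definition _ := Lmodule_isPzAlgebra.Build K opp_alg
  opp_mulA opp_mul1 opp_mulr1 opp_mulDl opp_mulDr opp_scaleAl opp_scaleAr.
HB.instance Definition _ := GRing.PzRing.copy opp_alg (PzAlgebra.sort opp_alg).
Lemma oppM (x y : opp_alg) : x * y = (y : A) * (x : A). Proof. by []. Qed.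
Lemma oppX (x : opp_alg) n : x ^+ n = (x : A) ^+ n.
Proof. by elim: n => [|n IH] //; rewrite exprS exprSr IH oppM. Qed.
End OppositeAlgebra.

Section Endomorphisms.
Variables (K : fieldType) (V : lmodType K).
Record lend := Lend { lend_fun :> V -> V; lendP : linear lend_fun }.
Lemma lend_ext (f g : lend) : lend_fun f =1 lend_fun g -> f = g.
Proof.
case: f g => f fP [g gP] /= fg; have {}fg : f = g by apply: funext.
by subst g; congr Lend; apply: Prop_irrelevance.
Qed.
HB.instance Definition _ := gen_eqMixin lend.
HB.instance Definition _ := gen_choiceMixin lend.
Definition lend0 := Lend (@linear_zero K V V).
Definition lend_add (f g : lend) := Lend (linear_add (lendP f) (lendP g)).
Definition lend_opp (f : lend) := Lend (linear_opp (lendP f)).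
Definition lend_scale k (f : lend) := Lend (linear_scaler k (lendP f)).
Definition lend1 := Lend (@linear_id K V).
Definition lend_mul (f g : lend) := Lend (linear_compose (lendP f) (lendP g)).
Fact lend_addA : associative lend_add.
Proof. by move=> f g h; apply: lend_ext => x /=; rewrite addrA. Qed.
Fact lend_addC : commutative lend_add.
Proof. by move=> f g; apply: lend_ext => x /=; rewrite addrC. Qed.
Fact lend_add0 : left_id lend0 lend_add.
Proof. by move=> f; apply: lend_ext => x /=; rewrite add0r. Qed.
Fact lend_addN : left_inverse lend0 lend_opp lend_add.
Proof. by move=> f; apply: lend_ext => x /=; rewrite addNr. Qed.
HB.instance Definition _ := GRing.isZmodule.Build lend
  lend_addA lend_addC lend_add0 lend_addN.
Fact lend_scaleA a b f : lend_scale a (lend_scale b f) = lend_scale (a * b) f.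
Proof. by apply: lend_ext => x /=; rewrite scalerA. Qed.
Fact lend_scale1 : left_id 1 lend_scale.
Proof. by move=> f; apply: lend_ext => x /=; rewrite scale1r. Qed.
Fact lend_scaleDr : right_distributive lend_scale +%R.
Proof. by move=> a f g; apply: lend_ext => x /=; rewrite scalerDr. Qed.
Fact lend_scaleDl f : {morph lend_scale^~ f : a b / a + b}.
Proof. by move=> a b; apply: lend_ext => x /=; rewrite scalerDl. Qed.
HB.instance Definition _ := GRing.Zmodule_isLmodule.Build K lend
  lend_scaleA lend_scale1 lend_scaleDr lend_scaleDl.
Fact lend_mulA : associative lend_mul.
Proof. by move=> f g h; apply: lend_ext. Qed.
Fact lend_mul1 : left_id lend1 lend_mul.
Proof. by move=> f; apply: lend_ext. Qed.
Fact lend_mulr1 : right_id lend1 lend_mul.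
Proof. by move=> f; apply: lend_ext. Qed.
Fact lend_mulDl : left_distributive lend_mul +%R.
Proof. by move=> f g h; apply: lend_ext. Qed.
Fact lend_mulDr : right_distributive lend_mul +%R.
Proof. by move=> f g h; apply: lend_ext => x /=; rewrite (linD (lendP f)). Qed.
Fact lend_scaleAl (c : K) f g : c *: lend_mul f g = lend_mul (c *: f) g.
Proof. by apply: lend_ext. Qed.
Fact lend_scaleAr (c : K) f g : c *: lend_mul f g = lend_mul f (c *: g).
Proof. by apply: lend_ext => x /=; rewrite (linZ (lendP f)). Qed.
HB.instance Definition _ := Lmodule_isPzAlgebra.Build K lend
  lend_mulA lend_mul1 lend_mulr1 lend_mulDl lend_mulDr lend_scaleAl lend_scaleAr.
HB.instance Definition _ := GRing.PzRing.copy lend (PzAlgebra.sort lend).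

Lemma lendM (f g : lend) x : (f * g) x = f (g x). Proof. by []. Qed.
Lemma lend1E x : (1 : lend) x = x. Proof. by []. Qed.
Lemma lendD (f g : lend) x : (f + g) x = f x + g x. Proof. by []. Qed.
Lemma lendN (f : lend) x : (- f) x = - f x. Proof. by []. Qed.
Lemma lendZ c (f : lend) x : (c *: f) x = c *: f x. Proof. by []. Qed.
Lemma lendE0 x : (0 : lend) x = 0. Proof. by []. Qed.
End Endomorphisms.

Local Close Scope quotient_scope.

(** * Skew commutation and q-exponentials *)

Section QCommutation.
Variables (K : fieldType) (B : pzAlgType K).
Implicit Types (x y z : B) (c d : K).

(** Most defining relations of A have this shape. Under products and tensor products the scalars
    simply multiply, which turns most verifications into a computation of scalars. *)
Definition qcomm c x y := x * y = c *: (y * x).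

Lemma qcommMl c d x y z : qcomm c x z -> qcomm d y z -> qcomm (c * d) (x * y) z.
Proof.
move=> xz yz; rewrite /qcomm -mulrA yz -pzscaleAr mulrA xz -pzscaleAl scalerA.
by rewrite mulrC -mulrA.
Qed.
Lemma qcommMr c d x y z : qcomm c x y -> qcomm d x z -> qcomm (c * d) x (y * z).
Proof.
move=> xy xz; rewrite /qcomm mulrA xy -pzscaleAl -mulrA xz -pzscaleAr scalerA.
by rewrite mulrA.
Qed.
Lemma qcomm1l x : qcomm 1 1 x. Proof. by rewrite /qcomm mul1r mulr1 scale1r. Qed.
Lemma qcomm1r x : qcomm 1 x 1. Proof. by rewrite /qcomm mul1r mulr1 scale1r. Qed.
Lemma qcommXl c x y n : qcomm c x y -> qcomm (c ^+ n) (x ^+ n) y.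
Proof.
move=> xy; elim: n => [|n IH]; first exact: qcomm1l.
by rewrite !exprS; apply: qcommMl.
Qed.
Lemma qcommXr c x y n : qcomm c x y -> qcomm (c ^+ n) x (y ^+ n).
Proof.
move=> xy; elim: n => [|n IH]; first exact: qcomm1r.
by rewrite !exprS; apply: qcommMr.
Qed.
Lemma qcomm_refl x : qcomm 1 x x. Proof. by rewrite /qcomm scale1r. Qed.
Lemma qcomm_sym c x y : c != 0 -> qcomm c x y -> qcomm c^-1 y x.
Proof. by move=> c0 xy; rewrite /qcomm xy scalerA mulVf // scale1r. Qed.
Lemma qcommZl c k x y : qcomm c x y -> qcomm c (k *: x) y.
Proof. by move=> xy; rewrite /qcomm -pzscaleAl xy -pzscaleAr !scalerA mulrC. Qed.
Lemma qcommZr c k x y : qcomm c x y -> qcomm c x (k *: y).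
Proof. by move=> xy; rewrite /qcomm -pzscaleAr xy -pzscaleAl !scalerA mulrC. Qed.
Lemma qcommDl c x x' y : qcomm c x y -> qcomm c x' y -> qcomm c (x + x') y.
Proof. by move=> xy x'y; rewrite /qcomm mulrDl xy x'y -scalerDr -mulrDr. Qed.
Lemma qcommDr c x y y' : qcomm c x y -> qcomm c x y' -> qcomm c x (y + y').
Proof. by move=> xy x'y; rewrite /qcomm mulrDr xy x'y -scalerDr -mulrDl. Qed.
Lemma qcomm_comm x y : qcomm 1 x y <-> x * y = y * x.
Proof. by rewrite /qcomm scale1r. Qed.
Lemma qcomm_anti x y : qcomm (-1) x y <-> x * y = - (y * x).
Proof. by rewrite /qcomm scaleN1r. Qed.

Lemma qcomm_expM c x y n : qcomm c y x ->
  (x * y) ^+ n = c ^+ ((n * n.-1) %/ 2)%N *: (x ^+ n * y ^+ n).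
Proof.
move=> yx; elim: n => [|n IH]; first by rewrite !expr0 mulr1 scale1r.
rewrite exprSr IH -pzscaleAl mulrA -(mulrA (x ^+ n)).
rewrite (qcommXl n yx : y ^+ n * x = _) -pzscaleAr -pzscaleAl scalerA -exprD.
rewrite mulrA -exprSr -mulrA -exprSr; congr (_ ^+ _ *: _).
case: n {IH} => // n /=.
by rewrite !divn2 -!bin2 [in RHS]binS bin1 addnC.
Qed.
End QCommutation.

Section TensorQComm.
Variables (K : fieldType) (B C : pzAlgType K).
Lemma qcomm_tens c d (x x' : B) (y y' : C) :
  qcomm c x x' -> qcomm d y y' -> qcomm (c * d) (tens x y) (tens x' y').
Proof. by move=> xx yy; rewrite /qcomm !tensM xx yy tensZl tensZr scalerA. Qed.
Lemma tensX (x : B) (y : C) n : tens x y ^+ n = tens (x ^+ n) (y ^+ n).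
Proof. by elim: n => [|n IH]; rewrite ?expr0 // !exprS IH tensM. Qed.
End TensorQComm.

Section QExponential.
Variables (K : fieldType) (t : K) (N : nat).
Definition qnum i : K := \sum_(j < i) t ^+ j.
Lemma qnum0 : qnum 0 = 0. Proof. by rewrite /qnum big_ord0. Qed.
Lemma qnumS i : qnum i.+1 = qnum i + t ^+ i.
Proof. by rewrite /qnum big_ord_recr. Qed.
Lemma qnumD i j : qnum (i + j) = qnum i + t ^+ i * qnum j.
Proof.
elim: j => [|j IH]; first by rewrite addn0 qnum0 mulr0 addr0.
by rewrite addnS !qnumS IH mulrDr exprD addrA.
Qed.
Definition qnfact n : K := \prod_(i < n) qnum i.+1.
Lemma qnfactS n : qnfact n.+1 = qnfact n * qnum n.+1.
Proof. by rewrite /qnfact big_ord_recr. Qed.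

Hypotheses (qnum_neq0 : forall i, (0 < i < N)%N -> qnum i != 0) (qnumN : qnum N = 0).
Lemma qnfact_neq0 n : (n < N)%N -> qnfact n != 0.
Proof.
move=> nN; rewrite prodf_seq_neq0; apply/allP => i _ /=.
by rewrite qnum_neq0 //= (leq_ltn_trans _ nN).
Qed.

Variables (B : pzAlgType K).
Implicit Types (x y X Y : B).
(** The q-divided power x^n / (n)_t!; [qexp] is the corresponding exponential, cut off before the
    vanishing factorial (N)_t!. *)
Definition divp n x := (qnfact n)^-1 *: x ^+ n.
Definition qexp x := \sum_(a < N) divp a x.

Lemma mul_divp i x : (i.+1 < N)%N \/ (i.+1 = N /\ x ^+ N = 0) ->
  x * divp i x = qnum i.+1 *: divp i.+1 x.
Proof.
rewrite /divp -pzscaleAr -exprS qnfactS => -[iN|[-> ->]]; last by rewrite !scaler0.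
rewrite scalerA invfM mulrCA mulfV ?mulr1 //.
by rewrite qnum_neq0.
Qed.

(** The q-binomial formula multiplied by (n+1)_t, so that it still makes sense at n + 1 = N, where
    (N)_t = 0. It serves both the induction below N and the vanishing of (X + Y)^N. *)
Lemma qbinom_step n X Y : qcomm t Y X -> (n < N)%N ->
  (n.+1 < N)%N \/ (X ^+ N = 0 /\ Y ^+ N = 0) ->
  divp n (X + Y) = \sum_(i < n.+1) divp i X * divp (n - i) Y ->
  (X + Y) * divp n (X + Y) =
  qnum n.+1 *: \sum_(i < n.+2) divp i X * divp (n.+1 - i) Y.
Proof.
move=> YX nN hN ->; rewrite mulrDl !mulr_sumr.
have hX i : (i <= n)%N -> (i.+1 < N)%N \/ (i.+1 = N /\ X ^+ N = 0).
  rewrite -ltnS => lein; case: hN => [hN|[-> _]]; first by left; apply: leq_ltn_trans hN.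
  by have := leq_trans lein nN; rewrite leq_eqVlt => /orP[/eqP ->|]; [right|left].
have hY i : (i <= n)%N -> (i.+1 < N)%N \/ (i.+1 = N /\ Y ^+ N = 0).
  rewrite -ltnS => lein; case: hN => [hN|[_ ->]]; first by left; apply: leq_ltn_trans hN.
  by have := leq_trans lein nN; rewrite leq_eqVlt => /orP[/eqP ->|]; [right|left].
have -> : \sum_(i < n.+1) X * (divp i X * divp (n - i) Y) =
  \sum_(i < n.+2) qnum i *: (divp i X * divp (n.+1 - i) Y).
  rewrite [RHS]big_ord_recl qnum0 scale0r add0r; apply: eq_bigr => i _.
  rewrite mulrA mul_divp; last by apply: hX; rewrite -ltnS.
  by rewrite -pzscaleAl subSS.
have -> : \sum_(i < n.+1) Y * (divp i X * divp (n - i) Y) =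
  \sum_(i < n.+2) (t ^+ i * qnum (n.+1 - i)) *: (divp i X * divp (n.+1 - i) Y).
  rewrite [RHS]big_ord_recr /= subnn qnum0 mulr0 scale0r addr0.
  apply: eq_bigr => i _; rewrite mulrA (qcommZr _ (qcommXr i YX) : Y * divp i X = _).
  rewrite -pzscaleAl -mulrA mul_divp; last by apply: hY; apply: leq_subr.
  by rewrite -pzscaleAr scalerA subSn // -ltnS.
rewrite -big_split scaler_sumr; apply: eq_bigr => i _ /=.
by rewrite -scalerDl -qnumD subnKC // -ltnS.
Qed.

Lemma qbinom n X Y : qcomm t Y X -> (n < N)%N ->
  divp n (X + Y) = \sum_(i < n.+1) divp i X * divp (n - i) Y.
Proof.
move=> YX; elim: n => [|n IH] nN.
  rewrite big_ord1 /divp subnn !expr0 /qnfact big_ord0 invr1 !scale1r mulr1 //.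
have := qbinom_step YX (ltnW nN) (or_introl nN) (IH (ltnW nN)).
rewrite mul_divp; last by left.
move=> E; have q0 : qnum n.+1 != 0 by rewrite qnum_neq0.
by rewrite -[LHS]scale1r -(mulVf q0) -scalerA E scalerA mulVf // scale1r.
Qed.

Lemma qbinomN X Y : (0 < N)%N -> qcomm t Y X -> X ^+ N = 0 -> Y ^+ N = 0 ->
  (X + Y) ^+ N = 0.
Proof.
move=> N0 YX XN YN; have nN : (N.-1 < N)%N by rewrite prednK.
have := qbinom_step YX nN (or_intror (conj XN YN)) (qbinom YX nN).
rewrite prednK // qnumN scale0r /divp -pzscaleAr -exprS prednK //.
by move/eqP; rewrite scaler_eq0 invr_eq0 (negPf (qnfact_neq0 nN)) => /eqP.
Qed.

(** The product of the truncated exponentials contains terms with i + j at least N that the left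
    side lacks; the hypothesis on X^i Y^j kills exactly these. *)
Lemma qexp_add X Y : qcomm t Y X ->
  (forall i j, (N <= i + j)%N -> X ^+ i * Y ^+ j = 0) ->
  qexp (X + Y) = qexp X * qexp Y.
Proof.
move=> YX XY0.
have shift (i : 'I_N) (G : nat -> B) :
    \sum_(a < N | (i <= a)%N) G (a - i)%N = \sum_(j < N - i) G j.
  rewrite -(big_mkord (fun a => i <= a)%N (fun a => G (a - i)%N)) -(big_mkord xpredT G).
  transitivity (\sum_(i <= a < N) G (a - i)%N).
    by rewrite [RHS](big_nat_widenl _ 0%N).
  rewrite -{1}[i : nat]add0n big_addn; apply: eq_bigr => j _.
  by rewrite addnK.
transitivity (\sum_(a < N) \sum_(i < N | (i <= a)%N) divp i X * divp (a - i) Y).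
  apply: eq_bigr => a _; rewrite qbinom //.
  by rewrite (big_ord_widen N (fun i => divp i X * divp (a - i) Y)).
rewrite (exchange_big_dep xpredT) //= /qexp mulr_suml; apply: eq_bigr => i _.
rewrite (shift i (fun j => divp i X * divp j Y)) mulr_sumr.
rewrite (big_ord_widen N (fun j => divp i X * divp j Y)) ?leq_subr //.
rewrite big_mkcond; apply: eq_bigr => j _; case: ltnP => // le.
rewrite /divp -pzscaleAl -pzscaleAr XY0 ?scaler0 //.
by rewrite -leq_subLR.
Qed.

Lemma alghom_divp (C : pzAlgType K) (f : B -> C) (hf : alghom f) n x :
  f (divp n x) = (qnfact n)^-1 *: f x ^+ n.
Proof. by rewrite /divp (linZ (alghom_lin hf)) (alghomX hf). Qed.
End QExponential.

Lemma alghom_qexp (K : fieldType) t N (B C : pzAlgType K) (f : B -> C) :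
  alghom f -> forall x, f (qexp t N x) = qexp t N (f x).
Proof.
move=> hf x; rewrite /qexp (lin_sum (alghom_lin hf)); apply: eq_bigr => i _.
exact: alghom_divp.
Qed.

(** * The presentation of the biproduct *)

Section RootOfUnity.
Set Default Proof Using "All".
Variables (r : nat) (K : fieldType) (q : K).
Hypotheses (q_prim : r.-primitive_root q) (r_dvd8 : (8 %| r)%N).
Local Notation N := (r %/ 2)%N.
Local Notation r'' := (r %/ 4)%N.

Lemma r_gt0 : (0 < r)%N. Proof. exact: prim_order_gt0 q_prim. Qed.
Lemma r_eq : r = (2 * N)%N. Proof. by have := dvdn_trans (isT : 2 %| 8)%N r_dvd8; lia. Qed.
Lemma N_eq : N = (2 * r'')%N. Proof. by lia. Qed.
Lemma r''_even : ~~ odd r''. Proof. by lia. Qed.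
Lemma N_gt2 : (2 < N)%N. Proof. by have := r_gt0; lia. Qed.
Lemma N_gt0 : (0 < N)%N. Proof. by have := N_gt2; lia. Qed.
Lemma N_pred_odd : odd N.-1. Proof. by have := N_gt2; lia. Qed.

Lemma q_neq0 : q != 0.
Proof.
apply/eqP => q0; have := prim_expr_order q_prim; rewrite q0 expr0n.
by rewrite -leqn0 leqNgt r_gt0 => /eqP; rewrite eq_sym oner_eq0.
Qed.
Lemma q2_neq0 : q ^+ 2 != 0. Proof. by rewrite expf_neq0 ?q_neq0. Qed.
Lemma qN : q ^+ N = -1.
Proof.
have : q ^+ N * q ^+ N = 1 by rewrite -exprD addnn -mul2n -r_eq (prim_expr_order q_prim).
move/eqP; rewrite -expr2 sqrf_eq1 => /orP[|/eqP //].
rewrite -(prim_order_dvd q_prim) => /(dvdn_leq N_gt0).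
by have := N_gt2; lia.
Qed.
Lemma q2_prim : N.-primitive_root (q ^+ 2).
Proof.
have := exp_prim_root q_prim 2.
have -> // : (r %/ gcdn 2 r = N)%N.
by congr (_ %/ _)%N; apply/gcdn_idPl; lia.
Qed.
Lemma q2r'' : (q ^+ 2) ^+ r'' = -1.
Proof. by rewrite -exprM -N_eq qN. Qed.
Lemma q2N : (q ^+ 2) ^+ N = 1. Proof. exact: prim_expr_order q2_prim. Qed.
Lemma q2_pred : (q ^+ 2) ^+ N.-1 = q ^- 2.
Proof.
apply: (mulfI q2_neq0); rewrite -exprS prednK ?N_gt0 // q2N.
by rewrite mulfV ?q2_neq0.
Qed.
(** In characteristic 2 the value q^{r/2} = -1 would be 1, against primitivity of q. *)
Lemma two_neq0 : (2%:R : K) != 0.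
Proof.
have : q ^+ N != 1.
  rewrite -(prim_order_dvd q_prim); apply/negP => /(dvdn_leq N_gt0).
  by have := N_gt2; lia.
rewrite qN; apply: contra => /eqP two0.
by rewrite eq_sym -subr_eq0 opprK -(natrD _ 1 1) two0.
Qed.
Lemma q_qinv_neq0 : q - q^-1 != 0.
Proof.
rewrite subr_eq0; apply/negP => /eqP qq; have : q ^+ 2 = 1.
  by rewrite expr2 {2}qq mulfV ?q_neq0.
rewrite -[q ^+ 2]expr1 => /eqP; rewrite -(prim_order_dvd q2_prim) dvdn1.
by have := N_gt2; lia.
Qed.
Local Notation t := (q ^- 2).
Lemma t_pow i : (t ^+ i == 1) = (N %| i)%N.
Proof. by rewrite exprVn invr_eq1 -(prim_order_dvd q2_prim). Qed.
Lemma qnum_geom i : (1 - t) * qnum t i = 1 - t ^+ i.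
Proof.
elim: i => [|i IH]; first by rewrite qnum0 mulr0 expr0 subrr.
by rewrite qnumS mulrDr IH [in RHS](exprS t) mulrBl mul1r addrA subrK.
Qed.
Lemma t_neq1 : 1 - t != 0.
Proof.
rewrite subr_eq0 eq_sym -[t]expr1 t_pow dvdn1.
by have := N_gt2; lia.
Qed.
Lemma qnumt_neq0 i : (0 < i < N)%N -> qnum t i != 0.
Proof.
move=> /andP[i0 iN]; have := t_pow i; rewrite (gtnNdvd i0 iN).
apply: contraFneq => q0; have := qnum_geom i; rewrite q0 mulr0.
by move/esym/eqP; rewrite subr_eq0 eq_sym.
Qed.
Lemma qnumtN : qnum t N = 0.
Proof.
apply: (mulfI t_neq1); rewrite qnum_geom mulr0.
by apply/eqP; rewrite subr_eq0 eq_sym t_pow.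
Qed.
Unset Default Proof Using.
End RootOfUnity.

Section FreeLiftEval.
Variables (K : fieldType) (X : choiceType) (B : pzAlgType K) (g : X -> B).
Local Notation F := (free_alg K X).
Implicit Types (x y : F) (a b : B).
Local Notation ev := (free_lift g).
Lemma evM x y a b : ev x = a -> ev y = b -> ev (x * y) = a * b.
Proof. by move=> <- <-; exact: free_liftM. Qed.
Lemma evX x a n : ev x = a -> ev (x ^+ n) = a ^+ n.
Proof. by move=> <-; exact: free_liftX. Qed.
Lemma evD x y a b : ev x = a -> ev y = b -> ev (x + y) = a + b.
Proof. by move=> <- <-; exact: (linD (free_lift_lin g)). Qed.
Lemma evN x a : ev x = a -> ev (- x) = - a.
Proof. by move=> <-; exact: free_liftN. Qed.
Lemma evZ k x a : ev x = a -> ev (k *: x) = k *: a.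
Proof. by move=> <-; exact: free_liftZ. Qed.
Lemma ev_rel (rel : F -> F -> Prop) (rg : respects rel g) x y a b :
  rel x y -> ev x = a -> ev y = b -> a = b.
Proof. by move=> /rg + <- <-. Qed.
Lemma ev_eq x y a b : ev x = a -> ev y = b -> a = b -> ev x = ev y.
Proof. by move=> -> ->. Qed.
End FreeLiftEval.

(** Evaluates [free_lift] along the syntax of a relation, so that each defining relation becomes an
    equation between images of generators. *)
Ltac ev_tac := lazymatch goal with
  | |- free_lift _ (GRing.mul _ _) = _ => eapply evM; ev_tac
  | |- free_lift _ (GRing.exp _ _) = _ => eapply evX; ev_tac
  | |- free_lift _ (Algebra.add _ _) = _ => eapply evD; ev_tac
  | |- free_lift _ (Algebra.opp _) = _ => eapply evN; ev_tac
  | |- free_lift _ (GRing.scale _ _) = _ => eapply evZ; ev_tac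
  | |- free_lift _ (GRing.one _) = _ => refine (free_lift1 _)
  | |- free_lift _ (@Algebra.zero _) = _ => refine (free_lift0 _)
  | |- ?G => refine (free_lift_gen _ _)
  end.

Section Relations.
Variables (p r : nat) (K : fieldType) (q : K).
Local Notation N := (r %/ 2)%N.
Local Notation r'' := (r %/ 4)%N.

Section Images.
Variables (B : pzAlgType K) (gK gE gF gL : B) (gZ : bool -> 'I_p -> B) (gS : 'S_p -> B).

Definition img (x : gen p) : B :=
  match x with
  | genK => gK | genE => gE | genF => gF | genL => gL
  | genZ e l => gZ e l | Defs.genS s => gS s
  end.

(** The defining relations for elements of an arbitrary algebra, with conjugation by K rewritten as
    skew commutation. The next two lemmas match them with compatibility with [A_rel]. *)
Record Arels : Prop := {
  rK : gK ^+ N = 1; rE : gE ^+ N = 0; rF : gF ^+ N = 0;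
  rKE : qcomm (q ^+ 2) gK gE; rKF : qcomm (q ^- 2) gK gF;
  rEF : gE * gF - gF * gE = (q - q^-1)^-1 *: (gK - gK ^+ N.-1);
  rL : gL * gL = 1; rLZ : forall e l, qcomm (-1) gL (gZ e l);
  rZ2 : forall e l, gZ e l * gZ e l = 0;
  rZZ : forall e l e' l', qcomm (-1) (gZ e l) (gZ e' l');
  rLK : qcomm 1 gL gK; rLE : qcomm 1 gL gE; rLF : qcomm 1 gL gF;
  rKZ : forall e l, qcomm (-1) gK (gZ e l);
  rEZ : forall e l, qcomm (-1) gE (gZ e l);
  rFZ : forall e l, qcomm 1 gF (gZ e l);
  rS1 : gS 1%g = 1; rSS : forall s u, gS s * gS u = gS (u * s)%g;
  rSE : forall s, qcomm 1 (gS s) gE; rSF : forall s, qcomm 1 (gS s) gF;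
  rSK : forall s, qcomm 1 (gS s) gK; rSL : forall s, qcomm 1 (gS s) gL;
  rSZ : forall s e l, gS s * gZ e l = gZ e (s l) * gS s
}.

Hypotheses (N0 : (0 < N)%N).

Lemma Arels_respects : Arels -> respects (@A_rel p K r q) img.
Proof.
case=> hK hE hF hKE hKF hEF hL hLZ hZ2 hZZ hLK hLE hLF hKZ hEZ hFZ h1 hSS hSE hSF hSK hSL hSZ.
have KKi : gK * gK ^+ N.-1 = 1 by rewrite -exprS prednK.
move=> x y; case=> *; (eapply ev_eq; [ev_tac|ev_tac|rewrite /=]).
all: try exact/qcomm_comm; try exact/qcomm_anti; rewrite ?expr2 //.
- by rewrite hKE -pzscaleAl -mulrA KKi mulr1.
- by rewrite hKF -pzscaleAl -mulrA KKi mulr1.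
Qed.

Lemma Arels_of_respects : respects (@A_rel p K r q) img -> Arels.
Proof.
move=> rg.
have hK : gK ^+ N = 1 by apply: (ev_rel rg (@A_rel_Kr p K r q)); ev_tac.
have KiK : gK ^+ N.-1 * gK = 1 by rewrite -exprSr prednK.
split=> // *; try apply/qcomm_comm; try apply/qcomm_anti.
- by apply: (ev_rel rg (@A_rel_Er p K r q)); ev_tac.
- by apply: (ev_rel rg (@A_rel_Fr p K r q)); ev_tac.
- have E : gK * gE * gK ^+ N.-1 = q ^+ 2 *: gE.
    by apply: (ev_rel rg (@A_rel_KE p K r q)); ev_tac.
  by rewrite /qcomm pzscaleAl -E -mulrA KiK mulr1.
- have E : gK * gF * gK ^+ N.-1 = q ^- 2 *: gF.
    by apply: (ev_rel rg (@A_rel_KF p K r q)); ev_tac.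
  by rewrite /qcomm pzscaleAl -E -mulrA KiK mulr1.
- by apply: (ev_rel rg (@A_rel_EF p K r q)); ev_tac.
- by rewrite -expr2; apply: (ev_rel rg (@A_rel_L2 p K r q)); ev_tac.
- by apply: (ev_rel rg (@A_rel_LZ p K r q _ _)); ev_tac.
- by rewrite -expr2; apply: (ev_rel rg (@A_rel_Z2 p K r q _ _)); ev_tac.
- by apply: (ev_rel rg (@A_rel_ZZ p K r q _ _ _ _)); ev_tac.
- by apply: (ev_rel rg (@A_rel_LK p K r q)); ev_tac.
- by apply: (ev_rel rg (@A_rel_LE p K r q)); ev_tac.
- by apply: (ev_rel rg (@A_rel_LF p K r q)); ev_tac.
- by apply: (ev_rel rg (@A_rel_KZ p K r q _ _)); ev_tac.
- by apply: (ev_rel rg (@A_rel_EZ p K r q _ _)); ev_tac.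
- by apply: (ev_rel rg (@A_rel_FZ p K r q _ _)); ev_tac.
- by apply: (ev_rel rg (@A_rel_S1 p K r q)); ev_tac.
- by apply: (ev_rel rg (@A_rel_SS p K r q _ _)); ev_tac.
- by apply: (ev_rel rg (@A_rel_SE p K r q _)); ev_tac.
- by apply: (ev_rel rg (@A_rel_SF p K r q _)); ev_tac.
- by apply: (ev_rel rg (@A_rel_SK p K r q _)); ev_tac.
- by apply: (ev_rel rg (@A_rel_SL p K r q _)); ev_tac.
- by apply: (ev_rel rg (@A_rel_SZ p K r q _ _ _)); ev_tac.
Qed.

Definition Alift : biproduct p r q -> B := plift img.
Hypothesis rels : Arels.
Lemma alghom_Alift : alghom Alift.
Proof. exact: alghom_plift (Arels_respects rels). Qed.
Lemma Alift_gen x : Alift (ppi (@A_rel p K r q) (@fgen K _ x)) = img x.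
Proof. exact: plift_gen (Arels_respects rels) x. Qed.
End Images.

(* A is presented by the given generators; keeping A abstract keeps the
   canonical structures of the concrete quotient out of unification. *)
Record presentation (A : pzAlgType K) (gK gE gF gL : A) (gZ : bool -> 'I_p -> A)
    (gS : 'S_p -> A) := {
  pres_rels : Arels gK gE gF gL gZ gS;
  pres_lift : forall (B : pzAlgType K) (hK hE hF hL : B) (hZ : bool -> 'I_p -> B)
      (hS : 'S_p -> B), Arels hK hE hF hL hZ hS ->
    {f : A -> B | alghom f /\
      forall x, f (img gK gE gF gL gZ gS x) = img hK hE hF hL hZ hS x};
  pres_ind : forall P : {pred A}, submod_closed P -> 1 \in P ->
    (forall x a, a \in P -> img gK gE gF gL gZ gS x * a \in P) -> forall a, a \in P
}.

Local Notation A := (biproduct p r q).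
Local Notation Agen x := (ppi (@A_rel p K r q) (@fgen K _ x)).
Definition aZ e l : A := Agen (genZ e l).
Local Notation gK := (@aK p K r q).
Local Notation gE := (@aE p K r q).
Local Notation gF := (@aF p K r q).
Local Notation gL := (@aL p K r q).
Local Notation gS := (@aS p K r q).

Lemma A_rels : (0 < N)%N -> Arels gK gE gF gL aZ gS.
Proof.
move=> N0; apply: Arels_of_respects => // x y xy.
have E z : free_lift (img gK gE gF gL aZ gS) z = ppi (@A_rel p K r q) z.
  rewrite -free_lift_ppi; congr flift; apply: funext => m.
  by apply: eq_bigr => -[].
by rewrite !E; apply: ppi_rel.
Qed.

Lemma biproduct_presentation : (0 < N)%N ->
  @presentation (biproduct p r q) gK gE gF gL aZ gS.
Proof.
move=> N0; have E x : img gK gE gF gL aZ gS x = Agen x by case: x.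
split; first exact: A_rels.
  move=> B hK hE hF hL hZ hS hrels; exists (Alift hK hE hF hL hZ hS); split.
    exact: alghom_Alift.
  by move=> x; rewrite E; exact: Alift_gen.
move=> P Psub P1 PM; apply: presented_ind => // x a Pa.
by rewrite -E; exact: PM.
Qed.
End Relations.

(** * The Hopf structure *)

Section ScalarAlgebra.
Variable K : fieldType.
(** The field as an algebra over itself, the target of the counit as an algebra map. *)
Definition scal_alg : Type := K^o.
HB.instance Definition _ := GRing.Lmodule.on scal_alg.
Fact scal_scaleAl (c : K) (x y : scal_alg) :
  c *: ((x : K) * (y : K) : scal_alg) = ((c *: x : scal_alg) : K) * y.
Proof. by rewrite /GRing.scale /= mulrA. Qed.
Fact scal_scaleAr (c : K) (x y : scal_alg) :
  c *: ((x : K) * (y : K) : scal_alg) = (x : K) * (c *: y : scal_alg).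
Proof. by rewrite /GRing.scale /= mulrCA. Qed.
HB.instance Definition _ := Lmodule_isPzAlgebra.Build K scal_alg
  (@mulrA K) (@mul1r K) (@mulr1 K) (@mulrDl K) (@mulrDr K) scal_scaleAl scal_scaleAr.
HB.instance Definition _ := GRing.PzRing.copy scal_alg (PzAlgebra.sort scal_alg).
End ScalarAlgebra.

Section Derived.
Variables (p r : nat) (K : fieldType) (q : K).
Hypotheses (q_prim : r.-primitive_root q) (r_dvd8 : (8 %| r)%N).
Local Notation N := (r %/ 2)%N.
Local Notation r'' := (r %/ 4)%N.
Variables (B : pzAlgType K) (gK gE gF gL : B) (gZ : bool -> 'I_p -> B) (gS : 'S_p -> B).
Hypothesis h : Arels r q gK gE gF gL gZ gS.

Let N0 : (0 < N)%N := N_gt0 q_prim r_dvd8.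
Let q0 : q != 0 := q_neq0 q_prim r_dvd8.
Let q20 : q ^+ 2 != 0 := q2_neq0 q_prim r_dvd8.
Local Notation t := (q ^- 2).

Lemma qcomm_eq c c' (C : pzAlgType K) (x y : C) : qcomm c x y -> c = c' -> qcomm c' x y.
Proof. by move=> xy <-. Qed.
Lemma qcomm_symN (C : pzAlgType K) (x y : C) : qcomm (-1 : K) x y -> qcomm (-1 : K) y x.
Proof. by move=> xy; apply: qcomm_eq (qcomm_sym _ xy) _; rewrite ?invrN ?invr1 // oppr_eq0 oner_eq0. Qed.
Lemma qcomm_sym1 (C : pzAlgType K) (x y : C) : qcomm (1 : K) x y -> qcomm (1 : K) y x.
Proof. by move=> /qcomm_comm xy; apply/qcomm_comm. Qed.

Lemma sum_diff_regroup (V : zmodType) (a b c d e f : V) :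
  a + b + (c + d) - (a + e + (f + d)) = (b - f) + (c - e).
Proof.
rewrite (addrC a b) (addrACA b) (addrC a e) (addrACA e) (addrC (e + f)) opprD (addrA (b + c + (a + d))) addrK.
by rewrite (addrC e f) opprD addrACA.
Qed.

Definition Ki := gK ^+ N.-1.
Definition Lb := gK ^+ r'' * gL.
Lemma KKi : gK * Ki = 1. Proof. by rewrite /Ki -exprS prednK ?(rK h). Qed.
Lemma KiK : Ki * gK = 1. Proof. by rewrite /Ki -exprSr prednK ?(rK h). Qed.
Lemma KiN : Ki ^+ N = 1. Proof. by rewrite /Ki -exprM mulnC exprM (rK h) expr1n. Qed.
Lemma Ki_pred : Ki ^+ N.-1 = gK.
Proof. by rewrite -[LHS]mulr1 -KiK mulrA -exprSr prednK // KiN mul1r. Qed.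
Lemma K_Ki : qcomm 1 gK Ki. Proof. by apply/qcomm_comm; rewrite KKi KiK. Qed.
Lemma Ki_E : qcomm t Ki gE.
Proof. by apply: qcomm_eq (qcommXl _ (rKE h)) _; rewrite (q2_pred q_prim r_dvd8). Qed.
Lemma Ki_F : qcomm (q ^+ 2) Ki gF.
Proof.
by apply: qcomm_eq (qcommXl _ (rKF h)) _; rewrite exprVn (q2_pred q_prim r_dvd8) // invrK.
Qed.
Lemma Ki_Z e l : qcomm (-1) Ki (gZ e l).
Proof.
apply: qcomm_eq (qcommXl _ (rKZ h e l)) _.
by rewrite -signr_odd (N_pred_odd q_prim r_dvd8).
Qed.
Lemma Ki_L : qcomm 1 Ki gL.
Proof. by apply: qcomm_eq (qcommXl _ (qcomm_sym1 (rLK h))) _; rewrite expr1n. Qed.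
Lemma E_K : qcomm t gE gK. Proof. exact: qcomm_sym (rKE h). Qed.
Lemma E_Ki : qcomm (q ^+ 2) gE Ki.
Proof. by apply: qcomm_eq (qcomm_sym _ Ki_E) _; rewrite ?invrK // invr_neq0. Qed.
Lemma F_K : qcomm (q ^+ 2) gF gK.
Proof. by apply: qcomm_eq (qcomm_sym _ (rKF h)) _; rewrite ?invrK // invr_neq0. Qed.
Lemma F_Ki : qcomm t gF Ki. Proof. exact: qcomm_sym Ki_F. Qed.

Let one_r'' : (1 : K) ^+ r'' = 1. Proof. by rewrite expr1n. Qed.
(** The sign comes from K^{r''}, since q^{2r''} = q^{r/2} = -1, and not from L, which commutes with
    E. *)
Lemma Lb_E : qcomm (-1) Lb gE.
Proof.
apply: qcomm_eq (qcommMl (qcommXl r'' (rKE h)) (rLE h)) _.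
by rewrite (q2r'' q_prim r_dvd8) // mulr1.
Qed.
Lemma Lb_F : qcomm (-1) Lb gF.
Proof.
apply: qcomm_eq (qcommMl (qcommXl r'' (rKF h)) (rLF h)) _.
by rewrite exprVn (q2r'' q_prim r_dvd8) // invrN invr1 mulr1.
Qed.
Lemma Lb_Z e l : qcomm (-1) Lb (gZ e l).
Proof.
apply: qcomm_eq (qcommMl (qcommXl r'' (rKZ h e l)) (rLZ h e l)) _.
by rewrite -signr_odd (negPf (r''_even q_prim r_dvd8)) mul1r.
Qed.
Lemma Lb_K : qcomm 1 Lb gK.
Proof.
apply: qcomm_eq (qcommMl (qcommXl r'' (qcomm_refl gK)) (rLK h)) _.
by rewrite one_r'' mulr1.
Qed.
Lemma Lb_L : qcomm 1 Lb gL.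
Proof.
apply: qcomm_eq (qcommMl (qcommXl r'' (qcomm_sym1 (rLK h))) (qcomm_refl gL)) _.
by rewrite one_r'' mulr1.
Qed.
Lemma Lb_S s : qcomm 1 Lb (gS s).
Proof.
apply: qcomm_eq (qcommMl (qcommXl r'' (qcomm_sym1 (rSK h s))) (qcomm_sym1 (rSL h s))) _.
by rewrite one_r'' mulr1.
Qed.
Lemma Lb_Ki : qcomm 1 Lb Ki.
Proof. by apply: qcomm_eq (qcommXr _ Lb_K) _; rewrite expr1n. Qed.
Lemma LbLb : Lb * Lb = 1.
Proof.
have /qcomm_comm E := Lb_L; rewrite {2}/Lb mulrA.
have /qcomm_comm -> : qcomm (1 : K) Lb (gK ^+ r'').
  by apply: qcomm_eq (qcommXr _ Lb_K) _; rewrite expr1n.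
rewrite /Lb mulrA -exprD addnn -mul2n -(N_eq q_prim r_dvd8) (rK h) mul1r.
exact: rL h.
Qed.

(** Nearly all relations follow by multiplying scalars in the two legs. The exceptions are E^N = F^N
    = 0, which need the q-binomial theorem at a root of unity, and the commutator of E and F. *)
Lemma Arels_comul : Arels r q (tens gK gK) (tens (1 : B) gE + tens gE gK)
  (tens gF (1 : B) + tens Ki gF) (tens gL gL)
  (fun e l => tens (1 : B) (gZ e l) + tens (gZ e l) Lb) (fun s => tens (gS s) (gS s)).
Proof.
have [c1 c2] := (@qcomm1l K B, @qcomm1r K B).
have tq := @qcomm_tens K B B.
have hn := qnumt_neq0 q_prim r_dvd8; have hN := qnumtN q_prim r_dvd8.
split.
- by rewrite tensX (rK h).
- rewrite addrC; apply: (qbinomN hn hN N0).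
  + by apply: qcomm_eq (tq _ _ _ _ _ _ (c1 _) E_K) _; rewrite mul1r.
  + by rewrite tensX (rE h) tens0l.
  + by rewrite tensX (rE h) tens0r.
- rewrite addrC; apply: (qbinomN hn hN N0).
  + by apply: qcomm_eq (tq _ _ _ _ _ _ F_Ki (c1 _)) _; rewrite mulr1.
  + by rewrite tensX (rF h) tens0r.
  + by rewrite tensX (rF h) tens0l.
- apply: qcommDr.
    by apply: qcomm_eq (tq _ _ _ _ _ _ (c2 _) (rKE h)) _; rewrite mul1r.
  by apply: qcomm_eq (tq _ _ _ _ _ _ (rKE h) (qcomm_refl _)) _; rewrite mulr1.
- apply: qcommDr.
    by apply: qcomm_eq (tq _ _ _ _ _ _ (rKF h) (c2 _)) _; rewrite mulr1.
  by apply: qcomm_eq (tq _ _ _ _ _ _ K_Ki (rKF h)) _; rewrite mul1r.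
(* The mixed terms E K^-1 ⊗ K F and K^-1 E ⊗ F K coincide because their two scalars are inverse to
   each other. *)
- have EKi : gE * Ki = q ^+ 2 *: (Ki * gE) := E_Ki.
  have KF : gK * gF = q ^- 2 *: (gF * gK) := rKF h.
  rewrite !mulrDl !mulrDr !tensM !mul1r !mulr1 tensX -/Ki.
  rewrite EKi KF tensZl tensZr scalerA mulfV // scale1r.
  rewrite sum_diff_regroup -tensNr -tensDr -tensNl -tensDl (rEF h) tensZl tensZr.
  rewrite -scalerDr; congr (_ *: _); rewrite -/Ki tensDl tensDr tensNl tensNr.
  by rewrite addrCA addrAC subrr add0r addrC.
- by rewrite tensM (rL h).
- move=> e l; apply: qcommDr.
    by apply: qcomm_eq (tq _ _ _ _ _ _ (c2 _) (rLZ h e l)) _; rewrite mul1r.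
  by apply: qcomm_eq (tq _ _ _ _ _ _ (rLZ h e l) (qcomm_sym1 Lb_L)) _; rewrite mulr1.
- move=> e l; have /qcomm_anti LZ := Lb_Z e l.
  rewrite !mulrDl !mulrDr !tensM !(rZ2 h) tens0l tens0r !mul1r !mulr1 addr0 add0r.
  by rewrite LZ tensNr subrr.
- move=> e l e' l'; apply: qcommDl; apply: qcommDr.
  + by apply: qcomm_eq (tq _ _ _ _ _ _ (c1 _) (rZZ h e l e' l')) _; rewrite mul1r.
  + by apply: qcomm_eq (tq _ _ _ _ _ _ (c1 _) (qcomm_symN (Lb_Z e l))) _; rewrite mul1r.
  + by apply: qcomm_eq (tq _ _ _ _ _ _ (c2 _) (Lb_Z e' l')) _; rewrite mul1r.
  + by apply: qcomm_eq (tq _ _ _ _ _ _ (rZZ h e l e' l') (qcomm_refl _)) _; rewrite mulr1.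
- by apply: qcomm_eq (tq _ _ _ _ _ _ (rLK h) (rLK h)) _; rewrite mulr1.
- apply: qcommDr.
    by apply: qcomm_eq (tq _ _ _ _ _ _ (c2 _) (rLE h)) _; rewrite mul1r.
  by apply: qcomm_eq (tq _ _ _ _ _ _ (rLE h) (rLK h)) _; rewrite mulr1.
- apply: qcommDr.
    by apply: qcomm_eq (tq _ _ _ _ _ _ (rLF h) (c2 _)) _; rewrite mulr1.
  by apply: qcomm_eq (tq _ _ _ _ _ _ (qcomm_sym1 Ki_L) (rLF h)) _; rewrite mulr1.
- move=> e l; apply: qcommDr.
    by apply: qcomm_eq (tq _ _ _ _ _ _ (c2 _) (rKZ h e l)) _; rewrite mul1r.
  by apply: qcomm_eq (tq _ _ _ _ _ _ (rKZ h e l) (qcomm_sym1 Lb_K)) _; rewrite mulr1.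
- move=> e l; apply: qcommDl; apply: qcommDr.
  + by apply: qcomm_eq (tq _ _ _ _ _ _ (c1 _) (rEZ h e l)) _; rewrite mul1r.
  + by apply: qcomm_eq (tq _ _ _ _ _ _ (c1 _) (qcomm_symN Lb_E)) _; rewrite mul1r.
  + by apply: qcomm_eq (tq _ _ _ _ _ _ (c2 _) (rKZ h e l)) _; rewrite mul1r.
  + by apply: qcomm_eq (tq _ _ _ _ _ _ (rEZ h e l) (qcomm_sym1 Lb_K)) _; rewrite mulr1.
- move=> e l; apply: qcommDl; apply: qcommDr.
  + by apply: qcomm_eq (tq _ _ _ _ _ _ (c2 _) (c1 _)) _; rewrite mul1r.
  + by apply: qcomm_eq (tq _ _ _ _ _ _ (rFZ h e l) (c1 _)) _; rewrite mul1r.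
  + by apply: qcomm_eq (tq _ _ _ _ _ _ (c2 _) (rFZ h e l)) _; rewrite mul1r.
  + by apply: qcomm_eq (tq _ _ _ _ _ _ (Ki_Z e l) (qcomm_symN Lb_F)) _; rewrite mulrNN mulr1.
- by rewrite (rS1 h) tens1.
- by move=> s u; rewrite tensM (rSS h).
- move=> s; apply: qcommDr.
    by apply: qcomm_eq (tq _ _ _ _ _ _ (c2 _) (rSE h s)) _; rewrite mul1r.
  by apply: qcomm_eq (tq _ _ _ _ _ _ (rSE h s) (rSK h s)) _; rewrite mulr1.
- move=> s; apply: qcommDr.
    by apply: qcomm_eq (tq _ _ _ _ _ _ (rSF h s) (c2 _)) _; rewrite mulr1.
  have SKi : qcomm 1 (gS s) Ki.
    by apply: qcomm_eq (qcommXr _ (rSK h s)) _; rewrite expr1n.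
  by apply: qcomm_eq (tq _ _ _ _ _ _ SKi (rSF h s)) _; rewrite mulr1.
- by move=> s; apply: qcomm_eq (tq _ _ _ _ _ _ (rSK h s) (rSK h s)) _; rewrite mulr1.
- by move=> s; apply: qcomm_eq (tq _ _ _ _ _ _ (rSL h s) (rSL h s)) _; rewrite mulr1.
move=> s e l; have /qcomm_comm LS := Lb_S s.
by rewrite mulrDl mulrDr !tensM !(rSZ h) mul1r mulr1 LS.
Qed.

Lemma qcomm_opp c (x y : B) : qcomm c y x -> @qcomm K (opp_alg B) c x y.
Proof. by []. Qed.
Lemma qcommNl c (C : pzAlgType K) (x y : C) : qcomm c x y -> qcomm c (- x) y.
Proof. by rewrite -scaleN1r; apply: qcommZl. Qed.
Lemma qcommNr c (C : pzAlgType K) (x y : C) : qcomm c x y -> qcomm c x (- y).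
Proof. by rewrite -[- y]scaleN1r; apply: qcommZr. Qed.

Lemma gS_Ki s : qcomm 1 (gS s) Ki.
Proof. by apply: qcomm_eq (qcommXr _ (rSK h s)) _; rewrite expr1n. Qed.
Lemma SV s : gS s^-1%g * gS s = 1.
Proof. by rewrite (rSS h) mulgV (rS1 h). Qed.

(** The target is the opposite algebra, so each skew commutation is checked in A with its sides
    exchanged. The N-th powers of S(E) and S(F) reduce to E^N and F^N because K skew commutes with E
    and F. *)
Lemma Arels_antipode : @Arels p r K q (opp_alg B) Ki (- (gE * Ki)) (- (gK * gF)) gL
  (fun e l => - (gZ e l * Lb)) (fun s => gS s^-1%g).
Proof.
have cNN : (-1) * (-1) = 1 :> K by rewrite mulrNN mulr1.
have Z_Lb e l := qcomm_symN (Lb_Z e l).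
have N2 : (2 <= N)%N by apply: ltnW (N_gt2 q_prim r_dvd8).
split.
- by rewrite oppX KiN.
- rewrite oppX exprNn (qcomm_expM _ Ki_E) (rE h) mul0r scaler0 mulr0 //.
- rewrite oppX exprNn (qcomm_expM _ F_K) (rF h) mulr0 scaler0 mulr0 //.
- apply/qcomm_opp/qcommNl.
  by apply: qcomm_eq (qcommMl E_Ki (qcomm_refl _)) _; rewrite mulr1.
- apply/qcomm_opp/qcommNl.
  by apply: qcomm_eq (qcommMl K_Ki F_Ki) _; rewrite mul1r.
- rewrite !oppM !mulrNN oppX Ki_pred.
  have -> : gK * gF * (gE * Ki) = gF * gE.
    rewrite (rKF h : gK * gF = _) -!pzscaleAl -mulrA (mulrA gK) (rKE h : gK * gE = _).
    rewrite -!pzscaleAl -pzscaleAr scalerA mulVf // scale1r.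
    by rewrite -(mulrA gE) KKi mulr1.
  have -> : gE * Ki * (gK * gF) = gE * gF.
    by rewrite mulrA -(mulrA gE) KiK mulr1.
  by rewrite -opprB (rEF h) -scalerN opprB.
- by rewrite oppM (rL h).
- move=> e l; apply/qcomm_opp/qcommNl.
  by apply: qcomm_eq (qcommMl (qcomm_symN (rLZ h e l)) Lb_L) _; rewrite mulr1.
- move=> e l; rewrite oppM mulrNN mulrA -(mulrA (gZ e l)).
  have /qcomm_anti -> := Lb_Z e l.
  by rewrite mulrN (mulrA (gZ e l)) (rZ2 h) mul0r oppr0 mul0r.
- move=> e l e' l'; apply/qcomm_opp/qcommNl/qcommNr.
  apply: qcomm_eq (qcommMl (qcommMr (rZZ h e' l' e l) (Z_Lb e' l'))
    (qcommMr (Lb_Z e l) (qcomm_refl Lb))) _.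
  by rewrite cNN mul1r mulr1.
- by apply/qcomm_opp; apply: Ki_L.
- apply/qcomm_opp/qcommNl.
  by apply: qcomm_eq (qcommMl (qcomm_sym1 (rLE h)) Ki_L) _; rewrite mulr1.
- apply/qcomm_opp/qcommNl.
  by apply: qcomm_eq (qcommMl (qcomm_sym1 (rLK h)) (qcomm_sym1 (rLF h))) _; rewrite mulr1.
- move=> e l; apply/qcomm_opp/qcommNl.
  by apply: qcomm_eq (qcommMl (qcomm_symN (Ki_Z e l)) Lb_Ki) _; rewrite mulr1.
- move=> e l; apply/qcomm_opp/qcommNl/qcommNr.
  apply: qcomm_eq (qcommMl (qcommMr (qcomm_symN (rEZ h e l)) (qcomm_symN (Ki_Z e l)))
    (qcommMr Lb_E Lb_Ki)) _.
  by rewrite cNN mul1r mulr1.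
- move=> e l; apply/qcomm_opp/qcommNl/qcommNr.
  apply: qcomm_eq (qcommMl (qcommMr (qcomm_symN (rKZ h e l)) (qcomm_sym1 (rFZ h e l)))
    (qcommMr Lb_K Lb_F)) _.
  by rewrite mulr1 mul1r cNN.
- by rewrite invg1 (rS1 h).
- by move=> s u; rewrite oppM (rSS h) -invMg.
- move=> s; apply/qcomm_opp/qcommNl.
  by apply: qcomm_eq (qcommMl (qcomm_sym1 (rSE h _)) (qcomm_sym1 (gS_Ki _))) _; rewrite mulr1.
- move=> s; apply/qcomm_opp/qcommNl.
  by apply: qcomm_eq (qcommMl (qcomm_sym1 (rSK h _)) (qcomm_sym1 (rSF h _))) _; rewrite mulr1.
- by move=> s; apply/qcomm_opp; apply/qcomm_sym1/gS_Ki.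
- by move=> s; apply/qcomm_opp; apply/qcomm_sym1/(rSL h).
move=> s e l; rewrite !oppM mulNr mulrN; congr (- _).
have /qcomm_comm LS := Lb_S s^-1%g.
by rewrite -mulrA LS !mulrA (rSZ h) permK.
Qed.

Lemma Arels_counit : @Arels p r K q (scal_alg K) 1 0 0 1 (fun _ _ => 0) (fun=> 1).
Proof.
have c0 c (x : scal_alg K) : qcomm c x 0 by rewrite /qcomm mulr0 mul0r scaler0.
have c0' c (x : scal_alg K) : qcomm c 0 x by rewrite /qcomm mulr0 mul0r scaler0.
split=> // *; rewrite ?expr1n ?mul1r ?mulr0 ?mul0r ?subrr ?scaler0 //.
- by rewrite -[N]prednK // exprS mul0r.
- by rewrite -[N]prednK // exprS mul0r.
- exact: qcomm_refl.
- exact: qcomm_refl.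
- exact: qcomm_refl.
Qed.
End Derived.

Definition lin_pack (K : fieldType) (U V : lmodType K) (f : U -> V)
    (lf : linear f) : {linear U -> V} :=
  HB.pack f (GRing.isLinear.Build K U V *:%R f lf).
Definition scalar_pack (K : fieldType) (U : lmodType K) (f : U -> K)
    (lf : linear_for *%R f) : {scalar U} :=
  HB.pack f (GRing.isLinear.Build K U K *%R f lf).

Section HopfStructure.
Variables (p r : nat) (K : fieldType) (q : K).
Hypotheses (q_prim : r.-primitive_root q) (r_dvd8 : (8 %| r)%N).
Local Notation N := (r %/ 2)%N.
Local Notation r'' := (r %/ 4)%N.
Variables (A : pzAlgType K) (gK gE gF gL : A) (gZ : bool -> 'I_p -> A) (gS : 'S_p -> A).
Hypothesis pres : presentation r q gK gE gF gL gZ gS.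
Local Notation T := (tensor A A).
Local Notation Ki := (Ki r gK).
Local Notation Lb := (Lb r gK gL).
Local Notation rels := (pres_rels pres).

Let N0 : (0 < N)%N := N_gt0 q_prim r_dvd8.

Lemma A_ind (P : {pred A}) : submod_closed P -> 1 \in P ->
  (forall x a, x \in P -> a \in P -> x * a \in P) ->
  gK \in P -> gE \in P -> gF \in P -> gL \in P ->
  (forall e l, gZ e l \in P) -> (forall s, gS s \in P) -> forall a, a \in P.
Proof.
move=> Psub P1 PM hK hE hF hL hZ hS; apply: (pres_ind pres) => // -[||||e l|s] a Pa;
  by apply: PM => //=; rewrite ?hZ ?hS.
Qed.

Lemma A_ext (B : pzAlgType K) (f g : A -> B) : alghom f -> alghom g ->
  f gK = g gK -> f gE = g gE -> f gF = g gF -> f gL = g gL ->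
  (forall e l, f (gZ e l) = g (gZ e l)) -> (forall s, f (gS s) = g (gS s)) ->
  f =1 g.
Proof.
move=> hf hg hK hE hF hL hZ hS a; apply/eqP; move: a.
apply: (A_ind (P := [pred a | f a == g a])); try by [rewrite inE hK|rewrite inE hE|rewrite inE hF|rewrite inE hL].
- split=> [|k u v]; rewrite !inE; first by rewrite !(lin0 (alghom_lin _)).
  by move=> /eqP fu /eqP fv; rewrite !(alghom_lin hf, alghom_lin hg) fu fv.
- by rewrite inE !alghom1.
- by move=> x a; rewrite !inE !alghomM // => /eqP -> /eqP ->.
- by move=> e l; rewrite inE hZ.
by move=> s; rewrite inE hS.
Qed.

Definition comul_sig := pres_lift pres (Arels_comul q_prim r_dvd8 rels).
Definition counit_sig := pres_lift pres (Arels_counit p q_prim r_dvd8).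
Definition antipode_sig := pres_lift pres (Arels_antipode q_prim r_dvd8 rels).
Definition comul_fun : A -> T := sval comul_sig.
Definition counit_fun : A -> scal_alg K := sval counit_sig.
Definition antipode_fun : A -> opp_alg A := sval antipode_sig.

Lemma alghom_comul_fun : alghom comul_fun.
Proof. exact: (svalP comul_sig).1. Qed.
Lemma alghom_counit_fun : alghom counit_fun.
Proof. exact: (svalP counit_sig).1. Qed.
Lemma alghom_antipode_fun : alghom antipode_fun.
Proof. exact: (svalP antipode_sig).1. Qed.

Let cgen x := (svalP comul_sig).2 x.
Let egen x := (svalP counit_sig).2 x.
Let sgen x := (svalP antipode_sig).2 x.

Definition comulL : {linear A -> T} := lin_pack (alghom_lin alghom_comul_fun).
Lemma counit_linear : linear_for *%R (counit_fun : A -> K).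
Proof. by case: alghom_counit_fun. Qed.
Definition counitL : {scalar A} := scalar_pack counit_linear.
Lemma antipode_linear : linear (antipode_fun : A -> A).
Proof. by case: alghom_antipode_fun. Qed.
Definition antipodeL : {linear A -> A} := lin_pack antipode_linear.

Local Notation D := comulL.
Local Notation eps := counitL.
Local Notation S := antipodeL.

Lemma D_K : D gK = tens gK gK. Proof. exact: (cgen (genK p)). Qed.
Lemma D_E : D gE = tens (1 : A) gE + tens gE gK. Proof. exact: (cgen (genE p)). Qed.
Lemma D_F : D gF = tens gF (1 : A) + tens Ki gF. Proof. exact: (cgen (genF p)). Qed.
Lemma D_L : D gL = tens gL gL. Proof. exact: (cgen (genL p)). Qed.
Lemma D_Z e l : D (gZ e l) = tens (1 : A) (gZ e l) + tens (gZ e l) Lb.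
Proof. exact: cgen (genZ e l). Qed.
Lemma D_S s : D (gS s) = tens (gS s) (gS s). Proof. exact: cgen (Defs.genS s). Qed.
Lemma eps_K : eps gK = 1. Proof. exact: (egen (genK p)). Qed.
Lemma eps_E : eps gE = 0. Proof. exact: (egen (genE p)). Qed.
Lemma eps_F : eps gF = 0. Proof. exact: (egen (genF p)). Qed.
Lemma eps_L : eps gL = 1. Proof. exact: (egen (genL p)). Qed.
Lemma eps_Z e l : eps (gZ e l) = 0. Proof. exact: egen (genZ e l). Qed.
Lemma eps_S s : eps (gS s) = 1. Proof. exact: egen (Defs.genS s). Qed.
Lemma S_K : S gK = Ki. Proof. exact: (sgen (genK p)). Qed.
Lemma S_E : S gE = - (gE * Ki). Proof. exact: (sgen (genE p)). Qed.
Lemma S_F : S gF = - (gK * gF). Proof. exact: (sgen (genF p)). Qed.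
Lemma S_L : S gL = gL. Proof. exact: (sgen (genL p)). Qed.
Lemma S_Z e l : S (gZ e l) = - (gZ e l * Lb). Proof. exact: sgen (genZ e l). Qed.
Lemma S_S s : S (gS s) = gS s^-1%g. Proof. exact: sgen (Defs.genS s). Qed.

Lemma hD : alghom (D : A -> T). Proof. exact: alghom_comul_fun. Qed.
Lemma heps : alghom (eps : A -> scal_alg K). Proof. exact: alghom_counit_fun. Qed.
Lemma hS : alghom (S : A -> opp_alg A). Proof. exact: alghom_antipode_fun. Qed.
Lemma SM x y : S (x * y) = S y * S x. Proof. by case: hS => _ _ ->. Qed.
Lemma S1 : S 1 = 1. Proof. by case: hS. Qed.
Lemma SX x n : S (x ^+ n) = S x ^+ n.
Proof. by elim: n => [|n IH]; rewrite ?S1 // exprS SM IH -exprSr. Qed.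
Lemma epsM x y : eps (x * y) = eps x * eps y. Proof. by case: heps => _ _ ->. Qed.
Lemma eps1 : eps 1 = 1. Proof. by case: heps. Qed.
Lemma epsX x n : eps (x ^+ n) = eps x ^+ n.
Proof. by elim: n => [|n IH]; rewrite ?eps1 // !exprS epsM IH. Qed.
Lemma D_Ki : D Ki = tens Ki Ki.
Proof. by rewrite /Ki (alghomX hD) D_K tensX. Qed.
Lemma D_Lb : D Lb = tens Lb Lb.
Proof. by rewrite /Lb (alghomM hD) (alghomX hD) D_K D_L tensX tensM. Qed.
Lemma eps_Ki : eps Ki = 1. Proof. by rewrite /Ki epsX eps_K expr1n. Qed.
Lemma eps_Lb : eps Lb = 1. Proof. by rewrite /Lb epsM epsX eps_K eps_L expr1n mulr1. Qed.
Lemma S_Ki : S Ki = gK. Proof. by rewrite /Ki SX S_K (Ki_pred q_prim r_dvd8 rels). Qed.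
Lemma S_Lb : S Lb = Lb.
Proof.
have KK : gK ^+ r'' * gK ^+ r'' = 1.
  by rewrite -exprD addnn -mul2n -(N_eq q_prim r_dvd8) (rK rels).
rewrite /Lb SM SX S_K S_L.
have -> : Ki ^+ r'' = gK ^+ r''.
  rewrite -[LHS]mulr1 -KK mulrA -exprMn_comm; last first.
    exact/esym/qcomm_comm/(K_Ki q_prim r_dvd8 rels).
  by rewrite (KiK q_prim r_dvd8 rels) expr1n mul1r.
apply/qcomm_comm; apply: qcomm_eq (qcommXr r'' (rLK rels)) _; by rewrite expr1n.
Qed.

(** Both sides are algebra maps from A to a triple tensor product, id ⊗ Δ being written as [f1], so
    they are compared on generators. *)
Lemma D_coassoc h :
  tlift (fun a b => tlift (fun c d => tens (tens a c) d) (D b)) (D h) =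
  tlift (fun a b => tens (D a) b) (D h).
Proof.
have h1 : alghom (fun c : A => tens (1 : A) c) := alghom_tensr A A.
have h2 := alghom_tmap h1 (@alghom_id K A).
have h3 : alghom (fun b : A => tmap (fun c => tens (1 : A) c) (fun d : A => d) (D b)).
  exact: alghom_comp h2 hD.
have h4 : alghom (fun a : A => tens (tens a (1 : A)) (1 : A)).
  exact: (alghom_comp (alghom_tensl _ _) (alghom_tensl _ _)).
have comm (a : A) (t : T) : tens (tens a (1 : A)) (1 : A) *
    tmap (fun c => tens (1 : A) c) (fun d : A => d) t =
  tlift (fun c d => tens (tens a c) d) t /\
  tmap (fun c => tens (1 : A) c) (fun d : A => d) t * tens (tens a (1 : A)) (1 : A) =
  tlift (fun c d => tens (tens a c) d) t.
  have l2 := alghom_lin h2.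
  have tE c d := tmapE h1 (@alghom_id K A) c d.
  split; move: t; apply: tens_ext => [||c d]; try (by lin);
    by rewrite tE !tensM ?mul1r ?mulr1 tliftE //; lin.
pose f1 := fun t : T => tcopair (fun a : A => tens (tens a (1 : A)) (1 : A))
  (fun b : A => tmap (fun c => tens (1 : A) c) (fun d : A => d) (D b)) t.
have hf1 : alghom f1.
  by apply: alghom_copair => // a b; rewrite (comm a (D b)).1 (comm a (D b)).2.
have hf2 := alghom_tmap hD (@alghom_id K A).
transitivity (f1 (D h)); first by apply: eq_tlift => a b; rewrite (comm a _).1.
transitivity (tmap D (fun d : A => d) (D h)); last first.
  by apply: eq_tlift => a b; rewrite tensM mulr1 mul1r.
have f1E a b : f1 (tens a b) = tlift (fun c d => tens (tens a c) d) (D b).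
  by rewrite /f1 tcopairE // (comm a _).1.
have f2E a b : tmap D (fun d : A => d) (tens a b) = tens (D a) b.
  by rewrite (tmapE hD (@alghom_id K A)).
have tE' (a c d : A) : tlift (fun c d : A => tens (tens a c) d) (tens c d) = tens (tens a c) d.
  by rewrite tliftE //; lin.
have tL (a : A) : linear (tlift (fun c d : A => tens (tens a c) d)) by apply: tlift_is_linear; lin.
have D1 : D 1 = tens (1 : A) (1 : A) by exact: alghom1 hD.
move: h; apply: A_ext => [||||||e l|s].
- exact: alghom_comp hf1 hD.
- exact: alghom_comp hf2 hD.
- by rewrite D_K f1E f2E D_K tE'.
- rewrite D_E (linD (alghom_lin hf1)) (linD (alghom_lin hf2)) !f1E !f2E D_E D_K D1.
  by rewrite (linD (tL _)) !tE' tensDl addrA.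
- rewrite D_F (linD (alghom_lin hf1)) (linD (alghom_lin hf2)) !f1E !f2E D_F D_Ki D1.
  by rewrite (linD (tL _)) !tE' tensDl addrA.
- by rewrite D_L f1E f2E D_L tE'.
- rewrite D_Z (linD (alghom_lin hf1)) (linD (alghom_lin hf2)) !f1E !f2E D_Z D_Lb D1.
  by rewrite (linD (tL _)) !tE' tensDl addrA.
by rewrite D_S f1E f2E D_S tE'.
Qed.

Lemma D_counitl h : tlift (fun a b : A => eps a *: b) (D h) = h.
Proof.
have h1 : alghom (fun a : A => eps a *: (1 : A)).
  have le : linear (eps : A -> K^o) := alghom_lin heps.
  split=> [||x y]; [by lin | by rewrite eps1 scale1r|].
  by rewrite epsM -pzscaleAl mul1r scalerA.
have hf : alghom (tcopair (fun a : A => eps a *: (1 : A)) (fun b : A => b)).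
  by apply: alghom_copair => // a b; rewrite -pzscaleAl -pzscaleAr mul1r mulr1.
have fE a b : tcopair (fun a : A => eps a *: (1 : A)) (fun b : A => b) (tens a b) = eps a *: b.
  by rewrite tcopairE // -pzscaleAl mul1r.
transitivity (tcopair (fun a : A => eps a *: (1 : A)) (fun b : A => b) (D h)).
  by apply: eq_tlift => a b; rewrite -pzscaleAl mul1r.
have lf := linD (alghom_lin hf).
move: h; apply: A_ext => [||||||e l|s]; [exact: alghom_comp hf hD|exact: alghom_id|..].
- by rewrite D_K fE eps_K scale1r.
- by rewrite D_E lf !fE eps1 eps_E scale1r scale0r addr0.
- by rewrite D_F lf !fE eps_F eps_Ki scale1r scale0r add0r.
- by rewrite D_L fE eps_L scale1r.
- by rewrite D_Z lf !fE eps1 eps_Z scale1r scale0r addr0.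
by rewrite D_S fE eps_S scale1r.
Qed.

Lemma D_counitr h : tlift (fun a b : A => eps b *: a) (D h) = h.
Proof.
have h1 : alghom (fun a : A => eps a *: (1 : A)).
  have le : linear (eps : A -> K^o) := alghom_lin heps.
  split=> [||x y]; [by lin | by rewrite eps1 scale1r|].
  by rewrite epsM -pzscaleAl mul1r scalerA.
have hf : alghom (tcopair (fun a : A => a) (fun b : A => eps b *: (1 : A))).
  by apply: alghom_copair => // a b; rewrite -pzscaleAl -pzscaleAr mul1r mulr1.
have fE a b : tcopair (fun a : A => a) (fun b : A => eps b *: (1 : A)) (tens a b) = eps b *: a.
  by rewrite tcopairE // -pzscaleAr mulr1.
transitivity (tcopair (fun a : A => a) (fun b : A => eps b *: (1 : A)) (D h)).
  by apply: eq_tlift => a b; rewrite -pzscaleAr mulr1.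
have lf := linD (alghom_lin hf).
move: h; apply: A_ext => [||||||e l|s]; [exact: alghom_comp hf hD|exact: alghom_id|..].
- by rewrite D_K fE eps_K scale1r.
- by rewrite D_E lf !fE eps_K eps_E scale1r scale0r add0r.
- by rewrite D_F lf !fE eps_F eps1 scale1r scale0r addr0.
- by rewrite D_L fE eps_L scale1r.
- by rewrite D_Z lf !fE eps_Lb eps_Z scale1r scale0r add0r.
by rewrite D_S fE eps_S scale1r.
Qed.

(** The left side is not multiplicative in h, but the h satisfying the identity are closed under
    products: m(Δ(x) Δ(a)) = S(a_1) m(Δ(x)) a_2 = ε(x) m(Δ(a)). *)
Lemma D_antipodel h : tlift (fun a b : A => S a * b) (D h) = eps h *: (1 : A).
Proof.
pose m := tlift (fun a b : A => S a * b).
have lm : linear m by apply: tlift_is_linear; lin.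
have mE a b : m (tens a b) = S a * b by rewrite /m tliftE //; lin.
have mM (t : T) c d : m (t * tens c d) = S c * m t * d.
  move: t; apply: tens_ext; [by lin|by lin|] => a b.
  by rewrite tensM !mE SM !mulrA.
apply/eqP; move: h.
apply: (A_ind (P := [pred h | m (D h) == eps h *: (1 : A)])).
- split=> [|k x y]; rewrite !inE; first by rewrite !linear0 scale0r (lin0 lm).
  move=> /eqP mx /eqP my; rewrite !linearP (linD lm) (linZ lm) mx my.
  by rewrite scalerDl scalerA.
- by rewrite inE (alghom1 hD) tens1 mE S1 mulr1 eps1 scale1r.
- move=> x a; rewrite !inE => /eqP mx /eqP ma; rewrite (alghomM hD).
  rewrite -[X in _ * X]tlift_id (tlift_comp (g := fun t : T => D x * t)); last by lin.
  rewrite (tlift_comp _ _ lm).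
  transitivity (eps x *: m (D a) == eps (x * a) *: (1 : A)); last first.
    by rewrite ma epsM scalerA eqxx.
  congr (_ == _); rewrite /m (tlift_comp (g := fun t : A => eps x *: t)); last by lin.
  apply: eq_tlift => c d; rewrite -/m mM mx -pzscaleAr mulr1 -pzscaleAl //.
- by rewrite inE D_K mE S_K (KiK q_prim r_dvd8 rels) eps_K scale1r.
- rewrite inE D_E (linD lm) !mE S1 S_E eps_E scale0r mul1r mulNr -mulrA.
  by rewrite (KiK q_prim r_dvd8 rels) mulr1 subrr.
- rewrite inE D_F (linD lm) !mE S_F S_Ki eps_F scale0r mulr1 addNr //.
- by rewrite inE D_L mE S_L (rL rels) eps_L scale1r.
- move=> e l; rewrite inE D_Z (linD lm) !mE S1 S_Z eps_Z scale0r mul1r mulNr -mulrA.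
  by rewrite (LbLb q_prim r_dvd8 rels) mulr1 subrr.
by move=> s; rewrite inE D_S mE S_S (SV rels) eps_S scale1r.
Qed.

Lemma D_antipoder h : tlift (fun a b : A => a * S b) (D h) = eps h *: (1 : A).
Proof.
pose m := tlift (fun a b : A => a * S b).
have lm : linear m by apply: tlift_is_linear; lin.
have mE a b : m (tens a b) = a * S b by rewrite /m tliftE //; lin.
have mM (t : T) c d : m (tens c d * t) = c * m t * S d.
  move: t; apply: tens_ext; [by lin|by lin|] => a b.
  by rewrite tensM !mE SM !mulrA.
apply/eqP; move: h.
apply: (A_ind (P := [pred h | m (D h) == eps h *: (1 : A)])).
- split=> [|k x y]; rewrite !inE; first by rewrite !linear0 scale0r (lin0 lm).
  move=> /eqP mx /eqP my; rewrite !linearP (linD lm) (linZ lm) mx my.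
  by rewrite scalerDl scalerA.
- by rewrite inE (alghom1 hD) tens1 mE S1 mulr1 eps1 scale1r.
- move=> x a; rewrite !inE => /eqP mx /eqP ma; rewrite (alghomM hD).
  rewrite -[X in X * _]tlift_id (tlift_comp (g := fun t : T => t * D a)); last by lin.
  rewrite (tlift_comp _ _ lm).
  transitivity (eps a *: m (D x) == eps (x * a) *: (1 : A)); last first.
    by rewrite mx epsM scalerA [eps a * _]mulrC eqxx.
  congr (_ == _); rewrite /m (tlift_comp (g := fun t : A => eps a *: t)); last by lin.
  apply: eq_tlift => c d; rewrite -/m mM ma -pzscaleAr mulr1 -pzscaleAl //.
- by rewrite inE D_K mE S_K (KKi q_prim r_dvd8 rels) eps_K scale1r.
- by rewrite inE D_E (linD lm) !mE S_K S_E eps_E scale0r mul1r addNr.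
- rewrite inE D_F (linD lm) !mE S_F S1 eps_F scale0r mulr1 mulrN mulrA.
  by rewrite (KiK q_prim r_dvd8 rels) mul1r subrr.
- by rewrite inE D_L mE S_L (rL rels) eps_L scale1r.
- by move=> e l; rewrite inE D_Z (linD lm) !mE S_Lb S_Z eps_Z scale0r mul1r addNr.
by move=> s; rewrite inE D_S mE S_S -{1}[s]invgK (SV rels) eps_S scale1r.
Qed.
End HopfStructure.

(** * The square of the antipode and its compatibilities *)

Section HopfProperties.
Variables (p r : nat) (K : fieldType) (q : K).
Hypotheses (q_prim : r.-primitive_root q) (r_dvd8 : (8 %| r)%N).
Local Notation N := (r %/ 2)%N.
Local Notation r'' := (r %/ 4)%N.
Variables (A : pzAlgType K) (gK gE gF gL : A) (gZ : bool -> 'I_p -> A) (gS : 'S_p -> A).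
Hypothesis pres : presentation r q gK gE gF gL gZ gS.
Local Notation T := (tensor A A).
Local Notation Ki := (Ki r gK).
Local Notation Lb := (Lb r gK gL).
Local Notation rels := (pres_rels pres).
Local Notation D := (comulL q_prim r_dvd8 pres).
Local Notation eps := (counitL q_prim r_dvd8 pres).
Local Notation S := (antipodeL q_prim r_dvd8 pres).
Let N0 : (0 < N)%N := N_gt0 q_prim r_dvd8.
Let KKi' := KKi q_prim r_dvd8 rels.
Let KiK' := KiK q_prim r_dvd8 rels.

Lemma D_morph : monoid_morphism (fun h : A => D h : T).
Proof. by case: (hD q_prim r_dvd8 pres). Qed.
Lemma eps_morph : monoid_morphism (fun h : A => eps h : K).
Proof. by split=> [|x y]; [exact: eps1 | exact: epsM]. Qed.

Definition hopfA : hopf_struct A := HopfStruct D_morph eps_morph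
  (D_coassoc q_prim r_dvd8 pres) (D_counitl q_prim r_dvd8 pres)
  (D_counitr q_prim r_dvd8 pres) (D_antipodel q_prim r_dvd8 pres)
  (D_antipoder q_prim r_dvd8 pres).

Let hS' := hS q_prim r_dvd8 pres.
Let lS : linear (S : A -> A) := alghom_lin hS'.
Let SM' := SM q_prim r_dvd8 pres.

(** Two algebra maps compared on generators. On Z the sign is -1 on both sides: Lbar anticommutes
    with Z and so does K. *)
Lemma antipode_sq x : S (S x) = gK * x * Ki.
Proof.
have h1 : alghom (fun x : A => S (S x) : A).
  by split=> [|| y z]; [lin | rewrite !S1 | rewrite !SM'].
have h2 : alghom (fun x : A => gK * x * Ki).
  split=> [|| y z]; [lin | by rewrite mulr1 KKi' |].
  by rewrite !mulrA -(mulrA _ Ki gK) KiK' mulr1.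
have R := rels.
have slide c y : qcomm c gK y -> gK * y * Ki = c *: y.
  by move=> ->; rewrite -pzscaleAl -mulrA KKi' mulr1.
have Z_Lb e l : gZ e l * Lb = - (Lb * gZ e l).
  by apply/qcomm_anti/qcomm_symN/(Lb_Z q_prim r_dvd8 R).
move: x; apply: (A_ext pres h1 h2) => [|||| e l|s].
- by rewrite S_K S_Ki (slide 1) ?scale1r //; apply: qcomm_refl.
- rewrite S_E linearN SM' S_Ki S_E mulrN opprK (slide (q ^+ 2)); last exact: rKE R.
  by rewrite mulrA (rKE R : gK * gE = _) -pzscaleAl -mulrA KKi' mulr1.
- by rewrite S_F linearN SM' S_K S_F mulNr opprK.
- by rewrite !S_L (slide 1) ?scale1r //; apply/qcomm_sym1/(rLK R).
- rewrite S_Z linearN SM' S_Lb S_Z mulrN opprK (slide (-1)); last exact: rKZ R _ _.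
  by rewrite Z_Lb mulrN mulrA (LbLb q_prim r_dvd8 R) mul1r scaleN1r.
by rewrite !S_S invgK (slide 1) ?scale1r //; apply/qcomm_sym1/(rSK R).
Qed.

(** Both sides are algebra maps from A to the opposite of A ⊗ A, so generators suffice. *)
Lemma comul_antipode x : D (S x) = tswap (tlift (fun a b : A => tens (S a) (S b)) (D x)).
Proof.
pose O := opp_alg T.
have hD' := hD q_prim r_dvd8 pres.
have h1 : alghom (fun x : A => D (S x) : O).
  split=> [||y z].
  - by have := linear_compose (alghom_lin hD') lS.
  - by rewrite S1 (alghom1 hD').
  by rewrite SM' (alghomM hD').
have f1 : alghom (fun a : A => tens (1 : A) (S a) : O).
  split=> [||y z]; first by have : linear (fun a : A => tens (1 : A) (S a)) by lin.
    by rewrite S1.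
  by rewrite SM' oppM tensM mulr1.
have f2 : alghom (fun a : A => tens (S a) (1 : A) : O).
  split=> [||y z]; first by have : linear (fun a : A => tens (S a) (1 : A)) by lin.
    by rewrite S1.
  by rewrite SM' oppM tensM mulr1.
have comm (a b : A) : (tens (1 : A) (S a) : O) * (tens (S b) (1 : A) : O) =
    (tens (S b) (1 : A) : O) * (tens (1 : A) (S a) : O).
  by rewrite !oppM !tensM !mul1r !mulr1.
have hc := alghom_copair f1 f2 comm.
have cE a b : tcopair (fun a : A => tens (1 : A) (S a) : O) (fun a : A => tens (S a) (1 : A) : O)
     (tens a b) = tens (S b) (S a) :> T.
  by rewrite (tcopairE f1 f2) oppM tensM mul1r mulr1.
have h2 := alghom_comp hc hD'.
transitivity (tcopair (fun a : A => tens (1 : A) (S a) : O)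
    (fun a : A => tens (S a) (1 : A) : O) (D x) : T); last first.
  rewrite (tlift_comp _ _ (@tswap_lin K A)).
  apply: eq_tlift => a b; rewrite tswapE oppM tensM mul1r mulr1 //.
have lc := linD (alghom_lin hc).
move: x; apply: (A_ext pres h1 h2) => [|||| e l|s].
- by rewrite S_K D_K D_Ki cE S_K.
- rewrite S_E linearN (alghomM hD') D_E D_Ki lc !cE S1 S_E S_K mulrDl !tensM mul1r.
  by rewrite KKi' opprD tensNl tensNr addrC.
- rewrite S_F linearN (alghomM hD') D_F D_K lc !cE S1 S_F S_Ki mulrDr !tensM mulr1.
  by rewrite KKi' opprD tensNl tensNr addrC.
- by rewrite S_L D_L cE S_L.
- rewrite S_Z linearN (alghomM hD') D_Z D_Lb lc !cE S1 S_Z S_Lb mulrDl !tensM mul1r.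
  by rewrite (LbLb q_prim r_dvd8 rels) opprD tensNl tensNr addrC.
by rewrite S_S !D_S cE S_S.
Qed.

Lemma counit_antipode x : eps (S x) = eps x.
Proof.
have h1 : alghom (fun x : A => eps (S x) : scal_alg K).
  have le : linear (eps : A -> K^o) := alghom_lin (heps q_prim r_dvd8 pres).
  split=> [||y z]; first exact: (linear_compose le lS).
    by rewrite S1 eps1.
  by rewrite SM' epsM mulrC.
move: x; apply: (A_ext pres h1 (heps q_prim r_dvd8 pres)) => [|||| e l|s].
- by rewrite S_K eps_Ki eps_K.
- by rewrite S_E linearN epsM eps_E mul0r oppr0.
- by rewrite S_F linearN epsM eps_F mulr0 oppr0.
- by rewrite S_L.
- by rewrite S_Z linearN epsM eps_Z mul0r oppr0.
by rewrite S_S !eps_S.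
Qed.
End HopfProperties.

(** * A representation detecting the top degree *)

Notation fspace K I := {ffun I -> K^o}.

Section BasisOperators.
Variables (K : fieldType) (I : finType).
Local Notation fspace := (fspace K I).
Definition delta (i : I) : fspace := locked [ffun j => (j == i)%:R].
Lemma deltaE i j : delta i j = (j == i)%:R.
Proof. by rewrite /delta -lock ffunE. Qed.
Lemma delta_sum (f : fspace) : f = \sum_i (f i : K) *: delta i.
Proof.
apply/ffunP => j; rewrite sum_ffunE (bigD1 j) //= big1 => [|i ij].
  by rewrite addr0 ffunE deltaE eqxx /GRing.scale /= mulr1.
by rewrite ffunE deltaE eq_sym (negPf ij) scaler0.
Qed.
Lemma coord_linear i (w : fspace) : linear (fun f : fspace => (f i : K) *: w).
Proof. by move=> c x y; rewrite !ffunE scalerDl scalerA. Qed.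
Definition basis_op (phi : I -> fspace) : lend fspace :=
  @Lend K fspace (fun f => \sum_i (f i : K) *: phi i)
  (@linear_sumf K fspace fspace I _ _ (fun i f => (f i : K) *: phi i)
    (fun i => coord_linear i (phi i))).
Lemma basis_opE phi i : basis_op phi (delta i) = phi i.
Proof.
rewrite /= (bigD1 i) //= big1 => [|j ji]; first by rewrite addr0 deltaE eqxx scale1r.
by rewrite deltaE (negPf ji) scale0r.
Qed.
Lemma lend_basis_ext (f g : lend fspace) : (forall i, f (delta i) = g (delta i)) -> f = g.
Proof.
move=> fg; apply: lend_ext => x; rewrite [x]delta_sum.
rewrite (lin_sum (lendP f)) (lin_sum (lendP g)); apply: eq_bigr => i _.
by rewrite (linZ (lendP f)) (linZ (lendP g)) fg.
Qed.
End BasisOperators.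

Section CommutatorPower.
Variables (K : fieldType) (B : pzAlgType K) (x y : B).
Lemma commutator_expl n : x ^+ n * y - y * x ^+ n =
  \sum_(i < n) x ^+ i * (x * y - y * x) * x ^+ (n.-1 - i).
Proof.
elim: n => [|n IH]; first by rewrite expr0 mulr1 mul1r subrr big_ord0.
rewrite big_ord_recr /= subnn expr0 mulr1 exprSr mulrBr.
have -> : \sum_(i < n) x ^+ i * (x * y - y * x) * x ^+ (n - i) =
   (x ^+ n * y - y * x ^+ n) * x.
  rewrite IH mulr_suml; apply: eq_bigr => i _.
  have -> : (n - i = (n.-1 - i).+1)%N by have := ltn_ord i; lia.
  by rewrite exprSr !mulrA.
by rewrite mulrBl !mulrA addrC addrA subrK.
Qed.
End CommutatorPower.

(** * Modules of dimension N^2 for the quantum group *)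

Section URep.
Variables (r : nat) (K : fieldType) (q : K).
Hypotheses (q_prim : r.-primitive_root q) (r_dvd8 : (8 %| r)%N).
Local Notation N := (r %/ 2)%N.
Let N0 : (0 < N)%N := N_gt0 q_prim r_dvd8.
Let q20 : q ^+ 2 != 0 := q2_neq0 q_prim r_dvd8.
Variable (kap : K).
Hypotheses (kapN : kap ^+ N = 1).
Local Notation z := (q ^+ 2).
Local Notation t := (q ^- 2).
Local Notation V := (fspace K ('I_N * 'I_N)%type).

(** The vector [eu b a] models F^b E^a v with K v = kap v. Its weight under K is [wgt b a], and
    [ecoef b a] is the scalar produced by [E, F^b], a sum of the values of [E, F] on F^i E^a v for i
    < b. *)
Definition wgt (b a : nat) : K := kap * z ^+ a * t ^+ b.
Definition ecoef (b a : nat) : K :=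
  (q - q^-1)^-1 * \sum_(i < b) (wgt i a - (wgt i a)^-1).
(** Total in [b] and [a], with value 0 from N on, so that the actions of E and F are given by
    formulas without bounds. *)
Definition eu (b a : nat) : V :=
  if insub b is Some i then if insub a is Some j then delta K (i, j) else 0 else 0.

Lemma euE (i j : 'I_N) : eu i j = delta K (i, j). Proof. by rewrite /eu !valK. Qed.
Lemma eu_out1 b a : (N <= b)%N -> eu b a = 0.
Proof. by move=> Nb; rewrite /eu insubF // ltnNge Nb. Qed.
Lemma eu_out2 b a : (N <= a)%N -> eu b a = 0.
Proof. by move=> Na; rewrite /eu; case: insub => // i; rewrite insubF // ltnNge Na. Qed.

Definition uF : lend V := basis_op (fun i : 'I_N * 'I_N => eu i.1.+1 i.2).
Definition uK : lend V := basis_op (fun i : 'I_N * 'I_N => wgt i.1 i.2 *: eu i.1 i.2).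
Definition uE : lend V :=
  basis_op (fun i : 'I_N * 'I_N => eu i.1 i.2.+1 + ecoef i.1 i.2 *: eu i.1.-1 i.2).

Lemma eu_case (P : V -> nat -> nat -> Prop) :
  (forall i j : 'I_N, P (delta K (i, j)) i j) ->
  (forall b a, (N <= b)%N || (N <= a)%N -> P 0 b a) -> forall b a, P (eu b a) b a.
Proof.
move=> P1 P0 b a; case: (ltnP b N) => [bN|Nb]; last by rewrite eu_out1 //; apply: P0; rewrite Nb.
case: (ltnP a N) => [aN|Na]; last by rewrite eu_out2 //; apply: P0; rewrite Na orbT.
by rewrite -[b]/(nat_of_ord (Ordinal bN)) -[a]/(nat_of_ord (Ordinal aN)) euE.
Qed.

Lemma wgtN b a : wgt b a ^+ N = 1.
Proof.
have zN := q2N q_prim r_dvd8; have tN : t ^+ N = 1 by rewrite exprVn zN invr1.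
rewrite /wgt (exprMn N (kap * _)) (exprMn N kap) kapN mul1r -(exprM z) -(exprM t).
by rewrite !(mulnC _ N) (exprM z) (exprM t) zN tN !expr1n mulr1.
Qed.
Lemma wgt_neq0 b a : wgt b a != 0.
Proof.
have := wgtN b a; rewrite -[N]prednK // exprS => w1.
by apply: contraTneq isT => w0; move: w1; rewrite w0 mul0r => /eqP; rewrite eq_sym oner_eq0.
Qed.
Lemma wgt_pred b a : wgt b a ^+ N.-1 = (wgt b a)^-1.
Proof.
apply: (mulfI (wgt_neq0 b a)); rewrite -exprS prednK // wgtN mulfV //.
exact: wgt_neq0.
Qed.
Lemma wgtSl b a : wgt b.+1 a = t * wgt b a.
Proof. by rewrite /wgt [t ^+ b.+1]exprS mulrCA. Qed.
Lemma wgtSr b a : wgt b a.+1 = z * wgt b a.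
Proof. by rewrite /wgt [z ^+ a.+1]exprS mulrCA !mulrA. Qed.

Lemma qnumzN : qnum z N = 0.
Proof.
have t0 : t ^+ N.-1 != 0 by rewrite expf_neq0 // invr_neq0.
apply: (mulIf t0); rewrite mul0r -[RHS](qnumtN q_prim r_dvd8) /qnum mulr_suml.
rewrite (reindex_inj rev_ord_inj) /=; apply: eq_bigr => i _.
have -> : N.-1 = (N - i.+1 + i)%N by have := ltn_ord i; lia.
rewrite exprD mulrA -exprMn mulfV // expr1n mul1r //.
Qed.

(** Compatibility of the action of E with F^N v = 0. Both geometric sums run over all N-th roots of
    unity, hence vanish. *)
Lemma ecoefN a : ecoef N a = 0.
Proof.
rewrite /ecoef sumrB.
have -> : \sum_(i < N) wgt i a = kap * z ^+ a * qnum t N.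
  by rewrite mulr_sumr; apply: eq_bigr.
have -> : \sum_(i < N) (wgt i a)^-1 = (kap * z ^+ a)^-1 * qnum z N.
  rewrite mulr_sumr; apply: eq_bigr => i _.
  by rewrite /wgt invfM; congr (_ * _); rewrite exprVn invrK.
by rewrite (qnumtN q_prim r_dvd8) qnumzN !mulr0 subrr mulr0.
Qed.
Lemma ecoef0 a : ecoef 0 a = 0. Proof. by rewrite /ecoef big_ord0 mulr0. Qed.
Lemma ecoefS b a : ecoef b.+1 a = ecoef b a + (q - q^-1)^-1 * (wgt b a - (wgt b a)^-1).
Proof. by rewrite /ecoef big_ord_recr /= mulrDr. Qed.

Lemma uFE b a : uF (eu b a) = eu b.+1 a.
Proof.
apply: (eu_case (P := fun v b a => uF v = eu b.+1 a)) => [i j|{}b {}a].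
  exact: basis_opE.
rewrite (lin0 (lendP uF)) => /orP[Nb|Na]; first by rewrite eu_out1 // leqW.
by rewrite eu_out2.
Qed.
Lemma uKE b a : uK (eu b a) = wgt b a *: eu b a.
Proof.
apply: (eu_case (P := fun v b a => uK v = wgt b a *: eu b a)) => [i j|{}b {}a].
  exact: basis_opE.
rewrite (lin0 (lendP uK)) => /orP[Nb|Na]; first by rewrite eu_out1 // scaler0.
by rewrite eu_out2 // scaler0.
Qed.
Lemma uEE b a : uE (eu b a) = eu b a.+1 + ecoef b a *: eu b.-1 a.
Proof.
apply: (eu_case (P := fun v b a => uE v = eu b a.+1 + ecoef b a *: eu b.-1 a)) => [i j|{}b {}a].
  exact: basis_opE.
rewrite (lin0 (lendP uE)) => /orP[|Na]; last by rewrite !eu_out2 ?scaler0 ?addr0 // leqW.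
rewrite leq_eqVlt => /orP[/eqP <-|Nb]; first by rewrite ecoefN scale0r addr0 eu_out1.
by rewrite !eu_out1 ?scaler0 ?addr0 //; [case: b Nb | rewrite ltnW].
Qed.

Lemma u_ext (f g : lend V) : (forall b a, f (eu b a) = g (eu b a)) -> f = g.
Proof. by move=> fg; apply: lend_basis_ext => -[i j]; rewrite -euE fg. Qed.

Lemma uKXE n b a : (uK ^+ n) (eu b a) = wgt b a ^+ n *: eu b a.
Proof.
elim: n => [|n IH]; first by rewrite !expr0 scale1r.
by rewrite exprSr lendM uKE (linZ (lendP _)) IH scalerA exprS.
Qed.
Lemma uFXE n b a : (uF ^+ n) (eu b a) = eu (n + b) a.
Proof. by elim: n => [|n IH]; rewrite ?expr0 // exprS lendM IH uFE. Qed.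
Lemma uEXE0 n a : (uE ^+ n) (eu 0 a) = eu 0 (n + a).
Proof.
by elim: n => [|n IH]; rewrite ?expr0 // exprS lendM IH uEE ecoef0 scale0r addr0.
Qed.

Lemma uK_N : uK ^+ N = 1.
Proof. by apply: u_ext => b a; rewrite uKXE wgtN scale1r. Qed.
Lemma uF_N : uF ^+ N = 0.
Proof. by apply: u_ext => b a; rewrite uFXE eu_out1 // leq_addr. Qed.
Lemma uK_E : qcomm z uK uE.
Proof.
apply: u_ext => b a; rewrite lendZ !lendM uEE (linD (lendP uK)) (linZ (lendP uK)) !uKE.
rewrite (linZ (lendP uE)) uEE scalerA !scalerDr !scalerA wgtSr; congr (_ + _).
case: b => [|b]; first by rewrite ecoef0 mul0r mulr0.
rewrite wgtSl /= -(mulrA z) [t * _]mulrC; congr (_ *: _).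
by rewrite (mulrC (wgt b a)) -(mulrA t) mulVKf // mulrC.
Qed.
Lemma uK_F : qcomm t uK uF.
Proof.
apply: u_ext => b a; rewrite lendZ !lendM uFE !uKE (linZ (lendP uF)) uFE scalerA.
by rewrite wgtSl.
Qed.
Lemma uE_F : uE * uF - uF * uE = (q - q^-1)^-1 *: (uK - uK ^+ N.-1).
Proof.
apply: u_ext => b a; rewrite lendD lendN lendZ lendD lendN !lendM uFE !uEE uKE uKXE.
rewrite (linD (lendP uF)) (linZ (lendP uF)) !uFE opprD addrACA subrr add0r.
have -> : ecoef b a *: eu b.-1.+1 a = ecoef b a *: eu b a.
  by case: b => [|b] //; rewrite ecoef0 !scale0r.
rewrite -scalerBl ecoefS [ecoef b a + _]addrC addrK -scalerBl scalerA.
by rewrite wgt_pred.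
Qed.
(** The geometric sums in the expansion of [E^N, F] vanish, so E^N commutes with F. It kills E^a v
    for degree reasons, hence every F^b E^a v. *)
Lemma uE_N : uE ^+ N = 0.
Proof.
have comm : uE ^+ N * uF = uF * uE ^+ N.
  apply/eqP; rewrite -subr_eq0 commutator_expl; apply/eqP.
  have qEK : qcomm t uE uK by apply: qcomm_sym uK_E.
  have qEKi : qcomm z uE (uK ^+ N.-1).
    apply: qcomm_eq (qcommXr N.-1 qEK) _.
    by rewrite exprVn (q2_pred q_prim r_dvd8) invrK.
  have EK (i : 'I_N) : uE ^+ i * uK * uE ^+ (N.-1 - i) = t ^+ i *: (uK * uE ^+ N.-1) .
    by rewrite (qcommXl i qEK : uE ^+ i * uK = _) -pzscaleAl -mulrA -exprD subnKC //
      -ltnS prednK.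
  have EKi (i : 'I_N) : uE ^+ i * uK ^+ N.-1 * uE ^+ (N.-1 - i) = z ^+ i *: (uK ^+ N.-1 * uE ^+ N.-1).
    by rewrite (qcommXl i qEKi : uE ^+ i * uK ^+ N.-1 = _) -pzscaleAl -mulrA -exprD
      subnKC // -ltnS prednK.
  transitivity ((q - q^-1)^-1 *: (qnum t N *: (uK * uE ^+ N.-1) -
      qnum z N *: (uK ^+ N.-1 * uE ^+ N.-1))); last first.
    by rewrite (qnumtN q_prim r_dvd8) qnumzN !scale0r subrr scaler0.
  rewrite /qnum !scaler_suml -sumrB scaler_sumr; apply: eq_bigr => i _.
  rewrite uE_F -pzscaleAr -pzscaleAl mulrBr mulrBl.
  by rewrite EK // EKi.
apply: u_ext => b a; rewrite lendE0.
elim: b => [|b IH]; first by rewrite uEXE0 eu_out2 // leq_addr.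
by rewrite -uFE -lendM comm lendM IH (lin0 (lendP uF)).
Qed.
End URep.

(** * The exterior algebra on the Z together with permutations *)

Section Below.
Variable p : nat.
Local Notation I2 := (bool * 'I_p)%type.
(** The exponent of the sign picked up when the letter i is sorted into the monomial indexed by
    X. *)
Definition below (i : I2) (X : {set I2}) := #|[set j in X | (enum_rank j < enum_rank i)%N]|.
End Below.

Notation sspace p K := (fspace K ('S_p * {set (bool * 'I_p)})%type).

(** The basis vector (s, X) models s Z_X applied to a vacuum. As Z_l s = s Z_{s^-1(l)}, the letter
    enters X with index s^-1(l). *)
HB.lock Definition sZ (p : nat) (K : fieldType) (e : bool) (l : 'I_p) : lend (sspace p K) :=
  basis_op (fun x : 'S_p * {set (bool * 'I_p)} =>
    let i := (e, x.1^-1%g l) in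
    if i \in x.2 then 0 else (-1) ^+ below i x.2 *: delta K (x.1, i |: x.2)).
HB.lock Definition sL (p : nat) (K : fieldType) (ell : K) : lend (sspace p K) :=
  basis_op (fun x : 'S_p * {set (bool * 'I_p)} => ((-1) ^+ #|x.2| * ell) *: delta K x).
(** The parity operator; tensoring K and E with it makes them anticommute with Z. *)
HB.lock Definition sP (p : nat) (K : fieldType) : lend (sspace p K) :=
  basis_op (fun x : 'S_p * {set (bool * 'I_p)} => (-1) ^+ #|x.2| *: delta K x).
HB.lock Definition sS (p : nat) (K : fieldType) (s : 'S_p) : lend (sspace p K) :=
  basis_op (fun x : 'S_p * {set (bool * 'I_p)} => delta K ((x.1 * s)%g, x.2)).

Section SRep.
Variables (p : nat) (K : fieldType) (ell : K).
Hypothesis (ell2 : ell * ell = 1).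
Local Notation I2 := (bool * 'I_p)%type.
Local Notation J := ('S_p * {set I2})%type.
Local Notation V := (fspace K J).
Local Notation es := (delta K).
Local Notation sZ := (@sZ p K).
Local Notation sL := (@sL p K ell).
Local Notation sP := (@sP p K).
Local Notation sS := (@sS p K).

Lemma sZE e l s X : sZ e l (es (s, X)) = if (e, s^-1%g l) \in X then 0
  else (-1) ^+ below (e, s^-1%g l) X *: es (s, (e, s^-1%g l) |: X).
Proof. by rewrite sZ.unlock basis_opE. Qed.
Lemma sZ_in e l (s : 'S_p) (X : {set I2}) : (e, s^-1%g l) \in X -> sZ e l (es (s, X)) = 0.
Proof. by move=> iX; rewrite sZE iX. Qed.
Lemma sZ_out e l (s : 'S_p) (X : {set I2}) : (e, s^-1%g l) \notin X -> sZ e l (es (s, X)) =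
  (-1) ^+ below (e, s^-1%g l) X *: es (s, (e, s^-1%g l) |: X).
Proof. by move=> iX; rewrite sZE (negPf iX). Qed.
Lemma sLE x : sL (es x) = ((-1) ^+ #|x.2| * ell) *: es x.
Proof. by rewrite sL.unlock basis_opE. Qed.
Lemma sPE x : sP (es x) = (-1) ^+ #|x.2| *: es x.
Proof. by rewrite sP.unlock basis_opE. Qed.
Lemma sSE s x : sS s (es x) = es ((x.1 * s)%g, x.2).
Proof. by rewrite sS.unlock basis_opE. Qed.

Lemma below_add i j (X : {set I2}) : j \notin X ->
  below i (j |: X) = ((enum_rank j < enum_rank i) + below i X)%N.
Proof.
move=> jX; rewrite /below.
have -> : [set x in j |: X | (enum_rank x < enum_rank i)%N] =
  (if (enum_rank j < enum_rank i)%N then j |: [set x in X | (enum_rank x < enum_rank i)%N]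
   else [set x in X | (enum_rank x < enum_rank i)%N]).
  apply/setP => x; rewrite !inE; case: ifP => ji; rewrite !inE.
    by case: eqP => // ->; rewrite ji.
  by case: eqP => // -> /=; rewrite ji andbF.
by case: ifP => ji //; rewrite cardsU1 !inE (negPf jX).
Qed.

Let sgn2 n : ((-1) ^+ n * (-1) ^+ n : K) = 1.
Proof. by rewrite -exprD addnn -mul2n exprM sqrrN expr1n expr1n. Qed.

Lemma sL2 : sL * sL = 1.
Proof.
apply: lend_basis_ext => x; rewrite lendM sLE (linZ (lendP sL)) sLE scalerA.
by rewrite mulrACA sgn2 ell2 mulr1 scale1r.
Qed.
Lemma sP2 : sP * sP = 1.
Proof.
apply: lend_basis_ext => x; rewrite lendM sPE (linZ (lendP sP)) sPE scalerA.
by rewrite sgn2 scale1r.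
Qed.
Lemma sP_L : qcomm 1 sP sL.
Proof.
apply/qcomm_comm; apply: lend_basis_ext => x.
rewrite !lendM sPE sLE (linZ (lendP sL)) (linZ (lendP sP)) sPE sLE !scalerA.
by rewrite mulrC.
Qed.
Lemma sP_S s : qcomm 1 sP (sS s).
Proof.
apply/qcomm_comm; apply: lend_basis_ext => x.
by rewrite !lendM sPE (linZ (lendP (sS s))) !sSE sPE.
Qed.
Lemma sL_S s : qcomm 1 sL (sS s).
Proof.
apply/qcomm_comm; apply: lend_basis_ext => x.
by rewrite !lendM sLE (linZ (lendP (sS s))) !sSE sLE.
Qed.
Lemma sP_Z e l : qcomm (-1) sP (sZ e l).
Proof.
apply/qcomm_anti; apply: lend_basis_ext => -[s X].
rewrite lendN !lendM sPE (linZ (lendP (sZ e l))) sZE.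
case: ifP => ix; first by rewrite (lin0 (lendP sP)) scaler0 oppr0.
rewrite (linZ (lendP sP)) sPE !scalerA cardsU1 ix add1n.
by rewrite [(-1) ^+ #|_|.+1]exprS mulN1r mulrN scaleNr [X in - (X *: _)]mulrC.
Qed.
Lemma sL_Z e l : qcomm (-1) sL (sZ e l).
Proof.
apply/qcomm_anti; apply: lend_basis_ext => -[s X].
rewrite lendN !lendM sLE (linZ (lendP (sZ e l))) sZE.
case: ifP => ix; first by rewrite (lin0 (lendP sL)) scaler0 oppr0.
rewrite (linZ (lendP sL)) sLE !scalerA cardsU1 ix add1n.
by rewrite [(-1) ^+ #|_|.+1]exprS mulN1r mulNr mulrN scaleNr [X in - (X *: _)]mulrC.
Qed.
Lemma sZ2 e l : sZ e l * sZ e l = 0.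
Proof.
apply: lend_basis_ext => -[s X]; rewrite lendM lendE0 sZE.
case: ifP => ix; first by rewrite (lin0 (lendP _)).
by rewrite (linZ (lendP _)) sZE setU11 scaler0.
Qed.
(** Two distinct letters inserted in either order give the same set. Exactly one of them precedes
    the other, so the two signs differ by -1. *)
Lemma sZZ e l e' l' : qcomm (-1) (sZ e l) (sZ e' l').
Proof.
have [/eqP[<- <-]|ne] := boolP ((e, l) == (e', l')).
  by rewrite /qcomm sZ2 scaler0.
have inI := @sZ_in e l; have outI := @sZ_out e l.
have inJ := @sZ_in e' l'; have outJ := @sZ_out e' l'.
move: (sZ e l) (sZ e' l') inI outI inJ outJ => Zi Zj inI outI inJ outJ.
apply/qcomm_anti; apply: lend_basis_ext => -[s X]; rewrite lendN !lendM.
set i := (e, s^-1%g l); set j := (e', s^-1%g l').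
have ij : i != j.
  by apply: contra ne => /eqP[-> /perm_inj ->].
have ji : j != i by rewrite eq_sym.
have [iX|iX] := boolP (i \in X); have [jX|jX] := boolP (j \in X).
- by rewrite (inI _ _ iX) (inJ _ _ jX) !(lin0 (lendP _)) oppr0.
- rewrite (inI _ _ iX) (outJ _ _ jX) (linZ (lendP _)) inI ?inE ?iX ?orbT //.
  by rewrite (lin0 (lendP _)) scaler0 oppr0.
- rewrite (outI _ _ iX) (inJ _ _ jX) (linZ (lendP _)) inJ ?inE ?jX ?orbT //.
  by rewrite (lin0 (lendP _)) scaler0 oppr0.
have ijX : i \notin j |: X by rewrite inE inE negb_or ij.
have jiX : j \notin i |: X by rewrite inE inE negb_or ji.
rewrite (outI _ _ iX) (outJ _ _ jX) !(linZ (lendP _)) (outI _ _ ijX) (outJ _ _ jiX) -/i -/j.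
rewrite !scalerA setUCA !below_add // -scaleNr; congr (_ *: _).
rewrite !exprD.
have rij : enum_rank i != enum_rank j by apply: contra ij => /eqP /enum_rank_inj ->.
have := rij; rewrite -val_eqE /= neq_ltn => /orP[lt|gt].
  by rewrite lt (ltnNge (enum_rank j)) ltnW //= expr1 expr0 mul1r mulN1r mulrN opprK mulrC.
by rewrite gt (ltnNge (enum_rank i)) ltnW //= expr1 expr0 mul1r mulN1r mulrN mulrC.
Qed.
Lemma sS1 : sS 1%g = 1.
Proof. by apply: lend_basis_ext => -[s X]; rewrite sSE lend1E mulg1. Qed.
Lemma sSS s u : sS s * sS u = sS (u * s)%g.
Proof. by apply: lend_basis_ext => -[w X]; rewrite lendM !sSE mulgA. Qed.
Lemma sSZ s e l : sS s * sZ e l = sZ e (s l) * sS s.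
Proof.
have inI := @sZ_in e l; have outI := @sZ_out e l.
have inJ := @sZ_in e (s l); have outJ := @sZ_out e (s l); have SE := sSE s.
move: (sZ e l) (sZ e (s l)) (sS s) inI outI inJ outJ SE => Zi Zj Ss inI outI inJ outJ SE.
apply: lend_basis_ext => -[w X]; rewrite !lendM SE /=.
have E : (e, (w * s)^-1%g (s l)) = (e, w^-1%g l) by rewrite invMg permM permK.
have [iX|iX] := boolP ((e, w^-1%g l) \in X).
  by rewrite inI // inJ ?E // (lin0 (lendP _)).
by rewrite outI // outJ E // (linZ (lendP _)) SE.
Qed.

Lemma sZ_in1 e l (X : {set I2}) : (e, l) \in X -> sZ e l (es (1%g, X)) = 0.
Proof. by have := @sZ_in e l 1%g X; rewrite invg1 perm1; apply. Qed.
Lemma sZ_out1 e l (X : {set I2}) : (e, l) \notin X ->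
  sZ e l (es (1%g, X)) = (-1) ^+ below (e, l) X *: es (1%g, (e, l) |: X).
Proof. by have := @sZ_out e l 1%g X; rewrite invg1 perm1; apply. Qed.

Definition sword (w : seq I2) : lend V := \prod_(i <- w) sZ i.1 i.2.
(** The scalar is a product of signs, and becomes 0 as soon as a letter repeats. *)
Lemma sword_vac w : exists2 k : K, sword w (es (1%g, set0)) = k *: es (1%g, [set x in w])
  & (k != 0) = uniq w.
Proof.
elim: w => [|[e l] w [k IH kP]].
  exists 1; last by rewrite oner_eq0.
  have -> : [set x in [::]] = set0 :> {set I2} by apply/setP => x; rewrite !inE.
  by rewrite /sword big_nil lend1E scale1r.
rewrite /sword big_cons lendM -/(sword w) IH (linZ (lendP _)).
have [iw|iw] := boolP ((e, l) \in [set x in w]).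
  exists 0; last by rewrite eqxx /= [_ \in w](_ : _ = true) // -iw inE.
  by rewrite (sZ_in1 iw) scaler0 scale0r.
exists (k * (-1) ^+ below (e, l) [set x in w]).
  rewrite (_ : [set x in (e, l) :: w] = (e, l) |: [set x in w]); last first.
    by apply/setP => x; rewrite !inE.
  by rewrite -scalerA; congr (k *: _); exact: sZ_out1 iw.
rewrite mulf_eq0 signr_eq0 orbF kP /=.
by rewrite [_ \in w](_ : _ = false) //; apply: contraNF iw; rewrite inE.
Qed.

(** The Berezin integral on the exterior algebra, taken at the identity permutation. *)
Definition stop (x : V) : K := x (1%g, setT).
Lemma stop_linear : linear (stop : V -> K^o).
Proof. by move=> c x y; rewrite /stop !ffunE. Qed.

Lemma stopZ c x : stop (c *: x) = c * stop x.
Proof. exact: (linZ stop_linear). Qed.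
Lemma stop_es s X : stop (es (s, X)) = ((s == 1%g) && (X == setT))%:R.
Proof. by rewrite /stop deltaE xpair_eqE ![_ == s]eq_sym [_ == X]eq_sym. Qed.

Lemma sPX_es n (X : {set I2}) s : ~~ odd #|X| -> (sP ^+ n) (es (s, X)) = es (s, X).
Proof.
move=> ev; elim: n => [|n IH]; first by rewrite expr0.
by rewrite exprS lendM IH sPE /= -signr_odd (negPf ev) scale1r.
Qed.
Lemma sLX n x : (sL ^+ n) (es x) = (((-1) ^+ #|x.2| * ell) ^+ n) *: es x.
Proof.
elim: n => [|n IH]; first by rewrite !expr0 scale1r.
by rewrite exprS lendM IH (linZ (lendP _)) sLE scalerA exprSr.
Qed.

Lemma card_I2 : #|[set: I2]| = (2 * p)%N.
Proof. by rewrite cardsT card_prod card_bool card_ord. Qed.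

(** The full monomial has even degree 2p, so P acts on it as 1 and L as [ell]. *)
Lemma stop_word_full s d n w : uniq w -> size w = (2 * p)%N ->
  stop ((sS s * sL ^+ d * sP ^+ n * sword w) (es (1%g, set0))) =
  stop (sword w (es (1%g, set0))) * (ell ^+ d * (s == 1%g)%:R).
Proof.
move=> uw sz; have [k kE kU] := sword_vac w; rewrite !lendM kE.
have wT : [set x in w] = [set: I2].
  by apply/eqP; rewrite eqEcard subsetT card_I2 -sz cardsE (card_uniqP uw) leqnn.
rewrite wT (linZ (lendP (sP ^+ n))) sPX_es; last by rewrite card_I2 mul2n odd_double.
rewrite (linZ (lendP (sL ^+ d))) sLX !(linZ (lendP (sS s))) sSE.
rewrite !stopZ !stop_es /= !eqxx mulr1 andbT mul1g card_I2.
by rewrite exprM sqrrN expr1n expr1n mul1r.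
Qed.

Lemma stop_word_neq0 w : uniq w -> size w = (2 * p)%N ->
  stop (sword w (es (1%g, set0))) != 0.
Proof.
move=> uw sz; have [k kE kU] := sword_vac w; rewrite kE.
have wT : [set x in w] = [set: I2].
  by apply/eqP; rewrite eqEcard subsetT card_I2 -sz cardsE (card_uniqP uw) leqnn.
by rewrite wT stopZ stop_es !eqxx mulr1 kU.
Qed.
End SRep.

Section SpanMap.
Variables (K : fieldType) (U V : lmodType K) (X : U -> Prop) (f : U -> V).
Hypothesis f_lin : linear f.
Lemma span_map (S : {pred V}) : submod_closed S -> (forall x, X x -> f x \in S) ->
  forall v, v \in Defs.span X -> f v \in S.
Proof.
move=> [S0 SD] XS; apply: (span_ind (S := [pred x | f x \in S])) => //.
by split=> [|c u v]; rewrite !inE ?(lin0 f_lin) // f_lin; exact: SD.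
Qed.
Lemma span_ker : (forall x, X x -> f x = 0) -> forall v, v \in Defs.span X -> f v = 0.
Proof.
move=> X0 v vX; apply/eqP; move: v vX; apply: (span_map (S := [pred x | x == 0])).
  split=> [|c u v]; rewrite !inE // => /eqP -> /eqP ->.
  by rewrite scaler0 addr0.
by move=> x /X0; rewrite inE => /eqP.
Qed.
End SpanMap.

Section CombinedRelations.
Variables (p r : nat) (K : fieldType) (q : K) (B C : pzAlgType K).
Hypotheses (q_prim : r.-primitive_root q) (r_dvd8 : (8 %| r)%N).
Local Notation N := (r %/ 2)%N.
Variables (uK uE uF : B) (L P : C) (Z : bool -> 'I_p -> C) (Sg : 'S_p -> C).
Hypotheses (hK : uK ^+ N = 1) (hE : uE ^+ N = 0) (hF : uF ^+ N = 0)
  (hKE : qcomm (q ^+ 2) uK uE) (hKF : qcomm (q ^- 2) uK uF)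
  (hEF : uE * uF - uF * uE = (q - q^-1)^-1 *: (uK - uK ^+ N.-1))
  (hL : L * L = 1) (hP : P * P = 1) (hPL : qcomm 1 P L)
  (hPS : forall s, qcomm 1 P (Sg s)) (hLS : forall s, qcomm 1 L (Sg s))
  (hPZ : forall e l, qcomm (-1) P (Z e l)) (hLZ : forall e l, qcomm (-1) L (Z e l))
  (hZ2 : forall e l, Z e l * Z e l = 0)
  (hZZ : forall e l e' l', qcomm (-1) (Z e l) (Z e' l'))
  (hS1 : Sg 1%g = 1) (hSS : forall s u, Sg s * Sg u = Sg (u * s)%g)
  (hSZ : forall s e l, Sg s * Z e l = Z e (s l) * Sg s).

(** K and E anticommute with Z while F commutes with it; the operator P in the second factor
    accounts for the difference, and N even gives P^N = 1. *)
Lemma Arels_tensor : Arels r q (tens uK P) (tens uE P) (tens uF (1 : C))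
  (tens (1 : B) L) (fun e l => tens (1 : B) (Z e l)) (fun s => tens (1 : B) (Sg s)).
Proof.
have [c1 c2] := (@qcomm1l K B, @qcomm1r K B).
have tq := @qcomm_tens K B C.
have PN n : ~~ odd n -> P ^+ n = 1.
  by move=> ev; rewrite -(odd_double_half n) (negPf ev) add0n -mul2n exprM expr2 hP expr1n.
have evN : ~~ odd N by rewrite (N_eq q_prim r_dvd8) mul2n odd_double.
split.
- by rewrite tensX hK PN.
- by rewrite tensX hE tens0l.
- by rewrite tensX hF tens0l.
- by apply: qcomm_eq (tq _ _ _ _ _ _ hKE (qcomm_refl _)) _; rewrite mulr1.
- by apply: qcomm_eq (tq _ _ _ _ _ _ hKF (qcomm1r _)) _; rewrite mulr1.
- rewrite !tensM mulr1 mul1r -tensNl -tensDl hEF tensZl; congr (_ *: _).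
  (* N - 1 is odd, so K and K^(N-1) carry the same factor P as the commutator does. *)
  rewrite tensX tensDl tensNl; congr (_ - tens _ _).
  have -> : N.-1 = N.-2.+1 by have := N_gt2 q_prim r_dvd8; lia.
  by rewrite exprS PN ?mulr1 //; have := N_gt2 q_prim r_dvd8; lia.
- by rewrite tensM mul1r hL.
- by move=> e l; apply: qcomm_eq (tq _ _ _ _ _ _ (c1 _) (hLZ e l)) _; rewrite mul1r.
- by move=> e l; rewrite tensM hZ2 tens0r.
- by move=> *; apply: qcomm_eq (tq _ _ _ _ _ _ (c1 _) (hZZ _ _ _ _)) _; rewrite mul1r.
- by apply: qcomm_eq (tq _ _ _ _ _ _ (c1 _) (qcomm_sym1 hPL)) _; rewrite mul1r.
- by apply: qcomm_eq (tq _ _ _ _ _ _ (c1 _) (qcomm_sym1 hPL)) _; rewrite mul1r.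
- by apply: qcomm_eq (tq _ _ _ _ _ _ (c1 _) (qcomm1r _)) _; rewrite mul1r.
- by move=> *; apply: qcomm_eq (tq _ _ _ _ _ _ (c2 _) (hPZ _ _)) _; rewrite mul1r.
- by move=> *; apply: qcomm_eq (tq _ _ _ _ _ _ (c2 _) (hPZ _ _)) _; rewrite mul1r.
- by move=> *; apply: qcomm_eq (tq _ _ _ _ _ _ (c2 _) (qcomm1l _)) _; rewrite mul1r.
- by rewrite hS1.
- by move=> s u; rewrite tensM mul1r hSS.
- by move=> s; apply: qcomm_eq (tq _ _ _ _ _ _ (c1 _) (qcomm_sym1 (hPS s))) _; rewrite mul1r.
- by move=> s; apply: qcomm_eq (tq _ _ _ _ _ _ (c1 _) (qcomm1r _)) _; rewrite mul1r.
- by move=> s; apply: qcomm_eq (tq _ _ _ _ _ _ (c1 _) (qcomm_sym1 (hPS s))) _; rewrite mul1r.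
- by move=> s; apply: qcomm_eq (tq _ _ _ _ _ _ (c1 _) (qcomm_sym1 (hLS s))) _; rewrite mul1r.
by move=> s e l; rewrite !tensM hSZ.
Qed.
End CombinedRelations.

(** * Matrix coefficients and their vanishing below the top degree *)

Section Rho.
Variables (p r : nat) (K : fieldType) (q : K).
Hypotheses (q_prim : r.-primitive_root q) (r_dvd8 : (8 %| r)%N).
Local Notation N := (r %/ 2)%N.
Variables (A : pzAlgType K) (gK gE gF gL : A) (gZ : bool -> 'I_p -> A) (gS : 'S_p -> A).
Hypothesis pres : presentation r q gK gE gF gL gZ gS.
Local Notation z := (q ^+ 2).
Local Notation I2 := (bool * 'I_p)%type.
Local Notation Vu := (fspace K ('I_N * 'I_N)%type).
Local Notation Vs := (sspace p K).
Local Notation U := (lend Vu).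
Local Notation W := (lend Vs).
Let N0 : (0 < N)%N := N_gt0 q_prim r_dvd8.
Local Notation n := N.-1.

Section Degree.
Variables (I : finType) (deg : I -> nat).
Local Notation V := (fspace K I).
Definition below_deg m (v : V) := forall i, (v i : K) != 0 -> (deg i <= m)%N.
Definition raises k (f : lend V) := forall m v, below_deg m v -> below_deg (m + k) (f v).
Lemma below_deg0 m : below_deg m 0.
Proof. by move=> i; rewrite ffunE eqxx. Qed.
Lemma below_degD m u v : below_deg m u -> below_deg m v -> below_deg m (u + v).
Proof.
move=> hu hv i; rewrite ffunE; have [u0|/hu //] := eqVneq (u i : K) 0.
by rewrite u0 add0r => /hv.
Qed.
Lemma below_degZ m c v : below_deg m v -> below_deg m (c *: v).
Proof.
move=> hv i; rewrite ffunE /GRing.scale /=; have [u0|/hv //] := eqVneq (v i : K) 0.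
by rewrite u0 mulr0 eqxx.
Qed.
Lemma below_deg_delta m i : (deg i <= m)%N -> below_deg m (delta K i).
Proof. by move=> im j; rewrite deltaE; have [->|] := eqVneq j i; rewrite ?eqxx. Qed.
Lemma raises_basis_op k phi : (forall i, below_deg (deg i + k) (phi i)) ->
  raises k (basis_op phi).
Proof.
move=> h m v hv; have E : basis_op phi v = \sum_i (v i : K) *: phi i by [].
rewrite E; apply: (big_ind (below_deg (m + k))).
- exact: below_deg0.
- exact: below_degD.
move=> i _; have [v0|/hv im] := eqVneq (v i : K) 0.
  by rewrite v0 scale0r; exact: below_deg0.
apply: below_degZ => j /h; move/leq_trans; apply; by rewrite leq_add2r.
Qed.
Lemma raises1 : raises 0 1.
Proof. by move=> m v; rewrite addn0 lend1E. Qed.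
Lemma raisesM k l f g : raises k f -> raises l g -> raises (k + l) (f * g).
Proof. by move=> hf hg m v /hg /hf; rewrite lendM addnAC addnA. Qed.
End Degree.

Definition udeg (i : 'I_N * 'I_N) : nat := (i.1 + i.2)%N.
Definition sdeg (i : 'S_p * {set I2}) : nat := #|i.2|.

Lemma below_deg_eu b a : below_deg udeg (b + a)%N (eu r K b a).
Proof.
apply: (eu_case (P := fun v b a => below_deg udeg (b + a)%N v)) => [i j|? ? _].
  exact: below_deg_delta.
exact: below_deg0.
Qed.
Lemma uF_raises : raises udeg 1 (uF r K).
Proof.
apply: raises_basis_op => -[i j]; rewrite /udeg /= addn1 -addSn.
exact: below_deg_eu.
Qed.
Lemma uK_raises kap : raises udeg 0 (uK r q kap).
Proof.
apply: raises_basis_op => -[i j]; apply: below_degZ; rewrite addn0.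
exact: below_deg_eu.
Qed.
Lemma uE_raises kap : raises udeg 1 (uE r q kap).
Proof.
apply: raises_basis_op => -[i j]; rewrite /udeg /= addn1.
apply: below_degD; first by rewrite -addnS; exact: below_deg_eu.
apply: below_degZ => x /(@below_deg_eu _ _ x) /leq_trans; apply.
by rewrite -addSn leq_add2r (leq_trans (leq_pred _)).
Qed.
Lemma sZ_raises e l : raises sdeg 1 (sZ K e l).
Proof.
rewrite unlock; apply: raises_basis_op => -[s X] /=.
case: ifP => iX; first exact: below_deg0.
by apply: below_degZ; apply: below_deg_delta; rewrite /sdeg cardsU1 iX addnC.
Qed.
Lemma sL_raises ell : raises sdeg 0 (sL p ell).
Proof.
rewrite unlock; apply: raises_basis_op => x /=.
by apply: below_degZ; apply: below_deg_delta; rewrite addn0.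
Qed.
Lemma sP_raises : raises sdeg 0 (sP p K).
Proof.
rewrite unlock; apply: raises_basis_op => x /=.
by apply: below_degZ; apply: below_deg_delta; rewrite addn0.
Qed.
Lemma sS_raises s : raises sdeg 0 (sS K s).
Proof.
rewrite unlock; apply: raises_basis_op => x /=.
by apply: below_deg_delta; rewrite addn0.
Qed.

(** K, L and the permutations have degree 0, so the bottom of the filtration is spanned by the words
    in them. *)
Definition gdeg (x : gen p) : nat :=
  match x with genE | genF | genZ _ _ => 1 | _ => 0 end.

Inductive word : nat -> A -> Prop :=
| word1 : word 0 1
| wordM x k a : word k a -> word (gdeg x + k) (img gK gE gF gL gZ gS x * a).
Definition Fil k : {pred A} := Defs.span (fun a => exists2 j, (j <= k)%N & word j a).

Definition rawdeg k : {pred tensor U W} :=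
  Defs.span (fun t => exists i j f g,
    [/\ raises udeg i f, raises sdeg j g, (i + j <= k)%N & t = tens f g]).

Section OneRep.
Variables (kap ell : K).
Hypotheses (kapN : kap ^+ N = 1) (ell2 : ell * ell = 1).

Definition rep_rels := Arels_tensor q_prim r_dvd8 (uK_N q_prim r_dvd8 kapN)
  (uE_N q_prim r_dvd8 kapN) (uF_N r K) (uK_E q_prim r_dvd8 kap) (uK_F r q kap)
  (uE_F q_prim r_dvd8 kapN) (sL2 p ell2) (sP2 p K) (sP_L p ell) (@sP_S p K)
  (@sL_S p K ell) (@sP_Z p K) (@sL_Z p K ell) (@sZ2 p K) (@sZZ p K) (@sS1 p K)
  (@sSS p K) (@sSZ p K).

Definition hom : A -> tensor U W := sval (pres_lift pres rep_rels).
Lemma alghom_hom : alghom hom.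
Proof. exact: (svalP (pres_lift pres rep_rels)).1. Qed.
Let hgen x := (svalP (pres_lift pres rep_rels)).2 x.
Lemma hom_K : hom gK = tens (uK r q kap) (sP p K). Proof. exact: (hgen (genK p)). Qed.
Lemma hom_E : hom gE = tens (uE r q kap) (sP p K). Proof. exact: (hgen (genE p)). Qed.
Lemma hom_F : hom gF = tens (uF r K) (1 : W). Proof. exact: (hgen (genF p)). Qed.
Lemma hom_L : hom gL = tens (1 : U) (sL p ell). Proof. exact: (hgen (genL p)). Qed.
Lemma hom_Z e l : hom (gZ e l) = tens (1 : U) (sZ K e l). Proof. exact: hgen (genZ e l). Qed.
Lemma hom_S s : hom (gS s) = tens (1 : U) (sS K s). Proof. exact: hgen (Defs.genS s). Qed.

Lemma hom_word k a : word k a -> hom a \in rawdeg k.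
Proof.
have closed j x t : t \in rawdeg j ->
    hom (img gK gE gF gL gZ gS x) * t \in rawdeg (gdeg x + j).
  move: t; apply: (span_map (f := fun t : tensor U W => hom (img gK gE gF gL gZ gS x) * t)).
  - by lin.
  - exact: span_submod_closed.
  - move=> t [i [l [f [g [hf hg il ->]]]]].
  case: x => [||||e m|s] /=.
  - rewrite hom_K tensM; apply: span_gen; exists i, l, (uK r q kap * f), (sP p K * g).
    split=> //; [exact (raisesM (@uK_raises kap) hf) | exact (raisesM sP_raises hg)].
  - rewrite hom_E tensM; apply: span_gen; exists (1 + i)%N, l, (uE r q kap * f), (sP p K * g).
    split=> //; [exact (raisesM (@uE_raises kap) hf) | exact (raisesM sP_raises hg)].
  - rewrite hom_F tensM mul1r; apply: span_gen; exists (1 + i)%N, l, (uF r K * f), g.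
    by split=> //; exact (raisesM uF_raises hf).
  - rewrite hom_L tensM mul1r; apply: span_gen; exists i, l, f, (sL p ell * g).
    by split=> //; exact (raisesM (@sL_raises ell) hg).
  - rewrite hom_Z tensM mul1r; apply: span_gen; exists i, (1 + l)%N, f, (sZ K e m * g).
    by split=> //; [exact (raisesM (@sZ_raises e m) hg) | rewrite addnCA].
  rewrite hom_S tensM mul1r; apply: span_gen; exists i, l, f, (sS K s * g).
  by split=> //; exact (raisesM (@sS_raises s) hg).
elim=> [|x j b _ IH]; last by rewrite (alghomM alghom_hom); exact: closed.
rewrite (alghom1 alghom_hom) tens1; apply: span_gen; exists 0%N, 0%N, (1 : U), (1 : W).
by split=> //; exact: raises1.
Qed.

Local Notation vac := (delta K (1%g : 'S_p, set0 : {set I2})).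
Lemma n_ltN : (n < N)%N. Proof. by rewrite prednK. Qed.
Definition ntop : 'I_N := Ordinal n_ltN.
(** The matrix coefficient from the vacuum e_{0,0} ⊗ (1, ∅) to the top vector e_{n,n} ⊗ (1, all
    letters). *)
Definition Phi : tensor U W -> K^o :=
  tlift (fun (f : U) (g : W) => (f (eu r K 0 0) (ntop, ntop) : K) * stop (g vac) : K^o).
Lemma Phi_lin_l (g : W) : linear (fun f : U => (f (eu r K 0 0) (ntop, ntop) : K) * stop (g vac) : K^o).
Proof. by move=> c f f'; rewrite lendD lendZ !ffunE mulrDl scalerAl. Qed.
Lemma Phi_lin_r (f : U) : linear (fun g : W => (f (eu r K 0 0) (ntop, ntop) : K) * stop (g vac) : K^o).
Proof. by move=> c g g'; rewrite lendD lendZ stop_linear mulrDr scalerAr. Qed.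
Lemma Phi_lin : linear Phi. Proof. exact: tlift_is_linear Phi_lin_l Phi_lin_r. Qed.
Lemma PhiE (f : U) (g : W) : Phi (tens f g) = (f (eu r K 0 0) (ntop, ntop) : K) * stop (g vac).
Proof. exact: (tliftE Phi_lin_l Phi_lin_r). Qed.

Definition rho1 (x : A) : K := Phi (hom x).
Lemma rho1_lin : linear (rho1 : A -> K^o).
Proof. by move=> c x y; rewrite /rho1 (alghom_lin alghom_hom) Phi_lin. Qed.

(** The top vector has degree n + n + 2p and each letter raises the degree by at most one. *)
Lemma rho1_Fil k a : (k < n + n + 2 * p)%N -> a \in Fil k -> rho1 a = 0.
Proof.
move=> kn; move: a; apply: (span_ker rho1_lin) => a [j jk /hom_word]; rewrite /rho1.
move: (hom a) => t; move: t; apply: (span_ker Phi_lin) => t [i [l [f [g [hf hg il ->]]]]].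
apply/eqP; rewrite PhiE mulf_eq0.
apply: contraTT isT; rewrite negb_or => /andP[nf ng].
have h1 := hf 0%N _ (@below_deg_eu 0 0) _ nf.
have v0 : below_deg sdeg 0 vac.
  by apply: below_deg_delta; rewrite /sdeg cards0.
have h2 := hg 0%N _ v0 _ ng.
move: h1 h2; rewrite /udeg /sdeg /= card_I2; lia.
Qed.

Definition Zw (w : seq I2) : A := \prod_(i <- w) gZ i.1 i.2.
Lemma hom_Zw w : hom (Zw w) = tens (1 : U) (sword K w).
Proof.
rewrite /Zw (alghom_prod alghom_hom) /sword; elim: w => [|i w IH].
  by rewrite !big_nil.
by rewrite !big_cons IH hom_Z tensM mulr1.
Qed.

(** The top vector has weight [kap], since z^n t^n = 1. Thus K^c and L^d contribute characters of c
    and d, ready for Fourier inversion. *)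
Lemma rho1_top s d c w : uniq w -> size w = (2 * p)%N ->
  rho1 (gS s * gL ^+ d * gK ^+ c * gF ^+ n * gE ^+ n * Zw w) =
  kap ^+ c * (ell ^+ d * (s == 1%g)%:R) * stop (sword K w vac).
Proof.
move=> uw sw; rewrite /rho1 !(alghomM alghom_hom) !(alghomX alghom_hom).
rewrite hom_S hom_L hom_K hom_F hom_E hom_Zw !tensX !tensM.
rewrite !mul1r mulr1 !expr1n !mul1r mulr1 PhiE.
have -> : sS K s * sL p ell ^+ d * sP p K ^+ c * sP p K ^+ n =
  sS K s * sL p ell ^+ d * sP p K ^+ (c + n) by rewrite exprD !mulrA.
rewrite (stop_word_full _ _ _ _ uw sw) !lendM (uEXE0 q_prim r_dvd8) uFXE uKXE.
rewrite !addn0 ffunE -[n]/(nat_of_ord ntop) euE deltaE eqxx /GRing.scale /= mulr1.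
rewrite /wgt -mulrA -exprMn mulfV ?(q2_neq0 q_prim r_dvd8) // expr1n mulr1.
by rewrite -mulrA; congr (_ * _); rewrite mulrC.
Qed.
End OneRep.
End Rho.

(** * The functional rho *)

Lemma sL_opp (p : nat) (K : fieldType) (ell : K) : sL p (- ell) = - sL p ell.
Proof.
by apply: lend_basis_ext => x; rewrite lendN !sLE mulrN scaleNr.
Qed.

Section Rho.
Variables (p r : nat) (K : fieldType) (q : K).
Hypotheses (q_prim : r.-primitive_root q) (r_dvd8 : (8 %| r)%N).
Local Notation N := (r %/ 2)%N.
Variables (A : pzAlgType K) (gK gE gF gL : A) (gZ : bool -> 'I_p -> A) (gS : 'S_p -> A).
Hypothesis pres : presentation r q gK gE gF gL gZ gS.
Local Notation z := (q ^+ 2).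
Local Notation I2 := (bool * 'I_p)%type.
Let N0 : (0 < N)%N := N_gt0 q_prim r_dvd8.
Local Notation n := N.-1.
Local Notation Fil := (Fil gK gE gF gL gZ gS).
Local Notation rels := (pres_rels pres).

Definition pairs_word : seq I2 := flatten [seq [:: (true, l); (false, l)] | l <- enum 'I_p].
Lemma size_pairs_word : size pairs_word = (2 * p)%N.
Proof.
rewrite /pairs_word -[X in (2 * X)%N](size_enum_ord p); elim: (enum _) => //= l s ->.
by rewrite mulnS.
Qed.
Lemma uniq_pairs_word : uniq pairs_word.
Proof.
apply: (leq_size_uniq (s1 := enum {: I2}) (enum_uniq _)) => [[e l] _|].
  apply/flattenP; exists [:: (true, l); (false, l)].
    by apply/mapP; exists l; rewrite ?mem_enum.
  by case: e; rewrite !inE eqxx ?orbT.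
by rewrite size_pairs_word -cardT -card_I2 cardsT.
Qed.
Definition Zt : A := \prod_(l < p) (gZ true l * gZ false l).
Lemma Zw_pairs : Zw gZ pairs_word = Zt.
Proof.
rewrite /Zw /Zt /pairs_word big_flatten big_map enumT [index_enum _]unlock /=.
by apply: eq_bigr => l _; rewrite big_cons big_seq1.
Qed.

Lemma zmN (m : nat) : (z ^+ m) ^+ N = 1.
Proof. by rewrite -exprM mulnC exprM (q2N q_prim r_dvd8) expr1n. Qed.
Lemma sgn_sq (b : bool) : ((-1) ^+ b * (-1) ^+ b : K) = 1.
Proof. by case: b; rewrite ?expr1 ?mulrNN mulr1. Qed.

(** Fourier inversion over the N values z^m of [kap] and the two signs [ell]. The weight (z^m)^-1
    selects K^1, and the constant weight in [b] selects L^0. *)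
Definition rho_unnorm (x : A) : K^o := \sum_(m < N) \sum_(b : bool)
  (z ^+ m)^-1 * rho1 q_prim r_dvd8 pres (zmN m) (sgn_sq b) x.
Lemma rho_unnorm_lin : linear rho_unnorm.
Proof.
apply: linear_sumf => m; apply: linear_sumf => b c x y.
by rewrite (rho1_lin q_prim r_dvd8 pres (zmN m) (sgn_sq b)) mulrDr scalerAr.
Qed.
Definition topval : K := N%:R * 2 * stop (sword K pairs_word (delta K (1%g : 'S_p, set0 : {set I2}))).
Lemma rho_linear : linear_for *%R (fun x : A => topval^-1 * (rho_unnorm x : K)).
Proof. by move=> c x y; rewrite rho_unnorm_lin mulrDr mulrCA. Qed.
Definition rho : {scalar A} := scalar_pack rho_linear.

Lemma rho_Fil k a : (k < n + n + 2 * p)%N -> a \in Fil k -> rho a = 0.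
Proof.
move=> kn ak; rewrite /rho /= /rho_unnorm big1 ?mulr0 // => m _.
by rewrite big1 // => b _; rewrite (rho1_Fil q_prim r_dvd8 pres _ _ kn ak) mulr0.
Qed.

Hypothesis NK : (N%:R : K) != 0.
Lemma rho_top s d c :
  rho (gS s * gL ^+ d * gK ^+ c * gF ^+ n * gE ^+ n * Zt) =
  ((s == 1%g) && ~~ odd d && (c == 1 %[mod N]))%:R.
Proof.
have sz := size_pairs_word; have un := uniq_pairs_word.
have t0 := stop_word_neq0 K un sz; set t := stop _ in t0.
rewrite /rho /= /rho_unnorm -Zw_pairs.
(* The average factors into a character sum over m, a character sum over b and the value on the word
   of all Z. *)
have -> : \sum_(m < N) \sum_(b : bool) (z ^+ m)^-1 * rho1 q_prim r_dvd8 pres (zmN m)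
   (sgn_sq b) (gS s * gL ^+ d * gK ^+ c * gF ^+ n * gE ^+ n * Zw gZ pairs_word) =
  (\sum_(m < N) (z ^+ m)^-1 * (z ^+ m) ^+ c) * (\sum_(b : bool) ((-1) ^+ b) ^+ d)
   * ((s == 1%g)%:R * t).
  rewrite mulr_suml mulr_suml; apply: eq_bigr => m _.
  rewrite mulr_sumr mulr_suml; apply: eq_bigr => b _.
  by rewrite (rho1_top q_prim r_dvd8 pres _ _ s d c un sz) !mulrA.
have two : (2 : K) != 0 := two_neq0 q_prim r_dvd8.
have z0 := q2_neq0 q_prim r_dvd8.
have zN := q2N q_prim r_dvd8.
have -> : \sum_(b : bool) ((-1) ^+ b) ^+ d = 2 * (~~ odd d)%:R :> K.
  rewrite big_bool /= expr0 expr1n expr1 -signr_odd.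
  by case: (odd d) => /=; rewrite ?expr1 ?expr0 ?mulr0 ?mulr1 // addNr.
have -> : \sum_(m < N) (z ^+ m)^-1 * (z ^+ m) ^+ c = N%:R * (c == 1 %[mod N])%:R.
  have E (m : nat) : (z ^+ m)^-1 * (z ^+ m) ^+ c = (z ^+ (c + n)) ^+ m.
    by rewrite exprD (q2_pred q_prim r_dvd8) (exprMn m (z ^+ c)) exprVn mulrC (exprAC z).
  rewrite (eq_bigr (fun m : 'I_N => (z ^+ (c + n)) ^+ m)) => [|m _]; last exact: E.
  have -> : (c == 1 %[mod N]) = (z ^+ (c + n) == 1).
    by rewrite -(prim_order_dvd (q2_prim q_prim r_dvd8)) -(eqn_modDr n) add1n prednK // modnn.
  move: (z ^+ _) (zmN (c + n)) => w wN; have [->|w1] := eqVneq w 1.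
    under eq_bigr do rewrite expr1n.
    by rewrite sumr_const card_ord mulr1.
  have w10 : w - 1 != 0 by rewrite subr_eq0.
  by apply: (mulfI w10); rewrite -subrX1 wN subrr !mulr0.
rewrite /topval -/t; case: (s == 1%g); case: (odd d); case: (c == 1 %[mod N]);
  rewrite /= ?mulr0 ?mul0r ?mulr0 // !mulr1 mul1r mulVf //.
by rewrite !mulf_neq0.
Qed.

Lemma Arels_twist : Arels r q gK gE gF (- gL) gZ gS.
Proof.
case: rels => *; split=> //; try (move=> *; apply: qcommNl; eauto).
  by rewrite mulrNN.
by move=> s; apply: qcommNr.
Qed.
Definition chi : A -> A := sval (pres_lift pres Arels_twist).
Lemma alghom_chi : alghom chi. Proof. exact: (svalP (pres_lift pres Arels_twist)).1. Qed.
Let xgen x := (svalP (pres_lift pres Arels_twist)).2 x.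
Lemma chi_K : chi gK = gK. Proof. exact: (xgen (genK p)). Qed.
Lemma chi_E : chi gE = gE. Proof. exact: (xgen (genE p)). Qed.
Lemma chi_F : chi gF = gF. Proof. exact: (xgen (genF p)). Qed.
Lemma chi_L : chi gL = - gL. Proof. exact: (xgen (genL p)). Qed.
Lemma chi_Z e l : chi (gZ e l) = gZ e l. Proof. exact: xgen (genZ e l). Qed.
Lemma chi_S s : chi (gS s) = gS s. Proof. exact: xgen (Defs.genS s). Qed.

(** Composing with chi exchanges the representations for [ell] and [- ell], which enter the average
    with equal weight. *)
Lemma rho_chi x : rho (chi x) = rho x.
Proof.
rewrite /rho /= /rho_unnorm; congr (_ * _); apply: eq_bigr => m _.
rewrite (reindex_inj (inv_inj negbK)) /=; apply: eq_bigr => b _; congr (_ * _).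
rewrite /rho1; congr Phi; move: x.
apply: (A_ext pres (alghom_comp (alghom_hom _ _ _ _ _) alghom_chi) (alghom_hom _ _ _ _ _)).
- by rewrite chi_K !hom_K.
- by rewrite chi_E !hom_E.
- by rewrite chi_F !hom_F.
- rewrite chi_L (linN (alghom_lin (alghom_hom _ _ _ _ _))) !hom_L -tensNr.
  have -> : (-1) ^+ (~~ b) = - ((-1) ^+ b) :> K by case: b; rewrite ?expr1 ?expr0 ?opprK.
  by rewrite sL_opp opprK.
- by move=> e l; rewrite chi_Z !hom_Z.
by move=> s; rewrite chi_S !hom_S.
Qed.
End Rho.

(** * The two-sided cointegral *)

Section CommutingProducts.
Variables (R : pzSemiRingType) (I : eqType) (F : I -> R).
Hypothesis FC : forall i j, F i * F j = F j * F i.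
Lemma prod_comm_elt (s : seq I) x : (forall i, x * F i = F i * x) ->
  x * (\prod_(i <- s) F i) = (\prod_(i <- s) F i) * x.
Proof.
move=> xF; elim: s => [|i s IH]; first by rewrite big_nil mulr1 mul1r.
by rewrite big_cons mulrA xF -!mulrA IH.
Qed.
Lemma prod_comm_perm (s1 s2 : seq I) : perm_eq s1 s2 ->
  \prod_(i <- s1) F i = \prod_(i <- s2) F i.
Proof.
move=> s12; pose P s := \prod_(i <- s1) F i = \prod_(i <- s) F i.
apply: (@catCA_perm_ind _ P) (s12) (erefl _) => a b c; rewrite /P => ->.
rewrite !big_cat /= !mulrA; congr (_ * _); apply: prod_comm_elt => i.
by apply/esym/prod_comm_elt.
Qed.
End CommutingProducts.

Section Cointegral.
Variables (p r : nat) (K : fieldType) (q : K).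
Hypotheses (q_prim : r.-primitive_root q) (r_dvd8 : (8 %| r)%N).
Local Notation N := (r %/ 2)%N.
Variables (A : pzAlgType K) (gK gE gF gL : A) (gZ : bool -> 'I_p -> A) (gS : 'S_p -> A).
Hypothesis pres : presentation r q gK gE gF gL gZ gS.
Local Notation z := (q ^+ 2).
Local Notation t := (q ^- 2).
Let N0 : (0 < N)%N := N_gt0 q_prim r_dvd8.
Local Notation n := N.-1.
Local Notation rels := (pres_rels pres).
Local Notation Ki := (Ki r gK).
Local Notation Zt := (Zt gZ).

Definition Zpair l : A := gZ true l * gZ false l.
Lemma qcomm_Zpair c x : c * c = 1 -> (forall e l, qcomm c x (gZ e l)) ->
  forall l, qcomm 1 x (Zpair l).
Proof. by move=> cc h l; apply: qcomm_eq (qcommMr (h _ _) (h _ _)) _. Qed.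
Lemma Z_Zpair e l k : gZ e l * Zpair k = Zpair k * gZ e l.
Proof.
apply/qcomm_comm; apply: (@qcomm_Zpair (-1)); first by rewrite mulrNN mulr1.
by move=> e' l'; exact: (rZZ rels _ _ _ _).
Qed.
Lemma Zpair_comm k l : Zpair k * Zpair l = Zpair l * Zpair k.
Proof. by rewrite {1 4}/Zpair -mulrA !Z_Zpair mulrA Z_Zpair mulrA. Qed.
Lemma Zpair_Z e l : Zpair l * gZ e l = 0.
Proof.
case: e; last by rewrite /Zpair -mulrA (rZ2 rels) mulr0.
by rewrite -Z_Zpair /Zpair mulrA (rZ2 rels) mul0r.
Qed.
Lemma Zt_Z e l : Zt * gZ e l = 0.
Proof.
rewrite /Zt; have : l \in index_enum 'I_p by rewrite mem_index_enum.
elim: (index_enum _) => // k s IH; rewrite inE big_cons => /orP[/eqP <-|/IH].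
  rewrite -mulrA -prod_comm_elt => [|i]; last exact: Z_Zpair.
  by rewrite mulrA [_ * gZ e l]Zpair_Z mul0r.
by rewrite -mulrA => ->; rewrite mulr0.
Qed.
Lemma comm_Zt c x : c * c = 1 -> (forall e l, qcomm c x (gZ e l)) -> x * Zt = Zt * x.
Proof.
move=> cc h; apply: prod_comm_elt => l.
exact/qcomm_comm/(qcomm_Zpair cc h).
Qed.
Let NN : (-1) * (-1) = 1 :> K. Proof. by rewrite mulrNN mulr1. Qed.
Lemma Z_Zt e l : gZ e l * Zt = 0.
Proof. by rewrite (comm_Zt NN) ?Zt_Z // => e' l'; exact: (rZZ rels _ _ _ _). Qed.
Lemma K_Zt : gK * Zt = Zt * gK. Proof. exact: comm_Zt NN (rKZ rels). Qed.
Lemma L_Zt : gL * Zt = Zt * gL. Proof. exact: comm_Zt NN (rLZ rels). Qed.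
Lemma E_Zt : gE * Zt = Zt * gE. Proof. exact: comm_Zt NN (rEZ rels). Qed.
Lemma F_Zt : gF * Zt = Zt * gF. Proof. exact: comm_Zt (mulr1 1) (rFZ rels). Qed.
Lemma S_Zpair s l : gS s * Zpair l = Zpair (s l) * gS s.
Proof. by rewrite /Zpair mulrA (rSZ rels) -mulrA (rSZ rels) mulrA. Qed.
(** A permutation permutes the factors Z_l^+ Z_l^-, which commute with one another. *)
Lemma S_Zt s : gS s * Zt = Zt * gS s.
Proof.
have E : Zt = \prod_(l <- [seq s l | l <- index_enum 'I_p]) Zpair l.
  apply: prod_comm_perm; first exact: Zpair_comm.
  apply: uniq_perm; rewrite ?(map_inj_uniq perm_inj) ?index_enum_uniq // => l.
  rewrite mem_index_enum; apply/esym/mapP; exists (s^-1%g l); last by rewrite permKV.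
  by rewrite mem_index_enum.
rewrite [in RHS]E big_map /Zt; elim: (index_enum _) => [|l L IH].
  by rewrite !big_nil mulr1 mul1r.
by rewrite !big_cons mulrA [gS s * _]S_Zpair -!mulrA IH.
Qed.

Definition Ssum : A := \sum_(s : 'S_p) gS s.
Definition Ksum : A := \sum_(c < N) gK ^+ c.
Definition Lam : A := Ssum * (1 + gL) * Ksum * gF ^+ n * gE ^+ n * Zt.

Lemma S_Ssum s : gS s * Ssum = Ssum.
Proof.
rewrite /Ssum mulr_sumr (reindex_inj (mulIg s^-1%g)) /=; apply: eq_bigr => u _.
by rewrite (rSS rels) mulgKV.
Qed.
Lemma Ssum_S s : Ssum * gS s = Ssum.
Proof.
rewrite /Ssum mulr_suml (reindex_inj (mulgI s^-1%g)) /=; apply: eq_bigr => u _.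
by rewrite (rSS rels) mulKVg.
Qed.
Lemma Ssum_comm x : (forall s, gS s * x = x * gS s) -> Ssum * x = x * Ssum.
Proof. by move=> h; rewrite /Ssum mulr_suml mulr_sumr; apply: eq_bigr. Qed.
Lemma K_Ksum : gK * Ksum = Ksum.
Proof.
rewrite /Ksum mulr_sumr -(prednK N0) big_ord_recr [RHS]big_ord_recl /=.
by rewrite -exprS prednK // (rK rels) addrC; congr (_ + _); apply: eq_bigr => i _; rewrite -exprS.
Qed.
Lemma Ksum_comm x : gK * x = x * gK -> Ksum * x = x * Ksum.
Proof.
move=> h; rewrite /Ksum mulr_suml mulr_sumr; apply: eq_bigr => i _.
by apply/esym/commrX.
Qed.
Lemma Ksum_K : Ksum * gK = Ksum. Proof. by rewrite Ksum_comm ?K_Ksum. Qed.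
Lemma Ksum_Ki : Ksum * Ki = Ksum.
Proof. by rewrite /Ki; elim: n => [|m IH]; rewrite ?mulr1 // exprS mulrA Ksum_K. Qed.

Lemma tn : t ^+ n = z. Proof. by rewrite exprVn (q2_pred q_prim r_dvd8) invrK. Qed.
Lemma zn : z ^+ n = t. Proof. exact: q2_pred q_prim r_dvd8. Qed.
Lemma qnum_pred (c : K) : qnum c N = 0 -> qnum c n = - c ^+ n.
Proof.
have : qnum c n.+1 = qnum c n + c ^+ n by rewrite /qnum big_ord_recr.
by rewrite prednK // => -> /eqP; rewrite addr_eq0 => /eqP.
Qed.
Lemma qnum_tn : qnum t n = - z. Proof. by rewrite qnum_pred ?tn // (qnumtN q_prim r_dvd8). Qed.
Lemma qnum_zn : qnum z n = - t.
Proof. by rewrite qnum_pred ?zn // (qnumzN q_prim r_dvd8). Qed.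

(** When [x, y] is a difference of elements skew commuting with x, the expansion of [x^m, y] becomes
    two geometric sums. *)
Lemma commutator_qnum m (x y : A) c d (P Q : A) k :
  x * y - y * x = k *: (P - Q) -> qcomm c x P -> qcomm d x Q ->
  x ^+ m * y = y * x ^+ m + k *: ((qnum c m *: P - qnum d m *: Q) * x ^+ m.-1).
Proof.
move=> xy xP xQ; apply/eqP; rewrite addrC -subr_eq commutator_expl; apply/eqP.
rewrite mulrBl scalerBr -!pzscaleAl /qnum !scaler_suml scaler_sumr scaler_sumr -sumrB.
apply: eq_bigr => i _; rewrite xy -pzscaleAr mulrBr -pzscaleAl mulrBl scalerBr.
have E c' (P' : A) : qcomm c' x P' -> x ^+ i * P' * x ^+ (m.-1 - i) = c' ^+ i *: (P' * x ^+ m.-1).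
  move=> h; rewrite (qcommXl i h : x ^+ i * P' = _) -pzscaleAl -mulrA -exprD subnKC //.
  by have := ltn_ord i; lia.
by rewrite (E _ _ xP) (E _ _ xQ).
Qed.

Lemma En_F : gE ^+ n * gF = gF * gE ^+ n +
  (q - q^-1)^-1 *: ((- z *: gK + t *: Ki) * gE ^+ n.-1).
Proof.
rewrite (commutator_qnum n (rEF rels) (E_K q_prim r_dvd8 rels) (E_Ki q_prim r_dvd8 rels)).
by rewrite qnum_tn qnum_zn (scaleNr t) opprK.
Qed.
Lemma E_Fn : gE * gF ^+ n = gF ^+ n * gE +
  (q - q^-1)^-1 *: ((- t *: gK + z *: Ki) * gF ^+ n.-1).
Proof.
have FE : gF * gE - gE * gF = (- (q - q^-1)^-1) *: (gK - gK ^+ n).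
  by rewrite scaleNr -(rEF rels) opprB.
rewrite (commutator_qnum n FE (F_K q_prim r_dvd8 rels) (F_Ki q_prim r_dvd8 rels)).
by rewrite qnum_tn qnum_zn (scaleNr z) opprK scaleNr subrK.
Qed.

Lemma FnK : gF ^+ n * gK = t *: (gK * gF ^+ n).
Proof. by rewrite -zn; exact: (qcommXl n (F_K q_prim r_dvd8 rels)). Qed.
Lemma FnKi : gF ^+ n * Ki = z *: (Ki * gF ^+ n).
Proof. by rewrite -tn; exact: (qcommXl n (F_Ki q_prim r_dvd8 rels)). Qed.
Lemma FN : gF ^+ n * gF = 0. Proof. by rewrite -exprSr prednK // (rF rels). Qed.
Lemma EN : gE ^+ n * gE = 0. Proof. by rewrite -exprSr prednK // (rE rels). Qed.
Lemma FN' : gF * gF ^+ n = 0. Proof. by rewrite -exprS prednK // (rF rels). Qed.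
Lemma EN' : gE * gE ^+ n = 0. Proof. by rewrite -exprS prednK // (rE rels). Qed.

(** The terms K and K^-1 of [E^n, F] are moved left through F^n and absorbed by the sum of powers of
    K; the scalars that remain are -zt and tz. *)
Lemma bottom_F : Ksum * gF ^+ n * gE ^+ n * gF = 0.
Proof.
rewrite -mulrA En_F mulrDr mulrA -(mulrA _ _ gF) FN mulr0 mul0r add0r -pzscaleAr.
rewrite mulrA mulrDr -!pzscaleAr -!(mulrA _ (gF ^+ n)) FnK FnKi -!pzscaleAr !mulrA.
rewrite Ksum_K Ksum_Ki !scalerA mulNr !mulfV ?invr_neq0 ?(q2_neq0 q_prim r_dvd8) //.
by rewrite mulVf ?(q2_neq0 q_prim r_dvd8) // scaleN1r scale1r addNr mul0r scaler0.
Qed.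

(** What the sum of powers of K becomes after E has passed it: an eigenvector for multiplication by
    K with eigenvalue z instead of 1. *)
Definition Ksum1 : A := \sum_(c < N) t ^+ c *: gK ^+ c.
Lemma E_Ksum : gE * Ksum = Ksum1 * gE.
Proof.
rewrite /Ksum /Ksum1 mulr_sumr mulr_suml; apply: eq_bigr => c _.
by rewrite (qcommXr c (E_K q_prim r_dvd8 rels)) pzscaleAl.
Qed.
Lemma Ksum1_K : Ksum1 * gK = z *: Ksum1.
Proof.
have tN : t ^+ N = 1 by rewrite exprVn (q2N q_prim r_dvd8) invr1.
rewrite /Ksum1 mulr_suml scaler_sumr -(prednK N0) big_ord_recr [RHS]big_ord_recl /=.
rewrite -pzscaleAl -exprSr prednK // (rK rels) addrC tn !expr0 scale1r.
congr (_ + _); apply: eq_bigr => i _.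
by rewrite /bump /= add1n -pzscaleAl -exprSr scalerA [t ^+ _.+1]exprS mulrA mulfV ?mul1r ?(q2_neq0 q_prim r_dvd8).
Qed.
Lemma Ksum1_Ki : Ksum1 * Ki = t *: Ksum1.
Proof.
rewrite /Ki -zn; elim: n => [|m IH]; first by rewrite mulr1 scale1r.
by rewrite exprSr mulrA IH -pzscaleAl Ksum1_K scalerA -exprSr.
Qed.
Lemma E_bottom : gE * (Ksum * gF ^+ n * gE ^+ n) = 0.
Proof.
rewrite !mulrA E_Ksum -!mulrA (mulrA gE) E_Fn mulrDl -mulrA EN' mulr0 add0r.
rewrite -pzscaleAl -pzscaleAr !mulrA mulrDr -!pzscaleAr Ksum1_K Ksum1_Ki !scalerA.
by rewrite mulNr mulVf ?mulfV ?(q2_neq0 q_prim r_dvd8) // scaleN1r scale1r addNr !mul0r scaler0.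
Qed.

Lemma comm_pow (x y : A) k : qcomm 1 x y -> x * y ^+ k = y ^+ k * x.
Proof. by move/qcomm_comm => h; apply/commrX. Qed.

Local Notation B := (Ksum * gF ^+ n * gE ^+ n).
Lemma LamE : Lam = Ssum * (1 + gL) * B * Zt. Proof. by rewrite /Lam !mulrA. Qed.

Lemma comm_Ksum x : qcomm 1 gK x -> x * Ksum = Ksum * x.
Proof. by move/qcomm_comm => h; rewrite Ksum_comm. Qed.
Lemma comm_B x : qcomm 1 x gK -> qcomm 1 x gE -> qcomm 1 x gF -> x * B = B * x.
Proof.
move=> hK hE hF; rewrite !mulrA (comm_Ksum (qcomm_sym1 hK)) -!mulrA; congr (_ * _).
by rewrite mulrA (comm_pow n hF) -!mulrA (comm_pow n hE).
Qed.
Lemma comm_SL x : (forall s, qcomm 1 (gS s) x) -> qcomm 1 gL x ->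
  x * (Ssum * (1 + gL)) = Ssum * (1 + gL) * x.
Proof.
move=> /(_ _)/qcomm_comm hS /qcomm_comm hL.
by rewrite mulrA -Ssum_comm // -!mulrA; congr (_ * _); rewrite mulrDr mulrDl mulr1 mul1r hL.
Qed.

Lemma mul_Lam x : (forall s, qcomm 1 (gS s) x) -> qcomm 1 gL x ->
  x * Lam = Ssum * (1 + gL) * (x * B) * Zt.
Proof.
move=> hS hL; rewrite LamE; have := comm_SL hS hL.
move: (Ssum * _) B => G b hG; by rewrite mulrA (mulrA x) hG -(mulrA G).
Qed.
Lemma Lam_mul x : x * Zt = Zt * x -> Lam * x = Ssum * (1 + gL) * (B * x) * Zt.
Proof. by move=> h; rewrite LamE -mulrA -h; move: (Ssum * _) B => G b; rewrite !mulrA. Qed.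

Lemma K_B : gK * B = B. Proof. by rewrite !mulrA K_Ksum. Qed.
Lemma B_K : B * gK = B.
Proof.
have EnK : gE ^+ n * gK = z *: (gK * gE ^+ n).
  by rewrite -tn; exact: (qcommXl n (E_K q_prim r_dvd8 rels)).
rewrite -!mulrA EnK -!pzscaleAr (mulrA _ gK) FnK -!pzscaleAl -!pzscaleAr scalerA.
by rewrite mulfV ?(q2_neq0 q_prim r_dvd8) // scale1r !mulrA Ksum_K.
Qed.
Lemma F_B : gF * B = 0.
Proof.
have this : gF * Ksum = (\sum_(c < N) z ^+ c *: gK ^+ c) * gF.
  rewrite /Ksum mulr_sumr mulr_suml; apply: eq_bigr => c _.
  by rewrite (qcommXr c (F_K q_prim r_dvd8 rels)) pzscaleAl.
by rewrite !mulrA this -(mulrA _ gF) FN' mulr0 mul0r.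
Qed.

(** To compute Z Λ, the letter Z is pushed right through the factors of Λ until it meets the product
    of all Z. The quantification over all letters is needed because passing a permutation changes
    the index. *)
Definition Zkilled (a : A) := forall e l, gZ e l * a * Zt = 0.
Lemma Zkilled_sum (I : Type) (L : seq I) (f : I -> A) a :
  (forall i, Zkilled (f i * a)) -> Zkilled ((\sum_(i <- L) f i) * a).
Proof.
move=> h e l; rewrite mulr_suml mulr_sumr mulr_suml big1 // => i _; exact: h.
Qed.
Lemma Zkilled_q (c : K) x a : (forall e l, qcomm c (gZ e l) x) -> Zkilled a -> Zkilled (x * a).
Proof. by move=> h ka e l; rewrite mulrA h -!pzscaleAl -!mulrA [_ * (a * _)]mulrA ka mulr0 scaler0. Qed.
Lemma Z_Lam e l : gZ e l * Lam = 0.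
Proof.
have qK : forall e l, qcomm (-1 : K) (gZ e l) gK by move=> *; apply/qcomm_symN/(rKZ rels).
have qE : forall e l, qcomm (-1 : K) (gZ e l) gE by move=> *; apply/qcomm_symN/(rEZ rels).
have qL : forall e l, qcomm (-1 : K) (gZ e l) gL by move=> *; apply/qcomm_symN/(rLZ rels).
have qF : forall e l, qcomm (1 : K) (gZ e l) gF by move=> *; apply/qcomm_sym1/(rFZ rels).
suff k : Zkilled (Ssum * ((1 + gL) * (Ksum * (gF ^+ n * (gE ^+ n * 1))))).
  by have := k e l; rewrite mulr1 /Lam !mulrA.
apply: Zkilled_sum => s e' l'.
have SZ x : gZ e' l' * (gS s * x) * Zt = gS s * (gZ e' (s^-1%g l') * x * Zt).
  by rewrite !mulrA (rSZ rels) permKV.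
rewrite SZ; suff h : Zkilled ((1 + gL) * (Ksum * (gF ^+ n * (gE ^+ n * 1)))).
  by rewrite h mulr0.
move=> {s e' l' SZ}.
suff k : Zkilled (Ksum * (gF ^+ n * (gE ^+ n * 1))).
  move=> e' l'; rewrite mulrDl mul1r mulrDr mulrDl k add0r; exact: (Zkilled_q qL k).
apply: Zkilled_sum => c; apply: Zkilled_q => [e' l'|]; first exact: (qcommXr c (qK e' l')).
apply: Zkilled_q => [e' l'|]; first exact: (qcommXr n (qF e' l')).
apply: Zkilled_q => [e' l'|]; first exact: (qcommXr n (qE e' l')).
by move=> e' l'; rewrite mulr1 Z_Zt.
Qed.

(** The elements h satisfying both equations form a subalgebra, so only the generators have to be
    checked. *)
Lemma Lam_two_sided h : h * Lam = counitL q_prim r_dvd8 pres h *: Lam /\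
  Lam * h = counitL q_prim r_dvd8 pres h *: Lam.
Proof.
set eps := counitL q_prim r_dvd8 pres.
pose P : {pred A} := [pred h | (h * Lam == eps h *: Lam) && (Lam * h == eps h *: Lam)].
suff : h \in P by rewrite inE => /andP[/eqP ? /eqP ?].
have ci x : x * Lam = eps x *: Lam -> Lam * x = eps x *: Lam -> x \in P.
  by move=> h1 h2; rewrite inE h1 h2 !eqxx.
have c1 : qcomm (1 : K) gK gK by exact: qcomm_refl.
move: h; apply: (A_ind pres).
- split=> [|c u v]; first by apply: ci; rewrite ?mul0r ?mulr0 linear0 scale0r.
  rewrite !inE => /andP[/eqP hu /eqP hu'] /andP[/eqP hv /eqP hv']; apply: ci.
    by rewrite mulrDl -pzscaleAl hu hv linearP /= scalerDl scalerA.
  by rewrite mulrDr -pzscaleAr hu' hv' linearP /= scalerDl scalerA.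
- by apply: ci; rewrite ?mul1r ?mulr1 (eps1 q_prim r_dvd8 pres) scale1r.
- move=> x a; rewrite !inE => /andP[/eqP hu /eqP hu'] /andP[/eqP hv /eqP hv']; apply: ci.
    by rewrite -mulrA hv -pzscaleAr hu (epsM q_prim r_dvd8 pres) scalerA mulrC.
  by rewrite mulrA hu' -pzscaleAl hv' (epsM q_prim r_dvd8 pres) scalerA.
- apply: ci; rewrite (eps_K q_prim r_dvd8 pres) scale1r.
    by rewrite (mul_Lam (rSK rels) (rLK rels)) K_B LamE.
  by rewrite (Lam_mul K_Zt) B_K LamE.
- apply: ci; rewrite (eps_E q_prim r_dvd8 pres) scale0r.
    by rewrite (mul_Lam (rSE rels) (rLE rels)) E_bottom mulr0 mul0r.
  by rewrite (Lam_mul E_Zt) -(mulrA _ _ gE) EN !mulr0 mul0r.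
- apply: ci; rewrite (eps_F q_prim r_dvd8 pres) scale0r.
    by rewrite (mul_Lam (rSF rels) (rLF rels)) F_B mulr0 mul0r.
  by rewrite (Lam_mul F_Zt) bottom_F mulr0 mul0r.
- have LB : gL * B = B * gL.
    by apply: comm_B; [exact: rLK rels | exact: rLE rels | exact: rLF rels].
  have LL : gL * (1 + gL) = 1 + gL by rewrite mulrDr mulr1 (rL rels) addrC.
  have LL' : (1 + gL) * gL = 1 + gL by rewrite mulrDl mul1r (rL rels) addrC.
  apply: ci; rewrite (eps_L q_prim r_dvd8 pres) scale1r LamE.
    rewrite !mulrA -Ssum_comm => [|s]; last exact/qcomm_comm/(rSL rels).
    by rewrite -(mulrA Ssum gL) LL.
  by rewrite -LamE (Lam_mul L_Zt) -LB mulrA -(mulrA Ssum) LL' LamE.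
- move=> e l; apply: ci; rewrite (eps_Z q_prim r_dvd8 pres) scale0r; first exact: Z_Lam.
  by rewrite /Lam -mulrA Zt_Z mulr0.
move=> s; have SB : gS s * B = B * gS s.
  by apply: comm_B; [exact: rSK rels s | exact: rSE rels s | exact: rSF rels s].
have SL : gS s * (1 + gL) = (1 + gL) * gS s.
  have /qcomm_comm h := rSL rels s.
  by rewrite mulrDr mulrDl h mulr1 mul1r.
apply: ci; rewrite (eps_S q_prim r_dvd8 pres) scale1r LamE; first by rewrite !mulrA S_Ssum.
by rewrite -LamE (Lam_mul (S_Zt s)) -SB -!mulrA (mulrA _ (gS s)) -SL -mulrA (mulrA Ssum) Ssum_S !mulrA LamE !mulrA.
Qed.
End Cointegral.

(** * The letter filtration *)

Section Filtration.
Variables (p r : nat) (K : fieldType) (q : K).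
Hypotheses (q_prim : r.-primitive_root q) (r_dvd8 : (8 %| r)%N).
Local Notation N := (r %/ 2)%N.
Variables (A : pzAlgType K) (gK gE gF gL : A) (gZ : bool -> 'I_p -> A) (gS : 'S_p -> A).
Hypothesis pres : presentation r q gK gE gF gL gZ gS.
Local Notation z := (q ^+ 2).
Local Notation t := (q ^- 2).
Local Notation T := (tensor A A).
Let N0 : (0 < N)%N := N_gt0 q_prim r_dvd8.
Local Notation n := N.-1.
Local Notation rels := (pres_rels pres).
Local Notation Ki := (Ki r gK).
Local Notation Lb := (Lb r gK gL).
Local Notation Zt := (Zt gZ).
Local Notation word := (word gK gE gF gL gZ gS).
Local Notation Fil := (Fil gK gE gF gL gZ gS).
Local Notation img := (img gK gE gF gL gZ gS).
Local Notation D := (comulL q_prim r_dvd8 pres).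
Local Notation eps := (counitL q_prim r_dvd8 pres).

Lemma wordM' k l a b : word k a -> word l b -> word (k + l) (a * b).
Proof.
move=> wa wb; elim: wa => [|x k' a' _ IH]; first by rewrite mul1r.
by rewrite -mulrA -addnA; apply: wordM.
Qed.
Lemma Fil_sub k : submod_closed (Fil k). Proof. exact: span_submod_closed. Qed.
Lemma Fil_mono j k : (j <= k)%N -> {subset Fil j <= Fil k}.
Proof.
move=> jk; apply: span_ind; first exact: Fil_sub.
by move=> x [i ij wx]; apply: span_gen; exists i => //; exact: leq_trans jk.
Qed.
Lemma FilM k l a b : a \in Fil k -> b \in Fil l -> a * b \in Fil (k + l).
Proof.
move=> + bl; move: a; apply: (span_map (f := fun a : A => a * b)); [lin | exact: Fil_sub |].
move=> a [j jk wa]; move: b bl; apply: (span_map (f := fun b : A => a * b));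
  [lin | exact: Fil_sub |].
move=> b [i il wb]; apply: span_gen; exists (j + i)%N; first exact: leq_add.
exact: wordM'.
Qed.
Lemma Fil_word k a : word k a -> a \in Fil k.
Proof. by move=> w; apply: span_gen; exists k. Qed.
Lemma Fil_img x : img x \in Fil (gdeg x).
Proof. by apply: Fil_word; rewrite -[img x]mulr1 -[gdeg x]addn0; apply/wordM/word1. Qed.
Lemma Fil1 : 1 \in Fil 0. Proof. exact/Fil_word/word1. Qed.
Lemma Fil_ex a : exists k, a \in Fil k.
Proof.
pose P : {pred A} := fun a => `[< exists k, a \in Fil k >].
suff : a \in P by move/asboolP.
have PM x b : b \in P -> img x * b \in P.
  move=> /asboolP [k bk]; apply/asboolP; exists (gdeg x + k)%N.
  by apply: FilM => //; exact: Fil_img.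
move: a; apply: (pres_ind pres) => //; last by apply/asboolP; exists 0%N; exact: Fil1.
split=> [|c u v /asboolP[k uk] /asboolP[l vl]]; apply/asboolP.
  by exists 0%N; case: (Fil_sub 0).
exists (maxn k l); case: (Fil_sub (maxn k l)) => _; apply.
  by apply: Fil_mono uk; rewrite leq_maxl.
by apply: Fil_mono vl; rewrite leq_maxr.
Qed.
Lemma Fil_K m : gK ^+ m \in Fil 0.
Proof.
elim: m => [|m IH]; first exact: Fil1.
by rewrite exprS -[0%N]add0n; apply: FilM => //; exact: (Fil_img (genK p)).
Qed.
Lemma Fil_Ki : Ki \in Fil 0. Proof. exact: Fil_K. Qed.
Lemma Fil_Lb : Lb \in Fil 0.
Proof. by rewrite /Lb -[0%N]add0n; apply: FilM; [exact: Fil_K | exact: (Fil_img (genL p))]. Qed.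

Definition TFil k : {pred T} := Defs.span (fun u : T => exists i (y z : A),
  [/\ (i <= k)%N, y \in Fil i, z \in Fil (k - i)%N & u = tens y z]).
Lemma TFil_gen i j k y z : (i + j <= k)%N -> y \in Fil i -> z \in Fil j -> tens y z \in TFil k.
Proof.
move=> ijk yi zj; apply: span_gen; exists i, y, z; split=> //.
  exact: leq_trans (leq_addr _ _) ijk.
by apply: Fil_mono zj; rewrite leq_subRL ?ijk // (leq_trans (leq_addr _ _) ijk).
Qed.
Lemma TFilD k u v : u \in TFil k -> v \in TFil k -> u + v \in TFil k.
Proof.
by move=> hu hv; have [_ h] := span_submod_closed (fun u : T => exists i (y z : A),
  [/\ (i <= k)%N, y \in Fil i, z \in Fil (k - i)%N & u = tens y z]);
  have := h 1 _ _ hu hv; rewrite scale1r.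
Qed.
Lemma TFilM k l u v : u \in TFil k -> v \in TFil l -> u * v \in TFil (k + l).
Proof.
move=> + vl; move: u; apply: (span_map (f := fun u : T => u * v));
  [lin | exact: span_submod_closed |].
move=> _ [i [y [w [ik yi wi ->]]]]; move: v vl; apply: (span_map (f := fun v : T => tens y w * v));
  [lin | exact: span_submod_closed |].
move=> _ [j [y' [w' [jl yj wj ->]]]]; rewrite tensM.
apply: (TFil_gen _ (FilM yi yj) (FilM wi wj)); lia.
Qed.
Lemma D_img_TFil x : D (img x) \in TFil (gdeg x).
Proof.
have F1 := Fil1; have FI := Fil_img x.
case: x FI => [||||e l|s] FI.
- by change (D gK \in TFil 0); rewrite D_K; apply: (TFil_gen (leqnn _) FI FI).
- change (D gE \in TFil 1); rewrite D_E; apply: TFilD; first exact: (TFil_gen (leqnn _) F1 FI).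
  exact: (TFil_gen (leqnn _) FI (Fil_img (genK p))).
- change (D gF \in TFil 1); rewrite D_F; apply: TFilD; first exact: (TFil_gen (leqnn _) FI F1).
  exact: (TFil_gen (leqnn _) Fil_Ki FI).
- by change (D gL \in TFil 0); rewrite D_L; apply: (TFil_gen (leqnn _) FI FI).
- change (D (gZ e l) \in TFil 1); rewrite D_Z; apply: TFilD; first exact: (TFil_gen (leqnn _) F1 FI).
  exact: (TFil_gen (leqnn _) FI Fil_Lb).
by change (D (gS s) \in TFil 0); rewrite D_S; apply: (TFil_gen (leqnn _) FI FI).
Qed.
Lemma D_Fil k a : a \in Fil k -> D a \in TFil k.
Proof.
have hD := hD q_prim r_dvd8 pres.
move: a; apply: (span_map (f := D)); [exact: linearP | exact: span_submod_closed |].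
move=> a [j jk wa]; have : D a \in TFil j.
  elim: wa => [|x i b _ IH]; last by rewrite (alghomM hD); apply: TFilM => //; exact: D_img_TFil.
  by rewrite (alghom1 hD) tens1; exact: (TFil_gen (leqnn _) Fil1 Fil1).
apply: span_ind; first exact: span_submod_closed.
move=> _ [i [y [w [ij yi wi ->]]]]; apply: TFil_gen yi wi; lia.
Qed.

Definition lower k : {pred T} := Defs.span (fun u : T => exists j (y z : A),
  [/\ (j < k)%N, y \in Fil j & u = tens y z]).
Lemma lower_sub k : submod_closed (lower k). Proof. exact: span_submod_closed. Qed.
Lemma lowerD k u v : u \in lower k -> v \in lower k -> u + v \in lower k.
Proof. by move=> hu hv; have [_ h] := lower_sub k; have := h 1 _ _ hu hv; rewrite scale1r. Qed.
Lemma lower_mono j k u : (j <= k)%N -> u \in lower j -> u \in lower k.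
Proof.
move=> jk; move: u; apply: span_ind; first exact: lower_sub.
move=> _ [i [y [w [ij yi ->]]]]; apply: span_gen; exists i, y, w; split=> //.
exact: leq_trans jk.
Qed.
Lemma lowerM k l m u v : (k + l <= m.+1)%N -> u \in lower k -> v \in lower l -> u * v \in lower m.
Proof.
move=> klm + vl; move: u; apply: (span_map (f := fun u : T => u * v));
  [lin | exact: lower_sub |].
move=> _ [i [y [w [ik yi ->]]]]; move: v vl; apply: (span_map (f := fun v : T => tens y w * v));
  [lin | exact: lower_sub |].
move=> _ [j [y' [w' [jl yj ->]]]]; rewrite tensM; apply: span_gen.
exists (i + j)%N, (y * y'), (w * w'); split=> //; [lia | exact: FilM].
Qed.
(** A leading term in which only the left leg is graded. As rho vanishes below the top degree,
    applying it to the left leg of such a tensor of top degree returns rho(x) g. *)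
Definition leads k (x g : A) (u : T) := x \in Fil k /\ u - tens x g \in lower k.
Lemma leads_lower k x g u : leads k x g u -> u \in lower k.+1.
Proof.
move=> [xk h]; rewrite -[u](subrK (tens x g)); apply: lowerD; first exact: lower_mono h.
by apply: span_gen; exists k, x, g.
Qed.
Lemma leadsM k l x y g h u v : leads k x g u -> leads l y h v ->
  leads (k + l) (x * y) (g * h) (u * v).
Proof.
move=> L1 L2; have [xk h1] := L1; have [yl h2] := L2; split; first exact: FilM.
have -> : u * v - tens (x * y) (g * h) = (u - tens x g) * v + tens x g * (v - tens y h).
  by rewrite mulrBl mulrBr tensM addrA subrK.
apply: lowerD; first by apply: lowerM h1 (leads_lower L2); rewrite addnS.
apply: (@lowerM k.+1 l) h2; rewrite ?addSn //.
by apply: span_gen; exists k, x, g.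
Qed.
Lemma leads_refl k x g : x \in Fil k -> leads k x g (tens x g).
Proof. by move=> xk; split=> //; rewrite subrr; case: (lower_sub k). Qed.
Lemma leads1 : leads 0 1 1 1. Proof. exact/leads_refl/Fil1. Qed.
Lemma leadsX k x g u m : leads k x g u -> leads (k * m) (x ^+ m) (g ^+ m) (u ^+ m).
Proof.
move=> h; elim: m => [|m IH]; first by rewrite muln0; exact: leads1.
by rewrite mulnS !exprS; exact: leadsM.
Qed.
Lemma leads_E : leads 1 gE gK (D gE).
Proof.
split; first exact: (Fil_img (genE p)).
rewrite D_E addrK; apply: span_gen; exists 0%N, 1, gE; split=> //; exact: Fil1.
Qed.
Lemma leads_F : leads 1 gF 1 (D gF).
Proof.
split; first exact: (Fil_img (genF p)).
rewrite D_F addrC addKr; apply: span_gen; exists 0%N, Ki, gF; split=> //; exact: Fil_Ki.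
Qed.
Lemma leads_Z e l : leads 1 (gZ e l) Lb (D (gZ e l)).
Proof.
split; first exact: (Fil_img (genZ e l)).
rewrite D_Z addrK; apply: span_gen; exists 0%N, 1, (gZ e l); split=> //; exact: Fil1.
Qed.
(** The right legs Lbar coming from Z_l^+ and Z_l^- multiply to 1. *)
Lemma leads_Zt : leads (2 * p) Zt 1 (D Zt).
Proof.
have hD := hD q_prim r_dvd8 pres.
suff h (L : seq 'I_p) : leads (2 * size L) (\prod_(l <- L) (gZ true l * gZ false l)) 1
    (D (\prod_(l <- L) (gZ true l * gZ false l))).
  have := h (index_enum 'I_p).
  by rewrite [X in leads (2 * X)](_ : _ = p) // [index_enum _]unlock -enumT size_enum_ord.
elim: L => [|l L IH]; first by rewrite !big_nil (alghom1 hD); exact: leads1.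
have -> : (2 * size (l :: L) = 2 + 2 * size L)%N by rewrite /= mulnS.
rewrite !big_cons (alghomM hD (_ * _)) -[X in leads _ _ X _]mulr1.
apply: leadsM => //; rewrite (alghomM hD) -[X in leads _ _ X _](LbLb q_prim r_dvd8 rels).
exact: (leadsM (leads_Z true l) (leads_Z false l)).
Qed.

Hypothesis NK : (N%:R : K) != 0.
Local Notation rho := (rho q_prim r_dvd8 pres).
Lemma papl_leads x g u : leads (n + n + 2 * p) x g u -> papl rho u = rho x *: g.
Proof.
have lr : linear (rho : A -> K^o) by exact: linearP.
have lp := papl_lin lr.
move=> [_ h]; rewrite -[u](subrK (tens x g)) (linD lp) paplE //.
rewrite [X in X + _](_ : _ = 0) ?add0r //; move: (u - _) h.
apply: (span_ker lp) => _ [j [y [w [jk yj ->]]]]; rewrite paplE //.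
by rewrite (rho_Fil q_prim r_dvd8 pres jk yj) scale0r.
Qed.

Lemma SumLam : Lam r gK gE gF gL gZ gS = \sum_(s : 'S_p) \sum_(d < 2) \sum_(c < N)
  gS s * gL ^+ d * gK ^+ c * gF ^+ n * gE ^+ n * Zt.
Proof.
rewrite /Lam /Ssum -!mulrA mulr_suml; apply: eq_bigr => s _.
have -> : 1 + gL = \sum_(d < 2) gL ^+ d by rewrite !big_ord_recr big_ord0 /= add0r expr1.
rewrite mulr_suml mulr_sumr; apply: eq_bigr => d _; rewrite /Ksum mulr_suml !mulr_sumr.
by apply: eq_bigr => c _; rewrite !mulrA.
Qed.

(** Only the leading term of each summand of Λ counts, and rho keeps the summand s = 1, d = 0, c =
    1, whose right leg is K K^n = 1. *)
Lemma papl_rho_Lam : papl rho (D (Lam r gK gE gF gL gZ gS)) = 1.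
Proof.
have hD := hD q_prim r_dvd8 pres.
have lp : linear (papl rho) by apply: papl_lin; exact: linearP.
pose gr (s : 'S_p) d c : A := gS s * gL ^+ d * gK ^+ c.
have E s d c : papl rho (D (gS s * gL ^+ d * gK ^+ c * gF ^+ n * gE ^+ n * Zt)) =
    ((s == 1%g) && ~~ odd d && (c == 1 %[mod N]))%:R *: (gr s d c * gK ^+ n).
  rewrite -(rho_top q_prim r_dvd8 pres NK) -[gr s d c * _]mulr1; apply: papl_leads.
  have -> : (n + n + 2 * p = 0 + 1 * n + 1 * n + 2 * p)%N by lia.
  rewrite (alghomM hD) (alghomM hD) (alghomM hD) !(alghomX hD).
  apply: leadsM leads_Zt; apply: leadsM (leadsX n leads_E).
  rewrite -[gr s d c]mulr1 -[1 in X in leads _ _ X _](expr1n _ n).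
  apply: leadsM (leadsX n leads_F).
  have -> : D (gr s d c) = tens (gr s d c) (gr s d c).
    by rewrite !(alghomM hD) !(alghomX hD) D_S D_L D_K !tensX !tensM.
  apply: leads_refl; rewrite /gr -[0%N]addn0; apply: FilM; last exact: Fil_K.
  rewrite -[0%N]addn0; apply: FilM; first exact: (Fil_img (Defs.genS s)).
  elim: d => [|d IH]; first exact: Fil1.
  by rewrite exprS -[0%N]addn0; apply: FilM => //; exact: (Fil_img (genL p)).
have lG : linear (fun x => papl rho (D x)) by exact: (linear_compose lp (@linearP _ _ _ _ D)).
have [G GE] : exists G : A -> A, (fun x => papl rho (D x)) = G by eexists.
rewrite GE in lG; have {}E s d c := etrans (esym (congr1 (fun f => f _) GE)) (E s d c).
rewrite -[LHS]/((fun x => papl rho (D x)) _) GE; have GS := lin_sum lG.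
have n1 : (1 < N)%N by have := N_gt2 q_prim r_dvd8; lia.
rewrite SumLam GS (bigD1 1%g) //= [X in _ + X]big1 ?addr0 => [|s s1]; last first.
  rewrite GS big1 // => d _; rewrite GS big1 // => c _.
  by rewrite E (negPf s1) scale0r.
rewrite GS big_ord_recr big_ord1 /= [X in _ + X]GS [X in _ + X]big1 => [|c _]; last first.
  by rewrite E andbF scale0r.
rewrite addr0 GS (bigD1 (Ordinal n1)) //= E [X in _ + X]big1 ?addr0 => [|c c1].
  by rewrite !eqxx scale1r /gr (rS1 rels) expr0 !mul1r -exprD add1n prednK // (rK rels).
rewrite E eqxx modn_small // modn_small // [_ == _ :> nat](_ : _ = false) ?andbF ?scale0r //.
by apply: contraNF c1 => /eqP h; apply/eqP/val_inj.
Qed.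
End Filtration.

(** * Grouplike elements *)

Section Grouplikes.
Variables (p r : nat) (K : fieldType) (q : K).
Hypotheses (q_prim : r.-primitive_root q) (r_dvd8 : (8 %| r)%N).
Local Notation N := (r %/ 2)%N.
Variables (A : pzAlgType K) (gK gE gF gL : A) (gZ : bool -> 'I_p -> A) (gS : 'S_p -> A).
Hypothesis pres : presentation r q gK gE gF gL gZ gS.
Local Notation z := (q ^+ 2).
Local Notation t := (q ^- 2).
Local Notation T := (tensor A A).
Let N0 : (0 < N)%N := N_gt0 q_prim r_dvd8.
Local Notation n := N.-1.
Local Notation rels := (pres_rels pres).
Local Notation Ki := (Ki r gK).
Local Notation Lb := (Lb r gK gL).
Local Notation Zt := (Zt gZ).
Local Notation word := (word gK gE gF gL gZ gS).
Local Notation Fil := (Fil gK gE gF gL gZ gS).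
Local Notation img := (img gK gE gF gL gZ gS).
Local Notation D := (comulL q_prim r_dvd8 pres).
Local Notation eps := (counitL q_prim r_dvd8 pres).

Hypothesis NK : (N%:R : K) != 0.
Local Notation rho := (rho q_prim r_dvd8 pres).
Local Notation I2 := (bool * 'I_p)%type.

Definition gword s d c : A := gS s * gL ^+ d * gK ^+ c.
(** The coefficient of s L^d K^c. Translation by s^-1, L^d and K^(N-c+1) carries this word to
    K^(N+1) = K, the group part that rho detects. *)
Definition gcoef s d c (x : A) : K :=
  rho (gS s^-1%g * x * (gL ^+ d * gK ^+ (N - c).+1) * gF ^+ n * gE ^+ n * Zt).
Lemma gcoef_lin s d c : linear (gcoef s d c : A -> K^o).
Proof.
have lr : linear (rho : A -> K^o) by exact: linearP.
move=> k x y; rewrite /gcoef -lr; congr (rho _).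
by rewrite mulrDr -pzscaleAr !mulrDl -!pzscaleAl.
Qed.
Lemma gcoefP s d c k x y : gcoef s d c (k *: x + y) = k * gcoef s d c x + gcoef s d c y.
Proof. exact: gcoef_lin. Qed.
Lemma gK_L c d : gK ^+ c * gL ^+ d = gL ^+ d * gK ^+ c.
Proof.
apply: commrX; apply/esym; apply: commrX; apply/esym.
exact/esym/qcomm_comm/(rLK rels).
Qed.
Lemma gcoefE s d c s' d' c' : (c < N)%N ->
  gcoef s d c (gword s' d' c') = ((s' == s) && (d' == d %[mod 2]) && (c' == c %[mod N]))%:R.
Proof.
move=> cN; rewrite /gcoef /gword.
have -> : gS s^-1%g * (gS s' * gL ^+ d' * gK ^+ c') * (gL ^+ d * gK ^+ (N - c).+1) =
  gS (s' * s^-1)%g * gL ^+ (d' + d) * gK ^+ (c' + (N - c).+1).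
  by rewrite -(rSS rels) !exprD -!mulrA [gK ^+ c' * _]mulrA gK_L !mulrA.
rewrite (rho_top q_prim r_dvd8 pres NK); congr (_ %:R); congr (nat_of_bool _).
congr (_ && _ && _).
- by rewrite -(inj_eq (mulIg s)) mulgKV mul1g.
- by rewrite oddD !modn2; case: (odd d); case: (odd d').
rewrite -(eqn_modDr ((N - c).+1) c' c).
have -> : (c + (N - c).+1 = N + 1)%N by lia.
by rewrite modnDl.
Qed.

Definition gspan : {pred A} := Defs.span (fun x => exists s d c, x = gword s d c).
Lemma Fil0_gspan : {subset Fil 0 <= gspan}.
Proof.
apply: span_ind; first exact: span_submod_closed.
move=> a [j j0 w]; have {j0} : j = 0%N by lia.
elim: w => [_|x k b _ IH]; first by apply: span_gen; exists 1%g, 0%N, 0%N; rewrite /gword (rS1 rels) !mulr1.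
move=> xk; have {IH} := IH (ltac:(lia)); have x0 : gdeg x = 0%N by lia.
move: b; apply: (span_map (f := fun b : A => img x * b)); [lin | exact: span_submod_closed |].
move=> _ [s [d [c ->]]]; apply: span_gen.
case: x x0 {xk} => [||||e l|u] // _.
- exists s, d, c.+1; change (gK * gword s d c = gword s d c.+1).
  have /qcomm_comm kS := rSK rels s.
  by rewrite /gword exprS !mulrA -kS -!mulrA [gK * (gL ^+ d * _)]mulrA (gK_L 1 d) !mulrA.
- exists s, d.+1, c; change (gL * gword s d c = gword s d.+1 c).
  by have /qcomm_comm kS := rSL rels s; rewrite /gword exprS !mulrA -kS.
exists (s * u)%g, d, c; change (gS u * gword s d c = gword (s * u) d c).
by rewrite /gword !mulrA (rSS rels).
Qed.

Lemma D_gword s d c : D (gword s d c) = tens (gword s d c) (gword s d c).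
Proof.
have hD := hD q_prim r_dvd8 pres.
by rewrite /gword !(alghomM hD) !(alghomX hD) D_S D_L D_K !tensX !tensM.
Qed.
Lemma gword_mod s d c s' d' c' : s = s' -> d = d' %[mod 2] -> c = c' %[mod N] ->
  gword s d c = gword s' d' c'.
Proof.
have modX (x : A) m k k' : x ^+ m = 1 -> k = k' %[mod m] -> x ^+ k = x ^+ k'.
  by move=> xm kk; rewrite (divn_eq k m) (divn_eq k' m) !exprD !(mulnC _ m) !exprM xm !expr1n kk.
move=> -> hd hc; rewrite /gword (modX _ _ _ _ (_ : gL ^+ 2 = 1) hd) ?(modX _ _ _ _ (rK rels) hc) //.
by rewrite expr2 (rL rels).
Qed.

(** On a word both sides are that word or 0, by orthogonality of the coefficient functionals. *)
Lemma gspan_coef s d c x : (c < N)%N -> x \in gspan ->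
  papl (gcoef s d c) (D x) = gcoef s d c x *: gword s d c.
Proof.
move=> cN; have lp := papl_lin (gcoef_lin s d c).
pose f (x : A) := papl (gcoef s d c) (D x) - gcoef s d c x *: gword s d c.
have lD : linear D by exact: linearP.
have lf : linear f.
  move=> k u v; rewrite /f lD lp (gcoef_lin s d c) scalerDl.
  rewrite -[(k *: (gcoef s d c u : K^o)) *: _]/((k * gcoef s d c u) *: gword s d c) -scalerA.
  by rewrite scalerBr addrACA opprD.
move=> xs; apply/eqP; rewrite -subr_eq0; apply/eqP; move: x xs.
apply: (span_ker lf) => _ [s' [d' [c' ->]]].
rewrite /f D_gword paplE ?(gcoefE _ _ _ _ _ cN); last exact: gcoef_lin.
have [/andP[/andP[/eqP ss /eqP dd] /eqP cc]|_] := boolP (_ && _); last by rewrite !scale0r subrr.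
by rewrite (gword_mod ss dd cc) subrr.
Qed.
Lemma gspan_expand x : x \in gspan ->
  x = \sum_(i : 'S_p * 'I_2 * 'I_N) gcoef i.1.1 i.1.2 i.2 x *: gword i.1.1 i.1.2 i.2.
Proof.
pose f (x : A) := x - \sum_(i : 'S_p * 'I_2 * 'I_N) gcoef i.1.1 i.1.2 i.2 x *: gword i.1.1 i.1.2 i.2.
have lf : linear f.
  move=> k u v; rewrite /f scalerBr scaler_sumr addrACA -opprD -big_split /=.
  congr (_ - _); by apply: eq_bigr => i _; rewrite gcoefP scalerDl scalerA.
move=> xs; apply/eqP; rewrite -subr_eq0; apply/eqP; move: x xs.
apply: (span_ker lf) => _ [s' [d' [c' ->]]]; rewrite /f.
have d2 : (d' %% 2 < 2)%N by rewrite ltn_mod.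
have cN : (c' %% N < N)%N by rewrite ltn_mod.
rewrite (bigD1 (s', Ordinal d2, Ordinal cN)) //= gcoefE // !modn_mod !eqxx scale1r.
rewrite (@gword_mod s' _ _ s' d' c') ?modn_mod // big1 ?addr0 ?subrr // => -[[s d] c] ne.
rewrite gcoefE //= (_ : _ && _ = false) ?scale0r //; apply: contraNF ne => /=.
move=> /andP[/andP[/eqP -> /eqP dd] /eqP cc]; rewrite !xpair_eqE eqxx /=.
by apply/andP; split; apply/eqP/val_inj; rewrite /= ?dd ?cc modn_small.
Qed.

(** Such a w has degree 0 by [grouplike_in_bottom], so it is a combination of words. A coefficient
    functional nonzero on w, applied to the left leg of w ⊗ w, gives w and the word with the same
    factor; if all coefficients vanished, ε(w) would be 0. *)
Lemma grouplike_gword w : D w = tens w w -> eps w = 1 -> exists s d c, w = gword s d c.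
Proof.
move=> Dw ew.
have [m [b [c [lc cE]]]] := frobenius_frame (H := hopfA q_prim r_dvd8 pres)
  (Lam_two_sided q_prim r_dvd8 pres) (papl_rho_Lam q_prim r_dvd8 pres NK).
have w0 : w \in Fil 0.
  apply: (grouplike_in_bottom (H := hopfA q_prim r_dvd8 pres) (F := Fil) lc cE) Dw.
  - by move=> k; exact: Fil_sub.
  - by move=> j k; exact: Fil_mono.
  - exact: Fil_ex pres.
  by move=> k x; exact: D_Fil.
have ws := Fil0_gspan w0.
have [/existsP[[[s d] k] fw]|/existsPn h] :=
  boolP [exists i : 'S_p * 'I_2 * 'I_N, gcoef i.1.1 i.1.2 i.2 w != 0].
  exists s, d, k; have := gspan_coef s d (ltn_ord k) ws; rewrite Dw paplE; last exact: gcoef_lin.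
  by move/(congr1 (GRing.scale (gcoef s d k w)^-1)); rewrite !scalerA mulVf // !scale1r.
move: ew; rewrite (gspan_expand ws) big1 => [|i _]; first by rewrite linear0 => /eqP; rewrite eq_sym oner_eq0.
by move: (h i); rewrite negbK => /eqP ->; rewrite scale0r.
Qed.

Lemma rho_KFEZ : rho (gK * gF ^+ n * gE ^+ n * Zt) = 1.
Proof.
have := rho_top q_prim r_dvd8 pres NK 1%g 0 1.
by rewrite (rS1 rels) expr0 expr1 !mul1r !eqxx.
Qed.
Lemma E_neq0 : gE <> 0.
Proof.
move=> E0; have En : gE ^+ n = 0.
  have n0 : n = n.-1.+1 by have := N_gt2 q_prim r_dvd8; lia.
  by rewrite n0 exprS [gE in LHS]E0 mul0r.
by have := rho_KFEZ; rewrite En mulr0 mul0r linear0 => /eqP; rewrite eq_sym oner_eq0.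
Qed.
Lemma Zw_neq0 w : uniq w -> size w = (2 * p)%N -> Zw gZ w <> 0.
Proof.
move=> uw sw Z0; have k1 : (1 : K) ^+ N = 1 by rewrite expr1n.
have := rho1_top q_prim r_dvd8 pres k1 (mulr1 1) 1%g 0 0 uw sw.
rewrite Z0 mulr0 !expr0 !mul1r.
have l1 := rho1_lin q_prim r_dvd8 pres k1 (mulr1 1).
rewrite (lin0 l1) eqxx mul1r => /esym/eqP.
exact/negP/(stop_word_neq0 K uw sw).
Qed.
(** Two distinct letters extend to a word using every letter once, and such a word acts nontrivially
    on the vacuum. *)
Lemma Z_prod_neq0 i j : i != j -> gZ i.1 i.2 * gZ j.1 j.2 <> 0.
Proof.
move=> ij Z0; pose rest := [seq x <- enum {: I2} | x \notin [:: i; j]].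
have u : uniq [:: i, j & rest].
  rewrite /= inE negb_or ij !mem_filter !inE !eqxx ?orbT /=.
  by rewrite filter_uniq // enum_uniq.
have sz : size [:: i, j & rest] = (2 * p)%N.
  rewrite -card_I2 cardsT cardT; apply/perm_size/uniq_perm; rewrite ?enum_uniq // => x.
  rewrite !mem_enum !inE mem_filter !inE mem_enum /=; by case: (x == i); case: (x == j).
apply: (Zw_neq0 u sz); rewrite /Zw !big_cons mulrA.
by rewrite [_ * gZ j.1 j.2]Z0 mul0r.
Qed.

Hypothesis p0 : (0 < p)%N.
(** Let w = s L^d K^c. Commuting with E forces q^{2c} = 1, so K^c = 1. Commuting with Z_l forces Z_l
    = ± Z_{s(l)}: if s moved l, the product Z_l Z_{s(l)} would vanish, and with s = 1 an odd d would
    give Z_l = -Z_l. *)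
Lemma central_grouplike_trivial w : D w = tens w w -> eps w = 1 ->
  (forall x, w * x = x * w) -> w = 1.
Proof.
move=> Dw ew wC; have [s [d [c wE]]] := grouplike_gword Dw ew.
pose w' : A := gK ^+ (c * n) * gL ^+ d * gS s^-1%g.
have LL k : gL ^+ k * gL ^+ k = 1.
  by rewrite -exprMn_comm // (rL rels) expr1n.
have ww' : w * w' = 1.
  rewrite wE /gword /w' -!mulrA (mulrA (gK ^+ c)) -exprD -mulnS prednK // mulnC exprM.
  by rewrite (rK rels) expr1n mul1r (mulrA _ _ (gS _)) LL mul1r (rSS rels) mulVg (rS1 rels).
have canc x y : x * w = y * w -> x = y.
  by move/(congr1 (fun u => u * w')); rewrite -!mulrA ww' !mulr1.
have qwE : qcomm (z ^+ c) w gE.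
  rewrite wE; apply: qcomm_eq (qcommMl (qcommMl (rSE rels s) (qcommXl d (rLE rels))) (qcommXl c (rKE rels))) _.
  by rewrite expr1n !mul1r.
have zc : z ^+ c = 1.
  apply/eqP; apply: contra_notT E_neq0; rewrite -subr_eq0 => zc.
  apply: canc; rewrite mul0r -[LHS]scale1r -(mulVf zc) -scalerA scalerBl scale1r -qwE wC subrr.
  by rewrite scaler0.
have Kc : gK ^+ c = 1.
  move/eqP: zc; rewrite -(prim_order_dvd (q2_prim q_prim r_dvd8)) => /dvdnP[k ->].
  by rewrite mulnC exprM (rK rels) expr1n.
have wZ e l : gZ e l = (-1) ^+ d *: gZ e (s l).
  apply: canc; rewrite -wC wE /gword Kc mulr1 -mulrA.
  rewrite (qcommXl d (rLZ rels e l)) -pzscaleAr mulrA (rSZ rels) -mulrA pzscaleAl.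
  by [].
have s1 : s = 1%g.
  apply/permP => l; rewrite perm1; apply/eqP; apply: contraT => sl.
  have ne : (true, l) != (true, s l) :> I2 by rewrite xpair_eqE eq_sym.
  case: (Z_prod_neq0 ne) => /=; rewrite [gZ true l]wZ -pzscaleAl (rZ2 rels) scaler0 //.
have d2 : ~~ odd d.
  apply/negP => od; pose l := Ordinal p0.
  have := wZ true l; rewrite s1 perm1 -signr_odd od expr1 scaleN1r => /eqP.
  rewrite -addr_eq0 -mulr2n -scaler_nat => /eqP h.
  have ne : (true, l) != (false, l) :> I2 by [].
  case: (Z_prod_neq0 ne) => /=.
  by rewrite -[gZ true l]scale1r -(mulVf (two_neq0 q_prim r_dvd8)) -scalerA h scaler0 mul0r.
rewrite wE /gword s1 (rS1 rels) Kc mulr1 mul1r.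
by rewrite -(odd_double_half d) (negPf d2) add0n -mul2n exprM expr2 (rL rels) expr1n.
Qed.
End Grouplikes.

(** * Bicharacters and hexagons *)

Section Bicharacter.
Variables (K : fieldType) (A : pzAlgType K) (g : A) (m : nat) (w : K).
Hypotheses (gm : g ^+ m = 1) (w_prim : m.-primitive_root w) (m0 : (m%:R : K) != 0).
Local Notation T := (tensor A A).

(** The idempotent for the eigenvalue w^-b of g. These idempotents are the Fourier dual of the
    powers of g. *)
Definition bidem b : A := m%:R^-1 *: \sum_(c < m) w ^+ (b * c)%N *: g ^+ c.
(** R_z is the case g = L, m = 2, w = -1, and D is the case g = K, m = N, w = q^-2. *)
Definition bichar : T :=
  m%:R^-1 *: \sum_(b < m) \sum_(c < m) w ^+ (b * c)%N *: tens (g ^+ b) (g ^+ c).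

Lemma bicharEl : bichar = \sum_(b < m) tens (g ^+ b) (bidem b).
Proof.
rewrite /bichar scaler_sumr; apply: eq_bigr => b _.
rewrite tensZr; congr (_ *: _); rewrite tens_sumr; apply: eq_bigr => c _; by rewrite tensZr.
Qed.
Lemma bicharEr : bichar = \sum_(c < m) tens (bidem c) (g ^+ c).
Proof.
rewrite /bichar exchange_big scaler_sumr; apply: eq_bigr => c _.
rewrite tensZl; congr (_ *: _); rewrite tens_suml; apply: eq_bigr => b _.
by rewrite tensZl mulnC.
Qed.

Let wm : w ^+ m = 1. Proof. exact: prim_expr_order. Qed.
Let m_gt0 : (0 < m)%N. Proof. exact: prim_order_gt0 w_prim. Qed.
Lemma w_neq0 : w != 0.
Proof. by apply: contra_eq_neq wm => ->; rewrite expr0n eqn0Ngt m_gt0 eq_sym oner_neq0. Qed.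

Lemma bidem_eigen b : g * bidem b = w ^- b *: bidem b.
Proof.
have wb0 : w ^+ b != 0 by rewrite expf_neq0 ?w_neq0.
pose f c := w ^+ (b * c)%N *: g ^+ c.
have fm : f m = f 0%N by rewrite /f gm muln0 mulnC exprM wm expr1n.
have sh : \sum_(c < m) f c.+1 = \sum_(c < m) f c.
  by rewrite -(prednK m_gt0) big_ord_recr [RHS]big_ord_recl /= prednK // fm addrC.
rewrite /bidem -pzscaleAr scalerA mulrC -scalerA; congr (_ *: _).
rewrite -[in RHS]sh mulr_sumr scaler_sumr; apply: eq_bigr => c _.
by rewrite /f -pzscaleAr -exprS scalerA mulnS exprD mulKf.
Qed.
Lemma bidem_eigenX k b : g ^+ k * bidem b = (w ^- k) ^+ b *: bidem b.
Proof.
elim: k => [|k IH]; first by rewrite mul1r expr0 invr1 expr1n scale1r.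
rewrite exprS -mulrA IH -pzscaleAr bidem_eigen scalerA; congr (_ *: _).
by rewrite !exprVn -invfM -!exprM -exprD mulSn addnC.
Qed.

Lemma sum_root_unity (x : K) : x ^+ m = 1 -> \sum_(b < m) x ^+ b = m%:R * (x == 1)%:R.
Proof.
move=> xm; have [->|x1] := eqVneq x 1.
  by under eq_bigr do rewrite expr1n; rewrite sumr_const card_ord mulr1.
have x10 : x - 1 != 0 by rewrite subr_eq0.
by apply: (mulfI x10); rewrite -subrX1 xm subrr !mulr0.
Qed.
Lemma bidem_sum : \sum_(b < m) bidem b = 1.
Proof.
rewrite -scaler_sumr exchange_big /=.
transitivity (m%:R^-1 *: \sum_(c < m) (m%:R * ((w ^+ c == 1)%:R : K)) *: g ^+ c).
  congr (_ *: _); apply: eq_bigr => c _; rewrite -scaler_suml; congr (_ *: _).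
  rewrite -sum_root_unity; last by rewrite -exprM mulnC exprM wm expr1n.
  by apply: eq_bigr => b _; rewrite -exprM mulnC.
rewrite (bigD1 (Ordinal m_gt0)) //= expr0 eqxx mulr1 big1 ?addr0 => [|c c0].
  by rewrite scalerA mulVf // scale1r.
rewrite -(prim_order_dvd w_prim) (_ : (m %| c)%N = false) ?mulr0 ?scale0r //.
by apply: contraNF c0 => /dvdn_leq h; apply/eqP/val_inj => /=; have := ltn_ord c; lia.
Qed.
Lemma bidemM (b c : 'I_m) : bidem b * bidem c = (b == c)%:R *: bidem c.
Proof.
rewrite {1}/bidem -pzscaleAl mulr_suml.
have -> : \sum_(i < m) (w ^+ (b * i) *: g ^+ i) * bidem c =
   (\sum_(i < m) (w ^+ b * w ^- c) ^+ i) *: bidem c.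
  rewrite scaler_suml; apply: eq_bigr => i _.
  by rewrite -pzscaleAl bidem_eigenX scalerA exprMn -!exprM !exprVn -!exprM (mulnC i).
rewrite sum_root_unity; last first.
  by rewrite exprMn exprVn (exprAC w b) (exprAC w c) wm !expr1n invr1 mulr1.
rewrite scalerA mulrA mulVf // mul1r; congr (_ %:R *: _).
rewrite -(inj_eq (mulIf (expf_neq0 c w_neq0))) mulfVK ?expf_neq0 ?w_neq0 // mul1r.
by rewrite (eq_prim_root_expr w_prim) !modn_small.
Qed.

(** Passing x costs c^b in front of [bidem b], and c^b = w^(-kb) is the scalar by which g^k acts on
    that idempotent. *)
Lemma bichar_l c x k : qcomm c g x -> c = w ^- k ->
  bichar * tens x (1 : A) = tens x (g ^+ k) * bichar.
Proof.
move=> gx ck; rewrite bicharEl mulr_suml mulr_sumr; apply: eq_bigr => b _.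
rewrite !tensM mulr1 (qcommXl b gx : g ^+ b * x = _) bidem_eigenX -ck.
by move: (bidem b) => e; rewrite tensZl tensZr.
Qed.
Lemma bichar_r c x k : qcomm c g x -> c = w ^- k ->
  bichar * tens (1 : A) x = tens (g ^+ k) x * bichar.
Proof.
move=> gx ck; rewrite bicharEr mulr_suml mulr_sumr; apply: eq_bigr => b _.
rewrite !tensM mulr1 (qcommXl b gx : g ^+ b * x = _) bidem_eigenX -ck.
by move: (bidem b) => e; rewrite tensZl tensZr.
Qed.

(** Writing the bicharacter as the sum of g^b ⊗ e_b, orthogonality of the e_b leaves only the
    diagonal terms g^b ⊗ g^b ⊗ e_b. *)
Lemma bichar_hexl (D : A -> T) : alghom D -> D g = tens g g ->
  tmap D (@id A) bichar = tmap (fun a : A => tens a (1 : A)) (@id A) bichar *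
    tmap (fun a : A => tens (1 : A) a) (@id A) bichar.
Proof.
move=> hD Dg; have hi := @alghom_id K A.
have h1 : alghom (fun a : A => tens a (1 : A)) := alghom_tensl A A.
have h2 : alghom (fun a : A => tens (1 : A) a) := alghom_tensr A A.
rewrite bicharEl !(lin_sum (alghom_lin (alghom_tmap _ hi))) //.
rewrite mulr_suml; apply: eq_bigr => b _; rewrite mulr_sumr.
rewrite !tmapE // (bigD1 b) //= tmapE // big1 ?addr0 => [|c cb].
  by rewrite !tensM mulr1 mul1r bidemM eqxx scale1r (alghomX hD) Dg tensX.
by rewrite !tmapE // !tensM bidemM eq_sym (negPf cb) scale0r tens0r.
Qed.
Lemma bichar_hexr (D : A -> T) : alghom D -> D g = tens g g ->
  tmap (@id A) D bichar = tmap (@id A) (fun a : A => tens a (1 : A)) bichar *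
    tmap (@id A) (fun a : A => tens (1 : A) a) bichar.
Proof.
move=> hD Dg; have hi := @alghom_id K A.
have h1 : alghom (fun a : A => tens a (1 : A)) := alghom_tensl A A.
have h2 : alghom (fun a : A => tens (1 : A) a) := alghom_tensr A A.
rewrite bicharEr !(lin_sum (alghom_lin (alghom_tmap hi _))) //.
rewrite mulr_suml; apply: eq_bigr => b _; rewrite mulr_sumr.
rewrite !tmapE // (bigD1 b) //= tmapE // big1 ?addr0 => [|c cb].
  by rewrite !tensM mulr1 mul1r bidemM eqxx scale1r (alghomX hD) Dg tensX.
by rewrite !tmapE // !tensM bidemM eq_sym (negPf cb) scale0r tens0l.
Qed.
End Bicharacter.

Section Intertwine.
Variables (K : fieldType) (t : K) (N : nat) (I : Type).
Lemma prod_intertwine (B : pzAlgType K) (s : seq I) (f f' : I -> B) y : (forall i, f i * y = y * f' i) ->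
  (\prod_(i <- s) (1 + f i)) * y = y * \prod_(i <- s) (1 + f' i).
Proof.
move=> h; elim: s => [|i s IH]; first by rewrite !big_nil mul1r mulr1.
by rewrite !big_cons -mulrA IH !mulrA mulrDl mulrDr mul1r mulr1 h.
Qed.
Lemma qexp_intertwine (B : pzAlgType K) (x x' y : B) : x * y = y * x' ->
  qexp t N x * y = y * qexp t N x'.
Proof.
move=> h; rewrite /qexp mulr_suml mulr_sumr; apply: eq_bigr => a _.
rewrite /divp -pzscaleAl -pzscaleAr; congr (_ *: _).
elim: (nat_of_ord a) => [|k IH]; first by rewrite mul1r mulr1.
by rewrite exprSr -mulrA h mulrA IH exprSr mulrA.
Qed.

End Intertwine.

(** * An abstract hexagon identity *)

Section Hexagon.
Variables (K : fieldType) (T C : pzAlgType K) (D j1 j2 : T -> C).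
Hypotheses (hD : alghom D) (h1 : alghom j1) (h2 : alghom j2).
Variables (t : K) (N : nat) (I : Type) (L : seq I) (R0 EF : T) (zz : I -> T).
Variables (XE : C) (XZ : I -> C).
Hypothesis qn : forall i, (0 < i < N)%N -> qnum t i != 0.
Hypotheses (DR0 : D R0 = j1 R0 * j2 R0)
  (DEF : D EF = XE + j2 EF) (YX : qcomm t (j2 EF) XE)
  (XY0 : forall i j, (N <= i + j)%N -> XE ^+ i * j2 EF ^+ j = 0)
  (EF_R0 : j1 EF * j2 R0 = j2 R0 * XE)
  (Dzz : forall i, D (zz i) = XZ i + j2 (zz i))
  (zz_R0 : forall i, j1 (zz i) * j2 R0 = j2 R0 * XZ i)
  (XZ_zz : forall i, XZ i * j2 (zz i) = 0)
  (XZ_comm : forall i j, XZ i * j2 (zz j) = j2 (zz j) * XZ i)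
  (XZ_EF : forall i, XZ i * j2 EF = j2 EF * XZ i).

(** Here [D] is Δ on one leg, and [j1], [j2] insert R into two of three legs. The elements [XE] and
    [XZ i] are both the remaining parts of [D EF] and [D (zz i)] and what [j1 EF] and [j1 (zz i)]
    become when moved past [j2 R0]. Hence splitting the exponentials of the left side and reordering
    the right side give the same product. *)
Lemma hexagon_product R : R = R0 * qexp t N EF * \prod_(i <- L) (1 + zz i) ->
  D R = j1 R * j2 R.
Proof.
move=> ->; rewrite !(alghomM hD) !(alghomM h1) !(alghomM h2) !(alghom_qexp _ _ hD, alghom_qexp _ _ h1, alghom_qexp _ _ h2).
rewrite !(alghom_prod hD, alghom_prod h1, alghom_prod h2) DR0 DEF (qexp_add qn YX XY0).
have E (f : T -> C) : alghom f -> forall s, \prod_(i <- s) f (1 + zz i) = \prod_(i <- s) (1 + f (zz i)).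
  by move=> hf s; apply: eq_bigr => i _; rewrite (linD (alghom_lin hf)) (alghom1 hf).
rewrite !(E D, E j1, E j2) //.
have -> : \prod_(i <- L) (1 + D (zz i)) =
    (\prod_(i <- L) (1 + XZ i)) * \prod_(i <- L) (1 + j2 (zz i)).
  elim: L => [|i s IH]; first by rewrite !big_nil mulr1.
  rewrite !big_cons IH Dzz.
  have -> : 1 + (XZ i + j2 (zz i)) = (1 + XZ i) * (1 + j2 (zz i)).
    by rewrite mulrDr mulr1 mulrDl mul1r XZ_zz addr0 addrA.
  rewrite -!mulrA; congr (_ * _); rewrite !mulrA; congr (_ * _).
  by symmetry; apply: prod_intertwine => k; rewrite mulrDr mulrDl mulr1 mul1r XZ_comm.
have PR := prod_intertwine L zz_R0; have QR := qexp_intertwine t N EF_R0.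
have PQ : (\prod_(i <- L) (1 + XZ i)) * qexp t N (j2 EF) =
    qexp t N (j2 EF) * \prod_(i <- L) (1 + XZ i).
  by symmetry; apply: qexp_intertwine; symmetry; apply: prod_intertwine.
rewrite -!mulrA; congr (_ * _); rewrite [in RHS](mulrA (\prod_(i <- L) _)) PR.
rewrite -!mulrA [in RHS](mulrA (qexp t N (j1 EF))) QR -!mulrA; congr (_ * (_ * _)).
by rewrite [in RHS]mulrA PQ -!mulrA.
Qed.
End Hexagon.

(** * The R-matrix *)

Section Rmatrix.
Variables (p r : nat) (K : fieldType) (q : K).
Hypotheses (q_prim : r.-primitive_root q) (r_dvd8 : (8 %| r)%N).
Local Notation N := (r %/ 2)%N.
Variables (A : pzAlgType K) (gK gE gF gL : A) (gZ : bool -> 'I_p -> A) (gS : 'S_p -> A).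
Hypothesis pres : presentation r q gK gE gF gL gZ gS.
Local Notation z := (q ^+ 2).
Local Notation t := (q ^- 2).
Local Notation T := (tensor A A).
Let N0 : (0 < N)%N := N_gt0 q_prim r_dvd8.
Local Notation n := N.-1.
Local Notation rels := (pres_rels pres).
Local Notation Ki := (Ki r gK).
Local Notation Lb := (Lb r gK gL).
Local Notation Zt := (Zt gZ).

Local Notation D := (comulL q_prim r_dvd8 pres).
Local Notation eps := (counitL q_prim r_dvd8 pres).
Local Notation r'' := (r %/ 4)%N.
Hypothesis NK : (N%:R : K) != 0.
Local Notation I2 := (bool * 'I_p)%type.

Definition Rz_ : T :=
  2^-1 *: \sum_(v < 2) \sum_(w < 2) (-1) ^+ (v * w)%N *: tens (gL ^+ w) (gL ^+ v).
Definition Dmx_ : T :=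
  N%:R^-1 *: \sum_(b < N) \sum_(c < N) q ^- (2 * b * c)%N *: tens (gK ^+ b) (gK ^+ c).
Definition Theta_ : T :=
  \sum_(a < N) (qbrace q 1 ^+ a / qfact q a * q ^+ ((a * a.-1) %/ 2)%N) *:
    tens (gE ^+ a) (gF ^+ a).
Definition Rbar_ (alpha : 'I_p -> K) : T :=
  \prod_(l < p) ((1 + alpha l *: tens (gZ true l) (Lb * gZ false l)) *
                 (1 - alpha l *: tens (gZ false l) (Lb * gZ true l))).
Definition Rmat : T := Rz_ * Dmx_ * Theta_ * Rbar_ (fun=> 1).

Local Notation BL := (bichar gL 2 (-1)).
Local Notation BK := (bichar gK N t).
Definition R0 : T := BL * BK.
(** Absorbs the factor {1}^a of Θ, so that Θ becomes the q-exponential of [EF]. *)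
Definition E1 : A := qbrace q 1 *: gE.
(** The letter (false, l) stands for -Z_l^-, with the sign of the second term in the exponent of
    Rbar. *)
Definition sgZ (i : I2) : A := (-1) ^+ (~~ i.1) *: gZ i.1 i.2.
Definition LZ (i : I2) : A := Lb * gZ (~~ i.1) i.2.
Definition EF : T := tens E1 gF.
Definition zz (i : I2) : T := tens (sgZ i) (LZ i).

Lemma RzE : Rz_ = BL.
Proof.
rewrite /Rz_ /bichar exchange_big; congr (_ *: _); apply: eq_bigr => v _.
by apply: eq_bigr => w _; rewrite mulnC.
Qed.
Lemma DmxE : Dmx_ = BK.
Proof.
rewrite /Dmx_ /bichar; congr (_ *: _); apply: eq_bigr => b _; apply: eq_bigr => c _.
by rewrite -mulnA exprM -exprVn.
Qed.

(** Passage from the symmetric q-integers to the sums 1 + t + ... + t^i with t = q^-2. *)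
Lemma qint_qnum i : qint q i.+1 = q ^+ i * qnum t i.+1.
Proof.
have q0 := q_neq0 q_prim r_dvd8; have b0 := q_qinv_neq0 q_prim r_dvd8.
have qb1 : qbrace q 1 = q - q^-1 by rewrite /qbrace expr1.
rewrite /qint qb1; apply: (mulIf b0); rewrite mulfVK //.
have -> : q - q^-1 = q * (1 - t) by rewrite mulrBr mulr1 expr2 invfM mulVKf.
transitivity (q ^+ i.+1 * ((1 - t) * qnum t i.+1)); last by rewrite exprS; ring.
rewrite (qnum_geom q_prim r_dvd8) mulrBr mulr1; congr (_ - _).
by rewrite exprVn exprAC expr2 invfM mulVKf // expf_neq0.
Qed.
Lemma qfact_qnfact a : qfact q a = q ^+ ((a * a.-1) %/ 2)%N * qnfact t a.
Proof.
elim: a => [|a IH]; first by rewrite /qfact big_geq // /qnfact big_ord0 mulr1.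
rewrite /qfact big_nat_recr //= -/(qfact q a) IH qint_qnum qnfactS mulrACA -exprD.
by congr (q ^+ _ * _); rewrite !divn2 -[a.+1 in RHS]/(a.+1) -!bin2 binS bin1 addnC.
Qed.
(** The power of q in Θ cancels the one relating [a]! to the factorial for t. *)
Lemma ThetaE : Theta_ = qexp t N EF.
Proof.
rewrite /Theta_ /qexp; apply: eq_bigr => a _.
rewrite /divp /EF tensX.
have -> : E1 ^+ a = qbrace q 1 ^+ a *: gE ^+ a.
  elim: (nat_of_ord a) => [|k IH]; first by rewrite scale1r.
  by rewrite !exprS IH -pzscaleAl -pzscaleAr scalerA.
rewrite tensZl scalerA; congr (_ *: _).
have q0 : q ^+ ((a * a.-1) %/ 2)%N != 0 by rewrite expf_neq0 // (q_neq0 q_prim r_dvd8).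
by rewrite qfact_qnfact invfM mulrA mulrAC mulfVK // mulrC.
Qed.
Lemma RbarE : Rbar_ (fun=> 1) = \prod_(i <- pairs_word p) (1 + zz i).
Proof.
rewrite /pairs_word big_flatten big_map enumT /Rbar_ [index_enum _]unlock /=.
apply: eq_bigr => l _; rewrite big_cons big_seq1 /zz /sgZ /LZ /=.
by rewrite expr0 expr1 scaleN1r tensNl !scale1r.
Qed.
Lemma RmatE : Rmat = R0 * qexp t N EF * \prod_(i <- pairs_word p) (1 + zz i).
Proof. by rewrite /Rmat RzE DmxE ThetaE RbarE. Qed.

Lemma N1_prim : 2.-primitive_root (-1 : K).
Proof.
have two : (2 : K) != 0 := two_neq0 q_prim r_dvd8.
have m1 : (-1 == 1 :> K) = false by apply: contraNF two => /eqP h; rewrite -[2%:R]/(1 + 1) -{1}h addNr.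
apply/forallP => -[[|[|//]]] ? /=; rewrite unity_rootE ?expr1 ?m1 //.
by rewrite sqrrN expr1n !eqxx.
Qed.
Let L2 : gL ^+ 2 = 1. Proof. by rewrite expr2 (rL rels). Qed.
Lemma t_prim : N.-primitive_root t.
Proof.
rewrite -(q2_pred q_prim r_dvd8) prim_root_exp_coprime ?coprimePn //.
exact: q2_prim q_prim r_dvd8.
Qed.
Let two0 : (2%:R : K) != 0 := two_neq0 q_prim r_dvd8.
Let KN := rK rels.

Let LKj j : qcomm 1 gL (gK ^+ j).
Proof. by apply: qcomm_eq (qcommXr j (rLK rels)) (expr1n _ _). Qed.
Let KLi i : qcomm 1 gK (gL ^+ i).
Proof. by apply: qcomm_eq (qcommXr i (qcomm_sym1 (rLK rels))) (expr1n _ _). Qed.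
Let one_w (w : K) : 1 = w ^- 0. Proof. by rewrite expr0 invr1. Qed.

Let KL i j : gK ^+ j * gL ^+ i = gL ^+ i * gK ^+ j.
Proof. by apply/qcomm_comm; apply: qcomm_eq (qcommXl j (KLi i)) (expr1n _ _). Qed.
Let tensE (x y : A) : tens x y = tens x (1 : A) * tens (1 : A) y :> T.
Proof. by rewrite tensM mulr1 mul1r. Qed.
Let tensE' (x y : A) : tens x y = tens (1 : A) y * tens x (1 : A) :> T.
Proof. by rewrite tensM mulr1 mul1r. Qed.

(** R0 converts the weights of x under L and K, recorded by i and j, into the grouplike K^j L^i in
    the other leg: K for E, K^-1 for F and Lbar for Z. *)
Lemma R0_l i j c d x g : g = gK ^+ j * gL ^+ i ->
  qcomm c gL x -> c = (-1) ^- i -> qcomm d gK x -> d = t ^- j ->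
  R0 * tens x (1 : A) = tens x g * R0.
Proof.
move=> -> hc ci hd dj; rewrite /R0 -mulrA (bichar_l KN t_prim hd dj).
rewrite (tensE x (gK ^+ j)) !mulrA (bichar_l L2 N1_prim hc ci) -!(mulrA _ BL).
rewrite (bichar_r L2 N1_prim (LKj j) (one_w _)) expr0 !mulrA; congr (_ * _ * _).
by rewrite tensM mulr1 KL.
Qed.
Lemma R0_r i j c d x g : g = gK ^+ j * gL ^+ i ->
  qcomm c gL x -> c = (-1) ^- i -> qcomm d gK x -> d = t ^- j ->
  R0 * tens (1 : A) x = tens g x * R0.
Proof.
move=> -> hc ci hd dj; rewrite /R0 -mulrA (bichar_r KN t_prim hd dj).
rewrite (tensE' (gK ^+ j) x) !mulrA (bichar_r L2 N1_prim hc ci) -!(mulrA _ BL).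
rewrite (bichar_l L2 N1_prim (LKj j) (one_w _)) expr0 !mulrA; congr (_ * _ * _).
by rewrite tensM mulr1 KL.
Qed.

Let g0E : (1 : A) = gK ^+ 0 * gL ^+ 0. Proof. by rewrite mulr1. Qed.
Let gKE : gK = gK ^+ 1 * gL ^+ 0. Proof. by rewrite mulr1 expr1. Qed.
Let gKiE : Ki = gK ^+ n * gL ^+ 0. Proof. by rewrite mulr1. Qed.
Let gLbE : Lb = gK ^+ r'' * gL ^+ 1. Proof. by []. Qed.
Let zt : z = t ^- 1. Proof. by rewrite expr1 invrK. Qed.
Let tt' : t = t ^- n. Proof. by rewrite (tn q_prim r_dvd8). Qed.
Let m1 : -1 = (-1) ^- 1 :> K. Proof. by rewrite expr1 invrN invr1. Qed.
Let m1t : -1 = t ^- r''. Proof. by rewrite exprVn (q2r'' q_prim r_dvd8) !invrN !invr1. Qed.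

Lemma R0_lE : R0 * tens gE (1 : A) = tens gE gK * R0.
Proof. exact: (R0_l gKE (rLE rels) (one_w _) (rKE rels) zt). Qed.
Lemma R0_rE : R0 * tens (1 : A) gE = tens gK gE * R0.
Proof. exact: (R0_r gKE (rLE rels) (one_w _) (rKE rels) zt). Qed.
Lemma R0_lF : R0 * tens gF (1 : A) = tens gF Ki * R0.
Proof. exact: (R0_l gKiE (rLF rels) (one_w _) (rKF rels) tt'). Qed.
Lemma R0_rF : R0 * tens (1 : A) gF = tens Ki gF * R0.
Proof. exact: (R0_r gKiE (rLF rels) (one_w _) (rKF rels) tt'). Qed.
Lemma R0_lZ e l : R0 * tens (gZ e l) (1 : A) = tens (gZ e l) Lb * R0.
Proof. exact: (R0_l gLbE (rLZ rels e l) m1 (rKZ rels e l) m1t). Qed.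
Lemma R0_rZ e l : R0 * tens (1 : A) (gZ e l) = tens Lb (gZ e l) * R0.
Proof. exact: (R0_r gLbE (rLZ rels e l) m1 (rKZ rels e l) m1t). Qed.
Lemma L_LZ i : qcomm (-1) gL (LZ i).
Proof.
have h := qcomm_sym1 (Lb_L rels).
by apply: qcomm_eq (qcommMr h (rLZ rels _ _)) (mul1r _).
Qed.
Lemma K_LZ i : qcomm (-1) gK (LZ i).
Proof.
have h := qcomm_sym1 (Lb_K rels).
by apply: qcomm_eq (qcommMr h (rKZ rels _ _)) (mul1r _).
Qed.
Lemma R0_rLZ i : R0 * tens (1 : A) (LZ i) = tens Lb (LZ i) * R0.
Proof. exact: (R0_r gLbE (L_LZ i) m1 (K_LZ i) m1t). Qed.
Lemma R0_lg x : qcomm 1 gL x -> qcomm 1 gK x -> R0 * tens x (1 : A) = tens x (1 : A) * R0.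
Proof. by move=> hL hK; exact: (R0_l g0E hL (one_w _) hK (one_w _)). Qed.
Lemma R0_rg x : qcomm 1 gL x -> qcomm 1 gK x -> R0 * tens (1 : A) x = tens (1 : A) x * R0.
Proof. by move=> hL hK; exact: (R0_r g0E hL (one_w _) hK (one_w _)). Qed.
Lemma R0_cancel_l x g g' : R0 * tens x (1 : A) = tens x g * R0 -> g * g' = 1 ->
  qcomm 1 gL g' -> qcomm 1 gK g' -> R0 * tens x g' = tens x (1 : A) * R0.
Proof.
move=> h gg hL hK; rewrite tensE mulrA h -mulrA R0_rg // mulrA tensM mulr1 gg //.
Qed.
Lemma R0_cancel_r x g g' : R0 * tens (1 : A) x = tens g x * R0 -> g * g' = 1 ->
  qcomm 1 gL g' -> qcomm 1 gK g' -> R0 * tens g' x = tens (1 : A) x * R0.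
Proof.
move=> h gg hL hK; rewrite tensE' mulrA h -mulrA R0_lg // mulrA tensM mulr1 gg //.
Qed.
Let KKi' : gK * Ki = 1. Proof. exact: (KKi q_prim r_dvd8 rels). Qed.
Let KiK' : Ki * gK = 1. Proof. exact: (KiK q_prim r_dvd8 rels). Qed.
Let L_K : qcomm 1 gL gK := rLK rels.
Let L_Ki : qcomm 1 gL Ki. Proof. exact/qcomm_sym1/(Ki_L rels). Qed.
Let K_Ki' : qcomm 1 gK Ki. Proof. exact: (K_Ki q_prim r_dvd8 rels). Qed.
Let L_Lb : qcomm 1 gL Lb. Proof. exact/qcomm_sym1/(Lb_L rels). Qed.
Let K_Lb : qcomm 1 gK Lb. Proof. exact/qcomm_sym1/(Lb_K rels). Qed.
Let LbLb' : Lb * Lb = 1. Proof. exact: (LbLb q_prim r_dvd8 rels). Qed.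
Lemma R0_E : R0 * tens gE Ki = tens gE (1 : A) * R0.
Proof. by apply: R0_cancel_l R0_lE _ _ _. Qed.
Lemma R0_F : R0 * tens gK gF = tens (1 : A) gF * R0.
Proof. by apply: R0_cancel_r R0_rF _ _ _ => //; exact: qcomm_refl. Qed.
Lemma R0_Z e l : R0 * tens (gZ e l) Lb = tens (gZ e l) (1 : A) * R0.
Proof. by apply: R0_cancel_l (R0_lZ e l) _ _ _. Qed.
Lemma R0_LZ i : R0 * tens Lb (LZ i) = tens (1 : A) (LZ i) * R0.
Proof. by apply: R0_cancel_r (R0_rLZ i) _ _ _. Qed.

Let NN : (-1) * (-1) = 1 :> K. Proof. by rewrite mulrNN mulr1. Qed.
Lemma LZ_LZ i j : qcomm (-1) (LZ i) (LZ j).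
Proof.
have a := qcommMl (qcomm_refl Lb) (qcomm_symN (Lb_Z q_prim r_dvd8 rels (~~ i.1) i.2)).
have b := qcommMl (Lb_Z q_prim r_dvd8 rels (~~ j.1) j.2) (rZZ rels (~~ i.1) i.2 (~~ j.1) j.2).
apply: qcomm_eq (qcommMr a b) _; by rewrite NN mulr1 mul1r.
Qed.
Lemma LZ_sq i : LZ i * LZ i = 0.
Proof.
rewrite /LZ -mulrA (mulrA (gZ _ _)) (qcomm_symN (Lb_Z q_prim r_dvd8 rels (~~ i.1) i.2)).
by rewrite -pzscaleAl -mulrA (rZ2 rels) mulr0 scaler0 mulr0.
Qed.
Lemma sgZ_sq i : sgZ i * sgZ i = 0.
Proof. by rewrite /sgZ -pzscaleAl -pzscaleAr (rZ2 rels) !scaler0. Qed.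
Lemma sgZ_sgZ i j : qcomm (-1) (sgZ i) (sgZ j).
Proof. by apply: qcommZl; apply: qcommZr; exact: (rZZ rels). Qed.
Lemma Lb_sgZ i : qcomm (-1) Lb (sgZ i).
Proof. by apply: qcommZr; exact: (Lb_Z q_prim r_dvd8 rels). Qed.
Lemma Lb_E1 : qcomm (-1) Lb E1. Proof. by apply: qcommZr; exact: (Lb_E q_prim r_dvd8 rels). Qed.
Lemma E1_sgZ i : qcomm (-1) E1 (sgZ i).
Proof. by apply: qcommZl; apply: qcommZr; exact: (rEZ rels). Qed.
Lemma F_LZ i : qcomm (-1) gF (LZ i).
Proof.
have h := qcomm_symN (Lb_F q_prim r_dvd8 rels).
by apply: qcomm_eq (qcommMr h (rFZ rels _ _)) (mulr1 _).
Qed.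
Lemma Lb_LZ i : qcomm (-1) Lb (LZ i).
Proof. by apply: qcomm_eq (qcommMr (qcomm_refl _) (Lb_Z q_prim r_dvd8 rels _ _)) (mul1r _). Qed.
Lemma E_LZ i : qcomm 1 gE (LZ i).
Proof.
have h := qcomm_symN (Lb_E q_prim r_dvd8 rels).
by apply: qcomm_eq (qcommMr h (rEZ rels _ _)) NN.
Qed.
Lemma zz_comm i j : zz i * zz j = zz j * zz i.
Proof.
apply/qcomm_comm; apply: qcomm_eq (qcomm_tens (sgZ_sgZ i j) (LZ_LZ i j)) NN.
Qed.

(** * The hexagon identities for R *)

Local Notation il := (fun a : A => tens a (1 : A) : T).
Local Notation ir := (fun a : A => tens (1 : A) a : T).
Let hil : alghom il := alghom_tensl A A.
Let hir : alghom ir := alghom_tensr A A.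
Let hid : alghom (@id A) := @alghom_id K A.
Let hD' := hD q_prim r_dvd8 pres.
Let lD : linear D := alghom_lin hD'.
Definition Dop (a : A) : T := tswap (D a).
Lemma alghom_Dop : alghom Dop. Proof. exact: alghom_comp (alghom_tswap A) hD'. Qed.
Let qn : forall i, (0 < i < N)%N -> qnum t i != 0 := qnumt_neq0 q_prim r_dvd8.
Let E1N : E1 ^+ N = 0.
Proof.
have -> : E1 ^+ N = qbrace q 1 ^+ N *: gE ^+ N.
  elim: N => [|k IH]; first by rewrite scale1r.
  by rewrite !exprS IH -pzscaleAl -pzscaleAr scalerA.
by rewrite (rE rels) scaler0.
Qed.
Let big0 (x : A) k : x ^+ N = 0 -> (N <= k)%N -> x ^+ k = 0.
Proof. by move=> xN /subnK <-; rewrite exprD xN mulr0. Qed.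

Lemma R0_hexl : tmap D (@id A) R0 = tmap il (@id A) R0 * tmap ir (@id A) R0.
Proof.
have hx := bichar_hexl; have a1 := alghom_tmap hD' hid; have a2 := alghom_tmap hil hid.
have a3 := alghom_tmap hir hid.
rewrite /R0 !(alghomM a1, alghomM a2, alghomM a3).
rewrite (bichar_hexl L2 N1_prim two0 hD') ?D_L // (bichar_hexl KN t_prim NK hD') ?D_K //.
rewrite -!mulrA; congr (_ * _); rewrite !mulrA; congr (_ * _).
rewrite (bicharEr gL) (bicharEl gK) !(lin_sum (alghom_lin a2)) !(lin_sum (alghom_lin a3)).
rewrite mulr_suml mulr_sumr; apply: eq_bigr => i _; rewrite mulr_suml mulr_sumr.
apply: eq_bigr => j _; rewrite !tmapE // !tensM !mul1r !mulr1; congr tens.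
rewrite /bidem -!pzscaleAl -!pzscaleAr mulr_suml mulr_sumr; congr (_ *: _).
apply: eq_bigr => c _; rewrite -!pzscaleAl -!pzscaleAr; congr (_ *: _).
by rewrite KL.
Qed.
Lemma R0_hexr : tmap (@id A) Dop R0 = tmap (@id A) il R0 * tmap (@id A) ir R0.
Proof.
have hx := bichar_hexr; have a1 := alghom_tmap hid alghom_Dop; have a2 := alghom_tmap hid hil.
have a3 := alghom_tmap hid hir.
rewrite /R0 !(alghomM a1, alghomM a2, alghomM a3).
have dL : Dop gL = tens gL gL by rewrite /Dop D_L tswapE.
have dK : Dop gK = tens gK gK by rewrite /Dop D_K tswapE.
rewrite (bichar_hexr L2 N1_prim two0 alghom_Dop dL) (bichar_hexr KN t_prim NK alghom_Dop dK).
rewrite -!mulrA; congr (_ * _); rewrite !mulrA; congr (_ * _).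
rewrite (bicharEl gL) (bicharEr gK) !(lin_sum (alghom_lin a2)) !(lin_sum (alghom_lin a3)).
rewrite mulr_suml mulr_sumr; apply: eq_bigr => i _; rewrite mulr_suml mulr_sumr.
apply: eq_bigr => j _; rewrite !tmapE // !tensM !mul1r !mulr1; congr tens.
rewrite /bidem -!pzscaleAl -!pzscaleAr mulr_suml mulr_sumr; congr (_ *: _).
apply: eq_bigr => c _; rewrite -!pzscaleAl -!pzscaleAr; congr (_ *: _).
by rewrite KL.
Qed.

Lemma Rmat_hexl : tmap D (@id A) Rmat = tmap il (@id A) Rmat * tmap ir (@id A) Rmat.
Proof.
have a1 := alghom_tmap hD' hid; have a2 := alghom_tmap hil hid; have a3 := alghom_tmap hir hid.
have cm (x : A) u : tmap ir (@id A) u * tens (tens x (1 : A)) (1 : A) =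
    tens (tens x (1 : A)) (1 : A) * tmap ir (@id A) u.
  have l3 := alghom_lin a3; move: u; apply: tens_ext; [lin|lin|] => y w.
  by rewrite tmapE // !tensM !mul1r !mulr1.
have sp (x y w : A) : tens (tens x y) w = tens (tens x (1 : A)) (1 : A) * tmap ir (@id A) (tens y w).
  by rewrite tmapE // !tensM !mul1r mulr1.
have mv (x y y' w : A) : R0 * tens y w = tens y' w * R0 ->
   tens (tens x y') w * tmap ir (@id A) R0 = tmap ir (@id A) R0 * tens (tens x y) w.
  by move=> h; rewrite (sp x y' w) (sp x y w) -mulrA -(alghomM a3) -h (alghomM a3) !mulrA cm.
have il1 (x w : A) : tmap il (@id A) (tens x w) = tens (tens x (1 : A)) w by rewrite tmapE.
have ir1 (x w : A) : tmap ir (@id A) (tens x w) = tens (tens (1 : A) x) w by rewrite tmapE.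
have tq1 := @qcomm_tens K A A; have tq2 := @qcomm_tens K T A.
(* E1 ⊗ K ⊗ F is one part of (Δ ⊗ id)(E1 ⊗ F); moving E1 ⊗ 1 ⊗ F past R0 in legs 2 and 3 gives
   it. *)
apply: (hexagon_product (R0 := R0) (EF := EF) (zz := zz) (L := pairs_word p) (XE := tens (tens E1 gK) gF)
  (XZ := fun i => tens (tens (sgZ i) Lb) (LZ i)) a1 a2 a3 qn).
- exact: R0_hexl.
- rewrite /EF /zz ir1 tmapE // -tensDl; congr tens.
  by rewrite /E1 (linZ lD) D_E scalerDr tensZl tensZr addrC.
- rewrite /EF /zz ir1; have h : qcomm t E1 gK by apply: qcommZl; exact: (E_K q_prim r_dvd8 rels).
  apply: qcomm_eq (tq2 _ _ _ _ _ _ (tq1 _ _ _ _ _ _ (qcomm1l _) h) (qcomm_refl _)) _.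
  by rewrite mul1r mulr1.
- move=> i j ij; rewrite /EF /zz ir1 !tensX !tensM -exprD (big0 (rF rels) ij) tens0r //.
- by rewrite /EF /zz il1; apply: mv; exact: R0_F.
- move=> i; rewrite /EF /zz ir1 tmapE // -tensDl; congr tens.
  by rewrite /sgZ (linZ lD) D_Z scalerDr tensZl tensZr addrC.
- by move=> i; rewrite /EF /zz il1; apply: mv; exact: R0_LZ.
- by move=> i; rewrite /EF /zz ir1 !tensM LZ_sq tens0r.
- move=> i j; rewrite /EF /zz ir1; apply/qcomm_comm.
  apply: qcomm_eq (tq2 _ _ _ _ _ _ (tq1 _ _ _ _ _ _ (qcomm1r _) (Lb_sgZ j)) (LZ_LZ i j)) _.
  by rewrite mul1r NN.
- move=> i; rewrite /EF /zz ir1; apply/qcomm_comm.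
  apply: qcomm_eq (tq2 _ _ _ _ _ _ (tq1 _ _ _ _ _ _ (qcomm1r _) Lb_E1) (qcomm_symN (F_LZ i))) _.
  by rewrite mul1r NN.
exact: RmatE.
Qed.

Lemma Dop_LZ i : Dop (LZ i) = tens (LZ i) Lb + tens (1 : A) (LZ i).
Proof.
rewrite /LZ (alghomM alghom_Dop) /Dop (D_Lb q_prim r_dvd8 pres) D_Z.
rewrite (linD (@tswap_lin K A)) !tswapE mulrDr !tensM LbLb' mulr1 //.
Qed.

Lemma Rmat_hexr : tmap (@id A) Dop Rmat = tmap (@id A) il Rmat * tmap (@id A) ir Rmat.
Proof.
have a1 := alghom_tmap hid alghom_Dop; have a2 := alghom_tmap hid hil; have a3 := alghom_tmap hid hir.
have hDo := alghom_Dop.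
have cm (x : A) u : tmap (@id A) ir u * tens (1 : A) (tens x (1 : A)) =
    tens (1 : A) (tens x (1 : A)) * tmap (@id A) ir u.
  have l3 := alghom_lin a3; move: u; apply: tens_ext; [lin|lin|] => y w.
  by rewrite tmapE // !tensM !mul1r !mulr1.
have sp (x y w : A) : tens x (tens y w) = tens (1 : A) (tens y (1 : A)) * tmap (@id A) ir (tens x w).
  by rewrite tmapE // !tensM !mul1r mulr1.
have mv (x y w w' : A) : R0 * tens x w = tens x w' * R0 ->
   tens x (tens y w') * tmap (@id A) ir R0 = tmap (@id A) ir R0 * tens x (tens y w).
  by move=> h; rewrite (sp x y w') (sp x y w) -mulrA -(alghomM a3) -h (alghomM a3) !mulrA cm.
have il1 (x w : A) : tmap (@id A) il (tens x w) = tens x (tens w (1 : A)) by rewrite tmapE.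
have ir1 (x w : A) : tmap (@id A) ir (tens x w) = tens x (tens (1 : A) w) by rewrite tmapE.
have tq1 := @qcomm_tens K A A; have tq2 := @qcomm_tens K A T.
(* Now R0 sits in legs 1 and 3, and E1 ⊗ F ⊗ K^-1 is what E1 ⊗ F ⊗ 1 becomes on passing it. *)
apply: (hexagon_product (R0 := R0) (EF := EF) (zz := zz) (L := pairs_word p) (XE := tens E1 (tens gF Ki))
  (XZ := fun i => tens (sgZ i) (tens (LZ i) Lb)) a1 a2 a3 qn).
- exact: R0_hexr.
- rewrite /EF /zz ir1 tmapE // -tensDr; congr tens.
  by rewrite /Dop D_F (linD (@tswap_lin K A)) !tswapE addrC.
- rewrite /EF /zz ir1; have h : qcomm t gF Ki by exact: (F_Ki q_prim r_dvd8 rels).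
  apply: qcomm_eq (tq2 _ _ _ _ _ _ (qcomm_refl _) (tq1 _ _ _ _ _ _ (qcomm1l _) h)) _.
  by rewrite !mul1r.
- move=> i j ij; rewrite /EF /zz ir1 !tensX !tensM -exprD (big0 E1N ij) tens0l //.
- rewrite /EF /zz il1; apply: mv; rewrite /E1 !tensZl -!pzscaleAr -!pzscaleAl; congr (_ *: _).
  exact: R0_E.
- by move=> i; rewrite /EF /zz ir1 tmapE // -tensDr Dop_LZ.
- move=> i; rewrite /EF /zz il1; apply: mv; rewrite /sgZ !tensZl -!pzscaleAr -!pzscaleAl; congr (_ *: _).
  exact: R0_Z.
- by move=> i; rewrite /EF /zz ir1 !tensM sgZ_sq tens0l.
- move=> i j; rewrite /EF /zz ir1; apply/qcomm_comm.
  apply: qcomm_eq (tq2 _ _ _ _ _ _ (sgZ_sgZ i j) (tq1 _ _ _ _ _ _ (qcomm1r _) (Lb_LZ j))) _.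
  by rewrite mul1r NN.
- move=> i; rewrite /EF /zz ir1; apply/qcomm_comm.
  have h := Lb_F q_prim r_dvd8 rels.
  apply: qcomm_eq (tq2 _ _ _ _ _ _ (qcomm_symN (E1_sgZ i)) (tq1 _ _ _ _ _ _ (qcomm1r _) h)) _.
  by rewrite mul1r NN.
exact: RmatE.
Qed.

(** * R intertwines the coproduct with its opposite *)

Lemma qnum_inv a : qnum z a.+1 = z ^+ a * qnum t a.+1.
Proof.
rewrite /qnum mulr_sumr (reindex_inj rev_ord_inj) /=; apply: eq_bigr => i _.
have -> : (a.+1 - i.+1 = a - i)%N by [].
have ia : (i <= a)%N by rewrite -ltnS.
have -> : z ^+ a = z ^+ (a - i) * z ^+ i by rewrite -exprD subnK.
by rewrite exprVn mulfK // expf_neq0 // (q2_neq0 q_prim r_dvd8).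
Qed.
Let qb : qbrace q 1 = q - q^-1. Proof. by rewrite /qbrace expr1. Qed.
Let qb0 : qbrace q 1 != 0. Proof. by rewrite qb; exact: (q_qinv_neq0 q_prim r_dvd8). Qed.
Let E1F : E1 * gF - gF * E1 = 1 *: (gK - Ki).
Proof.
by rewrite /E1 -pzscaleAl -pzscaleAr -scalerBr (rEF rels) scalerA qb mulfV -?qb // scale1r.
Qed.
Let FE1 : gF * E1 - E1 * gF = (-1) *: (gK - Ki).
Proof. by rewrite -opprB E1F scaleN1r scale1r. Qed.
Let E1_K : qcomm t E1 gK. Proof. by apply: qcommZl; exact: (E_K q_prim r_dvd8 rels). Qed.
Let E1_Ki : qcomm z E1 Ki. Proof. by apply: qcommZl; exact: (E_Ki q_prim r_dvd8 rels). Qed.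
Let F_K' : qcomm z gF gK. Proof. exact: (F_K q_prim r_dvd8 rels). Qed.
Let F_Ki' : qcomm t gF Ki. Proof. exact: (F_Ki q_prim r_dvd8 rels). Qed.
Local Notation Th := (qexp t N EF).
Local Notation ea a := (qnfact t a)^-1.

Let eaS a : (a.+1 < N)%N -> ea a.+1 * qnum t a.+1 = ea a.
Proof.
by move=> aN; rewrite qnfactS invfM mulfVK // qn // ltn0Sn.
Qed.

Lemma telescope_ord (V : zmodType) (f g : nat -> V) : f n = 0 -> g 0%N = 0 ->
  (forall a, (a.+1 < N)%N -> f a = g a.+1) -> \sum_(a < N) f a = \sum_(a < N) g a.
Proof.
move=> fn g0 fg; rewrite -(prednK N0) big_ord_recr [RHS]big_ord_recl /= fn g0 addr0 add0r.
by apply: eq_bigr => i _; apply: fg; have := ltn_ord i; lia.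
Qed.
Let ThE : Th = \sum_(a < N) ea a *: tens (E1 ^+ a) (gF ^+ a).
Proof. by rewrite /qexp; apply: eq_bigr => a _; rewrite /divp /EF tensX. Qed.

Lemma sub_swap (V : zmodType) (a b c d : V) : a - d = c - b -> a + b = c + d.
Proof. by move=> h; rewrite -[a](subrK d) h addrAC subrK. Qed.
Let En0 : E1 ^+ N.-1.+1 = 0. Proof. by rewrite prednK. Qed.
Let Fn0 : gF ^+ N.-1.+1 = 0. Proof. by rewrite prednK // (rF rels). Qed.

(** The a-th term of (E1 ⊗ K^-1) Θ - Θ (E1 ⊗ K) is the (a+1)-st term of Θ (1 ⊗ E1) - (1 ⊗ E1) Θ,
    computed from [F^(a+1), E1]. The boundary terms vanish because E1^N = 0 and F^0 = 1. *)
Lemma Theta_E1 : (tens E1 Ki + tens (1 : A) E1) * Th = Th * (tens (1 : A) E1 + tens E1 gK).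
Proof.
pose f a := ea a *: tens (E1 ^+ a.+1) ((Ki - z ^+ a *: gK) * gF ^+ a).
pose g a := ea a *: tens (E1 ^+ a) (gF ^+ a * E1 - E1 * gF ^+ a).
rewrite mulrDl mulrDr; apply: sub_swap; transitivity (\sum_(a < N) f a).
  rewrite ThE mulr_sumr mulr_suml -sumrB; apply: eq_bigr => a _.
  rewrite -pzscaleAl -pzscaleAr -scalerBr !tensM -exprS -exprSr -tensNr -tensDr.
  by rewrite /f (qcommXl a F_K' : gF ^+ a * gK = _) mulrBl -pzscaleAl.
transitivity (\sum_(a < N) g a); last first.
  rewrite ThE mulr_sumr mulr_suml -sumrB; apply: eq_bigr => a _.
  by rewrite -pzscaleAl -pzscaleAr -scalerBr !tensM mulr1 mul1r -tensNr -tensDr.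
apply: telescope_ord; first by rewrite /f En0 tens0l scaler0.
  by rewrite /g mul1r mulr1 subrr tens0r scaler0.
move=> a aN; rewrite /f /g (commutator_qnum q_prim r_dvd8 a.+1 FE1 F_K' F_Ki') addrAC subrr add0r.
rewrite /= scaleN1r -mulNr opprB qnum_inv mulrC -scalerA -scalerBr -pzscaleAl tensZr scalerA.
by rewrite eaS.
Qed.
Lemma Theta_F : (tens gK gF + tens gF (1 : A)) * Th = Th * (tens gF (1 : A) + tens Ki gF).
Proof.
pose f a := ea a *: tens ((gK - z ^+ a *: Ki) * E1 ^+ a) (gF ^+ a.+1).
pose g a := ea a *: tens (E1 ^+ a * gF - gF * E1 ^+ a) (gF ^+ a).
rewrite mulrDl mulrDr; apply: sub_swap; transitivity (\sum_(a < N) f a).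
  rewrite ThE mulr_sumr mulr_suml -sumrB; apply: eq_bigr => a _.
  rewrite -pzscaleAl -pzscaleAr -scalerBr !tensM -exprS -exprSr -tensNl -tensDl.
  by rewrite /f (qcommXl a E1_Ki : E1 ^+ a * Ki = _) mulrBl -pzscaleAl.
transitivity (\sum_(a < N) g a); last first.
  rewrite ThE mulr_sumr mulr_suml -sumrB; apply: eq_bigr => a _.
  by rewrite -pzscaleAl -pzscaleAr -scalerBr !tensM mulr1 mul1r -tensNl -tensDl.
apply: telescope_ord; first by rewrite /f Fn0 tens0r scaler0.
  by rewrite /g mul1r mulr1 subrr tens0l scaler0.
move=> a aN; rewrite /f /g (commutator_qnum q_prim r_dvd8 a.+1 E1F E1_K E1_Ki) addrAC subrr add0r.
rewrite /= scale1r qnum_inv [z ^+ a * _]mulrC -scalerA -scalerBr -pzscaleAl tensZl scalerA.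
by rewrite eaS.
Qed.

Local Notation Pz := (\prod_(i <- pairs_word p) (1 + zz i)).
Lemma Pz_comm u : (forall i, u * zz i = zz i * u) -> u * Pz = Pz * u.
Proof. by move=> h; symmetry; apply: prod_intertwine => i; rewrite h. Qed.
Lemma braid_factors u1 u2 u3 : u1 * R0 = R0 * u2 -> u2 * Th = Th * u3 ->
  (forall i, u3 * zz i = zz i * u3) -> u1 * Rmat = Rmat * u3.
Proof.
move=> + h2 h3; rewrite RmatE; move: R0 => X h1.
by rewrite !mulrA h1 -(mulrA X) h2 -!mulrA Pz_comm.
Qed.
Let Th_comm u : EF * u = u * EF -> u * Th = Th * u.
Proof. by move=> h; symmetry; apply: qexp_intertwine. Qed.
Let comm2 c d (x x' y y' : A) : qcomm c x x' -> qcomm d y y' -> c * d = 1 ->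
  tens x y * tens x' y' = tens x' y' * tens x y.
Proof. by move=> h h' cd; apply/qcomm_comm; exact: qcomm_eq (qcomm_tens h h') cd. Qed.

Lemma braid_E : Dop gE * Rmat = Rmat * D gE.
Proof.
have -> : Dop gE = tens gE (1 : A) + tens gK gE.
  by rewrite /Dop D_E (linD (@tswap_lin K A)) !tswapE.
rewrite D_E; apply: (@braid_factors _ (tens gE Ki + tens (1 : A) gE)).
- by rewrite mulrDl mulrDr R0_E R0_rE.
- have := Theta_E1; rewrite /E1 !tensZl !tensZr -!scalerDr -pzscaleAl -pzscaleAr.
  by move/(scalerI qb0).
move=> i; have l1 : qcomm 1 (1 : A) (sgZ i) by exact: qcomm1l.
have h1 : qcomm (-1) gE (sgZ i) by apply: qcommZr; exact: (rEZ rels).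
rewrite mulrDl mulrDr (comm2 l1 (E_LZ i)) ?mulr1 //; congr (_ + _).
exact: comm2 h1 (K_LZ i) NN.
Qed.
Lemma braid_F : Dop gF * Rmat = Rmat * D gF.
Proof.
have -> : Dop gF = tens (1 : A) gF + tens gF Ki.
  by rewrite /Dop D_F (linD (@tswap_lin K A)) !tswapE.
rewrite D_F; apply: (@braid_factors _ (tens gK gF + tens gF (1 : A))).
- by rewrite mulrDl mulrDr R0_F R0_lF.
- exact: Theta_F.
move=> i; have l1 : qcomm 1 (1 : A) (LZ i) by exact: qcomm1l.
have h1 : qcomm 1 gF (sgZ i) by apply: qcommZr; exact: (rFZ rels).
have h2 : qcomm (-1) Ki (sgZ i) by apply: qcommZr; exact: (Ki_Z q_prim r_dvd8 rels).
by rewrite mulrDl mulrDr (comm2 h1 l1) ?mulr1 // (comm2 h2 (F_LZ i)).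
Qed.
Lemma braid_Z e l : Dop (gZ e l) * Rmat = Rmat * D (gZ e l).
Proof.
have -> : Dop (gZ e l) = tens (gZ e l) (1 : A) + tens Lb (gZ e l).
  by rewrite /Dop D_Z (linD (@tswap_lin K A)) !tswapE addrC.
have EZ : qcomm (-1) E1 (gZ e l) by apply: qcommZl; exact: (rEZ rels).
have FL := qcomm_symN (Lb_F q_prim r_dvd8 rels).
have u1 := @qcomm1r K A E1.
rewrite D_Z; apply: (@braid_factors _ (tens (1 : A) (gZ e l) + tens (gZ e l) Lb)).
- by rewrite mulrDl mulrDr R0_rZ R0_Z addrC.
- apply: Th_comm; rewrite mulrDl mulrDr /EF (comm2 u1 (rFZ rels e l)) ?mulr1 //.
  by rewrite (comm2 EZ FL).
move=> i; have l1 : qcomm 1 (1 : A) (sgZ i) by exact: qcomm1l.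
have h1 : qcomm (-1) (gZ e l) (sgZ i) by apply: qcommZr; exact: (rZZ rels).
have h2 : qcomm 1 (gZ e l) (LZ i).
  apply: qcomm_eq (qcommMr (qcomm_symN (Lb_Z q_prim r_dvd8 rels e l)) (rZZ rels _ _ _ _)) NN.
by rewrite mulrDl mulrDr (comm2 l1 h2) ?mulr1 // (comm2 h1 (Lb_LZ i)).
Qed.
Lemma braid_grouplike g : Dop g = tens g g -> D g = tens g g ->
  qcomm 1 gL g -> qcomm 1 gK g -> EF * tens g g = tens g g * EF ->
  tens g g * Pz = Pz * tens g g -> Dop g * Rmat = Rmat * D g.
Proof.
move=> -> -> hL hK hE hP; rewrite RmatE.
have R0g : tens g g * R0 = R0 * tens g g.
  have := R0_lg hL hK; have := R0_rg hL hK; rewrite (tensE g g); move: R0 => X hr hl.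
  by rewrite -mulrA -hr !mulrA -hl.
move: R0 R0g => X R0g.
by rewrite !mulrA R0g -(mulrA X) (Th_comm hE) -!mulrA hP.
Qed.
Let Dop_g g : D g = tens g g -> Dop g = tens g g. Proof. by rewrite /Dop => ->; rewrite tswapE. Qed.
Lemma braid_K : Dop gK * Rmat = Rmat * D gK.
Proof.
have dK := D_K q_prim r_dvd8 pres.
apply: braid_grouplike => //; [exact: Dop_g | exact: qcomm_refl | |].
  by rewrite /EF (comm2 E1_K F_K') // mulVf // (q2_neq0 q_prim r_dvd8).
apply: Pz_comm => i; have h : qcomm (-1) gK (sgZ i) by apply: qcommZr; exact: (rKZ rels).
exact: comm2 h (K_LZ i) NN.
Qed.
Lemma braid_L : Dop gL * Rmat = Rmat * D gL.
Proof.
have dL := D_L q_prim r_dvd8 pres.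
have h1 : qcomm 1 E1 gL by apply: qcommZl; exact: (qcomm_sym1 (rLE rels)).
apply: braid_grouplike => //; [exact: Dop_g | exact: qcomm_refl | exact: qcomm_sym1 | |].
  by rewrite /EF (comm2 h1 (qcomm_sym1 (rLF rels))) ?mulr1.
apply: Pz_comm => i; have h : qcomm (-1) gL (sgZ i) by apply: qcommZr; exact: (rLZ rels).
exact: comm2 h (L_LZ i) NN.
Qed.
Lemma mem_pairs_word (i : I2) : i \in pairs_word p.
Proof.
apply/flattenP; exists [:: (true, i.2); (false, i.2)].
  by apply/mapP; exists i.2; rewrite ?mem_enum.
by case: i => -[] l; rewrite !inE eqxx ?orbT.
Qed.
Lemma braid_S s : Dop (gS s) * Rmat = Rmat * D (gS s).
Proof.
have dS := D_S q_prim r_dvd8 pres s.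
have h1 : qcomm 1 E1 (gS s) by apply: qcommZl; exact: (qcomm_sym1 (rSE rels s)).
apply: braid_grouplike => //; [exact: Dop_g | exact: qcomm_sym1 (rSL rels s) | exact: qcomm_sym1 (rSK rels s) | |].
  by rewrite /EF (comm2 h1 (qcomm_sym1 (rSF rels s))) ?mulr1.
pose f (i : I2) : I2 := (i.1, s i.2).
have zzS i : tens (gS s) (gS s) * zz i = zz (f i) * tens (gS s) (gS s).
  rewrite /zz /sgZ /LZ /f !tensM /= -pzscaleAl -pzscaleAr (rSZ rels); congr tens.
  rewrite -mulrA -(rSZ rels) mulrA -(proj1 (qcomm_comm _ _) (Lb_S rels s)) mulrA //.
have fperm : perm_eq [seq f i | i <- pairs_word p] (pairs_word p).
  have finj : injective f by move=> [e l] [e' l'] [-> /perm_inj ->].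
  apply: uniq_perm; rewrite ?(map_inj_uniq finj) ?uniq_pairs_word // => i.
  rewrite mem_pairs_word; apply/mapP; exists (i.1, s^-1%g i.2); rewrite ?mem_pairs_word //.
  by rewrite /f /= permKV; case: i.
have E : \prod_(i <- [seq f i | i <- pairs_word p]) (1 + zz i) = Pz.
  apply: prod_comm_perm fperm => i j.
  by rewrite !mulrDl !mulrDr !mulr1 !mul1r zz_comm -!addrA; congr (_ + _); rewrite addrCA.
rewrite -[in RHS]E big_map.
elim: (pairs_word p) => [|i L IH]; first by rewrite !big_nil mulr1 mul1r.
rewrite !big_cons -[RHS]mulrA -IH !mulrA; congr (_ * _).
by rewrite mulrDr mulrDl mulr1 mul1r zzS.
Qed.
Lemma Rmat_braid h : Dop h * Rmat = Rmat * D h.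
Proof.
have := braid_S; have := braid_Z; have := braid_L; have := braid_F; have := braid_E.
have := braid_K; move: Rmat => M bK bE bF bL bZ bS.
have lDo := alghom_lin alghom_Dop; have hDo := alghom_Dop.
move: Dop lDo hDo bK bE bF bL bZ bS => G lG hG bK bE bF bL bZ bS.
apply/eqP; move: h; apply: (A_ind pres (P := [pred h | G h * M == M * D h])).
- split=> [|c u v].
    by rewrite !inE (lin0 lG) (lin0 lD) mul0r mulr0.
  rewrite !inE => /eqP hu /eqP hv.
  by rewrite lG lD mulrDl mulrDr -pzscaleAl -pzscaleAr hu hv.
- by rewrite inE (alghom1 hG) (alghom1 hD') mul1r mulr1.
- move=> x a; rewrite !inE => /eqP hx /eqP ha.
  by rewrite (alghomM hG) (alghomM hD') -mulrA ha !mulrA hx.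
- by rewrite inE bK.
- by rewrite inE bE.
- by rewrite inE bF.
- by rewrite inE bL.
- by move=> e l; rewrite inE bZ.
by move=> s; rewrite inE bS.
Qed.

Lemma alghom_Rmat1 (B : pzAlgType K) (c : T -> B) : alghom c -> c R0 = 1 -> c EF = 0 ->
  (forall i, c (zz i) = 0) -> c Rmat = 1.
Proof.
move=> hc; rewrite RmatE; move: R0 => X c1 c2 c3; rewrite !(alghomM hc) c1 (alghom_qexp _ _ hc) c2 (alghom_prod hc).
rewrite big1 ?mulr1 ?mul1r => [|i _]; last by rewrite (linD (alghom_lin hc)) c3 (alghom1 hc) addr0.
rewrite /qexp -(prednK N0) big_ord_recl big1 ?addr0 => [|i _].
  by rewrite /divp /qnfact big_ord0 invr1 scale1r.
by rewrite /divp lift0 expr0n scaler0.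
Qed.
Let f (a : A) : A := eps a *: (1 : A).
Let epsP k x y : eps (k *: x + y) = k * eps x + eps y. Proof. exact: linearP. Qed.
Let epsZ k x : eps (k *: x) = k * eps x.
Proof. by rewrite -[k *: x]addr0 epsP linear0 addr0. Qed.
Let hf : alghom f.
Proof.
split=> [k x y||x y]; rewrite /f.
- by rewrite epsP scalerDl scalerA.
- by rewrite (eps1 q_prim r_dvd8 pres) scale1r.
by rewrite (epsM q_prim r_dvd8 pres) -pzscaleAl -pzscaleAr mulr1 scalerA.
Qed.
Let cm x y : f x * y = y * f x. Proof. by rewrite /f -pzscaleAl -pzscaleAr mulr1 mul1r. Qed.
Lemma Rmat_counitl : tlift (fun a b : A => eps a *: b) Rmat = 1.
Proof.
have hc := alghom_copair hf hid cm.
have E x y : tcopair f (@id A) (tens x y) = eps x *: y.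
  by rewrite tcopairE // /f -pzscaleAl mul1r.
have -> : tlift (fun a b : A => eps a *: b) Rmat = tcopair f (@id A) Rmat.
  by rewrite /tcopair; apply: eq_tlift => x y; rewrite /f -pzscaleAl mul1r.
have B0 g m w (gm : g ^+ m = 1) (pw : m.-primitive_root w) (m0 : (m%:R : K) != 0) :
    eps g = 1 -> tcopair f (@id A) (bichar g m w) = 1.
  move=> eg; rewrite bicharEl (lin_sum (alghom_lin hc)) -(bidem_sum g pw m0).
  by apply: eq_bigr => b _; rewrite E (epsX q_prim r_dvd8 pres) eg expr1n scale1r.
apply: alghom_Rmat1 => //.
- rewrite /R0 (alghomM hc) (B0 _ _ _ L2 N1_prim two0) ?(eps_L q_prim r_dvd8 pres) //.
  by rewrite (B0 _ _ _ KN t_prim NK) ?mulr1 ?(eps_K q_prim r_dvd8 pres).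
- by rewrite /EF E /E1 epsZ (eps_E q_prim r_dvd8 pres) mulr0 scale0r.
by move=> i; rewrite /zz E /sgZ epsZ (eps_Z q_prim r_dvd8 pres) mulr0 scale0r.
Qed.
Lemma Rmat_counitr : tlift (fun a b : A => eps b *: a) Rmat = 1.
Proof.
have cm' x y : id x * f y = f y * id x by rewrite cm.
have hc := alghom_copair hid hf cm'.
have E x y : tcopair (@id A) f (tens x y) = eps y *: x.
  by rewrite tcopairE // /f -pzscaleAr mulr1.
have -> : tlift (fun a b : A => eps b *: a) Rmat = tcopair (@id A) f Rmat.
  by rewrite /tcopair; apply: eq_tlift => x y; rewrite /f -pzscaleAr mulr1.
have B0 g m w (gm : g ^+ m = 1) (pw : m.-primitive_root w) (m0 : (m%:R : K) != 0) :
    eps g = 1 -> tcopair (@id A) f (bichar g m w) = 1.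
  move=> eg; rewrite bicharEr (lin_sum (alghom_lin hc)) -(bidem_sum g pw m0).
  by apply: eq_bigr => b _; rewrite E (epsX q_prim r_dvd8 pres) eg expr1n scale1r.
apply: alghom_Rmat1 => //.
- rewrite /R0 (alghomM hc) (B0 _ _ _ L2 N1_prim two0) ?(eps_L q_prim r_dvd8 pres) //.
  by rewrite (B0 _ _ _ KN t_prim NK) ?mulr1 ?(eps_K q_prim r_dvd8 pres).
- by rewrite /EF E (eps_F q_prim r_dvd8 pres) scale0r.
move=> i; rewrite /zz E /LZ (epsM q_prim r_dvd8 pres) (eps_Z q_prim r_dvd8 pres).
by rewrite mulr0 scale0r.
Qed.

Lemma Rmat_quasitriangular : quasitriangular (hopfA q_prim r_dvd8 pres) Rmat.
Proof.
have a1 := alghom_tmap hD' hid; have a2 := alghom_tmap hil hid; have a3 := alghom_tmap hir hid.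
have b2 := alghom_tmap hid hil; have b3 := alghom_tmap hid hir.
split.
- transitivity (tmap D (@id A) Rmat).
    by apply: eq_tlift => a b; rewrite tensM mulr1 mul1r.
  rewrite Rmat_hexl; move: Rmat => R.
  rewrite {1}/tmap /tcopair (tlift_comp (g := fun u : tensor T A => u * tmap ir (@id A) R)); last by lin.
  apply/esym/eq_tlift => a b.
  rewrite /tmap /tcopair (tlift_comp (g := fun u : tensor T A => tens (tens a (1 : A)) (1 : A) * tens (1 : T) b * u)); last by lin.
  apply: eq_tlift => c d; by rewrite !tensM !mul1r !mulr1 ?tensM ?mul1r ?mulr1.
- transitivity (tmap (@id A) Dop Rmat).
    by apply: eq_tlift => a b; rewrite tensM mulr1 mul1r.
  rewrite Rmat_hexr; move: Rmat => R.
  rewrite {1}/tmap /tcopair (tlift_comp (g := fun u : tensor A T => u * tmap (@id A) ir R)); last by lin.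
  apply/esym/eq_tlift => a b.
  rewrite /tmap /tcopair (tlift_comp (g := fun u : tensor A T => tens a (1 : T) * tens (1 : A) (tens b (1 : A)) * u)); last by lin.
  apply: eq_tlift => c d; by rewrite !tensM !mul1r !mulr1 ?tensM ?mul1r ?mulr1.
- exact: Rmat_counitl.
- exact: Rmat_counitr.
exact: Rmat_braid.
Qed.
End Rmatrix.

(** * The chromatic element *)

Section Proportional.
Variable K : fieldType.
(** Only the nonvanishing of the final constant k matters, so scalars are carried up to a nonzero
    factor. *)
Definition prop_to (V : lmodType K) (x y : V) := exists2 c : K, c != 0 & x = c *: y.
Lemma prop_refl (V : lmodType K) (x : V) : prop_to x x.
Proof. by exists 1; rewrite ?oner_neq0 ?scale1r. Qed.
Lemma prop_scale (V : lmodType K) c (x y : V) : c != 0 -> prop_to x y -> prop_to (c *: x) y.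
Proof. by move=> c0 [d d0 ->]; exists (c * d); rewrite ?mulf_neq0 ?scalerA. Qed.
Lemma prop_trans (V : lmodType K) (x y w : V) : prop_to x y -> prop_to y w -> prop_to x w.
Proof. by move=> [c c0 ->]; exact: prop_scale. Qed.
Lemma prop_sym (V : lmodType K) (x y : V) : prop_to x y -> prop_to y x.
Proof. by move=> [c c0 ->]; exists c^-1; rewrite ?invr_eq0 ?scalerA ?mulVf ?scale1r. Qed.
Lemma propN (V : lmodType K) (x y : V) : prop_to x y -> prop_to (- x) y.
Proof. by rewrite -scaleN1r; apply: prop_scale; rewrite oppr_eq0 oner_neq0. Qed.
Lemma propM (A : pzAlgType K) (x y x' y' : A) : prop_to x y -> prop_to x' y' ->
  prop_to (x * x') (y * y').
Proof.
move=> [c c0 ->] [d d0 ->]; exists (c * d); first exact: mulf_neq0.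
by rewrite -pzscaleAl -pzscaleAr scalerA.
Qed.
Lemma propX (A : pzAlgType K) (x y : A) m : prop_to x y -> prop_to (x ^+ m) (y ^+ m).
Proof.
move=> h; elim: m => [|m IH]; first exact: prop_refl.
by rewrite !exprS; apply: propM.
Qed.
Lemma prop_qcomm (A : pzAlgType K) c (x y : A) : c != 0 -> qcomm c x y -> prop_to (x * y) (y * x).
Proof. by move=> c0 h; exists c. Qed.
Lemma prop_expM (A : pzAlgType K) c (x y : A) m : c != 0 -> qcomm c y x ->
  prop_to ((x * y) ^+ m) (x ^+ m * y ^+ m).
Proof. by move=> c0 h; rewrite (qcomm_expM m h); exists (c ^+ ((m * m.-1) %/ 2)%N); rewrite ?expf_neq0. Qed.
End Proportional.

Section ChromaticTwist.
Variables (p r : nat) (K : fieldType) (q : K).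
Hypotheses (q_prim : r.-primitive_root q) (r_dvd8 : (8 %| r)%N).
Local Notation N := (r %/ 2)%N.
Variables (A : pzAlgType K) (gK gE gF gL : A) (gZ : bool -> 'I_p -> A) (gS : 'S_p -> A).
Hypothesis pres : presentation r q gK gE gF gL gZ gS.
Local Notation z := (q ^+ 2).
Local Notation t := (q ^- 2).
Local Notation T := (tensor A A).
Let N0 : (0 < N)%N := N_gt0 q_prim r_dvd8.
Local Notation n := N.-1.
Local Notation rels := (pres_rels pres).
Local Notation Ki := (Ki r gK).
Local Notation Lb := (Lb r gK gL).
Local Notation Zt := (Zt gZ).
Local Notation word := (word gK gE gF gL gZ gS).
Local Notation Fil := (Fil gK gE gF gL gZ gS).
Local Notation img := (img gK gE gF gL gZ gS).
Local Notation D := (comulL q_prim r_dvd8 pres).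
Local Notation eps := (counitL q_prim r_dvd8 pres).

Hypothesis NK : (N%:R : K) != 0.
Hypothesis p0 : (0 < p)%N.
Hypothesis pfact : (p`!%:R : K) = 0.
Local Notation rho := (rho q_prim r_dvd8 pres).
Local Notation H := (hopfA q_prim r_dvd8 pres).
Local Notation Sa := (antipodeL q_prim r_dvd8 pres).
Local Notation R := (Rmat r q gK gE gF gL gZ).
Local Notation R0 := (R0 r q gK gL).
Local Notation EF := (EF q gE gF).
Local Notation E1 := (E1 q gE).
Local Notation zz := (zz r gK gL gZ).
Local Notation LZ := (LZ r gK gL gZ).
Local Notation sgZ := (sgZ gZ).
Local Notation L := (Lam r gK gE gF gL gZ gS).
Local Notation I2 := (bool * 'I_p)%type.
Let LamP := Lam_two_sided q_prim r_dvd8 pres.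
Let rhoLam := papl_rho_Lam q_prim r_dvd8 pres NK.
Let gg' := KKi q_prim r_dvd8 rels.
Let g'g := KiK q_prim r_dvd8 rels.
Let S2 := antipode_sq q_prim r_dvd8 pres.
Let SM := SM q_prim r_dvd8 pres.
Let S1 := S1 q_prim r_dvd8 pres.
Let SD := comul_antipode q_prim r_dvd8 pres.
Let epsS := counit_antipode q_prim r_dvd8 pres.
Let lrho : linear (rho : A -> K^o). Proof. exact: linearP. Qed.
Let lSa : linear Sa. Proof. exact: linearP. Qed.
Let SL : Sa L = L.
Proof. exact: (antipode_Lam (H := H) LamP rhoLam gg' S2 SM epsS). Qed.

Definition s0 : A := Ssum gS * (1 + gL) * Ksum r gK.
Let z0 : z != 0. Proof. exact: q2_neq0 q_prim r_dvd8. Qed.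
Let t0 : t != 0. Proof. by rewrite invr_eq0. Qed.
Let N10 : (-1 : K) != 0. Proof. by rewrite oppr_eq0 oner_neq0. Qed.

Lemma s0_K : s0 * gK = s0.
Proof. by rewrite /s0 -mulrA (Ksum_K q_prim r_dvd8 pres). Qed.
Lemma s0_L : s0 * gL = s0.
Proof.
have h : gL * Ksum r gK = Ksum r gK * gL.
  by apply: comm_Ksum; exact: qcomm_sym1 (rLK rels).
by rewrite /s0 -mulrA -h mulrA -(mulrA (Ssum gS)) mulrDl mul1r (rL rels) [gL + 1]addrC.
Qed.
Lemma s0_KX m : s0 * gK ^+ m = s0.
Proof. by elim: m => [|m IH]; rewrite ?mulr1 // exprS mulrA s0_K. Qed.
Lemma eps_s0 : eps s0 = 0.
Proof.
have le : linear (eps : A -> K^o) by exact: linearP.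
rewrite /s0 !(epsM q_prim r_dvd8 pres) [eps (Ssum gS)](lin_sum le).
rewrite (eq_bigr (fun _ => 1)) => [|s _]; last exact: (eps_S q_prim r_dvd8 pres).
by rewrite sumr_const card_Sn pfact !mul0r.
Qed.

(** S(Λ) = Λ, and S reverses the factors of Λ. The powers of K produced by S(E)^n and S(F)^n cancel,
    and s0 commutes with E^n F^n and with the product of all Z. *)
Lemma Lam_opposite : prop_to L (s0 * gE ^+ n * gF ^+ n * Zt).
Proof.
have SX x m : Sa (x ^+ m) = Sa x ^+ m by exact: (SX q_prim r_dvd8 pres).
have SZt : Sa Zt = Zt.
  rewrite /Zt; elim: (index_enum _) => [|l X IH]; first by rewrite !big_nil S1.
  rewrite !big_cons SM IH SM !S_Z mulrNN.
  have -> : gZ false l * Lb * (gZ true l * Lb) = gZ true l * gZ false l.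
    rewrite -mulrA (mulrA Lb) (Lb_Z q_prim r_dvd8 rels true l) -pzscaleAl -mulrA.
    rewrite (LbLb q_prim r_dvd8 rels) mulr1 -pzscaleAr (rZZ rels false l true l).
    by rewrite scalerA mulrNN mulr1 scale1r.
  symmetry; apply: (prod_comm_elt (F := Zpair gZ)) => i; exact: (Zpair_comm pres).
have SKs : Sa (Ksum r gK) = Ksum r gK.
  rewrite /Ksum (lin_sum lSa) -[RHS](K_Ksum q_prim r_dvd8 pres) /Ksum mulr_sumr.
  rewrite [RHS](reindex_inj rev_ord_inj); apply: eq_bigr => c _.
  rewrite -[nat_of_ord (rev_ord c)]/(N - c.+1)%N.
  have Kc : gK ^+ c * gK ^+ (N - c) = 1 by rewrite -exprD subnKC ?(rK rels) // ltnW.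
  have -> : Sa (gK ^+ c) = Ki ^+ c by rewrite SX S_K.
  have KiKc : Ki ^+ c * gK ^+ c = 1.
    have cKK : GRing.comm Ki gK by apply/esym/qcomm_comm/(K_Ki q_prim r_dvd8 rels).
    by rewrite -exprMn_comm // g'g expr1n.
  rewrite -exprS subnSK // -[LHS]mulr1 -Kc mulrA KiKc mul1r //.
have SSs : Sa (Ssum gS) = Ssum gS.
  rewrite /Ssum (lin_sum lSa) [RHS](reindex_inj invg_inj).
  by apply: eq_bigr => s _; exact: S_S.
have S1L : Sa (1 + gL) = 1 + gL by rewrite (linD lSa) S1 S_L.
rewrite -SL /Lam !SM SZt SKs SSs S1L !SX S_E S_F.
have KEn : qcomm 1 gK (gE ^+ n * gF ^+ n).
  apply: qcomm_eq (qcommMr (qcommXr n (rKE rels)) (qcommXr n (rKF rels))) _.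
  by rewrite -exprMn mulfV // expr1n.
have LEn : qcomm 1 gL (gE ^+ n * gF ^+ n).
  apply: qcomm_eq (qcommMr (qcommXr n (rLE rels)) (qcommXr n (rLF rels))) _.
  by rewrite !expr1n mulr1.
have SEn s : qcomm 1 (gS s) (gE ^+ n * gF ^+ n).
  apply: qcomm_eq (qcommMr (qcommXr n (rSE rels s)) (qcommXr n (rSF rels s))) _.
  by rewrite !expr1n mulr1.
have cEF : s0 * (gE ^+ n * gF ^+ n) = (gE ^+ n * gF ^+ n) * s0.
  rewrite /s0 -mulrA (Ksum_comm r) ?(proj1 (qcomm_comm _ _) KEn) //.
  by rewrite [LHS]mulrA -(comm_SL SEn LEn) -mulrA.
have cZ : s0 * Zt = Zt * s0.
  rewrite /s0 -mulrA (Ksum_comm r) ?(K_Zt pres) // [LHS]mulrA [RHS]mulrA; congr (_ * _).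
  have hL : (1 + gL) * Zt = Zt * (1 + gL) by rewrite mulrDl mulrDr mul1r mulr1 (L_Zt pres).
  by rewrite -mulrA hL mulrA (Ssum_comm (S_Zt pres)) -mulrA.
have cs : Ksum r gK * ((1 + gL) * Ssum gS) = s0.
  have -> : (1 + gL) * Ssum gS = Ssum gS * (1 + gL).
    rewrite mulrDl mulrDr mul1r mulr1; congr (_ + _); apply/esym/Ssum_comm => s.
    exact/qcomm_comm/(rSL rels).
  by rewrite /s0 (Ksum_comm r) //; exact: comm_SL (rSK rels) (rLK rels).
have -> : s0 * gE ^+ n * gF ^+ n * Zt = Zt * (gE ^+ n * (gF ^+ n * s0)).
  have eZ : Zt * gE ^+ n = gE ^+ n * Zt by apply: commrX; rewrite /GRing.comm (E_Zt pres).
  have fZ : Zt * gF ^+ n = gF ^+ n * Zt by apply: commrX; rewrite /GRing.comm (F_Zt pres).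
  by rewrite -(mulrA s0) cEF -mulrA cZ [RHS]mulrA eZ -[RHS]mulrA (mulrA Zt) fZ !mulrA.
apply: propM (prop_refl _) _; rewrite cs.
have P1 : prop_to ((- (gE * Ki)) ^+ n) (gE ^+ n * gK).
  have P : prop_to ((gE * Ki) ^+ n) (gE ^+ n * Ki ^+ n).
    by apply: prop_expM t0 _; exact: (Ki_E q_prim r_dvd8 rels).
  rewrite (Ki_pred q_prim r_dvd8 rels) in P.
  exact: prop_trans (propX n (propN (prop_refl _))) P.
have P2 : prop_to ((- (gK * gF)) ^+ n) (Ki * gF ^+ n).
  apply: prop_trans (propX n (propN (prop_refl _))) _.
  by apply: prop_expM z0 _; exact: (F_K q_prim r_dvd8 rels).
have := propM P1 (propM P2 (prop_refl s0)).
by rewrite -!mulrA (mulrA gK) gg' mul1r.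
Qed.

(* psi = lambda o S is rho twisted by K; only the part of the monodromy whose
   left legs have top degree contributes. *)
Definition psi (a : A) : K := rho (gK * a * Ki).
Lemma psi_lin : linear (psi : A -> K^o).
Proof.
by move=> k x y; rewrite /psi -lrho; congr (rho _); rewrite mulrDr mulrDl -pzscaleAr -pzscaleAl.
Qed.
(** Conjugation by K preserves the filtration, so psi reads off leading terms just as rho does. *)
Lemma papl_psi_leads x g u : leads gK gE gF gL gZ gS (n + n + 2 * p) x g u ->
  papl psi u = psi x *: g.
Proof.
move=> h; have lp := papl_lin lrho; have lq := papl_lin psi_lin.
have -> : papl psi u = papl rho (tens gK (1 : A) * u * tens Ki (1 : A)).
  move: u {h}; apply: tens_ext; [exact: lq | lin | ] => y w.
  by rewrite !tensM mul1r mulr1 !paplE //; exact: psi_lin.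
rewrite -[g in RHS]mul1r -[1 * g]mulr1; apply: (papl_leads q_prim r_dvd8 pres).
have -> : (n + n + 2 * p = 0 + (n + n + 2 * p) + 0)%N by rewrite addn0.
by apply: (leadsM q_prim r_dvd8); [apply: (leadsM q_prim r_dvd8) => //|]; apply: leads_refl; [rewrite -[gK]expr1|]; exact: Fil_K.
Qed.

Local Notation leads := (leads gK gE gF gL gZ gS).
Local Notation lower := (lower gK gE gF gL gZ gS).
Lemma FilZ k c x : x \in Fil k -> c *: x \in Fil k.
Proof. by move=> h; rewrite -[_ *: _]addr0; case: (Fil_sub gK gE gF gL gZ gS k) => F0; apply. Qed.
Lemma leadsZ k c x g u : leads k x g u -> leads k (c *: x) g (c *: u).
Proof.
move=> [xk h]; split; first by rewrite -[c *: x]addr0; case: (Fil_sub gK gE gF gL gZ gS k) => F0; apply.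
rewrite tensZl -scalerBr -[_ *: _]addr0.
by case: (lower_sub gK gE gF gL gZ gS k) => l0; apply.
Qed.
(** All terms of the truncated exponential before the last have smaller degree in the left leg. *)
Lemma leads_qexp x y : x \in Fil 1 ->
  leads n ((qnfact t n)^-1 *: x ^+ n) (y ^+ n) (qexp t N (tens x y)).
Proof.
move=> x1; rewrite /qexp -(prednK N0) big_ord_recr /=.
have xk k : x ^+ k \in Fil k.
  elim: k => [|k IH]; first exact: Fil1.
  by rewrite exprS -add1n; exact: FilM.
have h : leads n ((qnfact t n)^-1 *: x ^+ n) (y ^+ n) (divp t n (tens x y)).
  by rewrite /divp tensX; apply: leadsZ; apply: leads_refl.
case: h => h1 h2; split=> //; rewrite -addrA; apply: lowerD => //.
apply: (big_ind (fun u => u \in lower n)).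
- by case: (lower_sub gK gE gF gL gZ gS n).
- by move=> u v; exact: lowerD.
move=> i _; rewrite /divp tensX -tensZl; apply: span_gen.
exists (nat_of_ord i), ((qnfact t i)^-1 *: x ^+ i), (y ^+ i); split=> //.
by rewrite -[_ *: _]addr0; case: (Fil_sub gK gE gF gL gZ gS i) => F0; apply.
Qed.

Lemma prod_LZ : \prod_(i <- pairs_word p) LZ i = Zt.
Proof.
rewrite /pairs_word big_flatten big_map enumT /Zt [index_enum _]unlock /=.
apply: eq_bigr => l _; rewrite big_cons big_seq1 /LZ /=.
rewrite mulrA -(mulrA Lb) (qcomm_symN (Lb_Z q_prim r_dvd8 rels false l)) -pzscaleAr mulrA.
rewrite (LbLb q_prim r_dvd8 rels) mul1r -pzscaleAl (rZZ rels false l true l).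
by rewrite scalerA mulrNN mulr1 scale1r.
Qed.
Lemma prod_sgZ c : c != 0 -> prop_to (\prod_(i <- pairs_word p) (c *: sgZ i)) Zt.
Proof.
move=> c0; rewrite /pairs_word big_flatten big_map enumT /Zt [index_enum _]unlock /=.
elim: (Finite.enum _) => [|l X IH]; first by rewrite !big_nil; exact: prop_refl.
rewrite !big_cons !big_nil mulr1 /sgZ /=; apply: propM IH.
apply: propM; apply: prop_scale => //; apply: prop_scale; rewrite ?expr0 ?expr1 ?oner_neq0 //;
  exact: prop_refl.
Qed.

(** Each [zz i] squares to 0, so (1 + zz)^2 = 1 + 2 zz, and the right legs multiply to [Zt] by
    [prod_LZ]. *)
Lemma leads_Pz2 : leads (2 * p) (\prod_(i <- pairs_word p) (2 *: sgZ i)) Zt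
  ((\prod_(i <- pairs_word p) (1 + zz i)) * \prod_(i <- pairs_word p) (1 + zz i)).
Proof.
have zc i j : (1 + zz i) * (1 + zz j) = (1 + zz j) * (1 + zz i).
  rewrite !(mulrDl, mulrDr) !mulr1 !mul1r (zz_comm q_prim r_dvd8 pres) -!addrA.
  by congr (_ + _); rewrite addrCA.
have -> : (\prod_(i <- pairs_word p) (1 + zz i)) * \prod_(i <- pairs_word p) (1 + zz i) =
    \prod_(i <- pairs_word p) (1 + tens (2 *: sgZ i) (LZ i)).
  elim: (pairs_word p) => [|i X IH]; first by rewrite !big_nil mulr1.
  rewrite !big_cons -IH -!mulrA; rewrite [in LHS](mulrA (\prod_(j <- X) _)).
  rewrite -(prod_comm_elt _ (x := 1 + zz i)) => [|j]; last exact: zc.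
  rewrite !mulrA; congr (_ * _ * _).
  have zz2 : zz i * zz i = 0 by rewrite tensM (sgZ_sq pres) tens0l.
  rewrite mulrDr mulr1 mulrDl mul1r zz2 addr0 -addrA; congr (_ + _).
  by rewrite tensZl scaler_nat mulr2n.
rewrite -prod_LZ -(size_pairs_word p).
elim: (pairs_word p) => [|i X IH]; first by rewrite !big_nil; exact: leads1.
rewrite !big_cons -[size (i :: X)]add1n; apply: (leadsM q_prim r_dvd8) => //.
have F1 : 2 *: sgZ i \in Fil 1.
  apply: FilZ; apply: FilZ; exact: (Fil_img gK gE gF gL gZ gS (genZ i.1 i.2)).
split=> //; rewrite addrK tens1; apply: span_gen; exists 0%N, (1 : A), (1 : A).
by split=> //; exact: Fil1.
Qed.

(** To the right of s0 both K and L act as 1, and the idempotents in the other leg sum to 1. *)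
Lemma s0_R0 : tens s0 (1 : A) * R0 = tens s0 (1 : A).
Proof.
have ab g m w (gm : g ^+ m = 1) (pw : m.-primitive_root w) (m0 : (m%:R : K) != 0) :
    s0 * g = s0 -> tens s0 (1 : A) * bichar g m w = tens s0 (1 : A).
  move=> sg; have sX k : s0 * g ^+ k = s0 by elim: k => [|k IH]; rewrite ?mulr1 // exprS mulrA sg.
  rewrite bicharEl mulr_sumr -[X in _ = tens _ X](bidem_sum g pw m0) tens_sumr.
  by apply: eq_bigr => b _; rewrite tensM sX mul1r.
rewrite /R0 mulrA (ab _ _ _ _ (N1_prim q_prim r_dvd8)) ?two_neq0 ?s0_L ?expr2 ?(rL rels) //.
  by rewrite (ab _ _ _ (rK rels) (t_prim q_prim r_dvd8) NK s0_K).
exact: (two_neq0 q_prim r_dvd8).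
Qed.
Lemma R0_s0 : tens (1 : A) s0 * R0 = tens (1 : A) s0.
Proof.
have ab g m w (gm : g ^+ m = 1) (pw : m.-primitive_root w) (m0 : (m%:R : K) != 0) :
    s0 * g = s0 -> tens (1 : A) s0 * bichar g m w = tens (1 : A) s0.
  move=> sg; have sX k : s0 * g ^+ k = s0 by elim: k => [|k IH]; rewrite ?mulr1 // exprS mulrA sg.
  rewrite bicharEr mulr_sumr -[X in _ = tens X _](bidem_sum g pw m0) tens_suml.
  by apply: eq_bigr => b _; rewrite tensM sX mul1r.
rewrite /R0 mulrA (ab _ _ _ _ (N1_prim q_prim r_dvd8)) ?two_neq0 ?s0_L ?expr2 ?(rL rels) //.
  by rewrite (ab _ _ _ (rK rels) (t_prim q_prim r_dvd8) NK s0_K).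
exact: (two_neq0 q_prim r_dvd8).
Qed.

Local Notation Pz := (\prod_(i <- pairs_word p) (1 + zz i)).
Local Notation Th := (qexp t N EF).
Local Notation Ths := (qexp t N (tens (gF * Ki) (gK * E1))).
Let htw := alghom_tswap A.

Lemma tswap_EF_R0 : tswap EF * R0 = R0 * tens (gF * Ki) (gK * E1).
Proof.
have L_K := rLK rels; have K_K := qcomm_refl (gK : A) : qcomm (1 : K) gK gK.
have hF : R0 * tens gF gK = tens gF (1 : A) * R0.
  by apply: (R0_cancel_l q_prim r_dvd8 pres (R0_lF q_prim r_dvd8 pres)).
have hE : R0 * tens Ki gE = tens (1 : A) gE * R0.
  apply: (R0_cancel_r q_prim r_dvd8 pres (R0_rE q_prim r_dvd8 pres)) => //.
    exact: (qcomm_sym1 (Ki_L rels)).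
  exact: (K_Ki q_prim r_dvd8 rels).
rewrite /EF tswapE /E1 tensZr -pzscaleAr tensZr -pzscaleAl -pzscaleAr; congr (_ *: _).
move: R0 hF hE => X hF hE.
have -> : tens (gF * Ki) (gK * gE) = tens gF gK * tens Ki gE :> T by rewrite tensM.
have -> : tens gF gE = tens gF (1 : A) * tens (1 : A) gE :> T by rewrite tensM mulr1 mul1r.
by rewrite -mulrA -hE mulrA -hF -mulrA.
Qed.
Definition flip (i : I2) : I2 := (~~ i.1, i.2).
(** Passing R0 moves Lbar to the other leg and turns the flipped [zz i] into [zz] with Z^+ and Z^-
    exchanged; the product over all letters is therefore unchanged. *)
Lemma tswap_zz_R0 i : tswap (zz i) * R0 = R0 * zz (flip i).
Proof.
have LbLb' := LbLb q_prim r_dvd8 rels.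
have L_Lb := qcomm_sym1 (Lb_L rels); have K_Lb := qcomm_sym1 (Lb_K rels).
have hL : R0 * tens (gZ (~~ i.1) i.2) Lb = tens (gZ (~~ i.1) i.2) (1 : A) * R0 :=
  R0_Z q_prim r_dvd8 pres (~~ i.1) i.2.
have hZ : R0 * tens Lb (gZ i.1 i.2) = tens (1 : A) (gZ i.1 i.2) * R0.
  by apply: (R0_cancel_r q_prim r_dvd8 pres (R0_rZ q_prim r_dvd8 pres i.1 i.2)).
have hb : R0 * tens Lb (1 : A) = tens Lb (1 : A) * R0 by exact: (R0_lg q_prim r_dvd8 pres).
rewrite /zz tswapE /sgZ /LZ /flip /= negbK !tensZr !tensZl -pzscaleAl -pzscaleAr.
move: R0 hL hZ hb => X hL hZ hb.
have -> : tens (Lb * gZ (~~ i.1) i.2) (gZ i.1 i.2) =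
    tens Lb (1 : A) * (tens (gZ (~~ i.1) i.2) (1 : A) * tens (1 : A) (gZ i.1 i.2)) :> T.
  by rewrite !tensM !mul1r !mulr1.
rewrite -!mulrA -hZ (mulrA _ X) -hL -mulrA (mulrA _ X) -hb -!mulrA !tensM mul1r.
have -> : Lb * (gZ (~~ i.1) i.2 * Lb) = - gZ (~~ i.1) i.2.
  rewrite mulrA (Lb_Z q_prim r_dvd8 rels) -pzscaleAl -mulrA LbLb' mulr1 scaleN1r //.
rewrite tensNl mulrN scalerN -scaleNr; congr (_ *: _); last by rewrite /Lb !mulrA.
by case: (i.1); rewrite ?expr0 ?expr1 ?opprK.
Qed.

(** The Cartan part of R_21 is absorbed by s0 at once. That of R is first moved left through the
    other factors of R_21 and then absorbed too. *)
Lemma monodromy_s0 : tens (1 : A) s0 * monodromy R =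
  tens (1 : A) s0 * (Ths * Th * (Pz * Pz)).
Proof.
have h1 := prod_intertwine (pairs_word p) tswap_zz_R0.
have h2 := qexp_intertwine t N tswap_EF_R0.
have h3 := R0_s0.
have zc i j : (1 + zz i) * (1 + zz j) = (1 + zz j) * (1 + zz i).
  rewrite !(mulrDl, mulrDr) !mulr1 !mul1r (zz_comm q_prim r_dvd8 pres) -!addrA.
  by congr (_ + _); rewrite addrCA.
have Pf : \prod_(i <- pairs_word p) (1 + zz (flip i)) = Pz.
  rewrite -(big_map flip predT (fun i => 1 + zz i)); apply: (prod_comm_perm (F := fun i => 1 + zz i) zc).
  have finj : injective flip by move=> [e l] [e' l'] [/negb_inj -> ->].
  apply: uniq_perm; rewrite ?(map_inj_uniq finj) ?uniq_pairs_word // => i.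
  rewrite mem_pairs_word; apply/mapP; exists (flip i); rewrite ?mem_pairs_word //.
  by rewrite /flip /= negbK; case: i.
have Pc : Pz * Th = Th * Pz.
  apply: prod_intertwine => i; symmetry; apply: qexp_intertwine; apply/qcomm_comm.
  by apply: qcomm_eq (qcomm_tens (E1_sgZ pres i) (F_LZ q_prim r_dvd8 pres i)) _; rewrite mulrNN mulr1.
have st : tens (1 : A) s0 * tswap R0 = tens (1 : A) s0.
  by rewrite -[tens (1 : A) s0](tswapE s0 (1 : A)) -(alghomM htw) s0_R0.
have PT : tswap Pz = \prod_(i <- pairs_word p) (1 + tswap (zz i)).
  rewrite (alghom_prod htw); apply: eq_bigr => i _.
  by rewrite (linD (alghom_lin htw)) (alghom1 htw).
rewrite /monodromy (RmatE q_prim r_dvd8 gK gE gF gL gZ).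
move: R0 h1 h2 h3 st => X h1 h2 h3 st.
rewrite (alghomM htw) (alghomM htw) (alghom_qexp _ _ htw) PT mulrA 2!(mulrA (tens (1 : A) s0)) st.
rewrite -!mulrA (mulrA (\prod_(i <- pairs_word p) _) X) h1 Pf -!mulrA (mulrA _ X) h2.
by rewrite -!mulrA (mulrA _ X) h3 (mulrA Pz Th) Pc -!mulrA.
Qed.

(** After [monodromy_s0] the leading left leg is, up to a scalar, (F K^-1)^n E^n times all Z, on
    which psi is nonzero. The right leg is, up to a scalar, (K E)^n F^n times all Z, which s0 turns
    into the reversed form of Λ. *)
Lemma s0_chromatic (lam0 : {scalar A}) : (forall a, lam0 (Sa a) = psi a) ->
  prop_to (s0 * chromatic_elt H R lam0) L.
Proof.
move=> lamS; have lq := papl_lin psi_lin.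
have -> : chromatic_elt H R lam0 = papl psi (monodromy R).
  by apply: eq_tlift => a b; rewrite -lamS.
rewrite -(papl_mul psi_lin) monodromy_s0 (papl_mul psi_lin).
have E1F : E1 \in Fil 1 by apply: FilZ; exact: (Fil_img gK gE gF gL gZ gS (genE p)).
have FKi : gF * Ki \in Fil 1.
  rewrite -[1%N]addn0; apply: FilM; [exact: (Fil_img gK gE gF gL gZ gS (genF p)) | exact: Fil_Ki].
have ld := leadsM q_prim r_dvd8 (leadsM q_prim r_dvd8 (leads_qexp (gK * E1) FKi)
  (leads_qexp gF E1F)) leads_Pz2.
rewrite (papl_psi_leads ld) -pzscaleAr.
have qb0 : qbrace q 1 != 0 by rewrite /qbrace expr1; exact: (q_qinv_neq0 q_prim r_dvd8).
have f0 : (qnfact t n)^-1 != 0.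
  rewrite invr_neq0 // (qnfact_neq0 (N := N)) //; last by rewrite prednK.
  exact: (qnumt_neq0 q_prim r_dvd8).
have pE : prop_to (E1 ^+ n) (gE ^+ n) by apply: propX; apply: prop_scale qb0 (prop_refl _).
have KnKi : gK ^+ n = Ki by [].
have [c c0 lE] : prop_to (gK * ((qnfact t n)^-1 *: (gF * Ki) ^+ n * ((qnfact t n)^-1 *: E1 ^+ n) *
    (\prod_(i <- pairs_word p) (2 *: sgZ i))) * Ki) (gK * gF ^+ n * gE ^+ n * Zt).
  (* K^-n = K, and this K is moved past E^n to cancel the outer K^-1 of psi. *)
  have P1 : prop_to ((gF * Ki) ^+ n) (gF ^+ n * gK).
    have P : prop_to ((gF * Ki) ^+ n) (gF ^+ n * Ki ^+ n).
      by apply: prop_expM z0 _; exact: (Ki_F q_prim r_dvd8 rels).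
    by rewrite (Ki_pred q_prim r_dvd8 rels) in P.
  have P2 := propM (propM (prop_scale f0 P1) (prop_scale f0 pE)) (prod_sgZ (two_neq0 q_prim r_dvd8)).
  apply: prop_trans (propM (propM (prop_refl gK) P2) (prop_refl Ki)) _.
  have ZK : Zt * Ki = Ki * Zt by apply: commrX; rewrite /GRing.comm (K_Zt pres).
  have EK : prop_to (gK * gE ^+ n) (gE ^+ n * gK).
    by apply: prop_qcomm (qcommXr n (rKE rels)); rewrite expf_neq0.
  rewrite -!mulrA ZK; apply: propM (prop_refl _) _; apply: propM (prop_refl _) _.
  rewrite !mulrA; apply: propM (prop_refl _).
  apply: prop_trans (propM EK (prop_refl Ki)) _.
  by rewrite -mulrA gg' mulr1; exact: prop_refl.
rewrite /psi lE.
have -> : rho (c *: (gK * gF ^+ n * gE ^+ n * Zt)) = c.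
  by rewrite (linZ lrho) (rho_KFEZ q_prim r_dvd8 pres NK); exact: mulr1.
apply: prop_scale c0 _; apply: prop_trans _ (prop_sym Lam_opposite).
have PK : prop_to ((gK * E1) ^+ n) (Ki * gE ^+ n).
  apply: prop_trans (propM (prop_refl _) pE).
  by apply: prop_expM t0 _; apply: qcommZl; exact: (E_K q_prim r_dvd8 rels).
have := propM (prop_refl s0) (propM (propM PK (prop_refl (gF ^+ n))) (prop_refl Zt)).
by rewrite !mulrA s0_KX.
Qed.
End ChromaticTwist.

(** * Twist degeneracy and the main theorem *)

Section Main.
Variables (p r : nat) (K : fieldType) (q : K).
Hypotheses (q_prim : r.-primitive_root q) (r_dvd8 : (8 %| r)%N).
Local Notation N := (r %/ 2)%N.
Variables (A : pzAlgType K) (gK gE gF gL : A) (gZ : bool -> 'I_p -> A) (gS : 'S_p -> A).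
Hypothesis pres : presentation r q gK gE gF gL gZ gS.
Local Notation z := (q ^+ 2).
Local Notation t := (q ^- 2).
Local Notation T := (tensor A A).
Let N0 : (0 < N)%N := N_gt0 q_prim r_dvd8.
Local Notation n := N.-1.
Local Notation rels := (pres_rels pres).
Local Notation Ki := (Ki r gK).
Local Notation Lb := (Lb r gK gL).
Local Notation Zt := (Zt gZ).
Local Notation word := (word gK gE gF gL gZ gS).
Local Notation Fil := (Fil gK gE gF gL gZ gS).
Local Notation img := (img gK gE gF gL gZ gS).
Local Notation D := (comulL q_prim r_dvd8 pres).
Local Notation eps := (counitL q_prim r_dvd8 pres).

Hypothesis NK : (N%:R : K) != 0.
Hypothesis p0 : (0 < p)%N.
Hypothesis pfact : (p`!%:R : K) = 0.
Local Notation rho := (rho q_prim r_dvd8 pres).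
Local Notation H := (hopfA q_prim r_dvd8 pres).
Local Notation Sa := (antipodeL q_prim r_dvd8 pres).
Local Notation R := (Rmat r q gK gE gF gL gZ).
Local Notation R0 := (R0 r q gK gL).
Local Notation EF := (EF q gE gF).
Local Notation E1 := (E1 q gE).
Local Notation zz := (zz r gK gL gZ).
Local Notation LZ := (LZ r gK gL gZ).
Local Notation sgZ := (sgZ gZ).
Local Notation L := (Lam r gK gE gF gL gZ gS).
Local Notation I2 := (bool * 'I_p)%type.
Let LamP := Lam_two_sided q_prim r_dvd8 pres.
Let rhoLam := papl_rho_Lam q_prim r_dvd8 pres NK.
Let gg' := KKi q_prim r_dvd8 rels.
Let g'g := KiK q_prim r_dvd8 rels.
Let S2 := antipode_sq q_prim r_dvd8 pres.
Let SM := SM q_prim r_dvd8 pres.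
Let S1 := S1 q_prim r_dvd8 pres.
Let SD := comul_antipode q_prim r_dvd8 pres.
Let epsS := counit_antipode q_prim r_dvd8 pres.
Let lrho : linear (rho : A -> K^o). Proof. exact: linearP. Qed.
Let lSa : linear Sa. Proof. exact: linearP. Qed.
Let SL : Sa L = L.
Proof. exact: (antipode_Lam (H := H) LamP rhoLam gg' S2 SM epsS). Qed.

Local Notation BL := (bichar gL 2 (-1)).
Local Notation BK := (bichar gK N t).
Local Notation Pz := (\prod_(i <- pairs_word p) (1 + zz i)).
Local Notation Th := (qexp t N EF).
Local Notation chi := (chi pres).
Let hchi := alghom_chi pres.
Let lchi : linear chi := alghom_lin hchi.
Definition legs_mul (u : T) : A := tlift (fun a b : A => Sa b * a) u.
Lemma legs_mul_lin : linear legs_mul.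
Proof. by apply: tlift_is_linear; lin. Qed.
Lemma legs_mulE a b : legs_mul (tens a b) = Sa b * a.
Proof. by rewrite /legs_mul tliftE //; lin. Qed.

(** The condition on the right leg is on S(d), because u is made of products S(R'') R'. *)
Local Notation chi_fixed := (Defs.span (fun u : T => exists c d : A,
  [/\ chi c = c, chi (Sa d) = Sa d & u = tens c d])).
Lemma chi_fixed_gen c d : chi c = c -> chi (Sa d) = Sa d -> tens c d \in chi_fixed.
Proof. by move=> hc hd; apply: span_gen; exists c, d. Qed.
Lemma chi_fixed1 : 1 \in chi_fixed.
Proof. by rewrite tens1; apply: chi_fixed_gen; rewrite ?S1 (alghom1 hchi). Qed.
Lemma chi_fixedM u w : u \in chi_fixed -> w \in chi_fixed -> u * w \in chi_fixed.
Proof.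
move=> + hw; move: u; apply: (span_map (f := fun u : T => u * w));
  [lin | exact: span_submod_closed |].
move=> _ [c [d [hc hd ->]]]; move: w hw; apply: (span_map (f := fun w : T => tens c d * w));
  [lin | exact: span_submod_closed |].
move=> _ [c' [d' [hc' hd' ->]]]; rewrite tensM; apply: chi_fixed_gen.
  by rewrite (alghomM hchi) hc hc'.
by rewrite SM (alghomM hchi) hd hd'.
Qed.
Let chiX (x : A) m : chi x = x -> chi (x ^+ m) = x ^+ m.
Proof. by move=> h; rewrite (alghomX hchi) h. Qed.
Let SX x m : Sa (x ^+ m) = Sa x ^+ m. Proof. exact: (SX q_prim r_dvd8 pres). Qed.
Let cK : chi gK = gK := chi_K pres.
Let cKi : chi Ki = Ki. Proof. exact: chiX cK. Qed.
Let cE1 : chi E1 = E1. Proof. by rewrite (linZ lchi) (chi_E pres). Qed.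
Let cSF : chi (Sa gF) = Sa gF.
Proof. by rewrite S_F (linN lchi) (alghomM hchi) cK (chi_F pres). Qed.

Lemma chi_fixed_rest : BK * Th * Pz \in chi_fixed.
Proof.
apply: chi_fixedM; first apply: chi_fixedM.
- apply: rpredZ; apply: rpred_sum => b _; apply: rpred_sum => c _; apply: rpredZ.
  by apply: chi_fixed_gen; rewrite ?SX ?S_K; exact: chiX.
- apply: rpred_sum => a _; apply: rpredZ; rewrite tensX.
  by apply: chi_fixed_gen; rewrite ?SX; exact: chiX.
elim: (pairs_word p) => [|i X IH]; first by rewrite big_nil; exact: chi_fixed1.
rewrite big_cons; apply: chi_fixedM => //; apply: rpredD; first exact: chi_fixed1.
apply: chi_fixed_gen; first by rewrite (linZ lchi) (chi_Z pres).
(* S(Lbar Z) = -Z Lbar^2 = -Z no longer contains L. *)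
rewrite /LZ SM S_Z (S_Lb q_prim r_dvd8 pres) mulNr -mulrA (LbLb q_prim r_dvd8 rels) mulr1.
by rewrite (linN lchi) (chi_Z pres).
Qed.

Lemma legs_mul_BL c d : legs_mul (BL * tens c d) = Sa d * gL * c.
Proof.
have -> : BL = 2^-1 *: (tens (1 : A) (1 : A) + tens (1 : A) gL + (tens gL (1 : A) - tens gL gL)) :> T.
  rewrite /bichar !big_ord_recr !big_ord0 /= !add0r !muln0 !mul0n muln1.
  by rewrite !expr0 !expr1 !scale1r scaleN1r.
rewrite -pzscaleAl (linZ legs_mul_lin) mulrDl mulrDl mulrBl !tensM !mul1r.
rewrite (linD legs_mul_lin) (linD legs_mul_lin) (linB legs_mul_lin) !legs_mulE !SM S_L.
have e1 : Sa d * gL * (gL * c) = Sa d * c by rewrite mulrA -(mulrA (Sa d)) (rL rels) mulr1.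
rewrite e1 (mulrA (Sa d) gL c) [X in _ *: X]addrC addrA subrK -mulr2n -scaler_nat scalerA.
by rewrite mulVf ?scale1r // (two_neq0 q_prim r_dvd8).
Qed.

(** By [legs_mul_BL] the element is a sum of S(d) L c with S(d) and c fixed by chi, so only the sign
    of L changes. *)
Lemma chi_legs_mul : chi (legs_mul R) = - legs_mul R.
Proof.
have -> : R = BL * (BK * Th * Pz).
  by rewrite (RmatE q_prim r_dvd8 gK gE gF gL gZ) !mulrA.
apply/eqP; rewrite -addr_eq0; apply/eqP; move: chi_fixed_rest.
move: (BK * Th * Pz) => u; move: u.
apply: (span_ker (f := fun u => chi (legs_mul (BL * u)) + legs_mul (BL * u))).
  have lm := legs_mul_lin; move=> k x y.
  rewrite mulrDr -pzscaleAr !lm lchi scalerDr addrACA //.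
move=> _ [c [d [hc hd ->]]]; rewrite legs_mul_BL !(alghomM hchi) hc hd (chi_L pres).
by rewrite mulrN mulNr addNr.
Qed.

Lemma Lam_cointegral : nonzero_cointegral H L.
Proof.
split; first exact: LamP.
move=> L0; have := rho_Lam (H := H) rhoLam; rewrite L0 linear0 => /eqP.
by rewrite eq_sym oner_eq0.
Qed.
Let lam0 := lambda H rho.
Let lam0P : nonzero_left_integral H lam0.
Proof. exact: (lambdaP (H := H) LamP rhoLam gg' g'g S2 SM SD epsS). Qed.

(** S(v) = v turns λ(v) = rho(S(v)) into rho(v), and rho(v) = rho(chi(v)) = -rho(v) with 2
    invertible. *)
Lemma ribbon_twist : exists2 v, ribbon_element H R v & twist_degenerate H v.
Proof.
have [rs RE] := tens_sum R.
have D_Ki' := D_Ki q_prim r_dvd8 pres; have eps_Ki' := eps_Ki q_prim r_dvd8 pres.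
have qtR := Rmat_quasitriangular q_prim r_dvd8 pres NK.
have rib : ribbon_element H R (ribbon_candidate H rs Ki).
  apply: (ribbon_of_grouplikes (H := H) RE qtR gg' g'g S2 SM S1 SD epsS D_Ki' eps_Ki').
  by move=> w; exact: central_grouplike_trivial.
exists (ribbon_candidate H rs Ki) => //; exists lam0 => //.
have [_ Sv _ _] := rib.
have -> : lam0 (ribbon_candidate H rs Ki) = rho (antipode H (ribbon_candidate H rs Ki)) by [].
rewrite Sv ribbon_candidateE.
have -> : drinfeld H rs = legs_mul R.
  by rewrite /drinfeld /legs_mul RE tlift_sum //; lin.
set v := Ki * _; have cv : chi v = - v.
  by rewrite /v (alghomM hchi) cKi chi_legs_mul mulrN.
have := rho_chi q_prim r_dvd8 pres v; rewrite cv (linN lrho) => /eqP.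
rewrite eq_sym -addr_eq0 -mulr2n -mulr_natr mulf_eq0 (negPf (two_neq0 q_prim r_dvd8)) orbF.
by move/eqP.
Qed.

Lemma hopf_relations :
  [/\ [/\ grouplike H gK, grouplike H gL & forall s, grouplike H (gS s)],
      [/\ antipode H gK = Ki, antipode H gL = gL & forall s, antipode H (gS s) = gS s^-1%g],
      [/\ comul H gE = tens (1 : A) gE + tens gE gK, counit H gE = 0
        & antipode H gE = - (gE * Ki)],
      [/\ comul H gF = tens gF (1 : A) + tens Ki gF, counit H gF = 0
        & antipode H gF = - (gK * gF)]
    & forall l, [/\ comul H (gZ true l) = tens (1 : A) (gZ true l) + tens (gZ true l) Lb,
          counit H (gZ true l) = 0 & antipode H (gZ true l) = - (gZ true l * Lb)] /\
        [/\ comul H (gZ false l) = tens (1 : A) (gZ false l) + tens (gZ false l) Lb,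
          counit H (gZ false l) = 0 & antipode H (gZ false l) = - (gZ false l * Lb)]].
Proof.
split.
- split; [split; [exact: D_K|exact: eps_K] | split; [exact: D_L|exact: eps_L] |].
  by move=> s; split; [exact: D_S|exact: eps_S].
- by split; [exact: S_K|exact: S_L|exact: S_S].
- by split; [exact: D_E|exact: eps_E|exact: S_E].
- by split; [exact: D_F|exact: eps_F|exact: S_F].
by move=> l; split; split; [exact: D_Z|exact: eps_Z|exact: S_Z|exact: D_Z|exact: eps_Z|exact: S_Z].
Qed.

Lemma presented_theoremA R' : R' = R ->
  [/\ unimodular H, quasitriangular H R',
      exists2 v, ribbon_element H R' v & twist_degenerate H v
    & chromatic_nondegenerate H R' /\ ~ chromatic_compact H R'].
Proof.
move=> ->; have LP := Lam_cointegral.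
have [k k0 sC] : prop_to (s0 r gK gL gS * chromatic_elt H R lam0) L.
  apply: s0_chromatic => // a; rewrite /psi -S2 //.
have e0 : counit H (s0 r gK gL gS) = 0 by exact: eps_s0.
split; [by exists L | exact: Rmat_quasitriangular | exact: ribbon_twist | split].
  exact: (chromatic_nondegenerateP LP rhoLam lam0P k0 sC).
apply: (chromatic_not_compact LP _ k0 e0 sC) => lam lamP a.
exact: (left_integral_unique (H := H) LamP rhoLam lamP).
Qed.
End Main.

Lemma Rmatrix_presented (p r : nat) (K : fieldType) (q : K) :
  @Rmatrix p K r q (fun=> 1) = Rmat r q (@aK p K r q) (@aE p K r q) (@aF p K r q)
    (@aL p K r q) (@aZ p r K q).
Proof. exact (erefl _). Qed.

Local Close Scope ring_scope.
Theorem theoremA (p r : nat) (K : closedFieldType) (q : K)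
    (p_prime : prime p) (p_gt2 : 2 < p) (charK : p \in [pchar K]%R)
    (q_prim : (r.-primitive_root q)%R) (r_dvd8 : 8 %| r) (r_coprime : coprime r p) :
  exists H : hopf_struct (biproduct p r q), biproduct_hopf H /\
  exists alpha : 'I_p -> K, let R := Rmatrix r q alpha in
    [/\ unimodular H,
        quasitriangular H R,
        exists2 v, ribbon_element H R v & twist_degenerate H v
      & chromatic_nondegenerate H R /\ ~ chromatic_compact H R].
Proof.
have N0 := N_gt0 q_prim r_dvd8.
have pr : ~~ (p %| r) by rewrite -prime_coprime // coprime_sym.
(* r' divides r, which is coprime to p, so r' is invertible in K; the normalisations of D and rho
   divide by it. *)
have NK : ((r %/ 2)%:R != 0 :> K)%R.
  rewrite -(dvdn_pcharf charK); apply: contra pr => pN.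
  by apply: dvdn_trans pN _; apply: dvdn_div; apply: dvdn_trans r_dvd8.
have pfact : ((p`!)%:R = 0 :> K)%R.
  by apply/eqP; rewrite -(dvdn_pcharf charK) dvdn_fact // leqnn prime_gt0.
pose pres := @biproduct_presentation p r K q N0.
exists (hopfA q_prim r_dvd8 pres); split; first exact: (hopf_relations q_prim r_dvd8 pres).
exists (fun=> 1%R).
move=> R; exact: (presented_theoremA q_prim r_dvd8 pres NK (prime_gt0 p_prime) pfact
  (Rmatrix_presented p r q)).
Qed.
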